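(* Let $k$ be a field of characteristic $0$ and let $p(t)$ be an admissible Hilbert polynomial of degree $d$ for closed subschemes of $\mathbb{P}^n=\mathbb{P}^n_k$. Let $\mathbf{Gr}_p^N=\operatorname{Proj} k[\Delta]\hookrightarrow \mathbb{P}^E$ be the Plücker embedding of the Grassmannian and let $\mathfrak{H}\subset k[\Delta]$ be the ideal defined in the context. Then the homogeneous ideal $\mathfrak{H}$ is generated in degree $\leq d+2$ and defines the Hilbert scheme $\mathbf{Hilb}^n_{p(t)}$ as a closed subscheme of $\mathbf{Gr}_p^N$.
   Context: Numbers. ''Admissible'' means that $p(t)$ is the Hilbert polynomial of some closed subscheme of $\mathbb{P}^n=\operatorname{Proj} k[x]$, $k[x]=k[x_0,\dots,x_n]$. The Gotzmann number $r$ of $p(t)$ is the number of summands in the unique expression $p(t)=\sum_{i=1}^{r}\binom{t+a_i-i+1}{a_i}$ with $a_1\ge\dots\ge a_r\ge 0$. Put $N(t)=\binom{n+t}{n}$, $q(t)=N(t)-p(t)$, $p=p(r)$, $N=N(r)$, $q=q(r)=N-p$. Put $q'=\dim_k k[x_{d+1},\dots,x_n]_{r+1}$ and $q''=q(r+1)-q'$. Functors. The Hilbert functor sends a noetherian $k$-algebra $A$ to the set of closed subschemes $X\subset\mathbb{P}^n_A$ flat over $\operatorname{Spec}A$ all of whose fibers have Hilbert polynomial $p(t)$. The Grassmann functor sends $A$ to the set of submodules $L\subseteq A^N$ with $A^N/L$ locally free of rank $p$; it is represented by $\mathbf{Gr}_p^N$. Variables are ordered $x_0<\dots<x_n$; $x^{\alpha(1)},\dots,x^{\alpha(N)}$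 are the monomials of degree $r$ in descending degree reverse lexicographic order; the standard basis $\mathrm{a}_1,\dots,\mathrm{a}_N$ of $A^N$ is identified with them, so $A^N\simeq H^0(\mathcal{O}_{\mathbb{P}^n_A}(r))=A[x]_r$. The natural transformation $\mathscr{H}$ from the Hilbert functor to the Grassmann functor sends $X$ to $H^0(\mathcal{I}_X(r))$. The Hilbert scheme $\mathbf{Hilb}^n_{p(t)}$ represents the Hilbert functor and is regarded as a closed subscheme of $\mathbf{Gr}_p^N$ via $\mathscr{H}$. Plücker coordinates and the elements $\delta$. An $s$-multi-index is an increasing sequence of $s$ elements of $\{1,\dots,N\}$ (also regarded as a set); $\mathcal{E}^{(m)}$ is the set of all $(p+m)$-multi-indices. For $\mathcal{H}\subseteq\mathcal{K}$, $\varepsilon^{\mathcal{K}}_{\mathcal{H}}\in\{\pm1\}$ is the signature of the permutation $\mathcal{K}\mapsto \mathcal{H},\mathcal{K}\setminus\mathcal{H}$. The variables of $\mathbb{P}^E$, $E+1=\binom{N}{p}$, are indexed by $\mathcal{E}^{(0)}$; $k[\Delta]$ is the quotient of the polynomial ring in these variables by the Plücker relations, and $\Delta_{\mathcal{J}}$ is the coordinate sending $L$ to the image of $\mathrm{a}_{\mathcal J}=\mathrm{a}_{j_1}\wedge\dots\wedge\mathrm{a}_{j_p}$ in $\wedge^p(A^N/L)$. For $1\le m\le q$ and $\mathcal{K}\in\mathcal{E}^{(m)}$ set $$\delta^{(m)}_{\mathcal{K}}=\sum_{\mathcal{H}\subseteq\mathcal{K},\ |\mathcal{H}|=m}\varepsilon^{\mathcal{K}}_{\mathcal{H}}\,\Delta_{\mathcal{K}\setminus\mathcal{H}}\;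 x^{\alpha(h_1)}\wedge\dots\wedge x^{\alpha(h_m)},\qquad \mathcal{H}=(h_1,\dots,h_m),$$ and $\mathcal{B}^{(m)}=\{\delta^{(m)}_{\mathcal{K}}\mid\mathcal{K}\in\mathcal{E}^{(m)}\}$. By $x_i\delta^{(m)}_{\mathcal{K}}$ we mean the element of $\wedge^m(k[\Delta]\otimes k[x]_{r+1})$ obtained by replacing each $x^{\alpha(h_1)}\wedge\dots\wedge x^{\alpha(h_m)}$ with $x_ix^{\alpha(h_1)}\wedge\dots\wedge x_ix^{\alpha(h_m)}$. For a set of elements of an exterior power of $k[\Delta]\otimes k[x]_{r+1}$, $\mathrm{coeff}_x$ denotes the set of all coefficients in $k[\Delta]$ with respect to the basis of wedges of monomials of degree $r+1$. The equations. Let $\mathcal{W}$ be the set of polynomials $x_j\delta^{(1)}_{\mathcal{H}}\pm x_{l}\delta^{(1)}_{\overline{\mathcal{H}}}$ ($\mathcal{H},\overline{\mathcal{H}}\in\mathcal{E}^{(1)}$, $0\le j,l\le n$) such that: (a) $\mathcal{H}=(\mathcal{H}\cap\overline{\mathcal{H}})\cup\{h\}$ and $\overline{\mathcal{H}}=(\mathcal{H}\cap\overline{\mathcal{H}})\cup\{\overline h\}$; (b) $x_jx^{\alpha(h)}=x_lx^{\alpha(\overline h)}$ and the sign $\pm$ is chosen so that the terms $\Delta_{\mathcal{H}\cap\overline{\mathcal{H}}}x_jx^{\alpha(h)}$ and $\Delta_{\mathcal{H}\cap\overline{\mathcal{H}}}x_lx^{\alpha(\overline h)}$ cancel; (c)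 all the monomials in $x$ appearing in $x_j\delta^{(1)}_{\mathcal{H}}\pm x_{l}\delta^{(1)}_{\overline{\mathcal{H}}}$ with non-zero coefficient lie in the ideal $(x_0,\dots,x_d)$. Define $$\mathfrak{h}_1=\mathrm{coeff}_x\Big\{\bigwedge_{0\le i\le d,\ m_i>0}x_i\delta^{(m_i)}_{\mathcal{K}_i}\ \Big|\ \delta^{(m_i)}_{\mathcal{K}_i}\in\mathcal{B}^{(m_i)},\ \sum m_i=q''+1\Big\},$$ $$\mathfrak{h}_2=\mathrm{coeff}_x\Big\{\Big(\bigwedge_{0\le i\le d,\ m_i>0}x_i\delta^{(m_i)}_{\mathcal{K}_i}\Big)\wedge w\ \Big|\ \delta^{(m_i)}_{\mathcal{K}_i}\in\mathcal{B}^{(m_i)},\ \sum m_i=q'',\ w\in\mathcal{W}\Big\},$$ where $(m_0,\dots,m_d)$ ranges over sequences of non-negative integers, and $\mathfrak{h}=\mathfrak{h}_1\cup\mathfrak{h}_2$. Each $g\in\mathrm{PGL}_{\mathbb{Q}}(n+1)$ acts on $k[x]_r$ by linear change of coordinates, hence on $\mathbf{Gr}_p^N$ and (linearly, up to scalars) on $k[\Delta]$; $g\cdot\mathfrak{h}$ is the set of images of the elements of $\mathfrak{h}$. Finally $\mathfrak{H}$ is the ideal of $k[\Delta]$ generated by $\bigcup_{g\in\mathrm{PGL}_{\mathbb{Q}}(n+1)}g\cdot\mathfrak{h}$. ''Defines $\mathbf{Hilb}^n_{p(t)}$'' means that the closed subscheme of $\mathbf{Gr}_p^N=\operatorname{Proj}k[\Delta]$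 cut out by $\mathfrak{H}$ equals $\mathbf{Hilb}^n_{p(t)}$ ($\mathfrak{H}$ is not claimed to be saturated). *)

(* Defs.v *)
From HB Require Import structures.
From mathcomp Require Import all_boot all_order all_algebra.
From mathcomp.multinomials Require Export mpoly.

Set Implicit Arguments.
Unset Strict Implicit.
Unset Printing Implicit Defensive.

Import Order.TTheory GRing.Theory Num.Theory.

Local Open Scope ring_scope.

(* Schemes are handled through their functors of points on k-algebras.  The
   structure comAlgType excludes the zero algebra, at which every functor below
   has exactly one point.  Subsets of rings and modules (ideals, submodules)
   are Prop-valued predicates, considered up to pointwise equivalence. *)

Section CommutativeAlgebra.

Definition is_ideal (R : comNzRingType) (I : R -> Prop) : Prop :=
  [/\ I 0, (forall x y, I x -> I y -> I (x + y))
         & (forall a x, I x -> I (a * x))].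

Definition ideal_gen (R : comNzRingType) (S : R -> Prop) (x : R) : Prop :=
  forall I : R -> Prop, is_ideal I -> (forall y, S y -> I y) -> I x.

Definition noetherian (R : comNzRingType) : Prop :=
  forall I : R -> Prop, is_ideal I ->
    exists s : seq R, forall x, I x <-> ideal_gen (fun y => y \in s) x.

(* [sum_{(m, y) <- s} m (x) [y] = 0] in the tensor product of [M] with [V / Q],
   where [Q] is a submodule of [V]: by the universal property, every bilinear
   map on [M x V] that kills [M x Q] sends the sum to 0. *)
Definition tensor_zero (A : comNzRingType) (M V : lmodType A) (Q : V -> Prop)
    (s : seq (M * V)) : Prop :=
  forall (P : lmodType A) (b : M -> V -> P),
    (forall y, linear (b^~ y)) -> (forall m, linear (b m)) ->
    (forall m y, Q y -> b m y = 0) ->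
    \sum_(z <- s) b z.1 z.2 = 0.

(* [V / Q] is flat over [A]: tensoring with it preserves injectivity. *)
Definition flat_quotient (A : comNzRingType) (V : lmodType A) (Q : V -> Prop)
    : Prop :=
  forall (M M' : lmodType A) (phi : {linear M -> M'}), injective phi ->
  forall s : seq (M * V),
    tensor_zero Q [seq (phi z.1, z.2) | z <- s] -> tensor_zero Q s.

(* [phi] identifies [K] with the residue field of [A] at the prime [ker phi];
   the points of Spec A correspond to such [phi]. *)
Definition residue_field (A : comNzRingType) (K : fieldType)
    (phi : {rmorphism A -> K}) : Prop :=
  forall z : K, exists a b : A, phi b != 0 /\ z = phi a / phi b.

End CommutativeAlgebra.

Section ClosedSubschemes.
Context (n : nat).

(* The chart [x_i <> 0] of P^n_A has coordinate ring
   [A[x_0/x_i, ..., x_n/x_i] = A[x_0, ..., x_n] / (x_i - 1)], in which a form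
   [f] of degree [t] represents [f / x_i^t].  A family of charts gives, for each
   [i], an ideal of this ring, as its preimage in [A[x_0, ..., x_n]]. *)
Definition charts (A : comNzRingType) := 'I_n.+1 -> {mpoly A[n.+1]} -> Prop.

Definition charts_eq (A : comNzRingType) (X Y : charts A) : Prop :=
  forall i f, X i f <-> Y i f.

(* The last clause is the gluing condition: on the intersection of charts [i]
   and [j], [f / x_i^t] is in the localization of the [i]-th ideal iff
   [f / x_j^t] is in the localization of the [j]-th ideal. *)
Definition closed_subscheme (A : comNzRingType) (X : charts A) : Prop :=
  [/\ (forall i, is_ideal (X i)),
      (forall i, X i ('X_i - 1))
    & (forall i j t f, f \is t.-homog ->
        (exists m, X i ('X_j ^+ m * f)) -> (exists m, X j ('X_i ^+ m * f)))].

(* H^0(I_X(t)), as a subset of [A[x]_t = H^0(O(t))]. *)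
Definition ideal_sections (A : comNzRingType) (X : charts A) (t : nat)
    (f : {mpoly A[n.+1]}) : Prop :=
  f \is t.-homog /\ forall i, X i f.

Definition base_change (A B : comNzRingType) (phi : {rmorphism A -> B})
    (X : charts A) : charts B :=
  fun i => ideal_gen (fun g => exists2 f, X i f & g = map_mpoly phi f).

(* For all large [t], [dim_K K[x]_t / H^0(I_Y(t)) = p(t)], the dimension being
   the number of elements of a basis [b] of the quotient. *)
Definition has_hilbert_polynomial (K : fieldType) (Y : charts K)
    (pt : {poly rat}) : Prop :=
  exists T : nat, forall t : nat, (T <= t)%N ->
  exists (e : nat) (b : 'I_e -> {mpoly K[n.+1]}),
    [/\ e%:R = pt.[t%:R], (forall i, b i \is t.-homog)
      & (forall f, f \is t.-homog -> exists! c : 'rV[K]_e,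
           ideal_sections Y t (f - \sum_i c 0 i *: b i))].

Definition admissible (K : fieldType) (pt : {poly rat}) : Prop :=
  exists Y : charts K, closed_subscheme Y /\ has_hilbert_polynomial Y pt.

Definition hilbert_functor (pt : {poly rat}) (A : comNzRingType)
    (X : charts A) : Prop :=
  [/\ closed_subscheme X,
      (forall i, flat_quotient (X i))
    & (forall (K : fieldType) (phi : {rmorphism A -> K}), residue_field phi ->
         has_hilbert_polynomial (base_change phi X) pt)].

End ClosedSubschemes.

Section Numbers.

(* The polynomial [binomial (t + c, a)] in [t]. *)
Definition binomial_poly (c : rat) (a : nat) : {poly rat} :=
  (a`!%:R)^-1 *: \prod_(j < a) ('X + (c - j%:R)%:P).

(* [a] is indexed from 0, which absorbs the [+ 1] of [t + a_i - i + 1]. *)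
Definition gotzmann_number (pt : {poly rat}) (r : nat) : Prop :=
  exists a : seq nat,
    [/\ size a = r, sorted geq a
      & pt = \sum_(i < r) binomial_poly ((nth 0 a i)%:R - i%:R) (nth 0 a i)].

(* [p(t)] as a natural number, which it is for an admissible polynomial and
   [t >= r]. *)
Definition hval (pt : {poly rat}) (t : nat) : nat := Num.truncn pt.[t%:R].

(* [dim_k k[x_(d+1), ..., x_n]_t] *)
Definition dim_last (n d t : nat) : nat :=
  #|[set m : 'X_{1..n.+1 < t.+1} | (mdeg m == t)
      && [forall i : 'I_n.+1, (i <= d)%N ==> (m i == 0%N)]]|.

(* [q'' = q(r+1) - q'] *)
Definition qsecond (n : nat) (pt : {poly rat}) (d r : nat) : nat :=
  ('C(n + r.+1, n) - hval pt r.+1 - dim_last n d r.+1)%N.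

End Numbers.

Section Monomials.
Context (n : nat).

(* Degree reverse lexicographic order for [x_0 < ... < x_n]. *)
Definition drl_lt (m1 m2 : 'X_{1..n.+1}) : bool :=
  (mdeg m1 < mdeg m2)%N ||
  (mdeg m1 == mdeg m2) &&
    [exists i : 'I_n.+1, (m2 i < m1 i)%N
       && [forall j : 'I_n.+1, (j < i)%N ==> (m1 j == m2 j)]].

Definition monomials (t : nat) : seq 'X_{1..n.+1} :=
  sort (fun m1 m2 => ~~ drl_lt m1 m2)
    [seq m <- [seq bmnm b | b <- enum {: 'X_{1..n.+1 < t.+1}}] | mdeg m == t].

(* The number of monomials of degree [t]. *)
Definition nmon (t : nat) : nat := 'C(n + t, n).

(* [x^(alpha(j+1))], for monomials of degree [t]: indices start from 0. *)
Definition alpha (t : nat) (j : 'I_(nmon t)) : 'X_{1..n.+1} :=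
  nth 0%MM (monomials t) j.

End Monomials.

Section ExteriorAlgebra.
Context (M : nat) (R : comNzRingType).

(* The exterior algebra of [R^M]; the coordinate at [S = {s_1 < ... < s_m}] is
   that of [e_(s_1) /\ ... /\ e_(s_m)]. *)
Local Notation ext := {ffun {set 'I_M} -> R}.

(* Signature of the permutation [K |-> H, K \ H]. *)
Definition eps (K H : {set 'I_M}) : R :=
  (-1) ^+ #|[set z : 'I_M * 'I_M |
              [&& z.1 \in H, z.2 \in K :\: H & (z.2 < z.1)%N]]|.

Definition wedge (u v : ext) : ext :=
  [ffun S : {set 'I_M} => \sum_(T : {set 'I_M} | T \subset S)
     eps S T * u T * v (S :\: T)].

Definition wedge1 : ext := [ffun S => (S == set0)%:R].

End ExteriorAlgebra.

Arguments eps {M R}.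
Arguments wedge1 {M R}.

Section Plucker.
Context (k : fieldType) (N p : nat).

(* E^(0) *)
Definition midx := {J : {set 'I_N} | #|J| == p}.

(* The increasing sequence of the elements of [J]. *)
Definition elt (J : midx) (a : 'I_p) : 'I_N :=
  enum_val (cast_ord (esym (eqP (valP J))) a).

(* The polynomial ring in the variables indexed by E^(0).  Elements of k[Delta]
   are given by representatives in this ring, and an ideal of k[Delta] by its
   preimage, an ideal containing the Pluecker relations. *)
Definition plring := {mpoly k[#|{: midx}|]}.

(* Only used when [J] has [p] elements. *)
Definition Delta (J : {set 'I_N}) : plring :=
  if insub J is Some j then 'X_(enum_rank (j : midx)) else 0.

(* For [S] and [K] of cardinal [p - 1] and [p + 1], the relation
   [sum_l (-1)^l Delta_(S, k_l) Delta_(K \ k_l)], where [Delta_(S, k)] is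
   alternating in its indices. *)
Definition plucker_rel (F : plring) : Prop :=
  exists S K : {set 'I_N}, [/\ #|S|.+1 = p, #|K| = p.+1
    & F = \sum_(l in K :\: S)
            eps (l |: S) S * eps K [set l] * Delta (l |: S) * Delta (K :\ l)].

Definition plucker_ideal : plring -> Prop := ideal_gen plucker_rel.

Definition homogeneous_ideal (J : plring -> Prop) : Prop :=
  is_ideal J /\ forall F, J F -> forall e, J (pihomog [measure of mdeg] e F).

(* The image of [J] in k[Delta] is generated by homogeneous elements of degree
   at most [D]. *)
Definition generated_in_degree (J : plring -> Prop) (D : nat) : Prop :=
  exists S : plring -> Prop,
    (forall F, S F -> exists2 e, (e <= D)%N & F \is e.-homog) /\
    (forall F, J F <-> ideal_gen (fun G => plucker_rel G \/ S G) F).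

Section Grassmannian.
Context (A : comAlgType k).

Definition submodule (L : 'rV[A]_N -> Prop) : Prop :=
  [/\ L 0, (forall u v, L u -> L v -> L (u + v))
         & (forall (c : A) v, L v -> L (c *: v))].

(* The rows of [E] form a basis of the localization of [A^N / L] at [f]. *)
Definition free_away (f : A) (L : 'rV[A]_N -> Prop) (E : 'M[A]_(p, N)) : Prop :=
  (forall v, exists m (c : 'rV[A]_p), L (f ^+ m *: v - c *m E)) /\
  (forall c : 'rV[A]_p, L (c *m E) -> exists m, f ^+ m *: c = 0).

(* [A^N / L] is locally free of rank [p]: Spec A is covered by the open sets
   D(f) over which it is free. *)
Definition grassmann_functor (L : 'rV[A]_N -> Prop) : Prop :=
  submodule L /\ ideal_gen (fun f => exists E, free_away f L E) 1.

(* Over D(f), the class of [a_j] is [f^-m] times the combination of the basis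
   [E] given by the row [j] of [C].  Hence in the basis [E_1 /\ ... /\ E_p] of
   the [p]-th exterior power of [A^N / L] localized at [f], the coordinate of
   [a_J] is [f^-(m p)] times the minor of [C] with rows [J].  For [F]
   homogeneous the conclusion says that [F] vanishes there in [A_f]. *)
Definition plucker_vanish (F : plring) (L : 'rV[A]_N -> Prop) : Prop :=
  forall (f : A) (E : 'M[A]_(p, N)) (m : nat) (C : 'M[A]_(N, p)),
    free_away f L E ->
    (forall j, L (f ^+ m *: delta_mx 0 j - row j C *m E)) ->
    exists s : nat,
      f ^+ s * mmap (fun c => c%:A)
        (fun v => \det (rowsub (elt (enum_val v)) C)) F = 0.

(* A-points of the closed subscheme of the Grassmannian defined by [J]. *)
Definition cut_out (J : plring -> Prop) (L : 'rV[A]_N -> Prop) : Prop :=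
  grassmann_functor L /\
  forall e F, J F -> F \is e.-homog -> plucker_vanish F L.

End Grassmannian.

End Plucker.

Arguments Delta {k N p}.
Arguments plucker_rel {k N p}.
Arguments plucker_ideal {k N p}.

Section Equations.
Context (k : fieldType) (n : nat) (pt : {poly rat}) (d r : nat).

Local Notation N := (nmon n r).
Local Notation N1 := (nmon n r.+1).
Local Notation p := (hval pt r).
Local Notation R := (plring k N p).
Local Notation ext M := {ffun {set 'I_M} -> R}.

(* [delta^(m)_K], in the [m]-th exterior power of [k[Delta] (x) k[x]_r]. *)
Definition delta (m : nat) (K : {set 'I_N}) : ext N :=
  [ffun H : {set 'I_N} =>
     if (H \subset K) && (#|H| == m) then eps K H * Delta (K :\: H) else 0].

Definition monomial1 (m : 'X_{1..n.+1}) : ext N1 :=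
  [ffun S => (S == [set j | alpha j == m])%:R].

(* [u |-> x_i u] *)
Definition mulx (i : 'I_n.+1) (u : ext N) : ext N1 :=
  [ffun S => \sum_(H : {set 'I_N})
     u H * (\big[@wedge N1 R/wedge1]_(h <- enum H)
              monomial1 (U_(i) + alpha h)) S].

Definition wedge_product (s : nat) (u : ext N1) : Prop :=
  exists (m : 'I_n.+1 -> nat) (K : 'I_n.+1 -> {set 'I_N}),
    [/\ \sum_(i < n.+1 | (i <= d)%N) m i = s,
        (forall i : 'I_n.+1, (i <= d)%N -> (0 < m i)%N -> #|K i| = (p + m i)%N)
      & u = \big[@wedge N1 R/wedge1]_(i < n.+1 | (i <= d)%N && (0 < m i)%N)
              mulx i (delta (m i) (K i))].

Definition calW (w : ext N1) : Prop :=
  exists (H H' : {set 'I_N}) (h h' : 'I_N) (j l : 'I_n.+1) (sgn : bool),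
    [/\ [/\ #|H| = p.+1, #|H'| = p.+1 & #|H :&: H'| = p],
        H = h |: (H :&: H') /\ H' = h' |: (H :&: H'),
        (U_(j) + alpha h = U_(l) + alpha h')%MM /\
          delta 1 H [set h] + (-1) ^+ sgn * delta 1 H' [set h'] = 0,
        w = mulx j (delta 1 H) + (-1) ^+ sgn *: mulx l (delta 1 H')
      & forall i : 'I_N1, ~ plucker_ideal (w [set i]) ->
          exists2 a : 'I_n.+1, (a <= d)%N & (0 < alpha i a)%N].

Definition frakh1 (F : R) : Prop :=
  exists u (S : {set 'I_N1}),
    [/\ wedge_product (qsecond n pt d r).+1 u,
        #|S| = (qsecond n pt d r).+1 & F = u S].

Definition frakh2 (F : R) : Prop :=
  exists u w (S : {set 'I_N1}),
    [/\ wedge_product (qsecond n pt d r) u, calW w,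
        #|S| = (qsecond n pt d r).+1 & F = wedge u w S].

(* The change of coordinates [x_i |-> sum_l g_il x_l] on [k[x]_r]: column [j]
   is the image of [x^alpha(j)]. *)
Definition coord_change (g : 'M[rat]_n.+1) : 'M[k]_N :=
  \matrix_(l, j) ('X_[alpha j] \mPo
    [tuple \sum_(a < n.+1) (ratr (g i a) : k) *: 'X_a | i < n.+1])@_(alpha l).

(* The action on k[Delta], whose linear part is the [p]-th exterior power of
   [k[x]_r].  The opposite conventions amount to replacing [g] by its inverse
   or its transpose, and give the same set of translates. *)
Definition gact (g : 'M[rat]_n.+1) (F : R) : R :=
  F \mPo [tuple \sum_(I : midx N p)
    \det (mxsub (elt I) (elt (enum_val v)) (coord_change g)) *: Delta (val I)
    | v < #|{: midx N p}|].

Definition frakH : R -> Prop :=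
  ideal_gen (fun F => plucker_rel F \/
    exists (g : 'M[rat]_n.+1) (F0 : R),
      [/\ g \in unitmx, frakh1 F0 \/ frakh2 F0 & F = gact g F0]).

(* The natural transformation from the Hilbert to the Grassmann functor. *)
Definition scrH (A : comAlgType k) (X : charts n A) (v : 'rV[A]_N) : Prop :=
  ideal_sections X r (\sum_j v 0 j *: 'X_[alpha j]).

(* On every noetherian k-algebra, [scrH] is a bijection from the Hilbert functor
   onto the points of the closed subscheme of the Grassmannian cut out by [J]. *)
Definition defines_hilbert_scheme (J : R -> Prop) : Prop :=
  forall A : comAlgType k, noetherian A ->
    (forall X : charts n A, hilbert_functor pt X -> cut_out J (scrH X)) /\
    (forall L : 'rV[A]_N -> Prop, cut_out J L ->
       exists X : charts n A,
         [/\ hilbert_functor pt X, (forall v, scrH X v <-> L v)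
           & (forall Y, hilbert_functor pt Y ->
                (forall v, scrH Y v <-> L v) -> charts_eq Y X)]).

End Equations.

Arguments frakH : clear implicits.
Arguments defines_hilbert_scheme : clear implicits.

(* Main.v *)
(* Over a field, and over a local ring, a general rational change of coordinates
   makes a Borel-fixed set [N] of monomials of degree [r] a basis of the forms of
   degree [r] modulo the given submodule [L].  For Borel sets Macaulay's bound on
   growth, Gotzmann's persistence and the descent from large degrees to degree
   [r] are counting arguments, and they lift to [L] through the marked basis
   [x^al - (combination of N)], [al] not in [N]: if [N] grows minimally and the
   syzygies of degree [r + 1] reduce to star products, then the standard
   monomials stay a basis of the quotient in all degrees.

   The elements [delta] evaluate to wedge products of forms of [L].  Since the
   standard monomials of degree [r + 1] lie in the ideal [(x_0, ..., x_d)], the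
   first family of equations says that the span of [x_0 L, ..., x_d L] has rank
   at most [q''], which by Macaulay's bound is the least possible rank, and the
   second one says that this span contains the remaining syzygies.  Hence a point
   cut out by the equations generates, locally, an ideal with free quotients of
   ranks [p(t)], whose charts are flat.  Conversely, for a point of the Hilbert
   functor flatness and Nakayama's lemma make the sections of degrees [r] and
   [r + 1] free with quotients of ranks [p(r)] and [p(r + 1)]; the equations then
   hold in general coordinates, and in all coordinates because a polynomial over
   a local [Q]-algebra which vanishes at infinitely many integers is 0. *)
From HB Require Import structures.
From mathcomp Require Import all_boot all_order all_algebra.
From mathcomp Require Import zify ring.
From mathcomp Require Import generic_quotient.
From mathcomp.classical Require Import boolp functions.
From mathcomp.classical Require classical_sets.
Require Import Defs.

Set Implicit Arguments.
Unset Strict Implicit.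
Unset Printing Implicit Defensive.

Import Order.TTheory GRing.Theory Num.Theory.
Local Open Scope ring_scope.

(** * Borel sets of monomials *)

(** The choice, and the coordinates that make it Borel, depend on the maximal ideal; this is why all
    rational translates of the equations enter.

    The constant [q''] is a count. Let [Z] be the set of monomials of degree [r + 1] in
    [(x_0, ..., x_d)], so that [q'' = |Z| - p(r + 1)]. For a Borel set [N] with [p(r)] elements,
    [grow N] lies in [Z], and the star multiples of the marked basis by [x_0, ..., x_d] correspond
    to the rest of [Z]. By Macaulay's bound they are at least [q''] in number, and they are
    independent, so the first equations exclude a further one. The wedge of all of them with another
    vector then tests whether that vector lies in their span. A multiple by [x_j] with [j > d] may
    have its leading monomial outside [Z]; it is tested only after cancelling this monomial against
    another multiple, which is what the elements [w] do. *)

Section MonomialBasics.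
Context (n : nat).
Implicit Types (m u v : 'X_{1..n.+1}).

Lemma mem_monomials t m : (m \in monomials n t) = (mdeg m == t).
Proof.
rewrite /monomials mem_sort mem_filter; case: eqP => //= <-.
apply/mapP; have h : (mdeg m < (mdeg m).+1)%N by [].
by exists (BMultinom h) => //; rewrite mem_enum.
Qed.

Lemma monomials_uniq t : uniq (monomials n t).
Proof.
by rewrite sort_uniq filter_uniq // map_inj_uniq ?enum_uniq //; exact: val_inj.
Qed.

Lemma size_monomials t : size (monomials n t) = nmon n t.
Proof.
have -> : nmon n t = 'C(t + n, t) by rewrite /nmon addnC -bin_sub ?leq_addl // addnK.
rewrite -size_basis; apply/perm_size/uniq_perm; [exact: monomials_uniq|exact: uniq_basis|].
by move=> m; rewrite mem_monomials basis_cover.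
Qed.

Lemma mdeg_alpha t (j : 'I_(nmon n t)) : mdeg (alpha j) = t.
Proof. by apply/eqP; rewrite -mem_monomials mem_nth ?size_monomials. Qed.

Lemma alpha_inj t : injective (@alpha n t).
Proof.
move=> i j /eqP; rewrite /alpha nth_uniq ?size_monomials ?monomials_uniq //.
by move/eqP/val_inj.
Qed.

Lemma alphaP t m : mdeg m = t -> exists j : 'I_(nmon n t), alpha j = m.
Proof.
move=> /eqP; rewrite -mem_monomials => hm.
have h := hm; rewrite -index_mem size_monomials in h.
by exists (Ordinal h); rewrite /alpha nth_index.
Qed.

Lemma mnm_lepU m i : m i != 0%N -> (m - U_(i) + U_(i))%MM = m.
Proof. by rewrite -lep1mP => /submK. Qed.

Lemma mdegU m i : mdeg (m + U_(i)) = (mdeg m).+1.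
Proof. by rewrite mdegD mdeg1 addn1. Qed.

Lemma mdeg_subU m i : m i != 0%N -> (mdeg (m - U_(i))).+1 = mdeg m.
Proof. by move=> h; rewrite -[in RHS](mnm_lepU h) mdegU. Qed.

(** The bound is a natural number so that [n + 1], one more than the last index, is allowed;
    inductions on [i] end there, where only the monomial 1 is left. *)
Definition supge (i : nat) m := [forall j : 'I_n.+1, (j < i)%N ==> (m j == 0%N)].

Lemma supgeP i m : reflect (forall j : 'I_n.+1, (j < i)%N -> m j = 0%N) (supge i m).
Proof.
apply: (iffP forallP) => [h j hj|h j]; first by apply/eqP; move/implyP: (h j); apply.
by apply/implyP => hj; rewrite h.
Qed.

Lemma supge0 m : supge 0 m. Proof. exact/supgeP. Qed.

Lemma supgeW i j m : (i <= j)%N -> supge j m -> supge i m.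
Proof. by move=> hij /supgeP h; apply/supgeP => l hl; apply: h; apply: leq_trans hij. Qed.

Lemma supgeD i u v : supge i (u + v)%MM = supge i u && supge i v.
Proof.
apply/supgeP/andP => [h|[/supgeP hu /supgeP hv] j hj]; last by rewrite mnmDE hu ?hv.
by split; apply/supgeP => j hj; have := h j hj; rewrite mnmDE; lia.
Qed.

Lemma supgeU i (j : 'I_n.+1) : supge i U_(j)%MM = (i <= j)%N.
Proof.
apply/supgeP/idP => [h|h l hl].
  by rewrite leqNgt; apply/negP => /h; rewrite mnm1E eqxx.
by rewrite mnm1E; case: eqP => // e; move: hl; rewrite -e ltnNge h.
Qed.

Lemma supgeS (i : 'I_n.+1) m : supge i.+1 m = (m i == 0%N) && supge i m.
Proof.
apply/supgeP/andP => [h|[/eqP hi /supgeP h] j].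
  split; [by rewrite h|apply/supgeP => j hj; apply: h; exact: ltnW].
by rewrite ltnS leq_eqVlt => /orP[/eqP/val_inj->//|/h].
Qed.

Lemma supge_max m : supge n.+1 m = (m == 0%MM).
Proof.
apply/supgeP/eqP => [h|-> j _]; last by rewrite mnm0E.
by apply/mnmP => j; rewrite h // mnm0E.
Qed.

(* [ord0] at the monomial 1. *)
Definition mmin m : 'I_n.+1 := odflt ord0 [pick i | (m i != 0%N) && supge i m].

Lemma mmin_eq m (i : 'I_n.+1) : m i != 0%N -> supge i m -> mmin m = i.
Proof.
move=> hi /supgeP si; rewrite /mmin; case: pickP => /= [j /andP[hj /supgeP sj]|/(_ i)].
  case: (ltngtP (nat_of_ord j) i) => [h|h|/ord_inj //]; first by move: hj; rewrite (si _ h).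
  by move: hi; rewrite (sj _ h).
by rewrite hi /=; move/negbT/negP; case; apply/supgeP.
Qed.

Lemma mminP m : m != 0%MM -> m (mmin m) != 0%N /\ supge (mmin m) m.
Proof.
move=> hm; have [i hi] : exists i, m i != 0%N.
  apply/existsP; rewrite -negb_forall; apply: contra hm => /forallP h.
  by apply/eqP/mnmP => i; rewrite mnm0E; apply/eqP.
case: (@arg_minnP _ i (fun i => m i != 0%N) (@nat_of_ord n.+1) hi) => j hj hmin.
have sj : supge j m.
  apply/supgeP => l hl; apply/eqP/negPn/negP => hml; have := hmin _ hml; by rewrite leqNgt hl.
by rewrite (mmin_eq hj sj).
Qed.

Lemma mminU m (i : 'I_n.+1) : supge i m -> mmin (m + U_(i)) = i.
Proof.
move=> h; apply: mmin_eq; first by rewrite mnmDE mnm1E eqxx addn1.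
by rewrite supgeD supgeU h leqnn.
Qed.

Definition rm m : 'X_{1..n.+1} := (m - U_(mmin m))%MM.

Lemma rmK m : m != 0%MM -> (rm m + U_(mmin m))%MM = m.
Proof. by case/mminP => h _; exact: mnm_lepU. Qed.

Lemma mdeg_rm m : mdeg (rm m) = (mdeg m).-1.
Proof.
have [->|h] := eqVneq m 0%MM; first by rewrite /rm sub0m mdeg0.
by case: (mminP h) => /mdeg_subU <-.
Qed.

Lemma supge_rm i m : supge i m -> supge i (rm m).
Proof.
by move/supgeP => h; apply/supgeP => j hj; rewrite mnmBE h.
Qed.

(* The monomials of degree [r] outside [N] span a Borel-fixed space. *)
Definition borel (r : nat) (N : pred 'X_{1..n.+1}) :=
  forall m (i j : 'I_n.+1), (i < j)%N -> (mdeg m).+1 = r ->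
    N (m + U_(j))%MM -> N (m + U_(i))%MM.

(* For [borel r N], the monomials of degree [r + 1] outside the ideal generated
   by the monomials of degree [r] outside [N]. *)
Definition grow (N : pred 'X_{1..n.+1}) : pred 'X_{1..n.+1} := fun m => N (rm m).

Lemma grow_iter t N m : iter t grow N m = N (iter t rm m).
Proof. by elim: t m => //= t IH m; rewrite /grow IH -iterSr. Qed.

Lemma mdeg_iter_rm t m : mdeg (iter t rm m) = (mdeg m - t)%N.
Proof. by elim: t => [|t IH] /=; rewrite ?subn0 // mdeg_rm IH; lia. Qed.

Lemma growU N m (i : 'I_n.+1) : supge i m -> grow N (m + U_(i))%MM = N m.
Proof. by move=> h; rewrite /grow /rm mminU // addmK. Qed.

Lemma borel_dvd r N m (i j : 'I_n.+1) : borel r N -> (i <= j)%N -> mdeg m = r ->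
  m j != 0%N -> N m -> N (m - U_(j) + U_(i))%MM.
Proof.
move=> hN; rewrite leq_eqVlt => /orP[/eqP/val_inj->|hij] hr hj Nm.
  by rewrite mnm_lepU.
by apply: (hN _ i j) => //; rewrite ?mdeg_subU ?mnm_lepU.
Qed.

(** The divisor [m / x_i] arises from [rm m] by replacing [x_i] with the smallest variable of [m],
    which is a Borel move. So in degree [r + 1] the set [grow N] consists of the monomials all of
    whose divisors of degree [r] are in [N]. *)
Lemma grow_sub r N m (i : 'I_n.+1) : borel r N -> mdeg m = r.+1 -> m i != 0%N ->
  grow N m -> N (m - U_(i))%MM.
Proof.
move=> hN hr hi; have m0 : m != 0%MM by rewrite -mdeg_eq0 hr.
have [h1 h2] := mminP m0; rewrite /grow /rm.
have le : (mmin m <= i)%N.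
  by rewrite leqNgt; apply/negP => hl; move/supgeP: h2 => /(_ _ hl) e; rewrite e in hi.
have [<-//|ne] := eqVneq (mmin m) i.
have dr : mdeg (m - U_(mmin m)) = r by apply: succn_inj; rewrite mdeg_subU.
have hi' : (m - U_(mmin m))%MM i != 0%N by rewrite mnmBE mnm1E (negbTE ne) subn0.
move/(borel_dvd hN le dr hi'); congr (N _); apply/mnmP => l.
rewrite !(mnmDE, mnmBE) !mnm1E.
case: (eqVneq (mmin m) l) => [e|_]; case: (eqVneq i l) => [e'|_] /=; try lia.
  by move: ne; rewrite e e' eqxx.
by move: h1; rewrite e; lia.
Qed.

(** Let [x_l] be the smallest variable of [m x_i]. If [l = i], the claim is [N m], which [grow_sub]
    provides. Otherwise [l < i < j], so [x_l] is smallest in [m x_j] too, and the move takes place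
    inside [m / x_l]. *)
Lemma borel_grow r N : borel r N -> borel r.+1 (grow N).
Proof.
move=> hN m i j hij hr; have ej : (mdeg m).+1 = r.+1 by [].
move=> h; have Nm : N m.
  have := grow_sub (i := j) hN _ _ h; rewrite addmK; apply; first by rewrite mdegU.
  by rewrite mnmDE mnm1E eqxx addn1.
rewrite /grow; have n0 : (m + U_(i))%MM != 0%MM by rewrite -mdeg_eq0 mdegU.
have [h1 h2] := mminP n0; rewrite /rm; set l := mmin _ in h1 h2 *.
have [e|ne] := eqVneq l i; first by rewrite e addmK.
have li : (l < i)%N.
  have : (l <= i)%N by move: h2; rewrite supgeD supgeU => /andP[].
  by rewrite leq_eqVlt => /orP[/eqP/val_inj e|//]; rewrite e eqxx in ne.
have ml : m l != 0%N by move: h1; rewrite mnmDE mnm1E [i == l]eq_sym (negbTE ne) addn0.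
have -> : (m + U_(i) - U_(l))%MM = (m - U_(l) + U_(i))%MM.
  apply/mnmP => s; rewrite !(mnmDE, mnmBE) !mnm1E.
  by case: (eqVneq l s) => [e|]; move: ml; rewrite ?e; lia.
apply: (hN _ i j) => //.
  by rewrite mdeg_subU //; apply: succn_inj.
move: h; rewrite /grow /rm.
have -> : mmin (m + U_(j)) = l.
  apply: mmin_eq; first by rewrite mnmDE; lia.
  move: h2; rewrite !supgeD !supgeU => /andP[-> _] /=; apply/ltnW/(ltn_trans li hij).
congr (N _); apply/mnmP => s; rewrite !(mnmDE, mnmBE) !mnm1E.
by case: (eqVneq l s) => [e|]; move: ml; rewrite ?e; lia.
Qed.

Lemma borel_iter r t N : borel r N -> borel (t + r) (iter t grow N).
Proof. by move=> h; elim: t => //= t IH; apply: borel_grow. Qed.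

Lemma borel_colon r (i : 'I_n.+1) N :
  borel r.+1 N -> borel r (fun m => N (m + U_(i))%MM).
Proof.
move=> hN m a b hab hr; rewrite -!addmA ![(U_(_) + U_(i))%MM]addmC !addmA.
by apply: hN => //; rewrite mdegU hr.
Qed.

End MonomialBasics.

Arguments grow {n}.
Arguments rm {n}.

(* The value at [t] of the Gotzmann expression with exponents [a]. *)
Fixpoint gval (t : nat) (a : seq nat) : nat :=
  if a is x :: a' then ('C(t + x, x) + gval t.-1 a')%N else 0%N.

(** The exponents of the first difference of the Gotzmann expression, the numerical counterpart of a
    hyperplane section; constant terms drop out. *)
Definition gdec (a : seq nat) : seq nat := [seq x.-1 | x <- a & (0 < x)%N].

Lemma gval_cat_le t a b : (gval t a <= gval t (a ++ b))%N.
Proof. by elim: a t => //= x a IH t; rewrite leq_add2l. Qed.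

Lemma gdec_cat a b : gdec (a ++ b) = gdec a ++ gdec b.
Proof. by rewrite /gdec filter_cat map_cat. Qed.

Lemma gdec_sorted a : sorted geq a -> sorted geq (gdec a).
Proof.
rewrite /gdec => h; rewrite sorted_map; apply: sub_sorted (sorted_filter _ _ h).
  by move=> x y /=; lia.
by move=> x y z /=; lia.
Qed.

Lemma size_gdec a : (size (gdec a) <= size a)%N.
Proof. by rewrite size_map size_filter count_size. Qed.

(** Only a list of length [t + 1] needs an argument: its last term is taken at the value 0 of the
    decreasing argument and equals [C(x, x) = 1]. *)
Lemma gval_take t a : (size a <= t.+1)%N -> (gval t a <= (gval t (take t a)).+1)%N.
Proof.
elim: t a => [|t IH] [|x [|y a]] //=; rewrite ?take0 //=.
  by rewrite add0n binn.
by move=> h; have := IH (y :: a) h; rewrite /=; lia.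
Qed.

(* Pascal's rule, applied termwise. *)
Lemma gvalS t a : sorted geq a -> (size a <= t.+1)%N ->
  gval t.+1 a = (gval t a + gval t.+1 (gdec a))%N.
Proof.
elim: a t => [|x a IH] t //= hs; rewrite ltnS => ht.
have hs' : sorted geq a by exact: path_sorted hs.
case: x hs => [|x] hs.
  have a0 : all (pred1 0%N) a.
    apply/allP => y ya /=; have := order_path_min (rev_trans leq_trans) hs.
    by move/allP/(_ y ya); rewrite leqn0.
  have -> : gdec (0%N :: a) = [::].
    rewrite /gdec /= ; rewrite (_ : filter _ a = [::]) //.
    by apply/eqP; rewrite -size_eq0 size_filter -leqn0 leqNgt -has_count; apply/hasPn => y /(allP a0) /eqP ->.
  rewrite /= !addn0 !bin0; congr (1 + _)%N.
  have sz s : all (pred1 0%N) a -> gval s a = size a.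
    clear; elim: a s => [|y a IH] s //= /andP[/eqP-> h]; by rewrite bin0 IH.
  by rewrite !sz.
rewrite (_ : gdec _ = x :: gdec a) //= addSn addnS binS.
have -> : 'C((t + x).+1, x) = 'C(t.+1 + x, x) by rewrite addSn.
case: t ht => [|t] ht.
  by move: ht; rewrite leqn0 size_eq0 => /eqP->; rewrite /= !addn0 [LHS]addnC addnC.
rewrite /= (IH t) //.
lia.
Qed.

Lemma gval_gt0 t a : (0 < size a)%N -> (0 < gval t a)%N.
Proof.
case: a => //= x a _; apply: leq_trans (leq_addr _ _).
by rewrite bin_gt0 leq_addl.
Qed.

Lemma gdec_iter_nil a d : all (fun x => x <= d)%N a -> iter d.+1 gdec a = [::].
Proof.
elim: d a => [|d IH] a h.
  rewrite /= /gdec; have -> : [seq x <- a | (0 < x)%N] = [::] => //.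
  apply/eqP; rewrite -size_eq0 size_filter -leqn0 leqNgt -has_count.
  by apply/hasPn => y /(allP h); lia.
rewrite iterSr; apply: IH; apply/allP => y /mapP[x].
by rewrite mem_filter => /andP[x0 /(allP h) hx] ->; lia.
Qed.

(** * Green's theorem, Macaulay's bound and Gotzmann's persistence for Borel sets *)

Section Counting.
Context (n : nat).
Implicit Types (m u v : 'X_{1..n.+1}) (N : pred 'X_{1..n.+1}).

Definition cnt (t i : nat) N : nat := count [pred m | N m & supge i m] (monomials n t).

Lemma cnt_sub t i N N' : (forall m, mdeg m = t -> N m -> supge i m -> N' m) ->
  (cnt t i N <= cnt t i N')%N.
Proof.
move=> h; rewrite /cnt -!size_filter; apply: uniq_leq_size.
  by apply: filter_uniq; exact: monomials_uniq.
move=> m; rewrite !mem_filter mem_monomials /= => /andP[/andP[Nm sm] /eqP dm].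
by rewrite h // sm dm eqxx.
Qed.

Lemma eq_cnt t i N N' : (forall m, mdeg m = t -> supge i m -> N m = N' m) ->
  cnt t i N = cnt t i N'.
Proof.
move=> h; apply/eqP; rewrite eqn_leq !cnt_sub // => m dm Nm sm.
  by rewrite h.
by rewrite -h.
Qed.

Lemma cnt_eq_sub t N N' : (forall m, mdeg m = t -> N m -> N' m) ->
  (cnt t 0 N' <= cnt t 0 N)%N -> forall m, mdeg m = t -> N m = N' m.
Proof.
rewrite /cnt -!size_filter => h le m dm.
have e := uniq_min_size (s1 := filter [pred m | N m & supge 0 m] (monomials n t)) _ _ le.
have [||_ {}e] := e; first by apply: filter_uniq; exact: monomials_uniq.
  move=> u; rewrite !mem_filter mem_monomials /= => /andP[/andP[Nm sm] /eqP du].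
  by rewrite h // sm du eqxx.
by have := e m; rewrite !mem_filter mem_monomials /= dm eqxx !supge0 !andbT.
Qed.

(** The exact sequence of a hyperplane section, counted on monomials: a monomial either avoids [x_i]
    or is [x_i] times another one. *)
Lemma cntS t (i : 'I_n.+1) N :
  cnt t.+1 i N = (cnt t.+1 i.+1 N + cnt t i (fun m => N (m + U_(i))%MM))%N.
Proof.
rewrite /cnt -!size_filter -[X in (_ + X)%N](size_map (fun m => (m + U_(i))%MM)) -size_cat.
have inj : injective (fun m => (m + U_(i))%MM) by exact: addIm.
apply: perm_size; apply: uniq_perm.
- by apply: filter_uniq; exact: monomials_uniq.
- rewrite cat_uniq map_inj_uniq // !filter_uniq ?monomials_uniq // andbT /=.
  apply/hasPn => m /mapP[u _ ->]; rewrite mem_filter /= supgeS mnmDE mnm1E eqxx addn1.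
  by rewrite andbF.
move=> m; rewrite mem_cat !mem_filter /= mem_monomials supgeS.
have [m0|m0] := eqVneq (m i) 0%N.
  rewrite [in RHS](_ : (m \in map _ _) = false) ?orbF //.
  by apply/negP => /mapP[u _ e]; move: m0; rewrite e mnmDE mnm1E eqxx addn1.
rewrite andbF /=; apply/andP/mapP => [[/andP[Nm sm] /eqP dm]|[u]].
  exists (m - U_(i))%MM; last by rewrite mnm_lepU.
  rewrite mem_filter mem_monomials /= mnm_lepU // Nm -eqSS mdeg_subU // dm eqxx andbT.
  by move: sm; rewrite -{1}(mnm_lepU m0) supgeD => /andP[].
rewrite mem_filter mem_monomials => /andP[/andP[Nu su] /eqP du] ->.
by rewrite mdegU du eqxx supgeD supgeU leqnn su Nu.
Qed.

Lemma cnt_max t N : cnt t.+1 n.+1 N = 0%N.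
Proof.
apply/eqP; rewrite -leqn0 leqNgt -has_count; apply/hasPn => m /=.
rewrite mem_monomials supge_max => /eqP dm; rewrite negb_and; apply/orP; right.
by rewrite -mdeg_eq0 dm.
Qed.

Lemma cnt_growS t (i : 'I_n.+1) N :
  cnt t.+1 i (grow N) = (cnt t.+1 i.+1 (grow N) + cnt t i N)%N.
Proof. by rewrite cntS; congr (_ + _)%N; apply: eq_cnt => m _ sm; rewrite growU. Qed.

Lemma leq_cnt t i j N : (i <= j)%N -> (cnt t j N <= cnt t i N)%N.
Proof.
by move=> h; apply: sub_count => m /andP[Nm sm] /=; rewrite Nm (supgeW h sm).
Qed.

Lemma cnt_oversize t i N : (n.+1 <= i)%N -> cnt t i N = cnt t n.+1 N.
Proof.
move=> h; apply: eq_count => m /=; congr (_ && _); apply/idP/idP; first exact: supgeW.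
by rewrite supge_max => /eqP ->; apply/supgeP => j _; rewrite mnm0E.
Qed.

(* Green's hyperplane restriction theorem for Borel sets implies Macaulay's
   bound in the same degree. *)
Lemma macaulay_of_green r
  (green : forall i N a, borel r N -> sorted geq a -> (size a <= r)%N ->
     (cnt r i N <= gval r a)%N -> (cnt r i.+1 N <= gval r (gdec a))%N)
  i N a : borel r N -> sorted geq a -> (size a <= r)%N ->
  (cnt r i N <= gval r a)%N -> (cnt r.+1 i (grow N) <= gval r.+1 a)%N.
Proof.
move=> hN; have [k hk] := ubnP (n.+1 - i); elim: k i a hk => // k IH i a hk sa za h.
have [hi|hi] := ltnP i n.+1; last by rewrite cnt_oversize // cnt_max.
rewrite (cnt_growS r (Ordinal hi)) gvalS ?(leqW za) //= addnC leq_add //.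
apply: IH; [by lia|exact: gdec_sorted|exact: leq_trans (size_gdec _) za|exact: green].
Qed.

(** Suppose the section by [x_i] is too large. Then the colon of [N] by [x_i] is small, so by
    induction on the degree its section is small, and by Macaulay's bound in degree [r] the growth
    of that section is small as well. But the Borel property puts the section of [N] inside this
    growth. *)
Lemma green r i N a : borel r N -> sorted geq a -> (size a <= r)%N ->
  (cnt r i N <= gval r a)%N -> (cnt r i.+1 N <= gval r (gdec a))%N.
Proof.
elim: r i N a => [|r IH] i N a hN sa za h.
  move: h; move/leq_trans: (leq_cnt 0 N (leqnSn i)) => le.
  by move: za; rewrite leqn0 size_eq0 => /eqP ea; move: le; rewrite ea => le /le.
have [hi|hi] := ltnP i n.+1; last by rewrite cnt_oversize ?cnt_max // leqW.
pose io := Ordinal hi; rewrite leqNgt; apply/negP => hlt.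
pose N2 := fun m => N (m + U_(io))%MM.
have hN2 : borel r N2 by exact: borel_colon.
(* The colon has strictly fewer than [gval r a] elements. Dropping an exponent in position [r + 1]
   costs at most 1, so the truncated list still bounds it and is short enough for the induction. *)
pose a2 := take r a.
have sa2 : sorted geq a2 by exact: take_sorted.
have za2 : (size a2 <= r)%N by rewrite size_take; case: ltnP.
have h2 : (cnt r i N2 <= gval r a2)%N.
  move: h; rewrite (cntS r io) -/N2 gvalS //= => h.
  have := gval_take za; rewrite -/a2; move: h hlt.
  have [e|] := ltnP r (size a); first by lia.
  by rewrite /a2 => e; rewrite take_oversize //; lia.
have := macaulay_of_green IH hN2 (gdec_sorted sa2) (leq_trans (size_gdec _) za2) (IH _ _ _ hN2 sa2 za2 h2).
apply/negP; rewrite -ltnNge.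
have le1 : (gval r.+1 (gdec a2) <= gval r.+1 (gdec a))%N.
  have -> : gdec a = gdec a2 ++ gdec (drop r a) by rewrite -gdec_cat cat_take_drop.
  exact: gval_cat_le.
apply: (leq_ltn_trans le1); apply: (leq_trans hlt); apply: cnt_sub => m dm Nm sm.
have m0 : m != 0%MM by rewrite -mdeg_eq0 dm.
have [h3 h4] := mminP m0; rewrite /grow /N2.
apply: (borel_dvd hN (j := mmin m)) => //.
have : (i < mmin m)%N.
  by rewrite ltnNge; apply/negP => hl; move/supgeP: sm => /(_ (mmin m) hl) e; rewrite e in h3.
exact: ltnW.
Qed.

Lemma macaulay r i N a : borel r N -> sorted geq a -> (size a <= r)%N ->
  (cnt r i N <= gval r a)%N -> (cnt r.+1 i (grow N) <= gval r.+1 a)%N.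
Proof. exact: macaulay_of_green (@green r) i N a. Qed.

Lemma green_iter r N a d : borel r N -> sorted geq a -> (size a <= r)%N ->
  (cnt r 0 N <= gval r a)%N -> (cnt r d N <= gval r (iter d gdec a))%N.
Proof.
move=> hN sa za h; suff [] : [/\ (cnt r d N <= gval r (iter d gdec a))%N,
  sorted geq (iter d gdec a) & (size (iter d gdec a) <= r)%N] by [].
elim: d => [|d [h1 h2 h3]] //=; split; first exact: green.
  exact: gdec_sorted.
exact: leq_trans (size_gdec _) h3.
Qed.

Lemma cnt0_supge t N i m : cnt t i N = 0%N -> mdeg m = t -> supge i m -> ~~ N m.
Proof.
move=> /eqP; rewrite -leqn0 leqNgt -has_count => /hasPn h dm sm.
by have := h m; rewrite mem_monomials dm eqxx /= sm andbT; apply.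
Qed.

Lemma borel_no_last r N a d m : borel r N -> sorted geq a -> (size a <= r)%N ->
  all (fun x => x <= d)%N a -> (cnt r 0 N <= gval r a)%N -> mdeg m = r ->
  N m -> ~~ supge d.+1 m.
Proof.
move=> hN sa za da h dm Nm; apply/negP => sm.
have := green_iter d.+1 hN sa za h; rewrite gdec_iter_nil // leqn0 => /eqP h0.
by move: (cnt0_supge h0 dm sm); rewrite Nm.
Qed.

Lemma gval_eq0 t s a : gval t a = 0%N -> gval s a = 0%N.
Proof. by case: a => // x a e; have := gval_gt0 t (a := x :: a) isT; rewrite e. Qed.

(** The growth is the growth of the section plus [cnt r i N]. If the total reaches the bound while
    the section cannot exceed its share, then [cnt r i N] is at least [gval r a]. *)
Lemma macaulay_eq r i N a : borel r N -> sorted geq a -> (size a <= r)%N ->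
  (cnt r i N <= gval r a)%N -> cnt r.+1 i (grow N) = gval r.+1 a ->
  cnt r i N = gval r a.
Proof.
move=> hN sa za h e; have [hi|hi] := ltnP i n.+1; last first.
  move: e h; rewrite cnt_oversize // cnt_max => /esym/(@gval_eq0 _ r) ->.
  by rewrite leqn0 => /eqP.
have := macaulay hN (gdec_sorted sa) (leq_trans (size_gdec a) za) (green hN sa za h).
move: e; rewrite (cnt_growS r (Ordinal hi)) gvalS ?(leqW za) //=; lia.
Qed.

Lemma macaulay_eqS r i N a : borel r N -> sorted geq a -> (size a <= r)%N ->
  (cnt r i N <= gval r a)%N -> cnt r.+1 i (grow N) = gval r.+1 a -> (i < n.+1)%N ->
  cnt r i.+1 N = gval r (gdec a) /\ cnt r.+1 i.+1 (grow N) = gval r.+1 (gdec a).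
Proof.
move=> hN sa za h e hi; have e0 := macaulay_eq hN sa za h e.
have e1 : cnt r.+1 i.+1 (grow N) = gval r.+1 (gdec a).
  by move: e; rewrite (cnt_growS r (Ordinal hi)) gvalS ?(leqW za) //=; lia.
split=> //; apply: macaulay_eq => //; last exact: green.
  exact: gdec_sorted.
exact: leq_trans (size_gdec a) za.
Qed.

(** Minimal growth passes to the section by [x_i], where it persists by induction on the number of
    variables; the values are then added up degree by degree with [gvalS]. *)
Lemma persistence_from r i N a t : borel r N -> sorted geq a -> (size a <= r)%N ->
  cnt r i N = gval r a -> cnt r.+1 i (grow N) = gval r.+1 a ->
  cnt (t + r) i (iter t grow N) = gval (t + r) a.
Proof.
move=> hN; have [k hk] := ubnP (n.+1 - i); elim: k i a hk t => // k IH i a hk t sa za h h'.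
have [hi|hi] := ltnP i n.+1; last first.
  have e := h'; move: e; rewrite cnt_oversize // cnt_max => /esym e0.
  case: t => [|t] //; rewrite cnt_oversize // cnt_max.
  by apply: esym; apply: gval_eq0 e0.
have [e1 e2] := macaulay_eqS hN sa za (eq_leq h) h' hi.
elim: t => // t IHt; rewrite addSn iterS (cnt_growS _ (Ordinal hi)) /=.
rewrite gvalS ?(leqW (leq_trans za (leq_addl _ _))) // IHt addnC; congr (_ + _)%N.
rewrite -iterS; apply: (IH i.+1 (gdec a) _ t.+1) => //; first by lia.
  exact: gdec_sorted.
exact: leq_trans (size_gdec a) za.
Qed.

Lemma persistence r N a t : borel r N -> sorted geq a -> (size a <= r)%N ->
  cnt r 0 N = gval r a -> cnt r.+1 0 (grow N) = gval r.+1 a ->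
  cnt (t + r) 0 (iter t grow N) = gval (t + r) a.
Proof. exact: persistence_from. Qed.

(** The set in degree [r] is the colon by [x_0]. The section is extremal by [macaulay_eqS], which
    fixes the size of the colon. By the Borel property [N] lies in [grow N'], and Macaulay's bound
    leaves no room for a strict inclusion. *)
Lemma descend_step r N a : borel r.+1 N -> sorted geq a -> (size a <= r)%N ->
  cnt r.+1 0 N = gval r.+1 a -> cnt r.+2 0 (grow N) = gval r.+2 a ->
  exists2 N', borel r N' & cnt r 0 N' = gval r a /\
    forall m, mdeg m = r.+1 -> N m = grow N' m.
Proof.
move=> hN sa za h h'; pose o : 'I_n.+1 := ord0.
pose N' := fun m => N (m + U_(o))%MM; have hN' : borel r N' by exact: borel_colon.
have [e1 _] := macaulay_eqS hN sa (leqW za) (eq_leq h) h' (ltn0Sn n).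
have e0 : cnt r 0 N' = gval r a.
  by have := cntS r o N; rewrite /= -/N' h e1 gvalS ?(leqW za) //; lia.
exists N' => //; split=> //; apply: cnt_eq_sub => [m dm Nm|].
  have m0 : m != 0%MM by rewrite -mdeg_eq0 dm.
  rewrite /grow /N' /rm; apply: (borel_dvd hN) => //.
  by case: (mminP m0).
by rewrite h; apply: macaulay => //; rewrite e0.
Qed.

Lemma eq_grow_iter t N N' k : (forall m, mdeg m = k -> N m = N' m) ->
  forall m, mdeg m = (t + k)%N -> iter t grow N m = iter t grow N' m.
Proof. by move=> h m dm; rewrite !grow_iter h // mdeg_iter_rm dm addKn. Qed.

Lemma descend r t N a : borel (t + r) N -> sorted geq a -> (size a <= r)%N ->
  cnt (t + r) 0 N = gval (t + r) a ->
  cnt (t + r).+1 0 (grow N) = gval (t + r).+1 a ->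
  exists2 N', borel r N' & cnt r 0 N' = gval r a /\
    forall m, mdeg m = (t + r)%N -> N m = iter t grow N' m.
Proof.
elim: t N => [|t IH] N; first by move=> hN sa za h _; exists N.
rewrite addSn => hN sa za h h'.
have za' : (size a <= t + r)%N by exact: leq_trans (leq_addl _ _).
have [N1 hN1 [e1 g1]] := descend_step hN sa za' h h'.
have e2 : cnt (t + r).+1 0 (grow N1) = gval (t + r).+1 a.
  by rewrite -h; apply: eq_cnt => m dm _; rewrite g1.
have [N' hN' [e' g']] := IH N1 hN1 sa za e1 e2.
exists N' => //; split=> // m dm; rewrite g1 // /= /grow g' //.
by rewrite mdeg_rm dm.
Qed.

End Counting.

(** * Marked bases, persistence and descent *)

Section Submodules.
Context (R : comNzRingType) (V : lmodType R).
Implicit Types (Q S : V -> Prop).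

Definition subm Q := [/\ Q 0, (forall u v, Q u -> Q v -> Q (u + v))
                            & (forall c v, Q v -> Q (c *: v))].

(** The intersection of all submodules containing [S]. A property of a vector of the span is proved
    by applying the membership to the submodule of vectors that have it. *)
Definition span S v := forall Q, subm Q -> (forall u, S u -> Q u) -> Q v.

Lemma subm_span S : subm (span S).
Proof.
split=> [Q [] //|u v hu hv Q hQ hS|c v hv Q hQ hS].
  by case: (hQ) => _ hD _; apply: hD; [exact: hu|exact: hv].
by case: (hQ) => _ _ hZ; apply: hZ; exact: hv.
Qed.

Lemma span0 S : span S 0.
Proof. by case: (subm_span S). Qed.

Lemma mem_span S v : S v -> span S v.
Proof. by move=> Sv Q _; apply. Qed.

Lemma subm_sum Q (I : Type) {r : seq I} (P : pred I) (F : I -> V) :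
  subm Q -> (forall i, P i -> Q (F i)) -> Q (\sum_(i <- r | P i) F i).
Proof. by case=> h0 hD _ h; elim/big_rec: _ => // i x Pi Qx; apply: hD => //; exact: h. Qed.

Lemma subm_sumr Q (I : eqType) (r : seq I) (F : I -> V) :
  subm Q -> (forall i, i \in r -> Q (F i)) -> Q (\sum_(i <- r) F i).
Proof. by move=> hQ h; rewrite big_seq; apply: subm_sum. Qed.

Lemma submN Q v : subm Q -> Q v -> Q (- v).
Proof. by case=> _ _ hZ Qv; rewrite -scaleN1r; exact: hZ. Qed.

Lemma submB Q u v : subm Q -> Q u -> Q v -> Q (u - v).
Proof. by move=> hQ Qu Qv; case: (hQ) => _ hD _; apply: hD => //; exact: submN. Qed.

Lemma subm_sub Q u v : subm Q -> Q (u - v) -> Q u -> Q v.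
Proof. by move=> hQ h Qu; rewrite -[v](subKr u); exact: submB. Qed.

(** This is the sum of [Q] and [S], in the form used for rewriting: having a remainder in [S] modulo
    [Q] may be checked on the terms of a linear combination. *)
Lemma subm_mod Q S : subm Q -> subm S -> subm (fun v => exists2 u, S u & Q (v - u)).
Proof.
move=> [Q0 QD QZ] [S0 SD SZ]; split; first by exists 0; rewrite ?subr0.
  move=> u v [u' Su Qu] [v' Sv Qv]; exists (u' + v'); first exact: SD.
  by rewrite opprD addrACA; exact: QD.
by move=> c v [u Su Qu]; exists (c *: u); [exact: SZ|rewrite -scalerBr; exact: QZ].
Qed.

End Submodules.

Section MarkedBases.
Context (n : nat) (R : comNzRingType).
Local Notation S := {mpoly R[n.+1]}.
Implicit Types (m u v al be ga : 'X_{1..n.+1}) (N : pred 'X_{1..n.+1}) (L Q : S -> Prop).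

Definition supported (t : nat) N (h : S) :=
  forall m, h@_m != 0 -> mdeg m = t /\ N m.

Lemma subm_supported t N : subm (supported t N).
Proof.
split=> [m|u v hu hv m|c v hv m]; rewrite ?mcoeff0 ?eqxx // ?mcoeffD ?mcoeffZ.
  have [e|/hu //] := eqVneq u@_m 0; by rewrite e add0r => /hv.
by have [->|/hv //] := eqVneq v@_m 0; rewrite mulr0 eqxx.
Qed.

Lemma supportedX t N m : mdeg m = t -> N m -> supported t N 'X_[m].
Proof. by move=> dm Nm u; rewrite mcoeffX; case: (eqVneq m u) => [<-//|]; rewrite eqxx. Qed.

Lemma supported_homog t N h : supported t N h -> h \is t.-homog.
Proof.
move=> hh; apply/dhomogP => m; rewrite mcoeff_msupp => /hh [] //.
Qed.

Lemma homog_supported t h : h \is t.-homog -> supported t predT h.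
Proof. by move=> /dhomogP hh m; rewrite -mcoeff_msupp => /hh. Qed.

Lemma supportedW t N N' h : (forall m, mdeg m = t -> N m -> N' m) ->
  supported t N h -> supported t N' h.
Proof. by move=> hN hh m /hh [dm Nm]; split=> //; exact: hN. Qed.

Lemma mcoeff_msumX t N (c : 'X_{1..n.+1} -> R) m :
  (\sum_(u <- monomials n t | N u) c u *: 'X_[u] : S)@_m =
  if (mdeg m == t) && N m then c m else 0.
Proof.
rewrite raddf_sum /= (eq_bigr (fun u => if u == m then c m else 0)); last first.
  by move=> u _; rewrite mcoeffZ mcoeffX; case: eqVneq => [->|]; rewrite ?mulr1 ?mulr0.
rewrite -big_mkcondr /= big_const_seq -mem_monomials.
rewrite (eq_count (a2 := fun u => N m && (u == m))); last first.
  by move=> u /=; case: eqVneq => [->|]; rewrite ?andbT ?andbF.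
case: (N m) => /=; last by rewrite andbF (eq_count (a2 := pred0)) // count_pred0.
rewrite andbT (count_uniq_mem m (monomials_uniq n t)).
by case: (m \in _); rewrite //= addr0.
Qed.

Lemma supportedE t N h : supported t N h ->
  h = \sum_(m <- monomials n t | N m) h@_m *: 'X_[m].
Proof.
move=> hh; apply/mpolyP => m; rewrite mcoeff_msumX.
have [->|/hh [-> ->]] := eqVneq h@_m 0; last by rewrite eqxx.
by case: ifP.
Qed.

Lemma supported_sumX t N c : supported t N (\sum_(u <- monomials n t | N u) c u *: 'X_[u] : S).
Proof. by move=> m; rewrite mcoeff_msumX; case: ifP => [/andP[/eqP]|]; rewrite ?eqxx. Qed.

Lemma subm_supp t N h Q : subm Q -> supported t N h ->
  (forall m, mdeg m = t -> N m -> Q 'X_[m]) -> Q h.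
Proof.
move=> hQ hh hX; rewrite (supportedE hh) big_seq_cond; apply: subm_sum => // m.
rewrite mem_monomials => /andP[/eqP dm Nm]; case: (hQ) => _ _; apply; exact: hX.
Qed.

Lemma mcoeffXM_neq0 ga (f : S) m : ('X_[ga] * f)@_m != 0 ->
  exists2 be, m = (ga + be)%MM & f@_be != 0.
Proof.
rewrite -mcoeff_msupp mulrC (perm_mem (msuppMX f ga)) => /mapP[be hb ->].
by exists be; rewrite -?mcoeff_msupp.
Qed.

Lemma mcoeffXM ga (f : S) be : ('X_[ga] * f)@_(ga + be) = f@_be.
Proof. by rewrite mulrC mcoeffMX. Qed.

Lemma homogX t m : mdeg m = t -> 'X_[R, m] \is t.-homog.
Proof. by move=> e; apply/dhomogP => u; rewrite msuppX inE => /eqP ->. Qed.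

Lemma homogXM t r ga (f : S) : mdeg ga = t -> f \is r.-homog ->
  'X_[ga] * f \is (t + r)%N.-homog.
Proof. by move=> dg hf; apply: dhomogM => //; exact: homogX. Qed.

Lemma supportedXM t r N N' ga (f : S) : mdeg ga = t ->
  (forall m, mdeg m = r -> N m -> N' (ga + m)%MM) ->
  supported r N f -> supported (t + r) N' ('X_[ga] * f).
Proof.
move=> dg h hf m /mcoeffXM_neq0[be -> /hf[db Nb]]; rewrite mdegD dg db; split=> //.
exact: h.
Qed.

Definition free_mod (t : nat) (I : S -> Prop) N :=
  (forall f, f \is t.-homog -> exists2 h, supported t N h & I (f - h)) /\
  (forall h, supported t N h -> I h -> h = 0).

(* The part of degree [r + t] of the ideal generated by [L], a set of forms of
   degree [r]. *)
Definition mulS (t : nat) L : S -> Prop :=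
  span (fun g => exists ga f, [/\ mdeg ga = t, L f & g = 'X_[ga] * f]).

Lemma mem_mulS t L ga f : mdeg ga = t -> L f -> mulS t L ('X_[ga] * f).
Proof. by move=> dg Lf; apply: mem_span; exists ga, f. Qed.

Lemma span_map Q' (ga : 'X_{1..n.+1}) (G : S -> Prop) : subm Q' ->
  (forall g, G g -> Q' ('X_[ga] * g)) -> forall g, span G g -> Q' ('X_[ga] * g).
Proof.
move=> [h0 hD hZ] h g hg; apply: (hg (fun g => Q' ('X_[ga] * g))) => //; split; first by rewrite mulr0.
  by move=> u v hu hv; rewrite mulrDr; exact: hD.
by move=> c v hv; rewrite -scalerAr; exact: hZ.
Qed.

(** The weight gives [x_i] the value [i + 1]. Removing the [t] smallest variables leaves the
    heaviest divisor of its degree, and no other divisor is as heavy: if the smallest variable sits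
    in [be], exchanging it with a larger variable of [ga] raises the weight of [be]. *)
Lemma top_weight t be ga : mdeg ga = t -> let al := iter t rm (ga + be)%MM in
  be = al \/ (mnmwgt be < mnmwgt al)%N.
Proof.
elim: t be ga => [|t IH] be ga dg /=.
  by left; move/eqP: dg; rewrite mdeg_eq0 => /eqP ->; rewrite add0m.
rewrite -iterS iterSr; set m := (ga + be)%MM; set i := mmin m.
have m0 : m != 0%MM by rewrite -mdeg_eq0 mdegD dg.
have [h1 h2] := mminP m0; rewrite -/i in h1 h2.
have [gi|gi] := eqVneq (ga i) 0%N; last first.
  have -> : rm m = (ga - U_(i) + be)%MM.
    apply: (@addIm _ U_(i)%MM); rewrite rmK // -addmA [(be + _)%MM]addmC addmA mnm_lepU //.
  by apply: IH; apply: succn_inj; rewrite mdeg_subU.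
have g0 : ga != 0%MM by rewrite -mdeg_eq0 dg.
have [l1 l2] := mminP g0; set l := mmin ga in l1 l2.
have bi : be i != 0%N by move: h1; rewrite mnmDE gi.
have il : (i < l)%N.
  rewrite ltnNge leq_eqVlt; apply/negP => /orP[/eqP/ord_inj e|hl].
    by move: l1; rewrite e gi.
  by move/supgeP: h2 => /(_ _ hl); rewrite mnmDE; move: l1; case: (ga l).
pose b1 := (be - U_(i) + U_(l))%MM; pose g1 := (ga - U_(l))%MM.
have e : rm m = (g1 + b1)%MM.
  apply: (@addIm _ U_(i)%MM); rewrite rmK // /m /g1 /b1.
  rewrite -[in LHS](mnm_lepU l1) -[in LHS](mnm_lepU bi) -!addmA; congr (_ + _)%MM.
  exact: Monoid.mulmCA.
have wb : (mnmwgt be < mnmwgt b1)%N.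
  by rewrite -{1}(mnm_lepU bi) !mnmwgtD !mnmwgt1 ltn_add2l.
rewrite e; right; have [|<-|h] // := IH b1 g1.
  by apply: succn_inj; rewrite mdeg_subU.
exact: ltn_trans h.
Qed.

Lemma iter_rm_split t m : (t <= mdeg m)%N ->
  exists2 ga, mdeg ga = t & m = (ga + iter t rm m)%MM.
Proof.
elim: t => [|t IH] ht /=; first by exists 0%MM; rewrite ?mdeg0 ?add0m.
have [ga dg e] := IH (ltnW ht); set u := iter t rm m in e *.
have u0 : u != 0%MM by rewrite -mdeg_eq0 mdeg_iter_rm; lia.
exists (ga + U_(mmin u))%MM; first by rewrite mdegU dg.
by rewrite -addmA [(U_(_) + _)%MM]addmC rmK.
Qed.

Section Marked.
Context (r : nat) (N : pred 'X_{1..n.+1}) (f : 'X_{1..n.+1} -> S).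
Hypothesis f_marked : forall al, mdeg al = r -> ~~ N al ->
  supported r N ('X_[al] - f al).

(** The weight of the part that is stripped off, and the measure by which rewriting terminates. It
    depends on monomials only, so no term order compatible with the marked basis is needed. *)
Definition excess t m := (mnmwgt m - mnmwgt (iter t rm m))%N.

(* The Eliahou-Kervaire decomposition of the monomial [ga + al]. *)
Definition star t ga al := [/\ mdeg ga = t, mdeg al = r, ~~ N al
                             & iter t rm (ga + al)%MM = al].

Definition star_span t k := span (fun g => exists ga al,
  [/\ star t ga al, (mnmwgt ga < k)%N & g = 'X_[ga] * f al]).

Lemma excess_star t ga al : iter t rm (ga + al)%MM = al -> excess t (ga + al) = mnmwgt ga.
Proof. by move=> e; rewrite /excess e mnmwgtD addnK. Qed.

Lemma excess_lt t ga be k : mdeg ga = t -> be != iter t rm (ga + be)%MM ->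
  (mnmwgt ga <= k)%N -> (excess t (ga + be) < k)%N.
Proof.
move=> dg ne; have [e|h1] := top_weight be dg; first by rewrite -e eqxx in ne.
have [|ga' _ /(congr1 (@mnmwgt _))] := @iter_rm_split t (ga + be)%MM.
  by rewrite mdegD dg leq_addr.
by move: h1; rewrite /excess /= !mnmwgtD; lia.
Qed.

Local Notation good t k g :=
  (exists2 h, supported (t + r) (iter t grow N) h & star_span t k (g - h)).

Lemma subm_good t k : subm (fun g => good t k g).
Proof. by apply: subm_mod; [exact: subm_span|exact: subm_supported]. Qed.

(** A monomial outside [iter t grow N] is a star product plus a multiple of the tail of [f al]. A
    tail term [ga + be] has [be] in [N]; if it is not standard, [be] is not its stripped divisor,
    and [top_weight] makes its excess strictly smaller. *)
Lemma good_mono t k m : mdeg m = (t + r)%N ->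
  iter t grow N m || (excess t m < k)%N -> good t k 'X_[m].
Proof.
have [s] := ubnP (excess t m); elim: s m => // s IH m hs dm.
case Nm: (iter t grow N m) => /= hk.
  by exists 'X_[m]; [exact: supportedX|rewrite subrr; exact: span0].
have [|ga dg e] := @iter_rm_split t m; first by rewrite dm leq_addr.
set al := iter t rm m in e; have da : mdeg al = r by rewrite mdeg_iter_rm dm addKn.
have Na : ~~ N al by rewrite /al -grow_iter Nm.
have st : star t ga al by split=> //; rewrite -e.
have ex : excess t m = mnmwgt ga by rewrite {1}e excess_star // -e.
have h : good t k ('X_[ga] * ('X_[al] - f al)).
  rewrite (supportedE (f_marked da Na)) mulr_sumr big_seq_cond.
  apply: (subm_sum (subm_good t k)) => be.
  rewrite mem_monomials => /andP[/eqP db Nb]; rewrite -scalerAr -mpolyXD.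
  case: (subm_good t k) => _ _; apply; have dgb : mdeg (ga + be) = (t + r)%N by rewrite mdegD dg db.
  case Ngb: (iter t grow N (ga + be)%MM).
    exists 'X_[(ga + be)%MM]; [exact: supportedX|].
    by rewrite subrr; exact: span0.
  have lt j : (mnmwgt ga <= j)%N -> (excess t (ga + be) < j)%N.
    by apply: excess_lt => //; apply/eqP => eb; rewrite grow_iter -eb Nb in Ngb.
  by apply: IH => //; [have := lt _ (leqnn _); lia|rewrite Ngb lt //; lia].
rewrite e mpolyXD -['X_[al]](subrK (f al)) mulrDr.
case: (subm_good t k) => _ hD _; apply: hD => //.
exists 0; first by case: (subm_supported (t + r) (iter t grow N)).
by rewrite subr0; apply: mem_span; exists ga, al; split=> //; lia.
Qed.

(** In a nonstar product the leading monomial too is divided by something other than its stripped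
    divisor. All nonstandard terms therefore have excess below the weight of [ga], and only star
    products with lighter cofactors are needed. *)
Lemma good_nonstar t ga al : mdeg ga = t -> mdeg al = r -> ~~ N al ->
  al != iter t rm (ga + al)%MM -> good t (mnmwgt ga) ('X_[ga] * f al).
Proof.
move=> dg da Na ns; rewrite -[f al](subKr 'X_[al]) mulrBr.
apply: (submB (subm_good t (mnmwgt ga))).
  by rewrite -mpolyXD; apply: good_mono; rewrite ?mdegD ?dg ?da // excess_lt ?orbT.
rewrite (supportedE (f_marked da Na)) mulr_sumr big_seq_cond.
apply: (subm_sum (subm_good t (mnmwgt ga))) => be.
rewrite mem_monomials => /andP[/eqP db Nb]; rewrite -scalerAr -mpolyXD.
case: (subm_good t (mnmwgt ga)) => _ _; apply; apply: good_mono.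
  by rewrite mdegD dg db.
case Ngb: (iter t grow N (ga + be)%MM) => //=; apply: excess_lt => //.
by apply/eqP => eb; rewrite grow_iter -eb Nb in Ngb.
Qed.

Lemma marked_span t Q : subm Q ->
  (forall ga al, mdeg ga = t -> mdeg al = r -> ~~ N al -> Q ('X_[ga] * f al)) ->
  forall g, g \is (t + r)%N.-homog ->
  exists2 h, supported (t + r) (iter t grow N) h & Q (g - h).
Proof.
move=> hQ hf g hg; have hm := subm_mod hQ (subm_supported (t + r) (iter t grow N)).
apply: (subm_supp (t := t + r) (N := predT) hm).
- exact: homog_supported.
move=> m dm _; have [||h hh] := @good_mono t (excess t m).+1 m => //.
  by rewrite ltnSn orbT.
by move=> h'; exists h => //; apply: (h' Q) => // u [ga [al [[dg da Na _] _ ->]]]; exact: hf.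
Qed.

Definition star_all t := span (fun g => exists ga al, star t ga al /\ g = 'X_[ga] * f al).

Lemma star_of t ga al : mdeg ga = t -> (forall j, ga j != 0%N -> supge j al) ->
  iter t rm (ga + al)%MM = al.
Proof.
elim: t ga => [|t IH] ga dg h /=.
  by move/eqP: dg; rewrite mdeg_eq0 => /eqP ->; rewrite add0m.
have m0 : (ga + al)%MM != 0%MM by rewrite -mdeg_eq0 mdegD dg.
rewrite -iterS iterSr; set m := (ga + al)%MM in m0 *; set i := mmin m.
have [h1 h2] := mminP m0; rewrite -/i in h1 h2.
have gi : ga i != 0%N.
  apply/negP => /eqP gi; have ai : al i != 0%N by move: h1; rewrite mnmDE gi.
  have g0 : ga != 0%MM by rewrite -mdeg_eq0 dg.
  have [l1 l2] := mminP g0; set l := mmin ga in l1 l2.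
  have /supgeP sl := h _ l1; have [il|] := ltnP i l; first by move: ai; rewrite sl.
  rewrite leq_eqVlt => /orP[/eqP/ord_inj e|hl]; first by move: l1; rewrite e gi.
  by move/supgeP: h2 => /(_ _ hl); rewrite mnmDE; move: l1; case: (ga l).
have -> : rm m = (ga - U_(i) + al)%MM.
  apply: (@addIm _ U_(i)%MM); rewrite rmK // -addmA [(al + _)%MM]addmC addmA mnm_lepU //.
apply: IH; first by apply: succn_inj; rewrite mdeg_subU.
by move=> j hj; apply: h; apply: contra hj; rewrite mnmBE => /eqP ->.
Qed.

Hypothesis syz : forall (j : 'I_n.+1) al, mdeg al = r -> ~~ N al -> ~~ supge j al ->
  star_span 1 j.+1 ('X_j * f al).

(** Choose [x_j] in [ga] that is larger than some variable of [al]. The hypothesis [syz] rewrites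
    ['X_j * f al] by star multiples with smaller variables, so the weight of the whole cofactor
    drops. *)
Lemma star_gen t ga al : mdeg ga = t -> mdeg al = r -> ~~ N al ->
  star_all t ('X_[ga] * f al).
Proof.
have [s] := ubnP (mnmwgt ga); elim: s ga al => // s IH ga al hs dg da Na.
have [/forallP h|] := boolP [forall j, (ga j != 0%N) ==> supge j al].
  apply: mem_span; exists ga, al; split=> //; split=> //.
  by apply: star_of => // j; apply/implyP.
rewrite negb_forall => /existsP[j]; rewrite negb_imply => /andP[gj sj].
rewrite -(mnm_lepU gj) mpolyXD -mulrA; set g' := (ga - U_(j))%MM.
have dg' : (mdeg g').+1 = t by rewrite mdeg_subU.
have wg : mnmwgt ga = (mnmwgt g' + j.+1)%N by rewrite -{1}(mnm_lepU gj) mnmwgtD mnmwgt1.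
apply: (span_map (Q' := star_all t) (subm_span _) _ (syz da Na sj)).
move=> _ [ga1 [al1 [[d1 da1 Na1 _] w1 ->]]].
rewrite mulrA -mpolyXD; apply: IH => //; last by rewrite mdegD d1; lia.
by rewrite mnmwgtD; lia.
Qed.

Lemma star_coef t g : star_all t g -> exists a : 'X_{1..n.+1} -> R,
  g = \sum_(m <- monomials n (t + r) | ~~ iter t grow N m)
        a m *: ('X_[m - iter t rm m] * f (iter t rm m)).
Proof.
move=> hs; apply: (hs (fun g => exists a : 'X_{1..n.+1} -> R, _)); first split.
- by exists (fun=> 0); rewrite big1 // => m _; rewrite scale0r.
- move=> u v [a ->] [b ->]; exists (fun m => a m + b m).
  by rewrite -big_split /=; apply: eq_bigr => m _; rewrite scalerDl.
- move=> c v [a ->]; exists (fun m => c * a m).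
  by rewrite scaler_sumr; apply: eq_bigr => m _; rewrite scalerA.
move=> _ [ga [al [[dg da Na e] ->]]]; pose m := (ga + al)%MM.
exists (fun u => (u == m)%:R).
have mm : m \in monomials n (t + r) by rewrite mem_monomials mdegD dg da.
rewrite (big_rem m) //= grow_iter e Na /= eqxx scale1r /m addmK.
rewrite big_seq_cond big1 ?addr0 // => u.
rewrite (mem_rem_uniq _ (monomials_uniq _ _)) inE => /andP[/andP[/negbTE ->]].
by rewrite scale0r.
Qed.

(* Compare coefficients at a star monomial of greatest excess. *)
Lemma star_indep t g : star_all t g -> supported (t + r) (iter t grow N) g -> g = 0.
Proof.
move=> /star_coef[a eg] hg.
suff a0 m : mdeg m = (t + r)%N -> ~~ iter t grow N m -> a m = 0.
  rewrite eg big_seq_cond big1 // => m; rewrite mem_monomials => /andP[/eqP dm Nm].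
  by rewrite a0 // scale0r.
pose B := \max_(m <- monomials n (t + r)) excess t m.
have hB u : mdeg u = (t + r)%N -> (excess t u <= B)%N.
  by move=> du; apply: leq_bigmax_seq; rewrite // mem_monomials du.
have [s] := ubnP (B - excess t m)%N; elim: s m => // s IH m hs dm Nm.
have : g@_m = 0 by apply/eqP/negPn/negP => /hg [_]; apply/negP.
rewrite eg raddf_sum /= (big_rem m) ?mem_monomials ?dm //= Nm big_seq_cond.
have [|ga dg em] := @iter_rm_split t m; first by rewrite dm leq_addr.
set al := iter t rm m in em; have da : mdeg al = r by rewrite mdeg_iter_rm dm addKn.
have split_f c u b : mdeg b = r -> ~~ N b ->
    (c *: ('X_[u] * f b))@_m = c * ('X_[u + b]@_m - ('X_[u] * ('X_[b] - f b))@_m).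
  by move=> db Nb; rewrite mcoeffZ mpolyXD -mcoeffB -mulrBr subKr.
have tail u : mdeg u = (t + r)%N -> ~~ iter t grow N u ->
    ('X_[u - iter t rm u] * ('X_[iter t rm u] - f (iter t rm u)))@_m != 0 ->
    (excess t m < excess t u)%N.
  move=> du Nu; have [|gu dgu eu] := @iter_rm_split t u; first by rewrite du leq_addr.
  set bu := iter t rm u in eu *; have db : mdeg bu = r by rewrite mdeg_iter_rm du addKn.
  have Nb : ~~ N bu by rewrite /bu -grow_iter.
  rewrite {1}eu addmK => /mcoeffXM_neq0[be e /(f_marked db Nb)[dbe Nbe]].
  rewrite eu excess_star -?eu // e; apply: excess_lt => //.
  by apply/eqP => eb; move: Nm; rewrite e grow_iter -eb Nbe.
rewrite big1 ?addr0 => [|u].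
  rewrite split_f //; last by rewrite /al -grow_iter.
  have -> : (m - al + al)%MM = m by rewrite {1}em addmK -em.
  rewrite mcoeffX eqxx.
  have -> : ('X_[m - al] * ('X_[al] - f al))@_m = 0.
    by apply/eqP/negPn/negP => /(tail m dm Nm); rewrite ltnn.
  by rewrite subr0 mulr1.
rewrite (mem_rem_uniq _ (monomials_uniq _ _)) inE mem_monomials.
move=> /andP[/andP[ne /eqP du] Nu].
have [|gu dgu eu] := @iter_rm_split t u; first by rewrite du leq_addr.
rewrite split_f -?grow_iter ?mdeg_iter_rm ?du ?addKn //.
have -> : (u - iter t rm u + iter t rm u)%MM = u by rewrite {1}eu addmK -eu.
rewrite mcoeffX (negbTE ne) sub0r.
have [->|nz] := eqVneq ('X_[u - iter t rm u] * ('X_[iter t rm u] - f (iter t rm u)))@_m 0.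
  by rewrite oppr0 mulr0.
have lt := tail u du Nu nz; rewrite IH ?mul0r //.
by have := hB u du; lia.
Qed.

End Marked.

Lemma free_mod_marked r L N : subm L -> free_mod r L N ->
  exists f : 'X_{1..n.+1} -> S, forall al, mdeg al = r -> ~~ N al ->
    L (f al) /\ supported r N ('X_[al] - f al).
Proof.
move=> hL [h1 _].
have h al : exists g, mdeg al = r -> L g /\ supported r N ('X_[al] - g).
  have [da|ne] := eqVneq (mdeg al) r; last by exists 0 => e; rewrite e eqxx in ne.
  have [|h hh Lh] := h1 'X_[al]; first exact: homogX.
  by exists ('X_[al] - h) => _; rewrite subKr.
by have [f hf] := choice h; exists f => al da _; apply: hf.
Qed.

Lemma marked_gen r L N f : subm L -> free_mod r L N ->
  (forall g, L g -> g \is r.-homog) ->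
  (forall al, mdeg al = r -> ~~ N al -> L (f al) /\ supported r N ('X_[al] - f al)) ->
  forall g, L g -> span (fun w => exists al, [/\ mdeg al = r, ~~ N al & w = f al]) g.
Proof.
move=> hL [_ hind] hom hf g Lg.
pose q : S := \sum_(al <- monomials n r | ~~ N al) g@_al *: f al.
have hq Q : subm Q -> (forall al, mdeg al = r -> ~~ N al -> Q (f al)) -> Q q.
  move=> hQ h; rewrite /q big_seq_cond; apply: subm_sum => // al.
  rewrite mem_monomials => /andP[/eqP da Na]; case: (hQ) => _ _; apply; exact: h.
have -> : g = q; last by apply: hq => [|al da Na]; [exact: subm_span|apply: mem_span; exists al].
apply/eqP; rewrite -subr_eq0; apply/eqP/hind; last first.
  by apply: submB => //; apply: hq => // al da Na; case: (hf al da Na).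
have hg := hom _ Lg.
have -> : g - q = \sum_(m <- monomials n r | N m) g@_m *: 'X_[m]
     + \sum_(al <- monomials n r | ~~ N al) g@_al *: ('X_[al] - f al).
  rewrite {1}(supportedE (homog_supported hg)) (bigID N) /= -addrA; congr (_ + _).
  by rewrite /q -sumrB; apply: eq_bigr => al _; rewrite scalerBr.
case: (subm_supported r N) => _ hD hZ; apply: hD; first exact: supported_sumX.
rewrite big_seq_cond; apply: subm_sum => [|al]; first exact: subm_supported.
by rewrite mem_monomials => /andP[/eqP da Na]; apply: hZ; case: (hf al da Na).
Qed.

(* Gotzmann's persistence: if the marked basis of [L] has the expected size in
   degree [r + 1], the nonstar multiples of its elements rewrite to star
   multiples by smaller variables, in every degree. *)
Theorem free_mod_persistence r L N t : subm L -> (forall g, L g -> g \is r.-homog) ->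
  free_mod r L N -> free_mod (1 + r) (mulS 1 L) (grow N) ->
  free_mod (t + r) (mulS t L) (iter t grow N).
Proof.
move=> hL hom hr hr1; have [f hf] := free_mod_marked hL hr.
have fm al : mdeg al = r -> ~~ N al -> supported r N ('X_[al] - f al).
  by move=> da Na; case: (hf al da Na).
have gen := marked_gen hL hr hom hf.
split.
  move=> g hg; apply: (marked_span fm) => //; first exact: subm_span.
  by move=> ga al dg da Na; apply: mem_mulS => //; case: (hf al da Na).
have syz (j : 'I_n.+1) al : mdeg al = r -> ~~ N al -> ~~ supge j al ->
    star_span r N f 1 j.+1 ('X_j * f al).
  move=> da Na sj; have d1 : mdeg (U_(j)%MM : 'X_{1..n.+1}) = 1%N by rewrite mdeg1.
  have [|h hh] := good_nonstar fm d1 da Na.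
    apply/eqP => /= e; have n0 : (U_(j) + al)%MM != 0%MM by rewrite -mdeg_eq0 mdegD d1.
    have e2 : (U_(mmin (U_(j) + al)) + al)%MM = (U_(j) + al)%MM.
      by rewrite {2}e addmC rmK.
    have /eqP := addIm e2; rewrite eq_mnm1 => /eqP e3.
    have [_] := mminP n0; rewrite e3 supgeD => /andP[_ s2]; by rewrite s2 in sj.
  rewrite mnmwgt1 => hs; have h0 : h = 0.
    case: hr1 => _; apply => //; have hM := @subm_span R S (fun g => exists ga f, [/\ mdeg ga = 1%N, L f & g = 'X_[ga] * f]).
    apply: (subm_sub hM (u := 'X_j * f al)); last first.
      by apply: mem_mulS => //; case: (hf al da Na).
    apply: (hs (mulS 1 L)) => // _ [ga [al1 [[dg da1 Na1 _] _ ->]]].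
    by apply: mem_mulS => //; case: (hf al1 da1 Na1).
  by move: hs; rewrite h0 subr0.
move=> h hh hL'; apply: (star_indep fm (t := t)) => //.
apply: (hL' (star_all r N f t)); first exact: subm_span.
move=> _ [ga [g [dg Lg ->]]]; apply: (span_map (Q' := star_all r N f t) (subm_span _) _ (gen g Lg)).
by move=> _ [al [da Na ->]]; apply: star_gen.
Qed.

End MarkedBases.

(** * Descent of freeness to lower degrees for a saturated ideal *)

Section Descent.
Context (n : nat) (R : comNzRingType).
Local Notation S := {mpoly R[n.+1]}.
Implicit Types (m u : 'X_{1..n.+1}) (N : pred 'X_{1..n.+1}) (I : S -> Prop).

(** A power of a variable no larger than any variable of [m] is what stripping removes before it
    reaches [m]. *)
Lemma grow_iter_pow s t N m (i : 'I_n.+1) : supge i m ->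
  iter (s + t) grow N (U_(i) *+ s + m)%MM = iter t grow N m.
Proof.
move=> hm; elim: s => [|s IH]; first by rewrite mulm0n add0m.
rewrite addSn iterS mulmSr -addmA [(U_(i) + m)%MM]addmC addmA growU ?IH //.
rewrite supgeD hm andbT; apply/supgeP => j hj.
rewrite mulmnE mnm1E; case: eqP => // e; by rewrite -e ltnn in hj.
Qed.

Lemma mcoeffXM0 u (f : S) m : ~~ (u <= m)%MM -> ('X_[u] * f)@_m = 0.
Proof.
move=> h; apply/eqP/negPn/negP => /mcoeffXM_neq0[v e _]; move: h.
by rewrite e lem_addr.
Qed.

Lemma mulX_eq0 u (f : S) : 'X_[u] * f = 0 -> f = 0.
Proof. by move=> e; apply/mpolyP => m; rewrite -(mcoeffXM u) e !mcoeff0. Qed.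

Context (r : nat) (N : pred 'X_{1..n.+1}) (I : S -> Prop).
Hypothesis I_subm : subm I.
Hypothesis I_mul : forall u f, I f -> I ('X_[u] * f).
Hypothesis I_sat : forall f e t, f \is t.-homog ->
  (forall u, mdeg u = e -> I ('X_[u] * f)) -> I f.

Local Notation Nt t := (iter t grow N).

Lemma supported_mulX0 t (h : S) : supported (t + r) (Nt t) h ->
  supported (t.+1 + r) (Nt t.+1) ('X_ord0 * h).
Proof.
move=> hh; apply: (supportedXM (t := 1) _ _ hh); first by rewrite mdeg1.
by move=> m _; rewrite addmC iterS growU // supge0.
Qed.

(** [x_0] is a nonzerodivisor modulo [I]. In a large degree the remainder of ['X_[u] * f] stays
    standard when multiplied by [x_0], since [x_0] is stripped first; so it vanishes, and saturation
    returns to [f]. *)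
Lemma mulX0_cancel T f t : (forall s, (T <= s)%N -> free_mod (s + r) I (Nt s)) ->
  f \is t.-homog -> I ('X_ord0 * f) -> I f.
Proof.
move=> hT hf h0; pose s := (T + t)%N.
have hs : (T <= s)%N by rewrite leq_addr.
apply: (I_sat (e := (s + r - t)%N) hf) => u du.
have hg : 'X_[u] * f \is (s + r)%N.-homog.
  by rewrite (_ : (s + r = mdeg u + t)%N) ?homogXM // du /s; lia.
have [h hh Ih] := (hT s hs).1 _ hg.
suff h0' : h = 0 by rewrite h0' subr0 in Ih.
apply: (@mulX_eq0 U_(ord0)); apply: (hT s.+1 (leqW hs)).2; first exact: supported_mulX0.
apply: (subm_sub I_subm (u := 'X_ord0 * ('X_[u] * f))).
  by rewrite -mulrBr; exact: I_mul.
by rewrite mulrCA; exact: I_mul.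
Qed.

(* A remainder not divisible by [x_0] survives multiplication by a power of
   [x_1] into the degrees where freeness is known. *)
Lemma free_mod_pred T t : (forall s, (T <= s)%N -> free_mod (s + r) I (Nt s)) ->
  free_mod (t.+1 + r) I (Nt t.+1) -> free_mod (t + r) I (Nt t).
Proof.
move=> hT ht; split=> [f hf|h hh Ih]; last first.
  apply: (@mulX_eq0 U_(ord0)); apply: ht.2; first exact: supported_mulX0.
  exact: I_mul.
have hm := subm_mod I_subm (subm_supported R (t + r) (Nt t)).
apply: (subm_supp hm (homog_supported hf)) => m dm _.
have hX : 'X_[R, U_(ord0)] * 'X_[m] \is (t.+1 + r)%N.-homog.
  have -> : (t.+1 + r = 1 + mdeg m)%N by rewrite dm.
  by apply: homogXM; [rewrite mdeg1|exact: homogX].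
have [h hh Ih] := ht.1 _ hX.
pose h1 : S := \sum_(u <- monomials n (t + r) | Nt t u) h@_(U_(ord0) + u) *: 'X_[u].
have sh1 : supported (t + r) (Nt t) h1 by exact: supported_sumX.
pose h2 := h - 'X_ord0 * h1.
have h2c u : h2@_(U_(ord0) + u) = 0.
  rewrite mcoeffB mcoeffXM mcoeff_msumX; case: ifP; first by rewrite subrr.
  move=> hu; rewrite subr0; apply/eqP/negPn/negP => /hh [].
  rewrite mdegD mdeg1 addmC iterS growU ?supge0 // => du Nu; move: hu.
  by rewrite Nu andbT -(eqn_add2l 1) du addnA eqxx.
have sh2 : supported (t.+1 + r) [pred u | Nt t.+1 u && (u ord0 == 0%N)] h2.
  move=> u hu; have u0 : u ord0 == 0%N.
    apply/negPn/negP => u0; move: hu.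
    by rewrite -(mnm_lepU u0) addmC h2c eqxx.
  move: hu; rewrite mcoeffB mcoeffXM0 ?subr0; first by move=> /hh [-> Nu]; split=> //; apply/andP; split.
  by rewrite lep1mP u0.
suff h20 : h2 = 0.
  exists h1 => //; apply: (mulX0_cancel hT (t := t + r)).
    by apply: rpredB; [exact: homogX|exact: supported_homog sh1].
  rewrite mulrBr; move/eqP: h20; rewrite subr_eq0 => /eqP eh.
  by rewrite -eh.
(* With a single variable there is no [x_1], but then every monomial of positive degree is divisible
   by [x_0]. *)
case: (posnP n) => [n0|npos].
  apply/mpolyP => u; rewrite mcoeff0; apply/eqP/negPn/negP => /sh2 [du /andP[_ /eqP u0]].
  move: du; rewrite mdegE (bigD1 ord0) //= u0 big1 // => i /negP[].
  by apply/eqP/ord_inj; move: (ltn_ord i); rewrite {2}n0 ltnS leqn0 => /eqP.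
have n1 : (1 < n.+1)%N by [].
pose i1 : 'I_n.+1 := Ordinal n1; pose v : 'X_{1..n.+1} := (U_(i1) *+ T)%MM.
have dv : mdeg v = T by rewrite mdegMn mdeg1 mul1n.
have hXh1 : 'X_[v] * ('X_[m] - h1) \is (T + t + r)%N.-homog.
  rewrite -addnA; apply: homogXM => //.
  by apply: rpredB; [exact: homogX|exact: supported_homog sh1].
have [k sk Ik] := (hT (T + t)%N (leq_addr _ _)).1 _ hXh1.
(* Both terms are standard in a degree where freeness holds, and their difference lies in [I]. On
   monomials without [x_0] only the first term has coefficients, so this identity forces
   [h2 = 0]. *)
have e0 : 'X_[v] * h2 - 'X_ord0 * k = 0.
  apply: (hT (T + t).+1 _).2; first by rewrite leqW // leq_addr.
    apply: (submB (subm_supported R _ _)); last exact: supported_mulX0.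
    rewrite -addnS -addnA; apply: (supportedXM dv _ sh2) => u du /andP[Nu u0].
    rewrite (grow_iter_pow T t.+1 N (m := u) (i := i1)) //.
    by rewrite -[nat_of_ord i1]/(1%N) (supgeS ord0) u0 supge0.
  have -> : 'X_[v] * h2 - 'X_ord0 * k =
      'X_ord0 * ('X_[v] * ('X_[m] - h1) - k) - 'X_[v] * ('X_ord0 * 'X_[m] - h).
    by rewrite /h2; ring.
  by apply: submB => //; exact: I_mul.
apply/mpolyP => u; rewrite mcoeff0; apply/eqP/negPn/negP => hu.
have [_ /andP[_ /eqP u0]] := sh2 _ hu; move/eqP: hu; apply.
have := congr1 (mcoeff (v + u)%MM) e0; rewrite mcoeffB mcoeffXM mcoeff0 mcoeffXM0 ?subr0 //.
by rewrite lep1mP mnmDE u0 mulmnE mnm1E.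
Qed.

Lemma free_mod_descend T t : (forall s, (T <= s)%N -> free_mod (s + r) I (Nt s)) ->
  free_mod (t + r) I (Nt t).
Proof.
move=> hT; have [k hk] := ubnP (T - t)%N; elim: k t hk => // k IH t hk.
have [le|lt] := leqP T t; first exact: hT.
by apply: (free_mod_pred hT); apply: IH; lia.
Qed.

End Descent.

(** * Exterior algebra and Pluecker coordinates *)

Section SignPairs.
Context (M : nat) (R : comNzRingType).
Implicit Types (A B C S T : {set 'I_M}).

(** The sign of the shuffle that puts [A] before [B]. Unlike [eps] it is multiplicative over
    disjoint unions in each argument, which makes all sign computations formal. *)
Definition sgp A B : R := \prod_(a in A) \prod_(b in B) (if (b < a)%N then -1 else 1).

Lemma eps_sgp S T : eps S T = sgp T (S :\: T) :> R.
Proof.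
rewrite /eps /sgp pair_big /= -big_mkcondr /= prodr_const; congr (_ ^+ _).
apply: eq_card => -[a b]; by rewrite !inE /= [RHS]/in_mem /= !inE andbA.
Qed.

Lemma sgp0l A : sgp set0 A = 1. Proof. by rewrite /sgp big_set0. Qed.
Lemma sgp0r A : sgp A set0 = 1.
Proof. by rewrite /sgp big1 // => a _; rewrite big_set0. Qed.

Lemma prod_setU A B (F : 'I_M -> R) : [disjoint A & B] ->
  \prod_(i in A :|: B) F i = (\prod_(i in A) F i) * \prod_(i in B) F i.
Proof. by move=> d; rewrite -bigU //; apply: eq_bigl => i; rewrite !inE. Qed.

Lemma sgpUl A B C : [disjoint A & B] -> sgp (A :|: B) C = sgp A C * sgp B C.
Proof. by move=> d; rewrite /sgp prod_setU. Qed.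

Lemma sgpUr A B C : [disjoint B & C] -> sgp A (B :|: C) = sgp A B * sgp A C.
Proof.
move=> d; rewrite /sgp -big_split /=; apply: eq_bigr => a _; exact: prod_setU.
Qed.

Lemma sgp_sq A B : sgp A B * sgp A B = 1.
Proof.
rewrite /sgp -big_split big1 //= => a _; rewrite -big_split big1 //= => b _.
by case: ifP; rewrite ?mulrNN mulr1.
Qed.

Lemma sgp11 (a b : 'I_M) : sgp [set a] [set b] = if (b < a)%N then -1 else 1.
Proof. by rewrite /sgp !big_set1. Qed.

Lemma sgp1_min (a : 'I_M) B : (forall b, b \in B -> (a <= b)%N) -> sgp [set a] B = 1.
Proof.
move=> h; rewrite /sgp big_set1 big1 // => b /h; rewrite leqNgt.
by case: ifP.
Qed.

End SignPairs.

Section Exterior.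
Context (M : nat) (R : comNzRingType).
Local Notation ext := {ffun {set 'I_M} -> R}.
Implicit Types (u v w : ext) (S T : {set 'I_M}) (x y : 'I_M -> R).

Definition sc (a : R) u : ext := [ffun S => a * u S].

Lemma wedgeE u v S : wedge u v S =
  \sum_(T : {set 'I_M} | T \subset S) sgp R T (S :\: T) * u T * v (S :\: T).
Proof. by rewrite ffunE; apply: eq_bigr => T _; rewrite eps_sgp. Qed.

Lemma wedgeDl u v w : wedge (u + v) w = wedge u w + wedge v w.
Proof.
apply/ffunP => S; rewrite !ffunE -big_split; apply: eq_bigr => T _ /=.
by rewrite ffunE; ring.
Qed.

Lemma wedgeDr u v w : wedge w (u + v) = wedge w u + wedge w v.
Proof.
apply/ffunP => S; rewrite !ffunE -big_split; apply: eq_bigr => T _ /=.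
by rewrite ffunE; ring.
Qed.

Lemma wedge0l u : wedge 0 u = 0.
Proof. by apply/ffunP => S; rewrite !ffunE big1 // => T _; rewrite ffunE mulr0 mul0r. Qed.

Lemma wedge0r u : wedge u 0 = 0.
Proof. by apply/ffunP => S; rewrite !ffunE big1 // => T _; rewrite ffunE mulr0. Qed.

Lemma wedgeNl u v : wedge (- u) v = - wedge u v.
Proof. by apply/eqP; rewrite -addr_eq0 -wedgeDl addNr wedge0l. Qed.

Lemma wedgeNr u v : wedge u (- v) = - wedge u v.
Proof. by apply/eqP; rewrite -addr_eq0 -wedgeDr addNr wedge0r. Qed.

Lemma wedgeBr u v w : wedge w (u - v) = wedge w u - wedge w v.
Proof. by rewrite wedgeDr wedgeNr. Qed.

Lemma wedge_suml (I : Type) (r : seq I) (P : pred I) (F : I -> ext) v :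
  wedge (\sum_(i <- r | P i) F i) v = \sum_(i <- r | P i) wedge (F i) v.
Proof. exact: (big_morph (fun u => wedge u v) (fun a b => wedgeDl a b v) (wedge0l v)). Qed.

Lemma wedge_sumr (I : Type) (r : seq I) (P : pred I) (F : I -> ext) v :
  wedge v (\sum_(i <- r | P i) F i) = \sum_(i <- r | P i) wedge v (F i).
Proof. exact: (big_morph (wedge v) (fun a b => wedgeDr a b v) (wedge0r v)). Qed.

Lemma wedge_scl a u v : wedge (sc a u) v = sc a (wedge u v).
Proof.
apply/ffunP => S; rewrite !ffunE mulr_sumr; apply: eq_bigr => T _.
by rewrite ffunE; ring.
Qed.

Lemma wedge_scr a u v : wedge u (sc a v) = sc a (wedge u v).
Proof.
apply/ffunP => S; rewrite !ffunE mulr_sumr; apply: eq_bigr => T _.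
by rewrite ffunE; ring.
Qed.

Lemma scA a b u : sc a (sc b u) = sc (a * b) u.
Proof. by apply/ffunP => S; rewrite !ffunE mulrA. Qed.
Lemma sc1 u : sc 1 u = u.
Proof. by apply/ffunP => S; rewrite !ffunE mul1r. Qed.
Lemma sc0 u : sc 0 u = 0.
Proof. by apply/ffunP => S; rewrite !ffunE mul0r. Qed.
Lemma sc0r a : sc a 0 = 0.
Proof. by apply/ffunP => S; rewrite !ffunE mulr0. Qed.
Lemma scN1 u : sc (-1) u = - u.
Proof. by apply/ffunP => S; rewrite !ffunE mulN1r. Qed.
Lemma scNl a u : sc (- a) u = - sc a u.
Proof. by apply/ffunP => S; rewrite !ffunE mulNr. Qed.
Lemma scDr a u v : sc a (u + v) = sc a u + sc a v.
Proof. by apply/ffunP => S; rewrite !ffunE mulrDr. Qed.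
Lemma scDl a b u : sc (a + b) u = sc a u + sc b u.
Proof. by apply/ffunP => S; rewrite !ffunE mulrDl. Qed.
Lemma sc_sumr (I : Type) (r : seq I) (P : pred I) (F : I -> ext) a :
  sc a (\sum_(i <- r | P i) F i) = \sum_(i <- r | P i) sc a (F i).
Proof. exact: (big_morph (sc a) (scDr a) (sc0r a)). Qed.

Lemma sc_suml (I : Type) (r : seq I) (P : pred I) (F : I -> R) u :
  sc (\sum_(i <- r | P i) F i) u = \sum_(i <- r | P i) sc (F i) u.
Proof.
apply/ffunP => S; rewrite sum_ffunE ffunE mulr_suml.
by apply: eq_bigr => i _; rewrite ffunE.
Qed.

Lemma wedge1l u : wedge wedge1 u = u.
Proof.
apply/ffunP => S; rewrite wedgeE (bigD1 set0) ?sub0set //= big1 ?addr0.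
  by rewrite sgp0l ffunE eqxx setD0 !mul1r.
by move=> T /andP[_ /negbTE e]; rewrite [wedge1 _]ffunE e mulr0 mul0r.
Qed.

Lemma wedge1r u : wedge u wedge1 = u.
Proof.
apply/ffunP => S; rewrite wedgeE (bigD1 S) //= big1 ?addr0.
  by rewrite setDv sgp0r ffunE eqxx mul1r mulr1.
move=> T /andP[sT ne]; rewrite [wedge1 _]ffunE setD_eq0.
by move: ne; rewrite eqEsubset sT /=; case: (S \subset T); rewrite ?mulr0.
Qed.

(** Both sides are sums over flags of subsets [T2] of [T1] of [S]; the signs agree because [sgp] is
    multiplicative in each argument. *)
Lemma wedgeA u v w : wedge u (wedge v w) = wedge (wedge u v) w.
Proof.
apply/ffunP => S; rewrite !wedgeE.
pose F T1 T2 := sgp R T2 (S :\: T2) * u T2 *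
  (sgp R (T1 :\: T2) (S :\: T1) * v (T1 :\: T2) * w (S :\: T1)).
transitivity (\sum_(T2 : {set 'I_M} | T2 \subset S)
   \sum_(T1 : {set 'I_M} | (T2 \subset T1) && (T1 \subset S)) F T1 T2).
  apply: eq_bigr => T2 s2; rewrite wedgeE mulr_sumr.
  rewrite (reindex_onto (fun T1 => T1 :\: T2) (fun T => T :|: T2)) /=; last first.
    move=> T sT; rewrite setDUl setDv setU0; apply/setDidPl.
    rewrite disjoint_sym; apply: disjointWr sT _.
    by rewrite disjoint_sym disjoints_subset; apply/subsetP => x; rewrite !inE => /andP[].
  apply: eq_big => [T1|T1 /andP[_ /eqP h2]].
    have -> : (T1 :\: T2) :|: T2 = T1 :|: T2.
      by apply/setP => x; rewrite !inE; case: (x \in T2); rewrite ?orbT.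
    rewrite andbC (sameP eqP setUidPl); case s21: (T2 \subset T1) => //=.
    apply/subsetP/subsetP => h x; last by rewrite !inE => /andP[-> /h].
    by move=> hx; have := h x; rewrite !inE hx andbT; have [x2 _|_] := boolP (x \in T2); [exact: (subsetP s2)|by apply].
  have s21 : T2 \subset T1 by rewrite -h2 subsetUr.
  rewrite /F; have -> : (S :\: T2) :\: (T1 :\: T2) = S :\: T1; last by [].
  apply/setP => x; rewrite !inE; case x2: (x \in T2) => //=.
  by rewrite (subsetP s21 _ x2).
rewrite (exchange_big_dep (fun T1 : {set 'I_M} => T1 \subset S)) /=; last by move=> ? ? _ /andP[].
apply: eq_bigr => T1 s1; rewrite wedgeE mulr_sumr mulr_suml.
apply: eq_big => [T2|T2 /and3P[s2 s21 _]].
  by case s21: (T2 \subset T1); rewrite ?andbF // s1 (subset_trans s21 s1).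
rewrite /F; have dj : [disjoint T1 :\: T2 & S :\: T1].
  by rewrite disjoints_subset; apply/subsetP => x; rewrite !inE => /andP[_ ->].
have e1 : sgp R T2 (S :\: T2) = sgp R T2 (T1 :\: T2) * sgp R T2 (S :\: T1).
  rewrite -sgpUr //; congr (sgp _ _ _).
  apply/setP => x; rewrite !inE; case x1: (x \in T1); rewrite /= ?andbF ?orbF.
    by rewrite (subsetP s1 _ x1) andbT.
  by case x2: (x \in T2) => //=; rewrite (subsetP s21 _ x2) in x1.
have e2 : sgp R T1 (S :\: T1) = sgp R T2 (S :\: T1) * sgp R (T1 :\: T2) (S :\: T1).
  rewrite -sgpUl; last by rewrite disjoints_subset; apply/subsetP => x hx; rewrite !inE hx.
  congr (sgp _ _ _); apply/setP => x; rewrite !inE.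
  by have [/(subsetP s21)|] := boolP (x \in T2).
rewrite e1 e2; ring.
Qed.

Definition form x : ext := [ffun S => \sum_(j | S == [set j]) x j].

Lemma form1 x j : form x [set j] = x j.
Proof.
rewrite ffunE (big_pred1 j) // => l /=; rewrite eq_sym.
by apply/eqP/eqP => [/set1_inj|->].
Qed.

Lemma form_out x S : #|S| != 1%N -> form x S = 0.
Proof. by move=> h; rewrite ffunE big1 // => j /eqP e; rewrite e cards1 in h. Qed.

Lemma form_eq x y : x =1 y -> form x = form y.
Proof. by move=> e; apply/ffunP => S; rewrite !ffunE; apply: eq_bigr => j _; rewrite e. Qed.

Lemma formE u : (forall S, #|S| != 1%N -> u S = 0) -> u = form (fun j => u [set j]).
Proof.
move=> h; apply/ffunP => S; have [/cards1P[j ->]|ne] := boolP (#|S| == 1%N).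
  by rewrite form1.
by rewrite h // form_out.
Qed.

Lemma formD x y : form (fun j => x j + y j) = form x + form y.
Proof. by apply/ffunP => S; rewrite !ffunE -big_split. Qed.

Lemma form_sum (I : Type) (r : seq I) (P : pred I) (F : I -> 'I_M -> R) :
  form (fun j => \sum_(i <- r | P i) F i j) = \sum_(i <- r | P i) form (F i).
Proof. by apply/ffunP => S; rewrite sum_ffunE ffunE exchange_big /=; apply: eq_bigr => i _; rewrite ffunE. Qed.

Lemma form_sc a x : form (fun j => a * x j) = sc a (form x).
Proof. by apply/ffunP => S; rewrite !ffunE mulr_sumr. Qed.

Lemma wedge_form x u S :
  wedge (form x) u S = \sum_(j in S) sgp R [set j] (S :\ j) * x j * u (S :\ j).
Proof.
rewrite wedgeE; pose F T j := sgp R T (S :\: T) * x j * u (S :\: T).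
transitivity (\sum_(T : {set 'I_M} | T \subset S) \sum_(j | T == [set j]) F T j).
  by apply: eq_bigr => T _; rewrite ffunE mulr_sumr mulr_suml.
rewrite (exchange_big_dep (mem S)) /=; last by move=> T j sT /eqP e; rewrite -sub1set -e.
apply: eq_bigr => j jS; rewrite (big_pred1 [set j]) // => T /=.
by rewrite andbC; case: eqP => //= ->; rewrite sub1set.
Qed.

Lemma wedge_form_sq x : wedge (form x) (form x) = 0.
Proof.
apply/ffunP => S; rewrite wedge_form [RHS]ffunE.
have [/cards2P[a [b [ab ->]]]|ne] := boolP (#|S| == 2%N); last first.
  rewrite big1 // => j jS; rewrite form_out ?mulr0 //.
  by apply: contra ne => /eqP e; rewrite (cardsD1 j) jS e.
rewrite big_setU1 ?inE //= big_set1 setU1K ?inE //.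
rewrite [in X in _ + X]setUC setU1K ?inE 1?eq_sym //.
rewrite !form1 !sgp11; case: (ltngtP a b) => [h|h|/ord_inj e]; try by ring.
by rewrite e eqxx in ab.
Qed.

Lemma wedge_formC x y : wedge (form x) (form y) = - wedge (form y) (form x).
Proof.
apply/eqP; rewrite -addr_eq0; apply/eqP.
have := wedge_form_sq (fun j => x j + y j).
rewrite formD wedgeDl !wedgeDr !wedge_form_sq add0r addr0 //.
Qed.

End Exterior.

Section EnumSets.
Context (N : nat).
Implicit Types (S T : {set 'I_N}).

Lemma enum_set_sorted T : sorted (fun i j : 'I_N => (i < j)%N) (enum T).
Proof.
have tr : transitive (fun i j : 'I_N => (i < j)%N) by move=> j i k; exact: ltn_trans.
rewrite [enum _](_ : _ = filter (mem T) (enum 'I_N)); last first.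
  by rewrite enumT /enum_mem.
apply: sorted_filter => //.
by have := iota_ltn_sorted 0 N; rewrite -val_enum_ord sorted_map.
Qed.

Lemma enum_set_eq T (s : seq 'I_N) : sorted (fun i j : 'I_N => (i < j)%N) s ->
  s =i T -> enum T = s.
Proof.
move=> hs hT; apply: (irr_sorted_eq (leT := fun i j : 'I_N => (i < j)%N)) => //.
- by move=> j i k; exact: ltn_trans.
- by move=> i; rewrite /= ltnn.
- exact: enum_set_sorted.
by move=> i; rewrite mem_enum hT.
Qed.

Lemma enum_min T a : a \in T -> (forall b, b \in T -> (a <= b)%N) ->
  enum T = a :: enum (T :\ a).
Proof.
move=> aT amin; apply: enum_set_eq => [|i]; last first.
  by rewrite inE mem_enum !inE; case: eqVneq => [->|].
rewrite /= path_min_sorted ?enum_set_sorted //; apply/allP => b.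
rewrite mem_enum !inE => /andP[ne bT]; rewrite ltn_neqAle amin // andbT.
by apply: contra ne => /eqP/ord_inj ->.
Qed.

Lemma set_minP T : T != set0 -> exists2 a, a \in T & forall b, b \in T -> (a <= b)%N.
Proof.
case/set0Pn => b bT; case: (@arg_minnP _ b (mem T) (@nat_of_ord N) bT) => a aT h.
by exists a.
Qed.

Lemma set_ind_min (P : {set 'I_N} -> Prop) : P set0 ->
  (forall T a, a \in T -> (forall b, b \in T -> (a <= b)%N) -> P (T :\ a) -> P T) ->
  forall T, P T.
Proof.
move=> h0 hS T; have [k] := ubnP #|T|; elim: k T => // k IH T hk.
have [->//|/set_minP[a aT am]] := eqVneq T set0.
by apply: (hS T a) => //; apply: IH; move: hk; rewrite (cardsD1 a) aT.
Qed.

End EnumSets.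

Section Compound.
Context (N M : nat) (R : comNzRingType).
Local Notation ext M := {ffun {set 'I_M} -> R}.
Context (W : 'I_N -> 'I_M -> R).
Implicit Types (S T : {set 'I_N}) (u v : ext N).

Definition omega T : ext M := \big[@wedge M R/wedge1]_(h <- enum T) form (W h).

Lemma omega0 : omega set0 = wedge1.
Proof. by rewrite /omega enum_set0 big_nil. Qed.

Lemma omega_min T a : a \in T -> (forall b, b \in T -> (a <= b)%N) ->
  omega T = wedge (form (W a)) (omega (T :\ a)).
Proof. by move=> aT am; rewrite /omega (enum_min aT am) big_cons. Qed.

Lemma omega_set1 a : omega [set a] = form (W a).
Proof.
rewrite (@omega_min _ a) ?set11 // => [|b /set1P -> //].
by rewrite setDv omega0 wedge1r.
Qed.

(** The new factor moves past the smaller elements of [T], with one sign for each; meeting itself,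
    it gives a square, which is 0. *)
Lemma omega_insert T h :
  (h \notin T -> wedge (form (W h)) (omega T) = sc (sgp R [set h] T) (omega (h |: T))) /\
  (h \in T -> wedge (form (W h)) (omega T) = 0).
Proof.
elim/set_ind_min: T h => [|T a aT am IH] h.
  split=> [_|]; last by rewrite inE.
  by rewrite omega0 wedge1r setU0 sgp0r sc1 omega_set1.
rewrite (omega_min aT am); case: (ltngtP h a) => [ha|ha|/ord_inj ->].
- split=> [hT|/am]; last by rewrite leqNgt ha.
  have hm b : b \in h |: T -> (h <= b)%N.
    by rewrite !inE => /orP[/eqP -> //|/am]; apply: leq_trans; exact: ltnW.
  rewrite [in RHS](@omega_min _ h) ?setU11 // setU1K // sgp1_min ?sc1 ?(omega_min aT am) //.
  by move=> b bT; apply: hm; rewrite setU1r.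
- have ne : h != a by apply: contraTneq ha => ->; rewrite ltnn.
  rewrite wedgeA wedge_formC -scN1 wedge_scl -wedgeA; split=> hT.
    have hT' : h \notin T :\ a by rewrite !inE (negbTE hT) andbF.
    rewrite (proj1 (IH h) hT') wedge_scr scA.
    have am' b : b \in h |: T -> (a <= b)%N.
      by rewrite !inE => /orP[/eqP ->|/am //]; exact: ltnW.
    rewrite [in RHS](@omega_min _ a) ?setU1r //.
    have -> : (h |: T) :\ a = h |: (T :\ a).
      by apply/setP => x; rewrite !inE; case: (eqVneq x h) => // ->; rewrite ne.
    congr (sc _ _); rewrite -{2}(setD1K aT) sgpUr ?sgp11 ?ha //.
    by rewrite disjoints_subset sub1set !inE eqxx.
  by rewrite (proj2 (IH h)) ?wedge0r ?sc0r // !inE ne.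
by split=> [|_]; [rewrite aT|rewrite wedgeA wedge_form_sq wedge0l].
Qed.

Lemma omegaM T T' : wedge (omega T) (omega T') =
  if [disjoint T & T'] then sc (sgp R T T') (omega (T :|: T')) else 0.
Proof.
elim/set_ind_min: T => [|T a aT am IH].
  by rewrite omega0 wedge1l disjoints_subset sub0set sgp0l sc1 set0U.
rewrite (omega_min aT am) -wedgeA IH.
have eT : T = a |: (T :\ a) by rewrite setD1K.
have dj : [disjoint T & T'] = (a \notin T') && [disjoint T :\ a & T'].
  by rewrite {1}eT !disjoints_subset subUset sub1set inE.
rewrite dj; case: ifP => d; rewrite ?andbF ?wedge0r // andbT wedge_scr.
have [aT'|aT'] := boolP (a \in T') => /=.
  by rewrite (proj2 (omega_insert _ _)) ?sc0r // inE aT' orbT.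
rewrite (proj1 (omega_insert _ _)) ?scA; last by rewrite !inE eqxx.
rewrite setUA -eT; congr (sc _ _).
rewrite sgpUr // sgp1_min; last by move=> b; rewrite !inE => /andP[_ /am].
rewrite mul1r {2}eT sgpUl 1?mulrC //.
by rewrite disjoints_subset sub1set !inE eqxx.
Qed.

(* The morphism of exterior algebras that sends [e_h] to [W h]. *)
Definition Lam u : ext M := \sum_(H : {set 'I_N}) sc (u H) (omega H).

Lemma LamD u v : Lam (u + v) = Lam u + Lam v.
Proof. by rewrite /Lam -big_split; apply: eq_bigr => H _; rewrite ffunE scDl. Qed.

Lemma Lam0 : Lam 0 = 0.
Proof. by rewrite /Lam big1 // => H _; rewrite ffunE sc0. Qed.

Lemma Lam_sum (I : Type) (r : seq I) (P : pred I) (F : I -> ext N) :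
  Lam (\sum_(i <- r | P i) F i) = \sum_(i <- r | P i) Lam (F i).
Proof. exact: (big_morph Lam LamD Lam0). Qed.

Lemma Lam_sc a u : Lam (sc a u) = sc a (Lam u).
Proof. by rewrite /Lam sc_sumr; apply: eq_bigr => H _; rewrite ffunE scA. Qed.

Lemma Lam1 : Lam wedge1 = wedge1.
Proof.
rewrite /Lam (bigD1 set0) //= ffunE eqxx sc1 omega0 big1 ?addr0 // => H /negbTE h.
by rewrite ffunE h sc0.
Qed.

Lemma Lam_form x : Lam (form x) = form (fun j => \sum_i x i * W i j).
Proof.
rewrite form_sum; under [RHS]eq_bigr => i _ do rewrite form_sc.
rewrite /Lam (bigID (fun T : {set 'I_N} => #|T| == 1%N)) /= [X in _ + X]big1 ?addr0; last first.
  by move=> T h; rewrite form_out // sc0.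
transitivity (\sum_(T : {set 'I_N}) \sum_(i | T == [set i]) sc (x i) (form (W i))).
  rewrite [RHS](bigID (fun T : {set 'I_N} => #|T| == 1%N)) /= [X in _ = _ + X]big1 ?addr0.
    apply: eq_bigr => T /cards1P[i ->]; rewrite form1 omega_set1 (big_pred1 i) // => l /=.
    by rewrite eq_sym; apply/eqP/eqP => [/set1_inj|->].
  by move=> T h; rewrite big1 // => i /eqP e; rewrite e cards1 in h.
rewrite (exchange_big_dep predT) //=; apply: eq_bigr => i _.
by rewrite (big_pred1 [set i]) // => T.
Qed.

Lemma LamM u v : Lam (wedge u v) = wedge (Lam u) (Lam v).
Proof.
rewrite {2 3}/Lam wedge_suml; under [RHS]eq_bigr => T _ do rewrite wedge_sumr.
transitivity (\sum_(S : {set 'I_N}) \sum_(T : {set 'I_N} | T \subset S)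
   sc (sgp R T (S :\: T) * u T * v (S :\: T)) (omega S)).
  apply: eq_bigr => S _; by rewrite wedgeE sc_suml.
rewrite (exchange_big_dep predT) //=; apply: eq_bigr => T _.
rewrite [RHS](bigID (fun T' : {set 'I_N} => [disjoint T & T'])) /= [X in _ = _ + X]big1 ?addr0.
  rewrite (reindex_onto (fun T' => T :|: T') (fun S => S :\: T)) /=; last first.
    by move=> S sT; rewrite setDE setUIr setUCr setIT; apply/setUidPr.
  apply: eq_big => [T'|T' /andP[_ /eqP e]].
    rewrite subsetUl /= setDUl setDv set0U; apply/eqP/idP => [/setDidPl|d].
      by rewrite disjoint_sym.
    by apply/setDidPl; rewrite disjoint_sym.
  have d : [disjoint T & T'].
    by rewrite -e disjoints_subset; apply/subsetP => x hx; rewrite !inE hx.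
  by rewrite e wedge_scl wedge_scr scA omegaM d scA; congr (sc _ _); ring.
by move=> T' h; rewrite wedge_scl wedge_scr omegaM (negbTE h) !sc0r.
Qed.

Lemma Lam_prod (I : Type) (r : seq I) (P : pred I) (F : I -> ext N) :
  Lam (\big[@wedge N R/wedge1]_(i <- r | P i) F i) =
  \big[@wedge M R/wedge1]_(i <- r | P i) Lam (F i).
Proof. exact: (big_morph Lam LamM Lam1). Qed.

Lemma omega_homog T (S : {set 'I_M}) : #|S| != #|T| -> omega T S = 0.
Proof.
elim/set_ind_min: T S => [|T a aT am IH] S.
  by rewrite omega0 cards0 ffunE cards_eq0 => /negbTE ->.
rewrite (omega_min aT am) wedge_form => h; rewrite big1 // => j jS.
rewrite IH ?mulr0 //; apply: contra h.
by rewrite (cardsD1 a T) aT (cardsD1 j S) jS.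
Qed.

End Compound.

Section CompoundComp.
Context (N M P : nat) (R : comNzRingType).
Context (W : 'I_N -> 'I_M -> R) (W' : 'I_M -> 'I_P -> R).

Lemma Lam_omega T : Lam W' (omega W T) = omega (fun i j => \sum_l W i l * W' l j) T.
Proof. by rewrite /omega Lam_prod; apply: eq_bigr => h _; rewrite Lam_form. Qed.

(** Functoriality of the exterior algebra; on coordinates it is the Cauchy-Binet formula. *)
Lemma Lam_comp u : Lam W' (Lam W u) = Lam (fun i j => \sum_l W i l * W' l j) u.
Proof. by rewrite {2 3}/Lam Lam_sum; apply: eq_bigr => H _; rewrite Lam_sc Lam_omega. Qed.

End CompoundComp.

Section CompoundId.
Context (N : nat) (R : comNzRingType).

Lemma omega_id T S : omega (fun i j : 'I_N => (i == j)%:R : R) T S = (S == T)%:R.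
Proof.
elim/set_ind_min: T S => [|T a aT am IH] S; first by rewrite omega0 ffunE.
rewrite (omega_min _ aT am) wedge_form.
under eq_bigr => j _ do rewrite IH.
have [->|ne] := eqVneq S T.
  rewrite (bigD1 a) //= !eqxx sgp1_min; last by move=> b; rewrite !inE => /andP[_ /am].
  rewrite !mul1r big1 ?addr0 // => j /andP[_ h].
  by rewrite eq_sym (negbTE h) mulr0 mul0r.
rewrite big1 // => j jS; have [e|h] := eqVneq a j; last by rewrite mulr0 mul0r.
case: eqP => e2; rewrite ?mulr0 //; case/eqP: ne.
by rewrite -(setD1K jS) e2 -e setD1K.
Qed.

Lemma Lam_id u : Lam (fun i j : 'I_N => (i == j)%:R : R) u = u.
Proof.
apply/ffunP => S; rewrite sum_ffunE (bigD1 S) //= ffunE omega_id eqxx mulr1.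
rewrite big1 ?addr0 // => H h; rewrite ffunE omega_id eq_sym (negbTE h) mulr0 //.
Qed.

Lemma Lam_eq M (W W' : 'I_N -> 'I_M -> R) u : (forall i, W i =1 W' i) -> Lam W u = Lam W' u.
Proof.
move=> e; rewrite /Lam; apply: eq_bigr => H _; congr (sc _ _).
by rewrite /omega; apply: eq_bigr => h _; exact: form_eq.
Qed.

End CompoundId.

Section Contraction.
Context (N : nat) (R : comNzRingType).
Local Notation ext := {ffun {set 'I_N} -> R}.
Implicit Types (S T K J : {set 'I_N}) (u v : ext) (x y : 'I_N -> R).

(* Contraction by the covector [x]. *)
Definition iota_ x u : ext :=
  [ffun S : {set 'I_N} => \sum_(t | t \notin S) sgp R [set t] S * x t * u (t |: S)].

Lemma sgp_swap1 (a b : 'I_N) : a != b -> sgp R [set a] [set b] = - sgp R [set b] [set a].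
Proof.
move=> h; rewrite !sgp11; case: (ltngtP a b) => [||/ord_inj e]; rewrite ?opprK //.
by rewrite e eqxx in h.
Qed.

Lemma disj1 (a : 'I_N) S : a \notin S -> [disjoint [set a] & S].
Proof. by move=> h; rewrite disjoints_subset sub1set inE. Qed.

Lemma sgp_swap S T : [disjoint S & T] -> sgp R S T = (-1) ^+ (#|S| * #|T|) * sgp R T S.
Proof.
move=> d; rewrite /sgp [in RHS]exchange_big /= mulnC exprM.
have -> : ((-1) ^+ #|T|) ^+ #|S| = \prod_(a in S) \prod_(b in T) (-1) :> R.
  by rewrite -prodr_const; apply: eq_bigr => a _; rewrite prodr_const.
rewrite -big_split; apply: eq_bigr => a aS; rewrite -big_split; apply: eq_bigr => b bT /=.
case: (ltngtP a b) => [||/ord_inj e]; rewrite ?mulrNN ?mulr1 ?mul1r //.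
by move: d; rewrite disjoints_subset => /subsetP /(_ _ aS); rewrite e inE bT.
Qed.

Lemma iotaE x u S :
  iota_ x u S = \sum_(t | t \notin S) sgp R [set t] S * x t * u (t |: S).
Proof. by rewrite ffunE. Qed.

(** Contraction is an antiderivation. The terms with two different indices match with opposite
    signs. The diagonal terms on the left give the part of the pairing with index outside [S], and
    the part with index in [S] cancels against the diagonal of the last term. *)
Lemma iota_form x y u :
  iota_ x (wedge (form y) u) = sc (\sum_j x j * y j) u - wedge (form y) (iota_ x u).
Proof.
apply/ffunP => S; rewrite iotaE.
have -> : (sc (\sum_j x j * y j) u - wedge (form y) (iota_ x u)) S =
  (\sum_j x j * y j) * u S - wedge (form y) (iota_ x u) S by rewrite !ffunE.
rewrite wedge_form.
under eq_bigr => t tS do rewrite wedge_form big_setU1 //= setU1K //.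
pose G t j := sgp R [set j] (S :\ j) * y j * (sgp R [set t] (S :\ j) * x t * u (t |: (S :\ j))).
have e1 t : t \notin S -> sgp R [set t] S * x t * (sgp R [set t] S * y t * u S +
    \sum_(j in S) sgp R [set j] ((t |: S) :\ j) * y j * u ((t |: S) :\ j)) =
    x t * y t * u S - \sum_(j in S) G t j.
  move=> tS; rewrite mulrDr mulr_sumr -sumrN; congr (_ + _).
    transitivity ((sgp R [set t] S * sgp R [set t] S) * (x t * y t * u S)); first by ring.
    by rewrite sgp_sq mul1r.
  apply: eq_bigr => j jS; have ne : t != j by apply: contraNneq tS => ->.
  have -> : (t |: S) :\ j = t |: (S :\ j).
    by apply/setP => i; rewrite !inE; case: (eqVneq i t) => // ->; rewrite ne.
  have tSj : t \notin S :\ j by rewrite !inE (negbTE tS) andbF.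
  rewrite -{1}(setD1K jS) !sgpUr ?disj1 ?setD11 // (sgp_swap1 ne) /G.
  have h := sgp_sq R [set j] [set t]; ring: h.
rewrite (eq_bigr _ e1) sumrB -mulr_suml.
rewrite [X in _ = X * _ - _](bigID (fun t => t \notin S)) /= mulrDl -addrA; congr (_ + _).
have -> : \sum_(j in S) sgp R [set j] (S :\ j) * y j * iota_ x u (S :\ j) =
  \sum_(j in S) sgp R [set j] (S :\ j) * y j * (sgp R [set j] (S :\ j) * x j * u (j |: S :\ j))
  + \sum_(j in S) \sum_(t | (t \notin S :\ j) && (t != j)) G t j.
  rewrite -big_split; apply: eq_bigr => j jS /=.
  by rewrite iotaE (bigD1 j) ?setD11 //= mulrDr mulr_sumr.
rewrite opprD addrA; set A := \sum_(i | ~~ (i \notin S)) _.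
have -> : \sum_(i in S) sgp R [set i] (S :\ i) * y i *
   (sgp R [set i] (S :\ i) * x i * u (i |: S :\ i)) = A * u S.
  rewrite /A mulr_suml; apply: eq_big => [i|i iS]; first by rewrite negbK.
  rewrite setD1K //; have h := sgp_sq R [set i] (S :\ i); ring: h.
rewrite subrr add0r; congr (- _); rewrite exchange_big; apply: eq_bigr => j jS /=.
apply: eq_bigl => t; rewrite !inE negb_and negbK.
by case: (eqVneq t j) => [->|]; rewrite ?jS ?andbF ?andbT.
Qed.

Lemma iota1 x : iota_ x wedge1 = 0.
Proof.
apply/ffunP => S; rewrite !ffunE big1 // => t tS; rewrite ffunE.
case: eqP => [e|_]; last by rewrite mulr0.
by have := setU11 t S; rewrite e inE.
Qed.

Lemma iotaD x u v : iota_ x (u + v) = iota_ x u + iota_ x v.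
Proof.
apply/ffunP => S; rewrite !ffunE -big_split; apply: eq_bigr => t _ /=.
by rewrite ffunE mulrDr.
Qed.

Lemma iota_sc x a u : iota_ x (sc a u) = sc a (iota_ x u).
Proof.
apply/ffunP => S; rewrite !ffunE mulr_sumr; apply: eq_bigr => t _ /=.
by rewrite ffunE; ring.
Qed.

Lemma iota0 x : iota_ x 0 = 0.
Proof. by apply/ffunP => S; rewrite !ffunE big1 // => t _; rewrite ffunE mulr0. Qed.

Lemma iota_sum (I : Type) (r : seq I) (P : pred I) (F : I -> ext) x :
  iota_ x (\sum_(i <- r | P i) F i) = \sum_(i <- r | P i) iota_ x (F i).
Proof. exact: (big_morph (iota_ x) (iotaD x) (iota0 x)). Qed.

Lemma iota_lin (I : Type) (r : seq I) (a : I -> R) (x : I -> 'I_N -> R) u :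
  (forall i, iota_ (x i) u = 0) -> iota_ (fun j => \sum_(i <- r) a i * x i j) u = 0.
Proof.
move=> h; apply/ffunP => S; rewrite !ffunE.
transitivity (\sum_(i <- r) a i * iota_ (x i) u S); last first.
  by rewrite big1 // => i _; rewrite h ffunE mulr0.
under [RHS]eq_bigr => i _ do rewrite ffunE mulr_sumr.
rewrite exchange_big /=; apply: eq_bigr => t _; rewrite mulr_sumr mulr_suml.
by apply: eq_bigr => i _; ring.
Qed.

Definition ev1 (a : 'I_N) : 'I_N -> R := fun j => (a == j)%:R.

(* [h |-> e_h - x h e_a] is the projection along [e_a] onto the kernel of [x];
   it fixes the exterior elements annihilated by the contraction by [x]. *)
Lemma Lam_transvection x a u :
  Lam (fun h j => ev1 h j - x h * ev1 a j) u = u - wedge (form (ev1 a)) (iota_ x u).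
Proof.
pose P (h j : 'I_N) : R := ev1 h j - x h * ev1 a j.
change (Lam P u = u - wedge (form (ev1 a)) (iota_ x u)).
have fP h : form (P h) = form (ev1 h) + sc (- x h) (form (ev1 a)).
  by rewrite -form_sc -formD; apply: form_eq => j; rewrite /P mulNr.
have h T : omega P T = omega ev1 T - wedge (form (ev1 a)) (iota_ x (omega ev1 T)).
  elim/set_ind_min: T => [|T t tT tm IH].
    by rewrite !omega0 iota1 wedge0r subr0.
  rewrite !(omega_min _ tT tm) IH iota_form fP; set e := omega _ _; set i := iota_ _ _.
  have -> : \sum_j x j * ev1 t j = x t.
    rewrite (bigD1 t) //= /ev1 eqxx mulr1 big1 ?addr0 // => j /negbTE.
    by rewrite eq_sym => ->; rewrite mulr0.
  have h1 : wedge (form (ev1 a)) (wedge (form (ev1 a)) i) = 0.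
    by rewrite wedgeA wedge_form_sq wedge0l.
  have h2 : wedge (form (ev1 t)) (wedge (form (ev1 a)) i)
            = - wedge (form (ev1 a)) (wedge (form (ev1 t)) i).
    by rewrite !wedgeA wedge_formC wedgeNl.
  rewrite wedgeDl !wedgeBr !wedge_scl h2 h1 sc0r subr0 opprK scNl wedge_scr opprB.
  by rewrite addrA addrAC.
rewrite -{2 3}[u]Lam_id /Lam iota_sum wedge_sumr -sumrB; apply: eq_bigr => H _.
by rewrite h iota_sc wedge_scr -!scN1 scDr !scA mulrC.
Qed.

(** The composite of one transvection for each [a] in [s]. Since the covectors [x a] are dual to the
    basis vectors of [s], the corrections do not interact. *)
Lemma Lam_projection (s : seq 'I_N) (x : 'I_N -> 'I_N -> R) u : uniq s ->
  {in s &, forall a b, x a b = (a == b)%:R} -> {in s, forall a, iota_ (x a) u = 0} ->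
  Lam (fun h j => ev1 h j - \sum_(a <- s) x a h * ev1 a j) u = u.
Proof.
elim: s => [|a s IH] /=.
  move=> _ _ _; rewrite -[RHS]Lam_id; apply: Lam_eq => i j /=.
  by rewrite big_nil subr0.
move=> /andP[as_ us] hx hi.
have {}IH : Lam (fun h j => ev1 h j - \sum_(b <- s) x b h * ev1 b j) u = u.
  apply: IH => // [b c bs cs|b bs]; [apply: hx|apply: hi]; by rewrite inE ?bs ?cs orbT.
have := Lam_transvection (x a) a u; rewrite hi ?mem_head // wedge0r subr0 => e.
rewrite -[RHS]IH -[in RHS]e Lam_comp; apply: Lam_eq => i j /=.
have sel (b : 'I_N) (G : 'I_N -> R) : \sum_l ev1 b l * G l = G b.
  rewrite (bigD1 b) //= /ev1 eqxx mul1r big1 ?addr0 // => l /negbTE.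
  by rewrite eq_sym => ->; rewrite mul0r.
set F := fun l : 'I_N => ev1 l j - \sum_(b <- s) x b l * ev1 b j.
have -> : \sum_l (ev1 i l - x a i * ev1 a l) * F l = F i - x a i * F a.
  under eq_bigr => l _ do rewrite mulrBl -mulrA.
  by rewrite sumrB -mulr_sumr !sel.
have F0 : F a = ev1 a j.
  rewrite /F big_seq big1 ?subr0 // => b bs; rewrite hx ?mem_head ?inE ?bs ?orbT //.
  by case: eqVneq bs as_ => [->->|]; rewrite ?mul0r.
by rewrite F0 /F big_cons opprD addrA addrAC.
Qed.

End Contraction.

Section DetForms.
Context (N : nat) (R : comNzRingType).

Lemma elt_lt p (J : midx N p) (a b : 'I_p) : (a < b)%N -> (elt J a < elt J b)%N.
Proof.
move=> ab; rewrite /elt; set i := cast_ord _ a; set j := cast_ord _ b.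
have x0 := enum_val i; rewrite !(enum_val_nth x0).
have := enum_set_sorted (val J).
have tr : transitive (fun i j : 'I_N => (i < j)%N) by move=> ? ? ?; exact: ltn_trans.
by move/(sorted_ltn_nth tr x0); apply; rewrite ?inE -?cardE ?ltn_ord.
Qed.

Lemma elt_inj p (J : midx N p) : injective (elt J).
Proof.
by move=> a b e; apply: ord_inj; case: (ltngtP a b) => // /(elt_lt J); rewrite e ltnn.
Qed.

Lemma elt_in p (J : midx N p) a : elt J a \in val J.
Proof. exact: enum_valP. Qed.

Lemma elt_imset p (J : midx N p) : elt J @: setT = val J.
Proof.
apply/eqP; rewrite eqEcard; apply/andP; split.
  by apply/subsetP => _ /imsetP[a _ ->]; exact: elt_in.
by rewrite card_imset ?cardsT ?card_ord ?(eqP (valP J)) //; exact: elt_inj.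
Qed.

Lemma eltP p (J : midx N p) j : j \in val J -> exists a, elt J a = j.
Proof. by rewrite -elt_imset => /imsetP[a _ ->]; exists a. Qed.

Lemma sgp_rank k (g : 'I_k.+1 -> 'I_N) l :
  {homo g : a b / (a < b)%N >-> (a < b)%N} -> injective g ->
  sgp R [set g l] ((g @: setT) :\ g l) = (-1) ^+ l.
Proof.
move=> hg gi; rewrite /sgp big_set1.
have -> : (g @: setT) :\ g l = g @: (setT :\ l).
  apply/setP => x; rewrite !inE; apply/andP/imsetP.
    by move=> [ne /imsetP[a _ e]]; exists a => //; rewrite !inE andbT; apply: contraNneq ne => <-; rewrite e.
  by move=> [a]; rewrite !inE andbT => ne ->; split; [rewrite (inj_eq gi)|exact: imset_f].
rewrite big_imset /=; last by move=> ? ? _ _; exact: gi.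
have mono a : (g a < g l)%N = (a < l)%N.
  apply/idP/idP => [h|/hg //]; rewrite ltnNge leq_eqVlt; apply/negP => /orP[/eqP/ord_inj e|/hg].
    by rewrite e ltnn in h.
  by rewrite ltnNge (ltnW h).
rewrite -big_mkcondr /= prodr_const; congr (_ ^+ _).
have -> : nat_of_ord l = #|[set a : 'I_k.+1 | (a < l)%N]|.
  pose w := @widen_ord l k.+1 (ltnW (ltn_ord l)).
  have wi : injective w by move=> a b /(congr1 val) /= /ord_inj.
  rewrite -[LHS]card_ord -cardsT -(card_imset _ wi).
  congr #|pred_of_set _|; apply/setP => a; rewrite !inE; apply/imsetP/idP => [[b _ ->] /=|]; first exact: ltn_ord.
  by move=> h; exists (Ordinal h) => //; apply: ord_inj.
apply: eq_card => a; rewrite [LHS]/in_mem /= !inE mono andbT.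
by case: eqVneq => [->|]; rewrite ?ltnn.
Qed.

(** Both sides are expanded along the first row: [wedge_form] splits off the first factor, and by
    [sgp_rank] its sign at position [l] is that of the cofactor. *)
Lemma det_forms k (X : 'M[R]_(k, N)) (g : 'I_k -> 'I_N) :
  {homo g : a b / (a < b)%N >-> (a < b)%N} ->
  (\big[@wedge N R/wedge1]_(i < k) form (X i)) (g @: setT) = \det (colsub g X).
Proof.
have inj k' (g' : 'I_k' -> 'I_N) : {homo g' : a b / (a < b)%N >-> (a < b)%N} -> injective g'.
  by move=> h a b e; apply: ord_inj; case: (ltngtP a b) => // /h; rewrite e ltnn.
elim: k X g => [|k IH] X g hg.
  rewrite big_ord0 det_mx00 ffunE (_ : g @: setT = set0) ?eqxx //.
  by apply/setP => x; rewrite inE; apply/imsetP => -[[]].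
rewrite big_ord_recl wedge_form big_imset /=; last by move=> ? ? _ _; exact: inj.
rewrite (expand_det_row _ ord0) (eq_bigl predT) => [|i]; last by rewrite inE.
apply: eq_bigr => l _; rewrite sgp_rank //; last exact: inj.
rewrite mxE mulrAC mulrC /cofactor; congr (_ * _); rewrite add0n; congr (_ * _).
have -> : (g @: setT) :\ g l = (g \o lift l) @: setT.
  apply/setP => x; rewrite !inE; apply/andP/imsetP.
    move=> [ne /imsetP[a _ e]]; case: (unliftP l a) => [b eb|eb]; last by rewrite e eb eqxx in ne.
    by exists b => //; rewrite /= -eb.
  move=> [b _ ->]; split; last exact: imset_f.
  by apply/eqP => /(inj _ _ hg) e; have := neq_lift l b; rewrite e eqxx.
have hom : {homo g \o lift l : a b / (a < b)%N >-> (a < b)%N}.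
  move=> a b ab; apply: hg; move: ab; change (a < b -> bump l a < bump l b)%N.
  by move: (nat_of_ord a) (nat_of_ord b) => x y; rewrite /bump; lia.
rewrite (eq_bigr (fun i : 'I_k => form ((row' ord0 X : 'M_(k, N)) i))) => [|i _]; last first.
  by apply: form_eq => j; rewrite mxE.
rewrite IH //; congr (\det _); apply/matrixP => i j; rewrite !mxE //.
Qed.

Lemma omega_elt p M (W : 'I_N -> 'I_M -> R) (I : midx N p) :
  omega W (val I) = \big[@wedge M R/wedge1]_(a < p) form (W (elt I a)).
Proof.
rewrite /omega -[enum _](_ : map (elt I) (enum 'I_p) = _); first by rewrite big_map enumT [index_enum _]unlock.
apply/esym/enum_set_eq => [|j].
  rewrite sorted_map; apply: (sub_sorted (e := fun a b : 'I_p => (a < b)%N)).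
    by move=> a b; exact: elt_lt.
  by have := iota_ltn_sorted 0 p; rewrite -val_enum_ord sorted_map.
apply/mapP/idP => [[a _ ->]|/eltP[a <-]]; first exact: elt_in.
by exists a; rewrite ?mem_enum.
Qed.

End DetForms.

Lemma omega_det (N M p : nat) (R : comNzRingType) (W : 'I_N -> 'I_M -> R)
    (I : midx N p) (J : midx M p) :
  omega W (val I) (val J) = \det (\matrix_(a, b) W (elt I a) (elt J b)).
Proof.
rewrite omega_elt -(elt_imset J).
rewrite (eq_bigr (fun a => form ((\matrix_(a < p, j < M) W (elt I a) j) a))) => [|a _]; last first.
  by apply: form_eq => j; rewrite mxE.
rewrite det_forms; last exact: elt_lt.
by congr (\det _); apply/matrixP => a b; rewrite !mxE.
Qed.

Section Minors.
Context (N p : nat) (R : comNzRingType).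
Implicit Types (C : 'M[R]_(N, p)) (S T K J : {set 'I_N}).

(** The minor of [C] with rows [J], read off the wedge product of the columns. It is defined for
    every set [J], with value 0 unless [J] has [p] elements, so that exchanges of rows need no proof
    of cardinality. *)
Definition pl C J : R := omega (fun c j => C j c) [set: 'I_p] J.

Lemma omega_setT (M : nat) (W : 'I_p -> 'I_M -> R) :
  omega W [set: 'I_p] = \big[@wedge M R/wedge1]_(a < p) form (W a).
Proof. by rewrite /omega enum_setT [index_enum _]unlock. Qed.

Lemma pl_det C (J : midx N p) : \det (rowsub (elt J) C) = pl C (val J).
Proof.
rewrite /pl omega_setT -(elt_imset J) -det_tr.
rewrite (eq_bigr (fun a => form (C^T a))) => [|a _]; last by apply: form_eq => j; rewrite mxE.
rewrite det_forms; last exact: elt_lt.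
by congr (\det _); apply/matrixP => a b; rewrite !mxE.
Qed.

Lemma pl_card C J : #|J| != p -> pl C J = 0.
Proof. by move=> h; rewrite /pl omega_homog // cardsT card_ord. Qed.

(** A column wedged with the product of all columns is 0: the expansion of a determinant with a
    repeated column. *)
Lemma cramer C K c :
  \sum_(h in K) sgp R [set h] (K :\ h) * C h c * pl C (K :\ h) = 0.
Proof.
transitivity (wedge (form (fun j => C j c)) (omega (fun c j => C j c) [set: 'I_p]) K).
  by rewrite wedge_form.
by rewrite (proj2 (omega_insert (fun c j => C j c) setT c)) ?ffunE ?inE.
Qed.

Lemma cauchy_binet (G : 'M[R]_N) C (J : midx N p) :
  \sum_(I : midx N p) \det (mxsub (elt I) (elt J) G) * pl C (val I) = pl (G^T *m C) (val J).
Proof.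
have -> : pl (G^T *m C) (val J) = Lam (fun l j => G l j) (omega (fun c j => C j c) setT) (val J).
  rewrite Lam_omega /pl /omega; congr (_ _ _); apply: eq_bigr => c _.
  by apply: form_eq => j; rewrite mxE; apply: eq_bigr => l _; rewrite mxE mulrC.
rewrite /Lam sum_ffunE (bigID (fun I : {set 'I_N} => #|I| == p)) /= [X in _ + X]big1 ?addr0.
  rewrite (big_sub [pred I : {set 'I_N} | #|I| == p]
    (fun I => sc (omega (fun c j => C j c) setT I) (omega (fun l j => G l j) I) (val J))).
  apply: eq_bigr => I _; rewrite ffunE mulrC; congr (_ * _).
  exact/esym/(omega_det _ (I : midx N p) J).
by move=> I h; rewrite omega_homog ?sc0 ?ffunE // cardsT card_ord.
Qed.

(** The cofactors [D] do not depend on the covector [x], so contractions by different basis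
    covectors can be compared. *)
Lemma iota_prod (k : nat) (X : 'I_k -> 'I_N -> R) : exists D : 'I_k -> {ffun {set 'I_N} -> R},
  forall x, iota_ x (\big[@wedge N R/wedge1]_(i < k) form (X i)) =
    \sum_(i < k) sc (\sum_j x j * X i j) (D i).
Proof.
elim: k X => [|k IH] X; first by exists (fun=> 0) => x; rewrite !big_ord0 iota1.
have [D hD] := IH (fun i => X (lift ord0 i)).
exists (fun i => if unlift ord0 i is Some i' then - wedge (form (X ord0)) (D i')
                 else \big[@wedge N R/wedge1]_(i < k) form (X (lift ord0 i))) => x.
rewrite big_ord_recl iota_form hD [RHS]big_ord_recl unlift_none; congr (_ + _).
rewrite wedge_sumr -sumrN; apply: eq_bigr => i _; rewrite liftK wedge_scr.
by apply/ffunP => S; rewrite !ffunE mulrN.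
Qed.

(** By [iota_prod] the minor with rows [l] and [S] is linear in row [l] of [C], with coefficients
    independent of [l], and this linear expression vanishes for [l] in [S]. The sum thus becomes a
    combination of the relations [cramer] for [K]. *)
Lemma plucker_minors C S K : #|S|.+1 = p -> #|K| = p.+1 ->
  \sum_(l in K :\: S) eps (l |: S) S * eps K [set l] * pl C (l |: S) * pl C (K :\ l) = 0.
Proof.
move=> dS dK; have [D hD] := iota_prod (fun c j => C j c).
have hl l : iota_ (ev1 R l) (omega (fun c j => C j c) [set: 'I_p]) S =
    \sum_c C l c * D c S.
  rewrite omega_setT hD sum_ffunE; apply: eq_bigr => c _; rewrite ffunE; congr (_ * _).
  rewrite (bigD1 l) //= /ev1 eqxx mul1r big1 ?addr0 // => j /negbTE.
  by rewrite eq_sym => ->; rewrite mul0r.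
have hout l : l \notin S -> sgp R [set l] S * pl C (l |: S) = \sum_c C l c * D c S.
  move=> lS; rewrite -hl iotaE (bigD1 l) //= /ev1 eqxx mulr1 big1 ?addr0 // => j /andP[_ /negbTE].
  by rewrite eq_sym => ->; rewrite mulr0 mul0r.
have hin l : l \in S -> \sum_c C l c * D c S = 0.
  move=> lS; rewrite -hl iotaE big1 // => j jS; rewrite /ev1.
  by case: eqVneq => [e|]; [rewrite -e lS in jS|rewrite mulr0 mul0r].
transitivity ((-1) ^+ #|S| * \sum_c D c S * \sum_(l in K) sgp R [set l] (K :\ l) * C l c * pl C (K :\ l)).
  rewrite mulr_sumr; under [RHS]eq_bigr => c _ do rewrite mulr_sumr mulr_sumr.
  rewrite exchange_big [RHS](big_setID S) /= [X in _ = X + _]big1 ?add0r; last first.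
    move=> l /setIP[_ lS]; rewrite (eq_bigr (fun c => ((-1) ^+ #|S| * sgp R [set l] (K :\ l) * pl C (K :\ l)) * (C l c * D c S))).
      by rewrite -mulr_sumr hin // mulr0.
    by move=> c _; ring.
  apply: eq_bigr => l /setDP[lK lS].
  rewrite (eq_bigr (fun c => ((-1) ^+ #|S| * sgp R [set l] (K :\ l) * pl C (K :\ l)) * (C l c * D c S))); last first.
    by move=> c _; ring.
  rewrite -mulr_sumr -hout // !eps_sgp.
  have -> : (l |: S) :\: S = [set l].
    by apply/setP => x; rewrite !inE; case: eqVneq => [->|]; rewrite ?lS //= andNb.
  have -> : K :\: [set l] = K :\ l by [].
  rewrite (@sgp_swap _ _ S [set l]) ?cards1 ?muln1; last by rewrite disjoint_sym disj1.
  by ring.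
by rewrite big1 ?mulr0 // => c _; rewrite cramer mulr0.
Qed.

(* The value at [C] of [delta^(m)_K]. *)
Definition dl C m K : {ffun {set 'I_N} -> R} :=
  [ffun H : {set 'I_N} => if (H \subset K) && (#|H| == m) then sgp R H (K :\: H) * pl C (K :\: H) else 0].

(** Contraction by a column produces, up to sign, the relation [cramer] for the set [K :\: T]. This
    annihilation is what places [dl] in the exterior algebra of the kernel of [C] once a minor is a
    unit. *)
Lemma iota_dl C m K c : iota_ (fun j => C j c) (dl C m K) = 0.
Proof.
apply/ffunP => T; rewrite iotaE [RHS]ffunE.
have [/andP[sT /eqP cT]|h] := boolP ((T \subset K) && (#|T|.+1 == m)); last first.
  rewrite big1 // => t tT; rewrite ffunE; case: ifP; rewrite ?mulr0 // => /andP[sub].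
  rewrite cardsU1 tT add1n => e; case/negP: h; rewrite e andbT.
  by apply: subset_trans sub; apply: subsetUr.
have dTK : [disjoint T & K :\: T].
  by rewrite disjoints_subset; apply/subsetP => x xT; rewrite !inE xT.
rewrite (bigID (mem K)) /= [X in _ + X]big1 ?addr0; last first.
  move=> t /andP[tT tK]; rewrite ffunE; case: ifP; rewrite ?mulr0 // => /andP[/subsetP sub].
  by case/negP: tK; apply: sub; exact: setU11.
transitivity ((-1) ^+ #|T| * sgp R T (K :\: T) * \sum_(h in K :\: T)
    sgp R [set h] ((K :\: T) :\ h) * C h c * pl C ((K :\: T) :\ h)); last by rewrite cramer mulr0.
rewrite mulr_sumr.
apply: eq_big => [t|t /andP[tT tK]]; first by rewrite !inE.
have tKT : t \in K :\: T by rewrite !inE tT tK.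
have eK : K :\: (t |: T) = (K :\: T) :\ t.
  by apply/setP => x; rewrite !inE negb_or andbA [~~ _ && ~~ _]andbC.
rewrite ffunE cardsU1 tT add1n cT eqxx andbT subUset sub1set tK sT /= eK.
have -> : sgp R T (K :\: T) = sgp R T [set t] * sgp R T ((K :\: T) :\ t).
  by rewrite -{1}(setD1K tKT) sgpUr ?disj1 ?setD11.
rewrite sgpUl ?disj1 //.
rewrite (@sgp_swap _ _ T [set t]) ?cards1 ?muln1; last by rewrite disjoint_sym disj1.
have h1 : (-1) ^+ #|T| * (-1) ^+ #|T| = 1 :> R by rewrite -expr2 sqrr_sign.
transitivity (((-1) ^+ #|T| * (-1) ^+ #|T|) * (sgp R [set t] T * sgp R [set t] (K :\: T :\ t) *
   sgp R T (K :\: T :\ t) * C t c * pl C (K :\: T :\ t))); first by rewrite h1; ring.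
by ring.
Qed.

End Minors.

Section DeltaSpan.
Context (N p : nat) (R : comUnitRingType).
Implicit Types (C : 'M[R]_(N, p)).

(** [F] is the projection onto the kernel of [C] along the basis vectors of [J], written with [X],
    the matrix [C] normalized to the identity on the rows [J]. By the last clause it fixes every
    exterior element annihilated by the columns of [C]. *)
Lemma dl_Lam C (J : midx N p) : pl C (val J) \is a GRing.unit ->
  exists F : 'I_N -> 'I_N -> R,
  [/\ forall h c, \sum_j F h j * C j c = 0,
      forall h j, j \notin val J -> F h j = if h \in val J then 0 else (h == j)%:R,
      forall h j, h \in val J -> F h j = 0
    & forall u, (forall c, iota_ (fun j => C j c) u = 0) -> Lam F u = u].
Proof.
rewrite -pl_det => hJ; set CJ := rowsub (elt J) C in hJ.
pose X := C *m invmx CJ.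
have hX (a b : 'I_p) : X (elt J a) b = (a == b)%:R.
  have -> : X (elt J a) b = (CJ *m invmx CJ) a b.
    by rewrite !mxE; apply: eq_bigr => c _; rewrite !mxE.
  by rewrite mulmxV ?mxE // unitmxE.
have XC : X *m CJ = C by rewrite /X mulmxKV // unitmxE.
pose x (a : 'I_N) : 'I_N -> R := fun h => \sum_(b | elt J b == a) X h b.
have hx b h : x (elt J b) h = X h b.
  by rewrite /x (big_pred1 b) // => b' /=; rewrite (inj_eq (@elt_inj _ _ J)).
pose F (h j : 'I_N) : R := ev1 R h j - \sum_(a <- enum (val J)) x a h * ev1 R a j.
have FE h j : F h j = ev1 R h j - \sum_b X h b * ev1 R (elt J b) j.
  rewrite /F; congr (_ - _); rewrite big_enum /= -[in LHS](elt_imset J) big_imset /=.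
    by apply: eq_big => [b|b _]; rewrite ?inE ?hx.
  by move=> ? ? _ _; exact: elt_inj.
have sel h (G : 'I_N -> R) : \sum_j ev1 R h j * G j = G h.
  rewrite (bigD1 h) //= /ev1 eqxx mul1r big1 ?addr0 // => l /negbTE.
  by rewrite eq_sym => ->; rewrite mul0r.
have F0 h j : h \in val J -> F h j = 0.
  move=> /eltP[a <-]; rewrite FE (bigD1 a) //= hX eqxx mul1r big1 ?addr0 ?subrr // => b ne.
  by rewrite hX eq_sym (negbTE ne) mul0r.
exists F; split=> //.
- move=> h c; under eq_bigr => j _ do rewrite FE mulrBl mulr_suml.
  rewrite sumrB sel exchange_big /=.
  under [X in _ - X]eq_bigr => b _.
    under eq_bigr => j _ do rewrite -mulrA.
    rewrite -mulr_sumr sel.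
    over.
  by apply/eqP; rewrite subr_eq0 -{1}XC mxE; apply/eqP; apply: eq_bigr => b _; rewrite !mxE.
- move=> h j jJ; case: ifP => [|hJ']; first exact: F0.
  rewrite FE big1 ?subr0 // => b _; rewrite /ev1.
  by case: eqVneq => [e|]; rewrite ?mulr0 //; case/negP: jJ; rewrite -e elt_in.
move=> u hu; apply: Lam_projection; first exact: enum_uniq.
  move=> a b; rewrite !mem_enum => /eltP[a' <-] /eltP[b' <-].
  by rewrite hx hX (inj_eq (@elt_inj _ _ J)) eq_sym.
move=> a; rewrite mem_enum => /eltP[a' <-].
rewrite (_ : x _ = fun h => \sum_c invmx CJ c a' * C h c); last first.
  by apply/funext => h; rewrite hx mxE; apply: eq_bigr => c _; rewrite mulrC.
by apply: (@iota_lin _ _ _ _ (fun c => invmx CJ c a') (fun c h => C h c)) => c; exact: hu.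
Qed.

Lemma omega_zero M (F : 'I_N -> 'I_M -> R) (H : {set 'I_N}) h : h \in H ->
  (forall j, F h j = 0) -> omega F H = 0.
Proof.
move=> hH F0; have := proj1 (omega_insert F (H :\ h) h).
rewrite setD11 setD1K // => /(_ isT).
have -> : form (F h) = 0 by apply/ffunP => S; rewrite !ffunE big1.
rewrite wedge0l => e; rewrite -[LHS]sc1 -(sgp_sq R [set h] (H :\ h)) -scA -e sc0r //.
Qed.

(* Jacobi's complementary minor formula. *)
Lemma dl_decomposable C (J : midx N p) (F : 'I_N -> 'I_N -> R) (A : {set 'I_N}) :
  (forall h j, h \in val J -> F h j = 0) ->
  (forall m K, Lam F (dl C m K) = dl C m K) -> [disjoint A & val J] ->
  dl C #|A| (val J :|: A) = sc (sgp R A (val J) * pl C (val J)) (omega F A).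
Proof.
move=> F0 hF dA; rewrite -hF /Lam (bigD1 A) //= [X in _ + X]big1 ?addr0.
  rewrite ffunE subsetUr eqxx /= setDUl setDv setU0.
  by have -> : val J :\: A = val J by apply/setDidPl; rewrite disjoint_sym.
move=> H ne; rewrite ffunE; case: ifP; rewrite ?sc0 // => /andP[sub /eqP cH].
have [dH|] := boolP [disjoint H & val J].
  case/negP: ne; rewrite eqEcard cH leqnn andbT; apply/subsetP => x xH.
  have := subsetP sub x xH; rewrite inE => /orP[xJ|//].
  by move: dH; rewrite disjoints_subset => /subsetP /(_ x xH); rewrite inE xJ.
rewrite -setI_eq0 => /set0Pn[h /setIP[hH hJ]].
by rewrite (omega_zero hH) ?sc0r // => j; exact: F0.
Qed.

End DeltaSpan.

(** * Evaluation of the equations *)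

Section MapExt.
Context (M : nat) (R1 R2 : comNzRingType) (f : {rmorphism R1 -> R2}).
Local Notation ext R := {ffun {set 'I_M} -> R}.

Definition mapx (u : ext R1) : ext R2 := [ffun S => f (u S)].

Lemma mapxD u v : mapx (u + v) = mapx u + mapx v.
Proof. by apply/ffunP => S; rewrite !ffunE rmorphD. Qed.

Lemma rmorph_sgp (A B : {set 'I_M}) : f (sgp R1 A B) = sgp R2 A B.
Proof.
rewrite rmorph_prod; apply: eq_bigr => a _; rewrite rmorph_prod.
by apply: eq_bigr => b _; case: ifP => _; rewrite ?rmorphN rmorph1.
Qed.

Lemma mapx_wedge u v : mapx (wedge u v) = wedge (mapx u) (mapx v).
Proof.
apply/ffunP => S; rewrite ffunE !wedgeE rmorph_sum; apply: eq_bigr => T _.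
by rewrite !rmorphM !ffunE rmorph_sgp.
Qed.

Lemma mapx1 : mapx wedge1 = wedge1.
Proof. by apply/ffunP => S; rewrite !ffunE rmorph_nat. Qed.

Lemma mapx_prod (I : Type) (r : seq I) (P : pred I) (F : I -> ext R1) :
  mapx (\big[@wedge M R1/wedge1]_(i <- r | P i) F i) =
  \big[@wedge M R2/wedge1]_(i <- r | P i) mapx (F i).
Proof. exact: (big_morph mapx mapx_wedge mapx1). Qed.

End MapExt.

Section Homogeneous.
Context (M : nat) (R : comNzRingType).
Local Notation ext := {ffun {set 'I_M} -> R}.
Implicit Types (u v : ext).

Definition xhomog (s : nat) u := forall S : {set 'I_M}, #|S| != s -> u S = 0.

Lemma xhomog_wedge s t u v : xhomog s u -> xhomog t v -> xhomog (s + t) (wedge u v).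
Proof.
move=> hu hv S hS; rewrite wedgeE big1 // => T sT.
have [e|ne] := eqVneq #|T| s; last by rewrite hu // mulr0 mul0r.
rewrite [v _]hv ?mulr0 //; apply: contra hS => /eqP e'.
by rewrite -(cardsID T S) e' (setIidPr sT) e.
Qed.

Lemma xhomog1 : xhomog 0 (wedge1 : ext).
Proof. by move=> S; rewrite cards_eq0 ffunE => /negbTE ->. Qed.

Lemma xhomog_prod (I : Type) (r : seq I) (P : pred I) (F : I -> ext) (s : I -> nat) :
  (forall i, P i -> xhomog (s i) (F i)) ->
  xhomog (\sum_(i <- r | P i) s i) (\big[@wedge M R/wedge1]_(i <- r | P i) F i).
Proof.
move=> h; elim/big_ind2: _ => //; first exact: xhomog1.
by move=> *; exact: xhomog_wedge.
Qed.

Lemma xhomog_form x : xhomog 1 (form x : ext).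
Proof. by move=> S; exact: form_out. Qed.

(** A basis vector up to sign. The sign is kept only as a scalar of square 1, which suffices for
    cancellation and avoids tracking permutations. *)
Definition unit_basis (T : {set 'I_M}) u := exists2 c : R, c * c = 1 & u = sc c (omega (ev1 R) T).

Lemma unit_basis0 : unit_basis set0 wedge1.
Proof. by exists 1; rewrite ?mulr1 // omega0 sc1. Qed.

Lemma unit_basis_wedge (T T' : {set 'I_M}) u v : [disjoint T & T'] -> unit_basis T u ->
  unit_basis T' v -> unit_basis (T :|: T') (wedge u v).
Proof.
move=> d [c hc ->] [c' hc' ->]; exists (c * c' * sgp R T T').
  transitivity ((c * c) * (c' * c') * (sgp R T T' * sgp R T T')); first by ring.
  by rewrite hc hc' sgp_sq !mulr1.
by rewrite wedge_scl wedge_scr omegaM d !scA.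
Qed.

Lemma unit_basis_omega N (W : 'I_N -> 'I_M -> R) (g : 'I_N -> 'I_M) (H : {set 'I_N}) :
  {in H &, injective g} -> {in H, forall h, form (W h) = form (ev1 R (g h))} ->
  unit_basis (g @: H) (omega W H).
Proof.
elim/set_ind_min: H => [|T t tT tm IH] gi hW.
  by rewrite imset0 omega0; exact: unit_basis0.
rewrite (omega_min _ tT tm) hW //.
have -> : g @: T = [set g t] :|: (g @: (T :\ t)) by rewrite -imset_set1 -imsetU setD1K.
apply: unit_basis_wedge.
- rewrite disjoints_subset sub1set inE; apply/imsetP => -[s]; rewrite !inE => /andP[ne sT].
  by move/gi => e; rewrite e ?eqxx in ne.
- by exists 1; rewrite ?mulr1 // sc1 omega_set1.
apply: IH => [a b|a]; rewrite !inE => /andP[_ aT]; last exact: hW.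
by move=> /andP[_ bT]; exact: gi.
Qed.

Lemma unit_basis_prod (I : eqType) (r : seq I) (P : pred I) (F : I -> ext) (T : I -> {set 'I_M}) :
  uniq r -> (forall i j, i != j -> [disjoint T i & T j]) ->
  (forall i, P i -> unit_basis (T i) (F i)) ->
  unit_basis (\bigcup_(i <- r | P i) T i) (\big[@wedge M R/wedge1]_(i <- r | P i) F i).
Proof.
move=> ur dT hF; elim: r ur => [|i r IH] /=.
  by move=> _; rewrite !big_nil; exact: unit_basis0.
move=> /andP[ir /IH{}IH]; rewrite !big_cons; case: ifP => // Pi.
apply: unit_basis_wedge => //; last exact: hF.
rewrite disjoints_subset; apply/subsetP => x xi; rewrite inE.
elim: r ir {IH} => [|j r IH] /=; first by rewrite big_nil inE.
rewrite inE negb_or => /andP[ij /IH{}IH]; rewrite big_cons; case: ifP => // _.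
rewrite inE negb_or IH andbT; have := dT _ _ ij.
by rewrite disjoints_subset => /subsetP /(_ x xi); rewrite inE.
Qed.

Lemma unit_basis_neq0 (T : {set 'I_M}) u : unit_basis T u -> u != 0.
Proof.
move=> [c hc ->]; apply/eqP => /ffunP /(_ T); rewrite !ffunE omega_id eqxx mulr1 => c0.
by move/eqP: hc; rewrite c0 mulr0 eq_sym oner_eq0.
Qed.

Lemma wedge_unit_basis_eq0 x (T : {set 'I_M}) u l : unit_basis T u -> wedge (form x) u = 0 ->
  l \notin T -> x l = 0.
Proof.
move=> [c hc ->]; rewrite wedge_scr => /(congr1 (sc c)); rewrite scA hc sc1 sc0r.
move=> /ffunP /(_ (l |: T)) + lT; rewrite wedge_form big_setU1 //= setU1K // [RHS]ffunE.
rewrite omega_id eqxx mulr1 big1 ?addr0 => [e|j jT].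
  by rewrite -[LHS]mul1r -(sgp_sq R [set l] T) -mulrA e mulr0.
rewrite omega_id; case: eqP => [e|]; rewrite ?mulr0 //.
by have := setD11 j (l |: T); rewrite e jT.
Qed.

End Homogeneous.

Lemma iota_form1 (N : nat) (R : comNzRingType) (x y : 'I_N -> R) :
  iota_ x (form y) = sc (\sum_j x j * y j) wedge1.
Proof. by rewrite -[form y]wedge1r iota_form iota1 wedge0r subr0. Qed.

Lemma sc_wedge1_eq0 (N : nat) (R : comNzRingType) (a : R) :
  sc a (wedge1 : {ffun {set 'I_N} -> R}) = 0 -> a = 0.
Proof. by move/ffunP/(_ set0); rewrite !ffunE eqxx mulr1. Qed.

Section Evaluation.
Context (k : fieldType) (N p : nat) (R : comNzRingType) (io : {rmorphism k -> R}).
Implicit Types (C : 'M[R]_(N, p)) (F : plring k N p).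

(** Evaluation at the point with coordinate matrix [C]. The structure map [io] is explicit, so that
    [R] may be a localization, a residue field or a polynomial ring over one of them without a
    declared algebra structure. *)
Definition evp C : {rmorphism plring k N p -> R} :=
  mmap io (fun v : 'I_#|{: midx N p}| => \det (rowsub (elt (enum_val v)) C)).

Lemma evp_Delta C (J : {set 'I_N}) : evp C (Delta J) = pl C J.
Proof.
rewrite /Delta; case: insubP => [j hj ej|h]; last by rewrite rmorph0 pl_card.
by rewrite /evp /= mmapX mmap1U enum_rankK pl_det ej.
Qed.

Lemma evp_const C (c : k) : evp C c%:MP = io c.
Proof. exact: mmapC. Qed.

Lemma evp_scale C (c : k) F : evp C (c *: F) = io c * evp C F.
Proof. by rewrite -mul_mpolyC rmorphM evp_const. Qed.

Lemma evp_eps C M (K H : {set 'I_M}) : evp C (eps K H) = eps K H.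
Proof. by rewrite !eps_sgp rmorph_sgp. Qed.

Lemma evp_plucker C F : plucker_rel F -> evp C F = 0.
Proof.
move=> [S [K [dS dK ->]]]; rewrite rmorph_sum; apply: etrans (plucker_minors C dS dK).
by apply: eq_bigr => l _; rewrite !rmorphM !evp_eps !evp_Delta.
Qed.

Lemma evp_ideal_gen C (G : plring k N p -> Prop) F :
  (forall F', G F' -> evp C F' = 0) -> ideal_gen G F -> evp C F = 0.
Proof.
move=> hG hF; apply: (hF (fun F => evp C F = 0)) => //; split; first exact: rmorph0.
  by move=> x y hx hy; rewrite rmorphD hx hy addr0.
by move=> a x hx; rewrite rmorphM hx mulr0.
Qed.

Lemma evp_plucker_ideal C F : plucker_ideal F -> evp C F = 0.
Proof. apply: evp_ideal_gen; exact: evp_plucker. Qed.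

End Evaluation.

Section GeneralLinearForms.
Context (k : fieldType) (n : nat) (pt : {poly rat}) (d r : nat).
Local Notation N := (nmon n r).
Local Notation N1 := (nmon n r.+1).
Local Notation p := (hval pt r).
Local Notation q2 := (qsecond n pt d r).
Context (R : comUnitRingType) (io : {rmorphism k -> R}).
Implicit Types (C : 'M[R]_(N, p)).
Local Notation ev C := (evp io C).

Definition Xi (i : 'I_n.+1) (h : 'I_N) : 'I_N1 -> R :=
  fun j => (alpha j == (U_(i) + alpha h)%MM)%:R.

Definition Zset : {set 'I_N1} := [set j | [exists a : 'I_n.+1, (a <= d)%N && (0 < alpha j a)%N]].

Lemma idx_ex (i : 'I_n.+1) (h : 'I_N) : exists j : 'I_N1, alpha j == (U_(i) + alpha h)%MM.
Proof.
have [|j <-] := @alphaP n r.+1 (U_(i) + alpha h)%MM; last by exists j.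
by rewrite mdegD mdeg1 mdeg_alpha.
Qed.

Definition idx i h : 'I_N1 := xchoose (idx_ex i h).

Lemma alpha_idx i h : alpha (idx i h) = (U_(i) + alpha h)%MM.
Proof. exact/eqP/(xchooseP (idx_ex i h)). Qed.

Lemma idx_inj i : injective (idx i).
Proof.
by move=> h h' /(congr1 (@alpha n r.+1)); rewrite !alpha_idx => /addmI /alpha_inj.
Qed.

Lemma XiE i h j : Xi i h j = (j == idx i h)%:R.
Proof. by rewrite /Xi -alpha_idx (inj_eq (@alpha_inj n r.+1)). Qed.

Lemma sum_Xi_out i (v : 'I_N -> R) j : (forall h, j != idx i h) -> \sum_l v l * Xi i l j = 0.
Proof. by move=> h; rewrite big1 // => l _; rewrite XiE (negbTE (h l)) mulr0. Qed.

Lemma sum_Xi_Z (i : 'I_n.+1) (v : 'I_N -> R) j : (i <= d)%N -> j \notin Zset -> \sum_l v l * Xi i l j = 0.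
Proof.
move=> hi hj; apply: sum_Xi_out => h; apply: contra hj => /eqP ->; rewrite inE.
apply/existsP; exists i; rewrite hi alpha_idx mnmDE mnm1E eqxx //.
Qed.

Lemma ev_monomial1 C i h :
  mapx (ev C) (monomial1 k pt r (U_(i) + alpha h)%MM) = form (Xi i h).
Proof.
apply/ffunP => S; rewrite [LHS]ffunE [monomial1 _ _ _ _ _]ffunE rmorph_nat.
have -> : [set j : 'I_N1 | alpha j == (U_(i) + alpha h)%MM] = [set idx i h].
  by apply/setP => j; rewrite !inE -alpha_idx (inj_eq (@alpha_inj n r.+1)).
case: eqP => [->|ne]; first by rewrite form1 XiE eqxx.
rewrite ffunE big1 // => j /eqP eS; rewrite XiE; case: eqP => // ej.
by case: ne; rewrite eS ej.
Qed.

Lemma ev_mulx C i u : mapx (ev C) (mulx i u) = Lam (Xi i) (mapx (ev C) u).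
Proof.
apply/ffunP => S; rewrite ffunE [mulx _ _ _]ffunE rmorph_sum sum_ffunE.
apply: eq_bigr => H _; rewrite rmorphM !ffunE; congr (_ * _).
have := mapx_prod (ev C) (enum H) predT (fun h => monomial1 k pt r (U_(i) + alpha h)%MM).
move/ffunP/(_ S); rewrite ffunE => ->; rewrite /omega.
by congr (_ _ _); apply: eq_bigr => h _; exact: ev_monomial1.
Qed.

Lemma ev_delta C m K : mapx (ev C) (delta k pt m K) = dl C m K.
Proof.
apply/ffunP => H; rewrite !ffunE; case: ifP => _; last by rewrite rmorph0.
by rewrite rmorphM evp_eps evp_Delta eps_sgp.
Qed.

Lemma ev_signZ C (sgn : bool) (u : {ffun {set 'I_N1} -> plring k N p}) :
  mapx (ev C) ((-1) ^+ sgn *: u) = sc ((-1) ^+ sgn) (mapx (ev C) u).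
Proof.
by apply/ffunP => S; rewrite !ffunE; case: sgn; rewrite ?expr1 ?expr0 ?scaleN1r ?scale1r
  ?rmorphN ?mulN1r ?mul1r.
Qed.

Lemma wedge_product_ev C s u : wedge_product d s u ->
  exists (m : 'I_n.+1 -> nat) (K : 'I_n.+1 -> {set 'I_N}),
  (\sum_(i < n.+1 | (i <= d)%N && (0 < m i)%N) m i)%N = s /\
  mapx (ev C) u = \big[@wedge N1 R/wedge1]_(i < n.+1 | (i <= d)%N && (0 < m i)%N)
      Lam (Xi i) (dl C (m i) (K i)).
Proof.
move=> [m [K [hs hK ->]]]; exists m, K; split.
  rewrite -hs; change ((\sum_(i < n.+1 | (i <= d)%N && (0 < m i)%N) m i)%N =
    (\sum_(i < n.+1 | (i <= d)%N) m i)%N).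
  rewrite [RHS](bigID (fun i : 'I_n.+1 => (0 < m i)%N)) /= [X in _ = (_ + X)%N]big1 ?addn0 //.
  by move=> i /andP[_]; rewrite -eqn0Ngt => /eqP.
by rewrite mapx_prod; apply: eq_bigr => i _; rewrite ev_mulx ev_delta.
Qed.

Lemma dl_form C K : dl C 1 K = form (fun j => dl C 1 K [set j]).
Proof. by apply: formE => S h; rewrite ffunE (negbTE h) andbF. Qed.

Lemma dl1_ker C K c : \sum_j C j c * dl C 1 K [set j] = 0.
Proof.
apply: (@sc_wedge1_eq0 N); rewrite -iota_form1 -(dl_form C K); exact: iota_dl.
Qed.

Lemma calW_ev C w : calW d w -> exists y : 'I_N1 -> R,
  [/\ mapx (ev C) w = form y, forall j, j \notin Zset -> y j = 0
    & exists (a b : 'I_N -> R) j l, [/\ forall c, \sum_h a h * C h c = 0,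
        forall c, \sum_h b h * C h c = 0
      & forall x, y x = \sum_h a h * Xi j h x + \sum_h b h * Xi l h x]].
Proof.
move=> [H [H' [h [h' [j [l [sgn [_ _ _ ew hw]]]]]]]].
pose a x := dl C 1 H [set x]; pose b x := (-1) ^+ sgn * dl C 1 H' [set x].
have e : mapx (ev C) w = form (fun x => \sum_h a h * Xi j h x + \sum_h b h * Xi l h x).
  rewrite ew mapxD ev_signZ !ev_mulx !ev_delta (dl_form C H) (dl_form C H') !Lam_form.
  rewrite -form_sc -formD; apply: form_eq => x; congr (_ + _).
  by rewrite mulr_sumr; apply: eq_bigr => i _; rewrite /b mulrA.
exists (fun x => \sum_h a h * Xi j h x + \sum_h b h * Xi l h x); split=> //.
  (* Condition (c) concerns coefficients in [k[Delta]]: outside [Zset] a coefficient is only known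
     to lie in the Pluecker ideal, which is enough for its value to be 0. *)
  move=> x hx; have := congr1 (fun u : {ffun _ -> R} => u [set x]) e.
  rewrite form1 => <-; rewrite ffunE; apply: evp_plucker_ideal.
  apply: contrapT => /hw [i hi ai]; case/negP: hx; rewrite inE.
  by apply/existsP; exists i; rewrite hi.
exists a, b, j, l; split=> // c.
  by rewrite -[RHS](dl1_ker C H c); apply: eq_bigr => i _; rewrite mulrC.
transitivity ((-1) ^+ sgn * \sum_x C x c * dl C 1 H' [set x]); last by rewrite dl1_ker mulr0.
rewrite mulr_sumr.
by apply: eq_bigr => i _; rewrite /b; ring.
Qed.

Section Vanishing.
Context (p1 : nat) (C : 'M[R]_(N, p)) (C1 : 'M[R]_(N1, p1)).
Context (J : midx N p) (J1 : midx N1 p1).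
Hypothesis hJ : pl C (val J) \is a GRing.unit.
Hypothesis hJ1 : pl C1 (val J1) \is a GRing.unit.
Hypothesis hker : forall i (v : 'I_N -> R), (forall c, \sum_h v h * C h c = 0) ->
  forall c, \sum_j (\sum_h v h * Xi i h j) * C1 j c = 0.
Hypothesis hZ : (#|Zset :\: val J1| <= q2)%N.

(* All products of [q2 + 1] linear forms vanish in the exterior algebra of the
   elements of [ker C1] supported on [Zset], a free module of rank [q2]. *)
Lemma frakh_vanish F : frakh1 d F \/ frakh2 d F -> ev C F = 0.
Proof.
have [F1 [F1ker F1out F1in F1fix]] := dl_Lam hJ1.
(* The projection [F1] kills the basis vectors of [J1], so preimages may be taken with coordinates
   at subsets of [Zset :\: val J1]; there are none of cardinality [q2 + 1]. *)
pose P (s : nat) (u : {ffun {set 'I_N1} -> R}) := exists2 u' : {ffun {set 'I_N1} -> R}, u = Lam F1 u' &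
  forall H : {set 'I_N1}, u' H != 0 -> (H \subset Zset :\: val J1) /\ #|H| = s.
have Pw s t u v : P s u -> P t v -> P (s + t)%N (wedge u v).
  move=> [u' -> hu] [v' -> hv]; exists (wedge u' v'); first by rewrite LamM.
  move=> H hH; have [T [sT uT vT]] : exists T : {set 'I_N1}, [/\ T \subset H, u' T != 0 & v' (H :\: T) != 0].
    apply: contrapT => hn; case/negP: hH; rewrite wedgeE big1 // => T sT.
    have [u0|uT] := eqVneq (u' T) 0; first by rewrite u0 mulr0 mul0r.
    have [v0|vT] := eqVneq (v' (H :\: T)) 0; first by rewrite v0 mulr0.
    by case: hn; exists T.
  have [s1 c1] := hu _ uT; have [s2 c2] := hv _ vT; split; last first.
    by rewrite -(cardsID T H) c2 (setIidPr sT) c1.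
  by rewrite -(setID H T) (setIidPr sT) subUset s1 s2.
have P1 : P 0%N wedge1.
  exists wedge1; first by rewrite Lam1.
  move=> H; rewrite ffunE; case: (eqVneq H set0) => [-> _|_]; last by rewrite eqxx.
  by rewrite sub0set cards0.
have Psum (I : finType) s (G : I -> {ffun {set 'I_N1} -> R}) (a : I -> R) :
    (forall i, a i != 0 -> P s (G i)) -> P s (\sum_i sc (a i) (G i)).
  move=> h; have h' i : exists u', a i != 0 -> G i = Lam F1 u' /\
      forall H : {set 'I_N1}, u' H != 0 -> (H \subset Zset :\: val J1) /\ #|H| = s.
    have [a0|/h [u' e hu]] := eqVneq (a i) 0; first by exists 0.
    by exists u'.
  have [U hU] := choice h'; exists (\sum_i sc (a i) (U i)).
    rewrite Lam_sum; apply: eq_bigr => i _; rewrite Lam_sc.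
    by have [a0|/hU [-> _]] := eqVneq (a i) 0; rewrite ?a0 ?sc0.
  move=> H; rewrite sum_ffunE => hH.
  have [i hi] : exists i, sc (a i) (U i) H != 0.
    apply: contrapT => hn; case/negP: hH; rewrite big1 // => i _.
    by apply/eqP/negPn/negP => hi; apply: hn; exists i.
  move: hi; rewrite ffunE; have [a0|/hU [_ h2]] := eqVneq (a i) 0; first by rewrite a0 mul0r eqxx.
  by have [u0|/h2] := eqVneq (U i H) 0; rewrite ?u0 ?mulr0 ?eqxx.
have Pform (v : 'I_N1 -> R) : (forall c, \sum_j v j * C1 j c = 0) ->
    (forall j, j \notin Zset -> v j = 0) -> P 1%N (form v).
  move=> vker vZ; exists (form (fun j => if j \in val J1 then 0 else v j)).
    rewrite -[LHS]F1fix => [|c]; last first.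
      by rewrite iota_form1 (eq_bigr (fun j => v j * C1 j c)) ?vker ?sc0 // => j _; rewrite mulrC.
    rewrite !Lam_form; apply: form_eq => j; apply: eq_bigr => i _.
    by case: ifP => // iJ; rewrite F1in ?mulr0 ?mul0r.
  move=> H hH; have /cards1P[j eH] : #|H| == 1%N.
    by apply/negPn/negP => c1; rewrite form_out ?eqxx in hH.
  move: hH; rewrite eH form1 cards1; case: ifP; rewrite ?eqxx // => jJ vj; split=> //.
  rewrite sub1set inE jJ /=; apply/negPn/negP => /vZ e; by rewrite e eqxx in vj.
have Pomega (G : 'I_N -> 'I_N1 -> R) (H : {set 'I_N}) :
    (forall h c, \sum_j G h j * C1 j c = 0) ->
    (forall h j, j \notin Zset -> G h j = 0) -> P #|H| (omega G H).
  move=> gk gz; elim/set_ind_min: H => [|T t tT tm IH]; first by rewrite cards0 omega0.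
  by rewrite (omega_min _ tT tm) (cardsD1 t) tT; apply: Pw => //; apply: Pform; [exact: gk|exact: gz].
have [F0 [F0ker _ _ F0fix]] := dl_Lam hJ.
have Pdl (i : 'I_n.+1) m K : (i <= d)%N -> P m (Lam (Xi i) (dl C m K)).
  move=> hi; rewrite -(F0fix _ (iota_dl C m K)) Lam_comp; apply: Psum => H.
  rewrite ffunE; case: ifP => [/andP[_ /eqP <-] _|]; last by rewrite eqxx.
  apply: Pomega => h; first by apply: hker => c; exact: F0ker.
  by move=> j; exact: sum_Xi_Z.
have Pprod s u : wedge_product d s u -> P s (mapx (ev C) u).
  move=> /(wedge_product_ev C)[m [K [<- ->]]].
  by apply: (big_ind2 P) => // [*|i /andP[hi _]]; [exact: Pw|exact: Pdl].
have Pbig u : P q2.+1 u -> u = 0.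
  move=> [u' -> hu]; rewrite (_ : u' = 0) ?Lam0 //; apply/ffunP => H; rewrite ffunE.
  apply/eqP/negPn/negP => /hu [sH cH]; have := subset_leq_card sH.
  by rewrite cH leqNgt ltnS hZ.
have ext0 (u : {ffun {set 'I_N1} -> plring k N p}) S : mapx (ev C) u = 0 -> ev C (u S) = 0.
  by move/ffunP/(_ S); rewrite !ffunE.
case=> [[u [S [hu _ ->]]]|[u [w [S [hu hw _ ->]]]]]; apply: ext0.
  exact/Pbig/Pprod.
apply: Pbig; rewrite mapx_wedge -addn1; apply: Pw; first exact: Pprod.
have [y [-> yZ [a [b [j [l [ha hb hy]]]]]]] := calW_ev C hw.
apply: Pform => // c; under eq_bigr => i _ do rewrite hy mulrDl.
by rewrite big_split /= !hker ?addr0.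
Qed.

End Vanishing.

End GeneralLinearForms.

HB.instance Definition _ (M : nat) (R : comNzRingType) :=
  Monoid.isLaw.Build {ffun {set 'I_M} -> R} wedge1 (@wedge M R)
    (@wedgeA M R) (@wedge1l M R) (@wedge1r M R).

Section SignedCommutation.
Context (M : nat) (R : comNzRingType).
Local Notation ext := {ffun {set 'I_M} -> R}.
Implicit Types (u v : ext) (x : 'I_M -> R).

Lemma omega_eq_in N (W W' : 'I_N -> 'I_M -> R) (H : {set 'I_N}) :
  (forall h, h \in H -> W h =1 W' h) -> omega W H = omega W' H.
Proof.
move=> e; rewrite /omega; apply: eq_big_seq => h; rewrite mem_enum => hH.
by apply: form_eq; exact: e.
Qed.

Definition scomm x u := exists2 c : R, c * c = 1 & wedge u (form x) = sc c (wedge (form x) u).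

Lemma scomm_sc x a u : scomm x u -> scomm x (sc a u).
Proof.
by move=> [c hc e]; exists c => //; rewrite wedge_scl e wedge_scr !scA mulrC.
Qed.

Lemma scomm_wedge x u v : scomm x u -> scomm x v -> scomm x (wedge u v).
Proof.
move=> [c hc eu] [c' hc' ev]; exists (c * c').
  by rewrite mulrACA hc hc' mulr1.
by rewrite -wedgeA ev wedge_scr wedgeA eu wedge_scl scA -wedgeA mulrC.
Qed.

Lemma scomm1 x : scomm x wedge1.
Proof. by exists 1; rewrite ?mulr1 // wedge1l wedge1r sc1. Qed.

Lemma scomm_form x y : scomm x (form y).
Proof. by exists (-1); rewrite ?mulrNN ?mulr1 // scN1 wedge_formC. Qed.

Lemma scomm_omega N x (W : 'I_N -> 'I_M -> R) (H : {set 'I_N}) : scomm x (omega W H).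
Proof.
elim/set_ind_min: H => [|T t tT tm IH]; first by rewrite omega0; exact: scomm1.
by rewrite (omega_min _ tT tm); apply: scomm_wedge => //; exact: scomm_form.
Qed.

(** Serves to enlarge one block of a family by a single form: the extra factor is pulled to the
    front past the earlier blocks, with which it commutes up to sign. *)
Lemma wedge_prod_insert (I : eqType) (r : seq I) (P : pred I) (X Y : I -> ext) (i0 : I) x c0 :
  uniq r -> i0 \in r -> P i0 -> c0 * c0 = 1 -> (forall i, P i -> scomm x (Y i)) ->
  X i0 = sc c0 (wedge (form x) (Y i0)) -> (forall i, i != i0 -> X i = Y i) ->
  exists2 c, c * c = 1 & \big[@wedge M R/wedge1]_(i <- r | P i) X i =
    sc c (wedge (form x) (\big[@wedge M R/wedge1]_(i <- r | P i) Y i)).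
Proof.
move=> ur hi Pi hc0 hY hX hXY; elim: r ur hi => //= i r IH /andP[ir ur].
rewrite inE eq_sym; have [ei _|ne /= hi] := eqVneq i i0.
  exists c0 => //; rewrite !big_cons ei Pi hX wedge_scl -wedgeA; congr (sc _ (wedge _ (wedge _ _))).
  rewrite big_seq_cond [RHS]big_seq_cond; apply: eq_bigr => j /andP[jr _]; apply: hXY.
  by apply: contraTneq jr => ->; rewrite -ei.
have [c hc e] := IH ur hi; rewrite !big_cons; case: ifP => Pj; last by exists c.
rewrite hXY // e; have [c' hc' e'] := hY i Pj; exists (c * c'); first by rewrite mulrACA hc hc' mulr1.
by rewrite wedge_scr wedgeA e' wedge_scl scA wedgeA.
Qed.

End SignedCommutation.

Lemma subset_card (T : finType) (A : {set T}) (s : nat) : (s <= #|A|)%N ->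
  exists2 B : {set T}, B \subset A & #|B| = s.
Proof.
move=> h; exists [set x in take s (enum A)].
  by apply/subsetP => x; rewrite inE => /mem_take; rewrite mem_enum.
rewrite cardsE (card_uniqP _) ?take_uniq ?enum_uniq // size_takel // -cardE //.
Qed.

(** * The span of the multiples of the marked basis by [x_0, ..., x_d] *)

Section Rank.
Context (k : fieldType) (n : nat) (pt : {poly rat}) (d r : nat).
Local Notation nr := (nmon n r).
Local Notation nr1 := (nmon n r.+1).
Local Notation p := (hval pt r).
Local Notation q2 := (qsecond n pt d r).
Context (R : comUnitRingType) (io : {rmorphism k -> R}).
Context (C : 'M[R]_(nr, p)) (J : midx nr p) (N : pred 'X_{1..n.+1}).
Local Notation ev := (evp io C).
Hypothesis hN : borel r N.
Hypothesis JE : val J = [set h | N (alpha h)].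
Hypothesis hJ : pl C (val J) \is a GRing.unit.
Hypothesis hF : forall F, frakh1 d F \/ frakh2 d F -> ev F = 0.
Hypothesis hd : forall m, mdeg m = r -> N m -> ~~ supge d.+1 m.

(** These monomials index the star multiples of the marked basis by the variables up to [x_d]: [l]
    stands for the multiple by [mmin (alpha l)] of the element with leading monomial
    [rm (alpha l)]. *)
Definition S0 : {set 'I_nr1} := [set l | (mmin (alpha l) <= d)%N && ~~ grow N (alpha l)].
Hypothesis hlow : (q2 <= #|S0|)%N.

Context (F : 'I_nr -> 'I_nr -> R).
Hypothesis Fout : forall h j, j \notin val J -> F h j = if h \in val J then 0 else (h == j)%:R.
Hypothesis Fin : forall h j, h \in val J -> F h j = 0.
Hypothesis Ffix : forall u, (forall c, iota_ (fun j => C j c) u = 0) -> Lam F u = u.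

Definition G (i : 'I_n.+1) (h : 'I_nr) : 'I_nr1 -> R := fun j => \sum_l F h l * Xi R i l j.

Lemma inJ h : (h \in val J) = N (alpha h).
Proof. by rewrite JE inE. Qed.

Lemma rmi_ex (l : 'I_nr1) : exists h : 'I_nr, alpha h == rm (alpha l).
Proof.
by have [|h <-] := @alphaP n r (rm (alpha l)); [rewrite mdeg_rm mdeg_alpha|exists h].
Qed.

Definition rmi l := xchoose (rmi_ex l).

Lemma alpha_rmi l : alpha (rmi l) = rm (alpha l).
Proof. exact/eqP/(xchooseP (rmi_ex l)). Qed.

Lemma alpha_neq0 (l : 'I_nr1) : alpha l != 0%MM.
Proof. by rewrite -mdeg_eq0 mdeg_alpha. Qed.

Lemma idx_rmi l : idx (mmin (alpha l)) (rmi l) = l.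
Proof.
by apply: (@alpha_inj n r.+1); rewrite alpha_idx alpha_rmi addmC rmK // alpha_neq0.
Qed.

Lemma mmin_idx (i : 'I_n.+1) (h : 'I_nr) : supge i (alpha h) -> mmin (alpha (idx i h)) = i.
Proof. by move=> s; rewrite alpha_idx addmC mminU. Qed.

Lemma rmi_idx (i : 'I_n.+1) (h : 'I_nr) : supge i (alpha h) -> rmi (idx i h) = h.
Proof.
move=> s; apply: (@alpha_inj n r).
by rewrite alpha_rmi /rm mmin_idx // alpha_idx addmC addmK.
Qed.

(** The star multiples indexed by [S0], completed by monomials to a basis of the forms of degree
    [r + 1]. *)
Definition W1 (l : 'I_nr1) : 'I_nr1 -> R :=
  if l \in S0 then G (mmin (alpha l)) (rmi l) else ev1 R l.

Lemma GE i h : h \notin val J ->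
  forall j, G i h j = ev1 R (idx i h) j + \sum_(x in val J) F h x * ev1 R (idx i x) j.
Proof.
move=> hh j; rewrite /G (bigID (mem (val J))) /= addrC; congr (_ + _).
  rewrite (bigD1 h) //= Fout // (negbTE hh) eqxx mul1r XiE /ev1 eq_sym big1 ?addr0 // => x /andP[xJ ne].
  by rewrite Fout // (negbTE hh) eq_sym (negbTE ne) mul0r.
by apply: eq_bigr => x _; rewrite XiE /ev1 eq_sym.
Qed.

(** Triangularity with respect to the smallest variable. Besides its leading monomial, a star
    multiple by [x_i] contains monomials [idx i x] with [x] in [J]. Such a monomial is outside [S0]
    or has a smallest variable below [x_i], for otherwise stripping [x_i] would leave an element of
    [N]. *)
Lemma W1_span l : exists a : 'I_nr1 -> R, forall j, \sum_m a m * W1 m j = ev1 R l j.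
Proof.
have sel (b : 'I_nr1) (X : 'I_nr1 -> R) : \sum_x ev1 R b x * X x = X b.
  rewrite (bigD1 b) //= /ev1 eqxx mul1r big1 ?addr0 // => x /negbTE.
  by rewrite eq_sym => ->; rewrite mul0r.
have [s] := ubnP (mmin (alpha l)); elim: s l => // s IH l hs.
have [lS|lS] := boolP (l \in S0); last first.
  by exists (ev1 R l) => j; rewrite sel /W1 (negbTE lS).
have hh : rmi l \notin val J by rewrite inJ alpha_rmi; move: lS; rewrite inE => /andP[].
set i := mmin (alpha l) in hs; set h := rmi l in hh.
have hx x : exists a : 'I_nr1 -> R, x \in val J -> forall j, \sum_m a m * W1 m j = ev1 R (idx i x) j.
  have [xJ|_] := boolP (x \in val J); last by exists (fun=> 0).
  have [xS|xS] := boolP (idx i x \in S0); last first.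
    by exists (ev1 R (idx i x)) => _ j; rewrite sel /W1 (negbTE xS).
  have [|a ha] := IH (idx i x); last by exists a.
  have : (mmin (alpha (idx i x)) <= i)%N.
    have [_] := mminP (alpha_neq0 (idx i x)).
    by rewrite {2}alpha_idx supgeD supgeU => /andP[].
  rewrite leq_eqVlt => /orP[/eqP/ord_inj e|lt]; last by apply: leq_trans lt _.
  move: xS; rewrite inE => /andP[_]; rewrite /grow /rm e alpha_idx addmC addmK -inJ xJ //.
have [a ha] := choice hx; exists (fun m => ev1 R l m - \sum_(x in val J) F h x * a x m) => j.
under eq_bigr => m _ do rewrite mulrBl mulr_suml.
rewrite sumrB sel exchange_big /= /W1 lS GE // idx_rmi.
have -> : \sum_(x in val J) \sum_m F h x * a x m * W1 m j =
          \sum_(x in val J) F h x * ev1 R (idx i x) j.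
  apply: eq_bigr => x xJ; rewrite -ha // mulr_sumr.
  by apply: eq_bigr => m _; rewrite mulrA.
by rewrite -/h addrK.
Qed.

Lemma W1_inv : exists A : 'I_nr1 -> 'I_nr1 -> R,
  (forall l j, \sum_m A l m * W1 m j = (l == j)%:R) /\
  (forall l j, \sum_m W1 l m * A m j = (l == j)%:R).
Proof.
have [A hA] := choice W1_span; exists A; split=> [l j|]; first exact: hA.
pose MA := \matrix_(l, m) A l m; pose MW := \matrix_(l, m) W1 l m.
have e : MA *m MW = 1%:M.
  by apply/matrixP => l j; rewrite !mxE -[RHS]/(ev1 R l j) -hA; apply: eq_bigr => m _; rewrite !mxE.
move/mulmx1C/matrixP: e => e l j; have := e l j; rewrite !mxE => <-.
by apply: eq_bigr => m _; rewrite !mxE.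
Qed.

Lemma LamW1_cancel A u : (forall l j, \sum_m W1 l m * A m j = (l == j)%:R) ->
  Lam A (Lam W1 u) = u.
Proof. by move=> hA; rewrite Lam_comp -[RHS]Lam_id; apply: Lam_eq => i j; exact: hA. Qed.

Definition family_prod (H : 'I_n.+1 -> {set 'I_nr}) :=
  \big[@wedge nr1 R/wedge1]_(i < n.+1 | (i <= d)%N) omega (G i) (H i).

Lemma dl_omega i (H : {set 'I_nr}) : [disjoint H & val J] -> exists c : R, c \is a GRing.unit /\
  Lam (Xi R i) (dl C #|H| (val J :|: H)) = sc c (omega (G i) H).
Proof.
move=> dH; exists (sgp R H (val J) * pl C (val J)); split.
  rewrite unitrM hJ andbT; apply/unitrPr; exists (sgp R H (val J)); exact: sgp_sq.
rewrite (@dl_decomposable _ _ _ _ _ F) // => [|m K].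
  by rewrite Lam_sc Lam_omega.
by apply: Ffix => c; exact: iota_dl.
Qed.

Lemma prod_sc (P : pred 'I_n.+1) (a : 'I_n.+1 -> R) (u : 'I_n.+1 -> {ffun {set 'I_nr1} -> R}) :
  \big[@wedge nr1 R/wedge1]_(i < n.+1 | P i) sc (a i) (u i) =
  sc (\prod_(i < n.+1 | P i) a i) (\big[@wedge nr1 R/wedge1]_(i < n.+1 | P i) u i).
Proof.
apply: (big_ind3 (fun x y z => x = sc y z)) => //; first by rewrite sc1.
by move=> x1 x2 x3 y1 y2 y3 -> ->; rewrite wedge_scl wedge_scr scA.
Qed.

(** The generator is the one with [K_i] the union of [J] and [H i]: for these sets Jacobi's formula
    makes each value of [delta] a unit times a decomposable element. *)
Lemma family_ev (H : 'I_n.+1 -> {set 'I_nr}) : (forall i, [disjoint H i & val J]) ->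
  exists (u : {ffun {set 'I_nr1} -> plring k nr p}) (c : R),
  [/\ wedge_product d (\sum_(i < n.+1 | (i <= d)%N) #|H i|)%N u, c \is a GRing.unit
    & mapx ev u = sc c (family_prod H)].
Proof.
move=> dH; exists (\big[@wedge _ _/wedge1]_(i < n.+1 | (i <= d)%N && (0 < #|H i|)%N)
  mulx i (delta k pt #|H i| (val J :|: H i))).
have hc i : exists c : R, c \is a GRing.unit /\
   (if (0 < #|H i|)%N then Lam (Xi R i) (dl C #|H i| (val J :|: H i)) else wedge1) = sc c (omega (G i) (H i)).
  case: ifP => [_|/negbT]; first exact: dl_omega.
  rewrite -eqn0Ngt cards_eq0 => /eqP ->; exists 1; split; first exact: unitr1.
  by rewrite omega0 sc1.
have {hc}[c hc] := choice hc.
exists (\prod_(i < n.+1 | (i <= d)%N) c i); split.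
- exists (fun i => #|H i|), (fun i => val J :|: H i); split=> // i _ _.
  by rewrite cardsU (eqP (valP J)) setIC (disjoint_setI0 (dH i)) cards0 subn0.
- apply: (big_ind (fun x : R => x \is a GRing.unit)) => [|x y hx hy|i _]; first exact: unitr1.
    by rewrite unitrM hx hy.
  by case: (hc i).
rewrite mapx_prod big_mkcondr -prod_sc; apply: eq_bigr => i _; case: (hc i) => _ <-.
by case: ifP => // _; rewrite ev_mulx ev_delta.
Qed.

Lemma ev_coef0 (u : {ffun {set 'I_nr1} -> plring k nr p}) (v : {ffun {set 'I_nr1} -> R}) c s :
  c \is a GRing.unit -> mapx ev u = sc c v -> xhomog s v ->
  (forall S : {set 'I_nr1}, #|S| = s -> ev (u S) = 0) -> v = 0.
Proof.
move=> hc e hv h; apply/ffunP => S; rewrite [RHS]ffunE.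
have [cS|/hv //] := eqVneq #|S| s; apply: (mulrI hc); rewrite mulr0.
by have := congr1 (fun w : {ffun _ -> R} => w S) e; rewrite !ffunE h.
Qed.

Lemma family_homog (H : 'I_n.+1 -> {set 'I_nr}) :
  xhomog (\sum_(i < n.+1 | (i <= d)%N) #|H i|)%N (family_prod H).
Proof. by apply: xhomog_prod => i _ S; exact: omega_homog. Qed.

Lemma family_vanish1 (H : 'I_n.+1 -> {set 'I_nr}) : (forall i, [disjoint H i & val J]) ->
  (\sum_(i < n.+1 | (i <= d)%N) #|H i|)%N = q2.+1 -> family_prod H = 0.
Proof.
move=> dH eH; have [u [c [hu hc e]]] := family_ev dH; rewrite eH in hu.
have hh := @family_homog H; rewrite eH in hh.
by apply: (ev_coef0 hc e hh) => S cS; apply: hF; left; exists u, S.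
Qed.

Lemma family_vanish2 (H : 'I_n.+1 -> {set 'I_nr}) w : (forall i, [disjoint H i & val J]) ->
  (\sum_(i < n.+1 | (i <= d)%N) #|H i|)%N = q2 -> calW d w ->
  wedge (family_prod H) (mapx ev w) = 0.
Proof.
move=> dH eH hw; have [u [c [hu hc e]]] := family_ev dH; rewrite eH in hu.
have hh := @family_homog H; rewrite eH in hh.
have e2 : mapx ev (wedge u w) = sc c (wedge (family_prod H) (mapx ev w)).
  by rewrite mapx_wedge e wedge_scl.
have [y [ey _ _]] := calW_ev io C hw; rewrite ey in e2 *.
have hh2 := xhomog_wedge hh (xhomog_form y); rewrite addn1 in hh2.
by apply: (ev_coef0 hc e2 hh2) => S cS; apply: hF; right; exists u, w, S.
Qed.

(** Splits a set of star multiples into blocks according to the variable, as needed to recognize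
    their product as the value of one generator. *)
Definition Hs (S : {set 'I_nr1}) (i : 'I_n.+1) : {set 'I_nr} :=
  [set h | [&& h \notin val J, supge i (alpha h) & idx i h \in S]].

Lemma Hs_disj S i : [disjoint Hs S i & val J].
Proof. by rewrite disjoints_subset; apply/subsetP => h; rewrite !inE => /and3P[]. Qed.

Lemma idx_S0 (i : 'I_n.+1) (h : 'I_nr) : (i <= d)%N -> h \notin val J -> supge i (alpha h) -> idx i h \in S0.
Proof.
move=> hi hh s; rewrite inE mmin_idx // hi /=.
by rewrite /grow /rm mmin_idx // alpha_idx addmC addmK -inJ.
Qed.

Lemma W1_idx (i : 'I_n.+1) (h : 'I_nr) : (i <= d)%N -> h \notin val J -> supge i (alpha h) ->
  W1 (idx i h) = G i h.
Proof. by move=> hi hh s; rewrite /W1 idx_S0 // mmin_idx // rmi_idx. Qed.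

Lemma Hs_imset (S : {set 'I_nr1}) (i : 'I_n.+1) : S \subset S0 -> (i <= d)%N ->
  idx i @: Hs S i = [set l in S | mmin (alpha l) == i].
Proof.
move=> sS hi; apply/setP => l; rewrite inE; apply/imsetP/andP.
  move=> [h]; rewrite inE => /and3P[hJ' s iS ->]; split=> //.
  by rewrite mmin_idx.
move=> [lS /eqP li]; exists (rmi l); last by rewrite -li idx_rmi.
rewrite inE -li idx_rmi lS andbT inJ alpha_rmi.
have := subsetP sS _ lS; rewrite inE => /andP[_ Nl]; rewrite Nl /=.
by apply: supge_rm; case: (mminP (alpha_neq0 l)).
Qed.

Lemma Hs_card (S : {set 'I_nr1}) : S \subset S0 -> (\sum_(i < n.+1 | (i <= d)%N) #|Hs S i|)%N = #|S|.
Proof.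
move=> sS; rewrite -sum1_card (partition_big (fun l => mmin (alpha l)) (fun i : 'I_n.+1 => (i <= d)%N)) /=.
  apply: eq_bigr => i hi; rewrite -(card_imset _ (@idx_inj n r i)) Hs_imset //.
  by rewrite -sum1_card; apply: eq_bigl => l; rewrite inE.
by move=> l /(subsetP sS); rewrite inE => /andP[].
Qed.

Lemma Hs_prod (S : {set 'I_nr1}) : S \subset S0 -> exists E T, [/\ unit_basis T E, T \subset S0 & family_prod (Hs S) = Lam W1 E].
Proof.
move=> sS; exists (\big[@wedge nr1 R/wedge1]_(i < n.+1 | (i <= d)%N) omega (Xi R i) (Hs S i)).
exists (\bigcup_(i < n.+1 | (i <= d)%N) (idx i @: Hs S i)); split.
- apply: unit_basis_prod.
  + exact: index_enum_uniq.
  + move=> i j ne; rewrite disjoints_subset; apply/subsetP => l /imsetP[h].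
    rewrite !inE => /and3P[_ s _ el]; apply/imsetP => -[h']; rewrite inE => /and3P[_ s' _ el'].
    by case/eqP: ne; rewrite -(mmin_idx s) -(mmin_idx s') -el -el'.
  move=> i _; apply: unit_basis_omega => [a b _ _|h _]; first exact: idx_inj.
  by apply: form_eq => j; rewrite XiE /ev1 eq_sym.
- apply/bigcupsP => i hi; rewrite Hs_imset //; apply/subsetP => l; rewrite inE => /andP[lS _].
  exact: (subsetP sS).
rewrite Lam_prod; apply: eq_bigr => i hi; rewrite Lam_omega; apply: omega_eq_in => h.
rewrite inE => /and3P[hh s _] j; rewrite -W1_idx // (bigD1 (idx i h)) //= XiE eqxx mul1r.
by rewrite big1 ?addr0 // => l /negbTE ne; rewrite XiE ne mul0r.
Qed.

(** A product of [q2 + 1] different star multiples is the image of a basis vector under the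
    invertible [W1], hence nonzero; but up to a unit it is a value of the first family of
    equations. *)
Lemma card_S0 : #|S0| = q2.
Proof.
apply/eqP; rewrite eqn_leq hlow andbT leqNgt; apply/negP => lt.
have [S sS cS] := subset_card lt; have [E [T [hE _ e]]] := Hs_prod sS.
have [A [_ hA]] := W1_inv.
have := family_vanish1 (@Hs_disj S); rewrite Hs_card // cS => /(_ erefl).
rewrite e => /(congr1 (Lam A)); rewrite LamW1_cancel // Lam0 => E0.
by have := unit_basis_neq0 hE; rewrite E0 eqxx.
Qed.

(** In the basis [W1] the second factor is a basis vector up to sign, indexed by [T]; a vector whose
    wedge with it vanishes has all its coordinates in [T]. *)
Lemma span_of_wedge y E T : unit_basis T E -> T \subset S0 -> wedge (form y) (Lam W1 E) = 0 ->
  exists a : 'I_nr1 -> R, forall j, y j = \sum_(l in S0) a l * W1 l j.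
Proof.
move=> hE sT; have [A [hA1 hA2]] := W1_inv.
move/(congr1 (Lam A)); rewrite LamM LamW1_cancel // Lam0 Lam_form => e.
pose a l := \sum_j y j * A j l.
have a0 l : l \notin S0 -> a l = 0.
  move=> lS; apply: (wedge_unit_basis_eq0 hE e); apply: contra lS; exact: (subsetP sT).
exists a => j; transitivity (\sum_l a l * W1 l j).
  rewrite /a; under [RHS]eq_bigr => l _ do rewrite mulr_suml.
  rewrite exchange_big /= (bigD1 j) //=.
  have s i : \sum_l y i * A i l * W1 l j = y i * (i == j)%:R.
    by rewrite -hA1 mulr_sumr; apply: eq_bigr => l _; rewrite mulrA.
  by rewrite s eqxx mulr1 big1 ?addr0 // => i /negbTE ne; rewrite s ne mulr0.
rewrite [RHS]big_mkcond; apply: eq_bigr => l _; case: ifP => // /negbT lS.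
by rewrite a0 // mul0r.
Qed.

(** A nonstar multiple by [x_i] is added to the block of [x_i] in the product of all star multiples.
    The result has [q2 + 1] factors and vanishes by the first family. *)
Lemma span_low (i : 'I_n.+1) (h : 'I_nr) : (i <= d)%N -> h \notin val J ->
  exists a : 'I_nr1 -> R, forall j, G i h j = \sum_(l in S0) a l * W1 l j.
Proof.
move=> hi hh; have [s|s] := boolP (supge i (alpha h)).
  exists (fun l => (l == idx i h)%:R) => j.
  rewrite (bigD1 (idx i h)) ?idx_S0 //= eqxx mul1r W1_idx // big1 ?addr0 // => l /andP[_ /negbTE ->].
  by rewrite mul0r.
have hHs : h \notin Hs S0 i by rewrite inE (negbTE s) andbF.
pose H j := if j == i then h |: Hs S0 i else Hs S0 j.
have dH j : [disjoint H j & val J].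
  rewrite /H; case: eqP => _; last exact: Hs_disj.
  rewrite disjoints_subset subUset sub1set inE hh /= -disjoints_subset; exact: Hs_disj.
have cH : (\sum_(j < n.+1 | (j <= d)%N) #|H j|)%N = q2.+1.
  rewrite (bigD1 i) //= /H eqxx cardsU1 hHs add1n addSn; congr (_.+1).
  rewrite -card_S0 -(Hs_card (subxx S0)) [in RHS](bigD1 i) //=; congr (_ + _)%N.
  by apply: eq_bigr => j /andP[_ /negbTE ->].
have v0 := family_vanish1 dH cH.
have [E [T [hE sT e]]] := Hs_prod (subxx S0).
have ins : omega (G i) (H i) = sc (sgp R [set h] (Hs S0 i)) (wedge (form (G i h)) (omega (G i) (Hs S0 i))).
  rewrite (proj1 (omega_insert _ _ _) hHs) scA sgp_sq sc1 /H eqxx //.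
have oth j : j != i -> omega (G j) (H j) = omega (G j) (Hs S0 j) by move=> /negbTE ne; rewrite /H ne.
have [c hc ec] := @wedge_prod_insert nr1 R _ (index_enum _) (fun i : 'I_n.+1 => (i <= d)%N)
    (fun j => omega (G j) (H j)) (fun j => omega (G j) (Hs S0 j)) i (G i h) _
    (index_enum_uniq _) (mem_index_enum _) hi (sgp_sq _ _ _) (fun j _ => scomm_omega _ _ _) ins oth.
apply: (span_of_wedge hE sT); rewrite -e.
move: ec; rewrite -/(family_prod H) v0 => /(congr1 (sc c)).
by rewrite scA hc sc1 sc0r.
Qed.

Lemma span_calW w y : calW d w -> mapx ev w = form y ->
  exists a : 'I_nr1 -> R, forall j, y j = \sum_(l in S0) a l * W1 l j.
Proof.
move=> hw ew; have eS : (\sum_(i < n.+1 | (i <= d)%N) #|Hs S0 i|)%N = q2 by rewrite Hs_card // card_S0.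
have := family_vanish2 (@Hs_disj S0) eS hw; rewrite ew.
have [E [T [hE sT ->]]] := Hs_prod (subxx S0) => e.
apply: (span_of_wedge hE sT).
have [c hc e'] : scomm y (Lam W1 E).
  have [c _ ->] := hE; rewrite Lam_sc; apply: scomm_sc; rewrite Lam_omega; exact: scomm_omega.
by move: e; rewrite e' => /(congr1 (sc c)); rewrite scA hc sc1 sc0r.
Qed.

Lemma dl1_form (i : 'I_n.+1) (h : 'I_nr) : h \notin val J -> exists c : R, c \is a GRing.unit /\
  mapx ev (mulx i (delta k pt 1 (val J :|: [set h]))) = sc c (form (G i h)).
Proof.
move=> hh; have dh : [disjoint [set h] & val J] by apply: disj1.
have [c [uc e]] := dl_omega i dh; exists c; split=> //.
by rewrite ev_mulx ev_delta -omega_set1 -e cards1.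
Qed.

Lemma mulx_Lam (j : 'I_n.+1) (u : {ffun {set 'I_nr} -> plring k nr p}) :
  mulx j u = Lam (Xi (plring k nr p) j) u :> {ffun {set 'I_nr1} -> plring k nr p}.
Proof.
apply/ffunP => S; rewrite [LHS]ffunE sum_ffunE; apply: eq_bigr => H _; rewrite [RHS]ffunE.
congr (_ * (_ : {ffun _ -> _}) S); apply: eq_bigr => h _; apply/ffunP => T.
rewrite [LHS]ffunE.
have -> : [set x : 'I_nr1 | alpha x == (U_(j) + alpha h)%MM] = [set idx j h].
  by apply/setP => x; rewrite !inE -alpha_idx (inj_eq (@alpha_inj n r.+1)).
case: eqP => [->|ne]; first by rewrite form1 XiE eqxx.
rewrite ffunE big1 // => x /eqP eS; rewrite XiE; case: eqP => // ex.
by case: ne; rewrite eS ex.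
Qed.

Lemma mulx_delta1 (j : 'I_n.+1) (H : {set 'I_nr}) (l : 'I_nr1) :
  (mulx j (delta k pt 1 H) : {ffun _ -> plring k nr p}) [set l] =
  \sum_h delta k pt 1 H [set h] * Xi (plring k nr p) j h l.
Proof.
rewrite mulx_Lam (_ : delta k pt 1 H = form (fun h => delta k pt 1 H [set h])).
  by rewrite Lam_form form1; apply: eq_bigr => h _; rewrite form1.
by apply: formE => T hT; rewrite ffunE (negbTE hT) andbF.
Qed.

(** Apart from its leading monomial, this [delta] involves only monomials of [J]. These are in [N],
    hence in the ideal [(x_0, ..., x_d)], so outside [Zset] only the leading term remains. *)
Lemma mulx_delta1_high (j : 'I_n.+1) (h : 'I_nr) (l : 'I_nr1) : h \notin val J -> l \notin Zset n d r ->
  (mulx j (delta k pt 1 (val J :|: [set h])) : {ffun _ -> plring k nr p}) [set l] =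
  delta k pt 1 (val J :|: [set h]) [set h] * (idx j h == l)%:R.
Proof.
move=> hh hl; rewrite mulx_delta1 (bigD1 h) //= XiE [l == _]eq_sym big1 ?addr0 // => x xh.
rewrite XiE; have [e|] := eqVneq l (idx j x); last by rewrite mulr0.
rewrite ffunE; case: ifP => [/andP[]|]; last by rewrite mul0r.
rewrite sub1set !inE (negbTE xh) orbF => xJ _; case/negP: hl; rewrite inE.
have := hd (mdeg_alpha x); rewrite -inJ => /(_ xJ); apply: contraR.
rewrite negb_exists => /forallP hx; apply/supgeP => a ha.
have := hx a; rewrite -ltnS ha /= -eqn0Ngt e alpha_idx mnmDE addn_eq0 => /andP[_ /eqP //].
Qed.

(** The two leading terms cancel, and by [mulx_delta1_high] nothing else can occur outside [Zset];
    this is condition (c). *)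
Lemma calW_pair (j i : 'I_n.+1) (h h2 : 'I_nr) :
  h \notin val J -> h2 \notin val J -> h != h2 -> (U_(j) + alpha h = U_(i) + alpha h2)%MM ->
  exists sgn : bool, calW d
    (mulx j (delta k pt 1 (val J :|: [set h])) + (-1) ^+ sgn *: mulx i (delta k pt 1 (val J :|: [set h2]))).
Proof.
move=> hh hh2 ne e.
have dE x : x \notin val J -> exists b : bool,
    delta k pt 1 (val J :|: [set x]) [set x] = (-1) ^+ b * Delta (val J) :> plring k nr p.
  move=> hx; rewrite ffunE subsetUr cards1 /= setDUl setDv setU0.
  have -> : val J :\: [set x] = val J by apply/setDidPl; rewrite disjoint_sym; exact: disj1.
  by eexists; rewrite /eps -[in LHS]signr_odd.
have [b eb] := dE _ hh; have [b2 eb2] := dE _ hh2.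
have cE x : x \notin val J -> #|val J :|: [set x]| = p.+1.
  by move=> hx; rewrite setUC cardsU1 hx (eqP (valP J)).
(* The leading coefficients are [Delta (val J)] with signs given by [b] and [b2]; this choice of
   sign makes them opposite. *)
exists (~~ (b (+) b2)).
have hs : delta k pt 1 (val J :|: [set h]) [set h] +
    (-1) ^+ (~~ (b (+) b2)) * delta k pt 1 (val J :|: [set h2]) [set h2] = 0 :> plring k nr p.
  by rewrite eb eb2; case: (b); case: (b2); rewrite /= ?expr0 ?expr1; ring.
have eI : (val J :|: [set h]) :&: (val J :|: [set h2]) = val J.
  rewrite -setUIr (_ : [set h] :&: [set h2] = set0) ?setU0 //.
  by apply/disjoint_setI0; rewrite disjoints1 inE.
exists (val J :|: [set h]), (val J :|: [set h2]), h, h2, j, i, (~~ (b (+) b2)); split=> //.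
- by rewrite eI !cE // (eqP (valP J)).
- by rewrite eI ![_ |: _]setUC.
move=> l; have [|lZ] := boolP (l \in Zset n d r).
  by rewrite inE => /existsP[a /andP[? ?]] _; exists a.
case; rewrite [_ [set l]]ffunE [((_ *: _) : {ffun _ -> _}) [set l]]ffunE.
rewrite !mulx_delta1_high //.
have -> : idx i h2 = idx j h by apply: (@alpha_inj n r.+1); rewrite !alpha_idx e.
have -> : (((-1) ^+ ~~ (b (+) b2)) *: (delta k pt 1 (val J :|: [set h2]) [set h2] * (idx j h == l)%:R) : plring k nr p)
  = (-1) ^+ (~~ (b (+) b2)) * delta k pt 1 (val J :|: [set h2]) [set h2] * (idx j h == l)%:R.
  by case: (~~ _); rewrite ?expr1 ?expr0 ?scaleN1r ?scale1r ?mulN1r ?mul1r ?mulNr.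
by rewrite -mulrDl hs mul0r => I [].
Qed.

(** For [j <= d] this is [span_low], and a star multiple needs nothing. Otherwise the star multiple
    with the same leading monomial is subtracted, up to units; the difference is a value of an
    element of [calW], which the second family puts in the span of [S0]. *)
Lemma span_star (j : 'I_n.+1) (h : 'I_nr) : h \notin val J ->
  exists b : 'I_n.+1 -> 'I_nr -> R, forall x,
  G j h x = \sum_(i : 'I_n.+1) \sum_(h' : 'I_nr | (h' \notin val J) && supge i (alpha h')) b i h' * G i h' x.
Proof.
move=> hh.
have self (i : 'I_n.+1) (h' : 'I_nr) : (h' \notin val J) && supge i (alpha h') -> exists b : 'I_n.+1 -> 'I_nr -> R, forall x,
  G i h' x = \sum_(i : 'I_n.+1) \sum_(h' : 'I_nr | (h' \notin val J) && supge i (alpha h')) b i h' * G i h' x.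
  move=> s; exists (fun a b => ((a == i) && (b == h'))%:R) => x.
  rewrite (bigD1 i) //= (bigD1 h') //= !eqxx mul1r !big1 ?addr0 //.
    move=> a /negbTE na; rewrite big1 // => b _; rewrite na mul0r //.
  by move=> b /andP[_ /negbTE nb]; rewrite nb mul0r.
pose ST (y : 'I_nr1 -> R) := exists b : 'I_n.+1 -> 'I_nr -> R, forall x,
  y x = \sum_(i : 'I_n.+1) \sum_(h' : 'I_nr | (h' \notin val J) && supge i (alpha h')) b i h' * G i h' x.
have STl a y y' : ST y -> ST y' -> ST (fun x => a * y x + y' x).
  move=> [b hb] [b' hb']; exists (fun i h' => a * b i h' + b' i h') => x.
  rewrite hb hb' mulr_sumr -big_split /=; apply: eq_bigr => i _.
  by rewrite mulr_sumr -big_split /=; apply: eq_bigr => h' _; ring.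
have ST0 : ST (fun=> 0).
  by exists (fun _ _ => 0) => x; rewrite big1 // => i _; rewrite big1 // => h' _; rewrite mul0r.
have STe y y' : y =1 y' -> ST y -> ST y' by move=> e [b hb]; exists b => x; rewrite -e.
have STS (a : 'I_nr1 -> R) : ST (fun x => \sum_(l in S0) a l * W1 l x).
  suff H (s : seq 'I_nr1) : ST (fun x => \sum_(l <- s | l \in S0) a l * W1 l x) by exact: H.
  elim: s => [|l s IH]; first by apply: STe ST0 => x; rewrite big_nil.
  have [lS|lS] := boolP (l \in S0); last by apply: STe IH => x; rewrite big_cons (negbTE lS).
  have : ST (W1 l).
    rewrite /W1 lS; apply: self; move: lS; rewrite inE inJ alpha_rmi => /andP[_ ->] /=.
    by apply: supge_rm; case: (mminP (alpha_neq0 l)).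
  by move=> h1; apply: STe (STl (a l) _ _ h1 IH) => x; rewrite big_cons lS.
have [jd|jd] := boolP (j <= d)%N.
  by have [a ha] := span_low jd hh; apply: STe (STS a) => x; rewrite ha.
have [s|s] := boolP (supge j (alpha h)); first by apply: self; rewrite hh.
set l := idx j h; set i := mmin (alpha l); set h2 := rmi l.
have e : (U_(j) + alpha h = U_(i) + alpha h2)%MM.
  by rewrite alpha_rmi [RHS]addmC (rmK (alpha_neq0 l)) alpha_idx.
have si : supge i (alpha h2) by rewrite alpha_rmi; apply: supge_rm; case: (mminP (alpha_neq0 l)).
have ij : (i < j)%N.
  have [_] := mminP (alpha_neq0 l); rewrite -/i {1}alpha_idx supgeD supgeU => /andP[ij sh].
  rewrite ltn_neqAle ij andbT; apply: contra s => /eqP/ord_inj <-; exact: sh.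
have hh2 : h2 \notin val J.
  apply: contra hh; rewrite !inJ alpha_rmi => Nl.
  have := @grow_sub n r N (alpha l) j hN (mdeg_alpha l) _ Nl.
  by rewrite alpha_idx addmC addmK; apply; rewrite mnmDE mnm1E eqxx addn1.
have ne : h != h2.
  apply: contraTneq ij => eh; rewrite -leqNgt; move/(congr1 (fun m : 'X_{1..n.+1} => m j)): e.
  rewrite -eh !mnmDE !mnm1E eqxx => /addIn; by case: eqP => // ->.
have [sgn hw] := calW_pair hh hh2 ne e.
have [c [uc ec]] := dl1_form j hh; have [c2 [uc2 ec2]] := dl1_form i hh2.
have [a ha] : exists a : 'I_nr1 -> R, forall x,
   c * G j h x + (-1) ^+ sgn * c2 * G i h2 x = \sum_(l in S0) a l * W1 l x.
  apply: (span_calW hw); rewrite mapxD ev_signZ ec ec2 scA -!form_sc -formD.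
  exact: form_eq.
have H2 : ST (G i h2) by apply: self; rewrite hh2.
have := STl (c^-1) _ _ (STS a) (STl (- (c^-1 * ((-1) ^+ sgn * c2))) _ _ H2 ST0).
by apply: STe => x; rewrite -ha mulrDr !mulrA mulVr // mul1r addr0 mulNr addrK.
Qed.

End Rank.

Section FormsAndVectors.
Context (n r : nat).
Local Notation nr := (nmon n r).

Lemma perm_alpha : perm_eq (monomials n r) [seq alpha j | j <- enum 'I_nr].
Proof.
apply: uniq_perm; first exact: monomials_uniq.
  by rewrite map_inj_uniq ?enum_uniq //; exact: alpha_inj.
move=> m; rewrite mem_monomials; apply/eqP/mapP => [/alphaP[j <-]|[j _ ->]].
  by exists j; rewrite ?mem_enum.
exact: mdeg_alpha.
Qed.

Lemma count_alpha (P : pred 'X_{1..n.+1}) :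
  count P (monomials n r) = #|[set j : 'I_nr | P (alpha j)]|.
Proof.
rewrite (permP perm_alpha) count_map -sum1_count big_enum_cond -sum1_card.
by apply: eq_bigl => j; rewrite inE.
Qed.

Lemma dim_last_count d : dim_last n d r = count (supge d.+1) (monomials n r).
Proof.
rewrite -size_filter /dim_last cardE -(size_map (@bmnm _ _)); apply/perm_size/uniq_perm.
- by rewrite map_inj_uniq ?enum_uniq //; exact: val_inj.
- by rewrite filter_uniq // monomials_uniq.
move=> m; rewrite mem_filter mem_monomials; apply/mapP/andP => [[b]|[/supgeP s /eqP dm]].
  rewrite mem_enum inE => /andP[db /forallP h] ->; split=> //; apply/supgeP => j hj; apply/eqP.
  by move/implyP: (h j); apply.
have lt : (mdeg m < r.+1)%N by rewrite dm.
exists (BMultinom lt) => //; rewrite mem_enum inE /= dm eqxx; apply/forallP => j; apply/implyP => hj.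
by rewrite s.
Qed.

Context (R : comNzRingType).
Local Notation S := {mpoly R[n.+1]}.

Definition pv (v : 'I_nr -> R) : S := \sum_h v h *: 'X_[alpha h].

Lemma pvE v h : (pv v)@_(alpha h) = v h.
Proof.
rewrite raddf_sum /= (bigD1 h) //= mcoeffZ mcoeffX eqxx mulr1 big1 ?addr0 // => j ne.
by rewrite mcoeffZ mcoeffX (inj_eq (@alpha_inj n r)) (negbTE ne) mulr0.
Qed.

Lemma pv_homog v : pv v \is r.-homog.
Proof. by apply: rpred_sum => h _; apply: rpredZ; apply: homogX; exact: mdeg_alpha. Qed.

Lemma homog_pv (f : S) : f \is r.-homog -> f = pv (fun h => f@_(alpha h)).
Proof.
move=> hf; apply/mpolyP => m; have [/alphaP[j <-]|ne] := eqVneq (mdeg m) r; first by rewrite pvE.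
by rewrite (dhomog_nemf_coeff hf) ?(dhomog_nemf_coeff (pv_homog _)).
Qed.

Lemma eq_pv v w : v =1 w -> pv v = pv w.
Proof. by move=> e; apply: eq_bigr => h _; rewrite e. Qed.

Lemma pv_lin (I : Type) (s : seq I) (P : pred I) (a : I -> R) (w : I -> 'I_nr -> R) :
  pv (fun h => \sum_(i <- s | P i) a i * w i h) = \sum_(i <- s | P i) a i *: pv (w i).
Proof.
rewrite /pv; under eq_bigr => h _ do rewrite scaler_suml.
rewrite exchange_big /=; apply: eq_bigr => i _; rewrite scaler_sumr.
by apply: eq_bigr => h _; rewrite scalerA.
Qed.

(* The rows of [C] are the classes of the monomials in a basis of a quotient of
   the forms of degree [r]. *)
Definition kerf p (C : 'M[R]_(nr, p)) (f : S) :=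
  f \is r.-homog /\ forall c, \sum_h f@_(alpha h) * C h c = 0.

Lemma subm_kerf p (C : 'M[R]_(nr, p)) : subm (kerf C).
Proof.
split.
- by split=> [|c]; rewrite ?rpred0 // big1 // => h _; rewrite mcoeff0 mul0r.
- move=> u v [hu ku] [hv kv]; split=> [|c]; first exact: rpredD.
  under eq_bigr => h _ do rewrite mcoeffD mulrDl.
  by rewrite big_split /= ku kv addr0.
move=> a u [hu ku]; split=> [|c]; first exact: rpredZ.
transitivity (a * \sum_h u@_(alpha h) * C h c); last by rewrite ku mulr0.
rewrite mulr_sumr; by apply: eq_bigr => h _; rewrite mcoeffZ mulrA.
Qed.

End FormsAndVectors.

Lemma pv_mulX (n r : nat) (R : comUnitRingType) (i : 'I_n.+1) (v : 'I_(nmon n r) -> R) :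
  'X_i * pv v = \sum_(x : 'I_(nmon n r.+1)) (\sum_l v l * Xi R i l x) *: 'X_[@alpha n r.+1 x].
Proof.
rewrite mulr_sumr; under [RHS]eq_bigr => x _ do rewrite scaler_suml.
rewrite exchange_big /=; apply: eq_bigr => l _.
rewrite (bigD1 (idx i l)) //= XiE eqxx mulr1 big1 ?addr0 => [|x ne].
  by rewrite alpha_idx mpolyXD -scalerAr.
by rewrite XiE (negbTE ne) mulr0 scale0r.
Qed.

Lemma grow_Zset n d r (N : pred 'X_{1..n.+1}) (l : 'I_(nmon n r.+1)) : borel r N ->
  (forall m, mdeg m = r -> N m -> ~~ supge d.+1 m) -> grow N (alpha l) -> (mmin (alpha l) <= d)%N.
Proof.
move=> hN hd Nl; have m0 : alpha l != 0%MM by rewrite -mdeg_eq0 mdeg_alpha.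
have [_ s] := mminP m0; rewrite leqNgt; apply/negP => lt.
have := hd (rm (alpha l)); rewrite mdeg_rm mdeg_alpha => /(_ erefl Nl).
by rewrite supge_rm // (supgeW lt).
Qed.

Lemma mmin_Zset n d r (l : 'I_(nmon n r.+1)) : (l \in Zset n d r) = (mmin (alpha l) <= d)%N.
Proof.
have m0 : alpha l != 0%MM by rewrite -mdeg_eq0 mdeg_alpha.
have [h1 h2] := mminP m0; rewrite inE; apply/existsP/idP => [[a /andP[ad al]]|h].
  apply: leq_trans ad; rewrite leqNgt; apply/negP => lt.
  by move/supgeP: h2 => /(_ _ lt) e; rewrite e in al.
by exists (mmin (alpha l)); rewrite h lt0n.
Qed.

Lemma card_Zset n d r : (#|Zset n d r| + dim_last n d r.+1)%N = nmon n r.+1.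
Proof.
rewrite dim_last_count count_alpha -[RHS]card_ord -(cardsC (Zset n d r)); congr (_ + _)%N.
apply: eq_card => l; rewrite !inE; apply/supgeP/existsPn => [h a|h a la].
  by rewrite negb_and -ltnNge; case: leqP => //= ad; rewrite -eqn0Ngt h.
by have := h a; rewrite negb_and -ltnS la /= -eqn0Ngt => /eqP.
Qed.

(** Since no element of [N] avoids all of [x_0, ..., x_d], the set [grow N] lies in [Zset], and [S0]
    is its complement there. *)
Lemma card_grow n d r (N : pred 'X_{1..n.+1}) : borel r N ->
  (forall m, mdeg m = r -> N m -> ~~ supge d.+1 m) ->
  (#|S0 d r N| + cnt r.+1 0 (grow N))%N = #|Zset n d r|.
Proof.
move=> hN hd; rewrite /cnt count_alpha -(cardsID [set l | grow N (alpha l)] (Zset n d r)) addnC.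
congr (_ + _)%N; apply: eq_card => l.
  rewrite in_setI mmin_Zset !inE (_ : supge 0 _) ?andbT; last by apply/supgeP.
  by rewrite andbC; case Nl: grow => //=; rewrite (grow_Zset hN hd Nl).
by rewrite in_setD mmin_Zset !inE andbC.
Qed.

(** The subtraction is truncated, so [q''] has its intended value only when [p(r + 1)] is at most
    the size of [Zset]. *)
Lemma qsecond_Zset n (pt : {poly rat}) d r : qsecond n pt d r = (#|Zset n d r| - hval pt r.+1)%N.
Proof. have := card_Zset n d r; rewrite /qsecond /nmon; lia. Qed.

Section KernelFreeness.
Context (n r p : nat) (R : comUnitRingType) (C : 'M[R]_(nmon n r, p)).
Context (J : midx (nmon n r) p) (N : pred 'X_{1..n.+1}).
Hypothesis JE : val J = [set h | N (alpha h)].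
Hypothesis hJ : pl C (val J) \is a GRing.unit.

Lemma cnt_midx : cnt r 0 N = p.
Proof.
rewrite /cnt count_alpha -(eqP (valP J)) JE; apply: eq_card => l; rewrite !inE.
by rewrite (_ : supge 0 _) ?andbT //; apply/supgeP.
Qed.

(** The projection [F] of [dl_Lam] modifies a monomial outside [N] only in coordinates of [N], so
    subtracting the projections of these monomials leaves a standard remainder. A standard form in
    the kernel is fixed by [F], which kills the monomials of [N]. *)
Lemma kerf_free_mod : free_mod r (kerf C) N.
Proof.
have [F [Fk Fout Fin Ffix]] := dl_Lam hJ; split=> [f hf|h hh [_ kh]].
  exists (f - pv (fun x => \sum_(l | l \notin val J) f@_(alpha l) * F l x)).
    move=> m h0; have dm : mdeg m = r.
      apply/eqP; apply: contraNT h0 => ne; rewrite mcoeffB.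
      by rewrite (dhomog_nemf_coeff hf) ?(dhomog_nemf_coeff (pv_homog _)) ?subr0.
    split=> //; have [x ex] := alphaP dm; rewrite -ex in h0 *.
    apply: contraNT h0 => Nx; have xJ : x \notin val J by rewrite JE inE.
    rewrite mcoeffB pvE (bigD1 x) //= Fout // (negbTE xJ) eqxx mulr1 big1 ?addr0 ?subrr //.
    by move=> l /andP[lJ ne]; rewrite Fout // (negbTE lJ) (negbTE ne) mulr0.
  rewrite subKr pv_lin; apply: subm_sum => [|l _]; first exact: subm_kerf.
  case: (subm_kerf C) => _ _; apply; split=> [|c]; first exact: pv_homog.
  by rewrite -[RHS](Fk l c); apply: eq_bigr => x _; rewrite pvE.
have := Ffix (form (fun x => h@_(alpha x))) => e.
have {}e : Lam F (form (fun x => h@_(alpha x))) = form (fun x => h@_(alpha x)).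
  apply: e => c; have e0 : \sum_j C j c * h@_(alpha j) = 0.
    by rewrite -[RHS](kh c); apply: eq_bigr => j _; rewrite mulrC.
  by rewrite iota_form1 e0 sc0.
rewrite (homog_pv (supported_homog hh)) /pv big1 // => x _.
have := congr1 (fun u : {ffun _ -> R} => u [set x]) e; rewrite Lam_form !form1 => <-.
rewrite big1 ?scale0r // => l _; have [->|/hh[_ Nl]] := eqVneq h@_(alpha l) 0; first by rewrite mul0r.
by rewrite Fin ?mulr0 // JE inE.
Qed.

End KernelFreeness.

Section BackwardFreeness.
Context (k : fieldType) (n : nat) (pt : {poly rat}) (d r : nat).
Local Notation nr := (nmon n r).
Local Notation nr1 := (nmon n r.+1).
Local Notation p := (hval pt r).
Context (R : comUnitRingType) (io : {rmorphism k -> R}).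
Context (C : 'M[R]_(nr, p)) (J : midx nr p) (N : pred 'X_{1..n.+1}) (a : seq nat).
Hypothesis hN : borel r N.
Hypothesis JE : val J = [set h | N (alpha h)].
Hypothesis hJ : pl C (val J) \is a GRing.unit.
Hypothesis sa : sorted geq a.
Hypothesis za : size a = r.
Hypothesis ad : all (fun x => x <= d)%N a.
Hypothesis hv : forall t, (r <= t)%N -> hval pt t = gval t a.

Hypothesis hF : forall F, frakh1 d F \/ frakh2 d F -> evp io C F = 0.
Hypothesis hZ : (hval pt r.+1 <= #|Zset n d r|)%N.

Lemma kerf_no_last m : mdeg m = r -> N m -> ~~ supge d.+1 m.
Proof. by apply: (@borel_no_last n r N a) => //; rewrite ?za // (cnt_midx JE) hv. Qed.

Lemma qsecond_le : (qsecond n pt d r <= #|S0 d r N|)%N.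
Proof.
have h : (cnt r.+1 0 (grow N) <= hval pt r.+1)%N.
  rewrite hv //; apply: macaulay => //; rewrite ?za // (cnt_midx JE) hv //.
have := card_grow hN kerf_no_last; rewrite qsecond_Zset => <-; lia.
Qed.

(** Macaulay's bound gave only the inequality [qsecond_le]; [card_S0] turns it into an equality. The
    hypothesis [hZ] makes the truncated difference in [q''] exact. *)
Lemma kerf_cntS : cnt r.+1 0 (grow N) = gval r.+1 a.
Proof.
have [F [_ Fout Fin Ffix]] := dl_Lam hJ.
have e := @card_S0 k n pt d r R io C J N JE hJ hF qsecond_le F Fout Fin Ffix.
have := card_grow hN kerf_no_last; rewrite e qsecond_Zset -hv //; lia.
Qed.

(** Remainders come from rewriting by the marked basis. For uniqueness, [span_star] expresses every
    multiple of an element of the kernel by star multiples, to which [star_indep] applies. *)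
Lemma kerf_free_modS : free_mod (1 + r) (mulS 1 (kerf C)) (grow N).
Proof.
have [F [Fk Fout Fin Ffix]] := dl_Lam hJ.
pose f (al : 'X_{1..n.+1}) : {mpoly R[n.+1]} := \sum_h (alpha h == al)%:R *: pv (F h).
have fE h : f (alpha h) = pv (F h).
  rewrite /f (bigD1 h) //= eqxx scale1r big1 ?addr0 // => l ne.
  by rewrite (inj_eq (@alpha_inj n r)) (negbTE ne) scale0r.
have kf h : kerf C (pv (F h)).
  split=> [|c]; first exact: pv_homog.
  by rewrite -[RHS](Fk h c); apply: eq_bigr => x _; rewrite pvE.
have fm al : mdeg al = r -> ~~ N al -> supported r N ('X_[al] - f al).
  move=> da Na m h0; have [h eh] := alphaP da; rewrite -eh fE in h0 Na.
  have hh : h \notin val J by rewrite JE inE.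
  have dm : mdeg m = r.
    apply/eqP; apply: contraNT h0 => ne; rewrite mcoeffB.
    rewrite (dhomog_nemf_coeff (homogX R (mdeg_alpha h))) //.
    by rewrite ?(dhomog_nemf_coeff (pv_homog _)) ?subr0.
  split=> //; have [x ex] := alphaP dm; rewrite -ex in h0 *.
  apply: contraNT h0 => Nx; have xJ : x \notin val J by rewrite JE inE.
  by rewrite mcoeffB pvE mcoeffX Fout // (negbTE hh) (inj_eq (@alpha_inj n r)) subrr.
have fmk al : mdeg al = r -> ~~ N al -> kerf C (f al) /\ supported r N ('X_[al] - f al).
  by move=> da Na; split; [have [h <-] := alphaP da; rewrite fE|exact: fm].
split=> [g hg|g hg Mg].
  apply: (marked_span (t := 1) fm) => //; first exact: subm_span.
  by move=> ga al dg da Na; apply: mem_mulS => //; case: (fmk al da Na).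
apply: (star_indep (t := 1) fm) => //.
apply: Mg => [|_ [ga [v [dg kv ->]]]]; first exact: subm_span.
have := marked_gen (subm_kerf C) (kerf_free_mod JE hJ) (fun g (kg : kerf C g) => kg.1) fmk kv.
apply: span_map => [|_ [al [da Na ->]]]; first exact: subm_span.
have [j ej] : exists j : 'I_n.+1, ga = U_(j)%MM.
  have g0 : ga != 0%MM by rewrite -mdeg_eq0 dg.
  exists (mmin ga); rewrite -[LHS](rmK g0) (_ : rm ga = 0%MM) ?add0m //.
  by apply/eqP; rewrite -mdeg_eq0 mdeg_rm dg.
have [h eh] := alphaP da; rewrite -eh fE in Na *; rewrite ej.
have hh : h \notin val J by rewrite JE inE.
have [b hb] := @span_star k n pt d r R io C J N hN JE hJ hF kerf_no_last qsecond_le F Fout Fin Ffix j h hh.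
have -> : 'X_j * pv (F h) = \sum_(i : 'I_n.+1) \sum_(h' : 'I_nr | (h' \notin val J) && supge i (alpha h'))
    b i h' *: ('X_i * pv (F h')).
  rewrite pv_mulX; under eq_bigr => x _ do rewrite -[\sum_l _]/(G F j h x) hb scaler_suml.
  rewrite exchange_big /=; apply: eq_bigr => i _.
  under eq_bigr => x _ do rewrite scaler_suml.
  rewrite exchange_big /=; apply: eq_bigr => h' _; rewrite pv_mulX scaler_sumr.
  by apply: eq_bigr => x _; rewrite scalerA.
have sS : subm (star_all r N f 1) by exact: subm_span.
apply: subm_sum => // i _; apply: subm_sum => // h' /andP[hh' s].
case: (sS) => _ _; apply; apply: mem_span; exists U_(i)%MM, (alpha h'); split; last by rewrite fE.
split; rewrite ?mdeg1 ?mdeg_alpha //; first by move: hh'; rewrite JE inE.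
apply: star_of => [|l]; first by rewrite mdeg1.
by rewrite mnm1E; case: (eqVneq i l) s => [->|].
Qed.

End BackwardFreeness.

(** * Linear substitutions and generic initial sets *)

Lemma mpoly_morph_ext n (R : comNzRingType) (R2 : nzRingType) (f g : {rmorphism {mpoly R[n]} -> R2}) :
  (forall c, f c%:MP = g c%:MP) -> (forall i, f 'X_i = g 'X_i) -> f =1 g.
Proof.
move=> hC hX P; rewrite (mpolyE P) !rmorph_sum; apply: eq_bigr => m _.
rewrite -mul_mpolyC !rmorphM hC; congr (_ * _); rewrite mpolyXE_id !rmorph_prod.
by apply: eq_bigr => i _; rewrite !rmorphXn hX.
Qed.

Section LinearSubstitutions.
Context (n : nat) (R : comNzRingType).
Local Notation S := {mpoly R[n.+1]}.
Implicit Types (M g h : 'M[R]_n.+1) (f : S).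

Definition lsub M f : S := f \mPo [tuple \sum_(a < n.+1) M i a *: 'X_a | i < n.+1].

HB.instance Definition _ M := GRing.LRMorphism.copy (lsub M)
  (comp_mpoly [tuple \sum_(a < n.+1) M i a *: 'X_a | i < n.+1]).

Lemma lsubXU M i : lsub M 'X_i = \sum_a M i a *: 'X_a.
Proof. by rewrite /lsub comp_mpolyXU -tnth_nth tnth_mktuple. Qed.

Lemma lsubX M m : lsub M 'X_[m] = \prod_i (\sum_a M i a *: 'X_a) ^+ m i.
Proof. by rewrite /lsub comp_mpolyX; apply: eq_bigr => i _; rewrite tnth_mktuple. Qed.

Lemma lsub_comp g h f : lsub g (lsub h f) = lsub (h *m g) f.
Proof.
apply: (mpoly_morph_ext (f := lsub g \o lsub h) (g := lsub (h *m g))) => [c|i] /=.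
  by rewrite /lsub !comp_mpolyC.
rewrite !lsubXU linear_sum /=; under eq_bigr => a _ do rewrite linearZ /= lsubXU scaler_sumr.
rewrite exchange_big /=; apply: eq_bigr => b _; rewrite mxE scaler_suml.
by apply: eq_bigr => a _; rewrite scalerA.
Qed.

Lemma lsub1 f : lsub 1%:M f = f.
Proof.
apply: (mpoly_morph_ext (f := lsub 1%:M) (g := idfun)) => [c|i] /=; first by rewrite /lsub comp_mpolyC.
rewrite lsubXU (bigD1 i) //= mxE eqxx scale1r big1 ?addr0 // => a ne.
by rewrite mxE eq_sym (negbTE ne) scale0r.
Qed.

Lemma lsub_homog M t f : f \is t.-homog -> lsub M f \is t.-homog.
Proof.
move=> hf; rewrite (homog_pv hf) linear_sum; apply: rpred_sum => j _ /=.
rewrite linearZ; apply: rpredZ; rewrite /= lsubX.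
have {2}<- : (\sum_i alpha j i)%N = t by rewrite -mdegE mdeg_alpha.
apply: (big_ind2 (fun (x : S) e => x \is e.-homog)) => [|x e y e' hx hy|i _].
- exact: dhomog1.
- exact: dhomogM.
rewrite -[m in m.-homog]mul1n; apply: dhomogMn; apply: rpred_sum => a _; apply: rpredZ.
exact: (homogX R (mdeg1 a)).
Qed.

Definition submx_ (t : nat) M : 'M[R]_(nmon n t) :=
  \matrix_(l, j) (lsub M 'X_[alpha j])@_(alpha l).

Lemma lsub_pv t M (v : 'I_(nmon n t) -> R) :
  lsub M (pv v) = pv (fun l => \sum_j v j * submx_ t M l j).
Proof.
rewrite pv_lin linear_sum; apply: eq_bigr => j _ /=; rewrite linearZ; congr (_ *: _).
rewrite [LHS](@homog_pv _ t); last by apply: lsub_homog; apply: homogX; exact: mdeg_alpha.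
by apply: eq_pv => l; rewrite mxE.
Qed.

Lemma submx_comp t g h : submx_ t (h *m g) = submx_ t g *m submx_ t h.
Proof.
apply/matrixP => l j; rewrite !mxE -lsub_comp.
rewrite [lsub h _](@homog_pv _ t); last by apply: lsub_homog; apply: homogX; exact: mdeg_alpha.
by rewrite lsub_pv pvE; apply: eq_bigr => a _; rewrite !mxE mulrC.
Qed.

Lemma submx1 t : submx_ t 1%:M = 1%:M.
Proof.
by apply/matrixP => l j; rewrite !mxE lsub1 mcoeffX (inj_eq (@alpha_inj n t)) eq_sym.
Qed.

Lemma kerf_lsub t p g (C : 'M[R]_(nmon n t, p)) f : f \is t.-homog ->
  kerf ((submx_ t g)^T *m C) f <-> kerf C (lsub g f).
Proof.
move=> hf; have hg := lsub_homog g hf.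
have e c : \sum_h f@_(alpha h) * ((submx_ t g)^T *m C) h c = \sum_h (lsub g f)@_(alpha h) * C h c.
  rewrite [in RHS](homog_pv hf) lsub_pv; under [RHS]eq_bigr => h _ do rewrite pvE mulr_suml.
  rewrite exchange_big /=; apply: eq_bigr => h _; rewrite mxE mulr_sumr.
  by apply: eq_bigr => l _; rewrite !mxE mulrA.
by split=> -[_ h]; split=> // c; [rewrite -e|rewrite e]; exact: h.
Qed.

End LinearSubstitutions.

Lemma lsub_map n (R R2 : comNzRingType) (io : {rmorphism R -> R2}) (M : 'M[R]_n.+1) f :
  map_mpoly io (lsub M f) = lsub (map_mx io M) (map_mpoly io f).
Proof.
apply: (mpoly_morph_ext (f := map_mpoly io \o lsub M) (g := lsub (map_mx io M) \o map_mpoly io)) => [c|i] /=.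
  by rewrite /lsub comp_mpolyC !map_mpolyC comp_mpolyC.
rewrite map_mpolyX !lsubXU rmorph_sum; apply: eq_bigr => a _ /=.
by rewrite map_mpolyZ map_mpolyX mxE.
Qed.

Lemma submx_map n t (R R2 : comNzRingType) (io : {rmorphism R -> R2}) (M : 'M[R]_n.+1) :
  map_mx io (submx_ t M) = submx_ t (map_mx io M).
Proof.
apply/matrixP => l j; rewrite !mxE -mcoeff_map_mpoly lsub_map.
by rewrite map_mpolyX.
Qed.

(** In characteristic 0 any presentation of a rational number as a fraction determines its image,
    not only the reduced one; this is [key], and the ring laws follow by clearing denominators. *)
Lemma ratr_rmorphism (k : fieldType) : [pchar k] =i pred0 ->
  exists f : {rmorphism rat -> k}, forall x, f x = ratr x.
Proof.
move=> ch; have nz (z : int) : z != 0 -> z%:~R != 0 :> k.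
  have nzn (m : nat) : (0 < m)%N -> m%:R != 0 :> k.
    by move=> m0; rewrite (proj1 (pcharf0P _) ch) -lt0n.
  case: z => m; first by move=> m0; rewrite -pmulrn nzn // lt0n; apply: contra m0 => /eqP ->.
  by move=> _; rewrite NegzE mulrNz oppr_eq0 -pmulrn nzn.
have nd x : (denq x)%:~R != 0 :> k by apply: nz; rewrite denq_neq0.
have kd (x : rat) : ratr x * (denq x)%:~R = (numq x)%:~R :> k by rewrite /ratr divfK.
have qd (x : rat) : x * (denq x)%:~R = (numq x)%:~R.
  by rewrite -{1}(divq_num_den x) divfK // intr_eq0 denq_neq0.
have key (x : rat) (a b : int) : b != 0 -> x * b%:~R = a%:~R -> ratr x * b%:~R = a%:~R :> k.
  move=> b0 e; apply: (mulIf (nd x)); rewrite mulrAC kd -!intrM.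
  by congr (_%:~R); apply: (@intr_inj rat); rewrite !intrM -e -qd; ring.
have fadd : zmod_morphism (ratr : rat -> k).
  move=> x y; have dd : denq x * denq y != 0 by rewrite mulf_neq0 ?denq_neq0.
  apply: (mulIf (nz _ dd)); rewrite (key (x - y) (numq x * denq y - numq y * denq x)) //.
    by rewrite intrB !intrM -!kd; ring.
  by rewrite intrB !intrM -!qd; ring.
have fmul : monoid_morphism (ratr : rat -> k).
  split=> [|x y]; first by rewrite (ratr_nat k 1).
  have dd : denq x * denq y != 0 by rewrite mulf_neq0 ?denq_neq0.
  apply: (mulIf (nz _ dd)); rewrite (key (x * y) (numq x * numq y)) //.
    by rewrite !intrM mulrACA !kd.
  by rewrite !intrM mulrACA !qd.
pose F0 := GRing.isZmodMorphism.Build rat k (ratr : rat -> k) fadd.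
pose F1 := GRing.isMonoidMorphism.Build rat k (ratr : rat -> k) fmul.
pose F : {rmorphism rat -> k} := HB.pack (ratr : rat -> k) F0 F1.
by exists F.
Qed.

Section PositionalWeight.
Context (n b : nat).
Implicit Types m u : 'X_{1..n.+1}.

(** The exponents are read as digits in base [b]. Monomials of degree below [b] get different
    weights, so the diagonal substitution with these weights separates all monomials of a given
    degree. *)
Definition pwt m : nat := (\sum_(i < n.+1) m i * b ^ i)%N.

Lemma pwtD m u : pwt (m + u) = (pwt m + pwt u)%N.
Proof. by rewrite /pwt -big_split /=; apply: eq_bigr => i _; rewrite mnmDE mulnDl. Qed.

Lemma pwtU (i : 'I_n.+1) : pwt U_(i) = (b ^ i)%N.
Proof.
rewrite /pwt (bigD1 i) //= mnm1E eqxx mul1n big1 ?addn0 // => l ne.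
by rewrite mnm1E eq_sym (negbTE ne).
Qed.

Lemma digits_inj (c c' : nat -> nat) l : (forall i, (c i < b)%N) -> (forall i, (c' i < b)%N) ->
  (\sum_(i < l) c i * b ^ i = \sum_(i < l) c' i * b ^ i)%N -> forall i, (i < l)%N -> c i = c' i.
Proof.
elim: l c c' => // l IH c c' hc hc'; rewrite !big_ord_recl /= !expn0 !muln1.
have sh (x : nat -> nat) : (\sum_(i < l) x (bump 0 i) * b ^ bump 0 i =
    b * \sum_(i < l) x i.+1 * b ^ i)%N.
  by rewrite big_distrr /=; apply: eq_bigr => i _; rewrite /bump add1n expnS mulnCA.
rewrite !sh => e; have e0 : c 0 = c' 0.
  have := congr1 (modn^~ b) e.
  by rewrite /= !(addnC _ (b * _)%N) !(mulnC b) !modnMDl !modn_small.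
have b0 : (0 < b)%N by apply: leq_ltn_trans (hc 0%N).
move: e; rewrite e0 => /addnI /eqP; rewrite eqn_pmul2l // => /eqP e [|i] //.
rewrite ltnS; exact: (IH (fun i => c i.+1) (fun i => c' i.+1)).
Qed.

Lemma pwt_inj m u : (mdeg m < b)%N -> (mdeg u < b)%N -> pwt m = pwt u -> m = u.
Proof.
move=> hm hu e; apply/mnmP => i.
pose c (m : 'X_{1..n.+1}) l := if insub l is Some j then m (j : 'I_n.+1) else 0%N.
have cE (m' : 'X_{1..n.+1}) (j : 'I_n.+1) : c m' j = m' j by rewrite /c valK.
have hc (m' : 'X_{1..n.+1}) l : (mdeg m' < b)%N -> (c m' l < b)%N.
  move=> h; rewrite /c; case: insubP => [j _ _|_]; last by apply: leq_ltn_trans h.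
  by apply: leq_ltn_trans h; rewrite mdegE (bigD1 j) //= leq_addr.
rewrite -!cE; apply: (@digits_inj (c m) (c u) n.+1) => // [l|l|].
- exact: hc.
- exact: hc.
rewrite /pwt in e; under eq_bigr => j _ do rewrite cE.
by rewrite e; apply: eq_bigr => j _; rewrite cE.
Qed.

End PositionalWeight.

Section ElementarySubstitutions.
Context (n t : nat) (R : comNzRingType).
Local Notation S := {mpoly R[n.+1]}.

Definition shear (i j : 'I_n.+1) : 'M[R]_n.+1 := 1%:M + delta_mx i j.

Definition weights (lam : R) : 'M[R]_n.+1 := diag_mx (\row_a lam ^+ (t.+1 ^ a)).

Lemma lsub_weights lam m : lsub (weights lam) 'X_[m] = lam ^+ pwt t.+1 m *: 'X_[m] :> S.
Proof.
rewrite lsubX [in RHS]mpolyXE_id -prodrXr.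
have -> : (\prod_i lam ^+ (m i * t.+1 ^ i)%N) *: (\prod_i 'X_i ^+ m i) =
   \prod_i (lam ^+ (m i * t.+1 ^ i)%N *: 'X_i ^+ m i) :> S.
  by rewrite scaler_prod.
apply: eq_bigr => i _; rewrite (bigD1 i) //= !mxE eqxx mulr1n big1 ?addr0.
  by rewrite exprZn -exprM mulnC.
by move=> a ne; rewrite !mxE eq_sym (negbTE ne) mulr0n scale0r.
Qed.

Lemma submx_weights lam :
  submx_ t (weights lam) = diag_mx (\row_h lam ^+ pwt t.+1 (@alpha n t h)).
Proof.
apply/matrixP => l h; rewrite !mxE lsub_weights mcoeffZ mcoeffX (inj_eq (@alpha_inj n t)) eq_sym.
by have [->|_] := eqVneq l h; rewrite ?mulr1 ?mulr0.
Qed.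

Definition shift (i j : 'I_n.+1) s m : 'X_{1..n.+1} := (m - U_(i) *+ s + U_(j) *+ s)%MM.

Lemma lsub_shear (i j : 'I_n.+1) m : i != j ->
  lsub (shear i j) 'X_[m] = \sum_(s < (m i).+1) 'C(m i, s)%:R *: 'X_[shift i j s m] :> S.
Proof.
move=> ij; have le s : (s <= m i)%N -> (U_(i) *+ s <= m)%MM.
  move=> h; apply/mnm_lepP => a; rewrite mulmnE mnm1E; case: eqP => [<-|_]; last by [].
  by rewrite mul1n.
have row a : \sum_b shear i j a b *: 'X_b = 'X_a + (a == i)%:R *: 'X_j :> S.
  under eq_bigr => b _ do rewrite !mxE scalerDl.
  rewrite big_split /=; congr (_ + _).
    rewrite (bigD1 a) //= eqxx scale1r big1 ?addr0 // => b ne.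
    by rewrite eq_sym (negbTE ne) scale0r.
  rewrite (bigD1 j) //= eqxx andbT big1 ?addr0 // => b ne.
  by rewrite (negbTE ne) andbF scale0r.
rewrite lsubX (bigD1 i) //= row eqxx scale1r exprDn mulr_suml; apply: eq_bigr => s _.
rewrite -mulrnAl -scaler_nat -!scalerAl; congr (_ *: _).
have e : \prod_(a < n.+1 | a != i) (\sum_b shear i j a b *: 'X_b) ^+ m a = 'X_[m - U_(i) *+ m i] :> S.
  rewrite mpolyXE_id [RHS](bigD1 i) //= mnmBE mulmnE mnm1E eqxx mul1n subnn expr0 mul1r.
  apply: eq_bigr => a ne; rewrite row (negbTE ne) scale0r addr0 mnmBE mulmnE mnm1E.
  by rewrite eq_sym (negbTE ne) subn0.
rewrite e !mpolyXn -!mpolyXD; congr 'X_[_]; apply/mnmP => a.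
rewrite /shift !mnmDE !mnmBE !mulmnE !mnm1E.
case: (eqVneq i a) => [<-|_]; rewrite ?mul1n ?mul0n ?subn0 ?subnn ?addn0 1?addnC //.
Qed.

Lemma submx_shear_neq0 (i j : 'I_n.+1) (g l : 'I_(nmon n t)) : i != j ->
  submx_ t (shear i j) l g != 0 ->
  exists2 s, (s <= alpha g i)%N & alpha l = shift i j s (alpha g).
Proof.
move=> ij; rewrite mxE lsub_shear // raddf_sum /= => h.
have [/existsP[s /eqP e]|/existsPn h0] :=
    boolP [exists s : 'I_(alpha g i).+1, alpha l == shift i j s (alpha g)].
  by exists s => //; rewrite -ltnS.
case/eqP: h; rewrite big1 // => s _; rewrite mcoeffZ mcoeffX.
by rewrite eq_sym (negbTE (h0 s)) mulr0.
Qed.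

Lemma submx_shear (i j : 'I_n.+1) (g l : 'I_(nmon n t)) s : i != j ->
  (s <= alpha g i)%N -> alpha l = shift i j s (alpha g) ->
  submx_ t (shear i j) l g = 'C(alpha g i, s)%:R.
Proof.
move=> ij hs e; rewrite mxE lsub_shear // raddf_sum /= (bigD1 (inord s)) //=.
rewrite inordK // mcoeffZ mcoeffX e eqxx mulr1 big1 ?addr0 // => s' ne.
rewrite mcoeffZ mcoeffX; case: eqP => [e'|_]; last by rewrite mulr0.
case/eqP: ne; apply/val_inj; rewrite /= inordK //.
move/(congr1 (fun m : 'X_{1..n.+1} => m j)): e'.
rewrite /shift !mnmDE !mnmBE !mulmnE !mnm1E eqxx (negbTE ij) !mul0n !subn0 !mul1n.
by move/addnI.
Qed.

Lemma pwt_shift (i j : 'I_n.+1) s (m : 'X_{1..n.+1}) : (0 < t)%N -> (i < j)%N -> (s <= m i)%N ->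
  (pwt t.+1 m <= pwt t.+1 (shift i j s m) ?= iff (s == 0%N))%N.
Proof.
move=> t0 ij hs; have le : (U_(i) *+ s <= m)%MM.
  by apply/mnm_lepP => a; rewrite mulmnE mnm1E; case: eqP => [<-|_] //; rewrite mul1n.
have pwtM a : pwt t.+1 (U_(a) *+ s : 'X_{1..n.+1}) = (s * t.+1 ^ a)%N.
  by elim: (s) => [|x IH]; rewrite ?mulm0n ?mulmS ?pwtD ?IH ?pwtU ?mulSn // /pwt big1 // => l _; rewrite mnm0E.
rewrite /shift pwtD pwtM -[in pwt t.+1 m](submK le) pwtD pwtM.
have lt : (t.+1 ^ i < t.+1 ^ j)%N by rewrite ltn_exp2l.
split; first by rewrite leq_add2l leq_mul2l (ltnW lt) orbT.
by rewrite eqn_add2l eqn_mul2l [(t.+1 ^ i == _)%N]ltn_eqF ?orbF.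
Qed.

End ElementarySubstitutions.

Lemma natr_fieldI (K : fieldType) (io : {rmorphism rat -> K}) : injective (fun m : nat => m%:R : K).
Proof.
move=> a b /= e; have : io a%:R = io b%:R by rewrite !rmorph_nat.
by move/fmorph_inj/eqP; rewrite eqr_nat => /eqP.
Qed.

Lemma poly_nat_nonroot (K : fieldType) (io : {rmorphism rat -> K}) (P : {poly K}) :
  P != 0 -> exists2 l : nat, (0 < l)%N & P.[l%:R] != 0.
Proof.
move=> P0; pose s := [seq m%:R : K | m <- iota 1 (size P)].
have us : uniq s by rewrite map_inj_uniq ?iota_uniq //; exact: (natr_fieldI io).
have : ~~ all (root P) s.
  by apply/negP => h; have := max_poly_roots P0 h us; rewrite size_map size_iota ltnn.
by move/allPn => [_ /mapP[l hl ->] h]; exists l; first by move: hl; rewrite mem_iota => /andP[].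
Qed.

Section GenericInitial.
Context (K : fieldType) (io : {rmorphism rat -> K}) (n t e : nat).
Local Notation M := (nmon n t).
Local Notation w := (pwt t.+1).
Implicit Types (C : 'M[K]_(M, e)) (J : midx M e).

Definition wt J := (\sum_(h in val J) w (alpha h))%N.

Lemma wt_exchange J J' (a b : 'I_M) : b \in val J -> a \notin val J ->
  val J' = a |: (val J :\ b) -> (wt J' + w (alpha b) = wt J + w (alpha a))%N.
Proof.
move=> bJ aJ eJ; rewrite /wt eJ big_setU1; last by rewrite !inE (negbTE aJ) andbF.
by rewrite [in RHS](big_setD1 b bJ) addnC [RHS]addnC addnCA.
Qed.

Lemma midx_exchange J (a b : 'I_M) : b \in val J -> a \notin val J ->
  exists J' : midx M e, val J' = a |: (val J :\ b).
Proof.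
move=> bJ aJ; have h : #|a |: (val J :\ b)| == e.
  rewrite cardsU1 !inE (negbTE aJ) andbF /= -[X in _ == X](eqP (valP J)).
  by rewrite [in X in _ == X](cardsD1 b) bJ.
by exists (exist (fun J0 : {set 'I_M} => #|J0| == e) _ h).
Qed.

Lemma alpha_pwt_inj (a b : 'I_M) : w (alpha a) = w (alpha b) -> a = b.
Proof. by move=> h; apply: (@alpha_inj n t); apply: (@pwt_inj n t.+1); rewrite ?mdeg_alpha. Qed.

Lemma reduction C J : pl C (val J) != 0 ->
  (forall J', pl C (val J') != 0 -> (wt J <= wt J')%N) ->
  exists A : 'I_M -> 'I_M -> K,
  [/\ forall x c, C x c = \sum_(y in val J) A x y * C y c,
      forall x y, y \in val J -> x \in val J -> A x y = (x == y)%:R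
    & forall x y, y \in val J -> A x y != 0 -> (w (alpha y) <= w (alpha x))%N].
Proof.
move=> hJ min; exists (fun x y => if x \in val J then (x == y)%:R else
  - (sgp K [set x] (val J) * sgp K [set y] ((x |: val J) :\ y) * pl C ((x |: val J) :\ y) / pl C (val J))).
split=> [x c|x y yJ -> //|x y yJ].
  have [xJ|xJ] := boolP (x \in val J).
    rewrite (bigD1 x) //= eqxx mul1r big1 ?addr0 // => y /andP[_ ne].
    by rewrite eq_sym (negbTE ne) mul0r.
  have := cramer C (x |: val J) c; rewrite big_setU1 //= setU1K // => /eqP.
  rewrite addr_eq0 => /eqP e1; apply: (mulIf hJ); apply: (mulfI (_ : sgp K [set x] (val J) != 0)).
    by apply: contraTneq (oner_neq0 K) => e0; rewrite -(sgp_sq K [set x] (val J)) e0 mul0r eqxx.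
  rewrite mulrA e1 mulr_suml mulr_sumr -sumrN; apply: eq_bigr => y yJ.
  have s2 := sgp_sq K [set x] (val J).
  rewrite mulNr mulNr mulrN; congr (- _).
  transitivity ((sgp K [set x] (val J) * sgp K [set x] (val J)) *
     sgp K [set y] ((x |: val J) :\ y) * pl C ((x |: val J) :\ y) * C y c * (pl C (val J) / pl C (val J))).
    by rewrite s2 divff //; ring.
  by ring.
have [_|xJ] := boolP (x \in val J).
  by have [->|] := eqVneq x y; rewrite ?eqxx.
rewrite oppr_eq0 !mulf_eq0 !negb_or => /andP[/andP[_ h] _].
have [J' eJ] := midx_exchange yJ xJ.
have eK : (x |: val J) :\ y = x |: (val J :\ y).
  by apply/setP => z; rewrite !inE; case: eqP => // ->; rewrite orbF; case: eqP => // exy; rewrite -exy yJ in xJ.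
rewrite eK -eJ in h; have := min _ h; have := wt_exchange yJ xJ eJ; lia.
Qed.

(** A failure of the Borel condition at [a] and [b] is used to lower the weight, by the shear of
    [x_i] along [x_j] and a diagonal substitution with parameter [lam]. Up to nonzero factors the
    new minor at [J'] is the determinant of a polynomial matrix in [lam], and its value at 0 is a
    block of the shear, which is unitriangular for the weight. *)
Lemma shear_exchange C J (i j : 'I_n.+1) (a b : 'I_M) m : pl C (val J) != 0 ->
  (forall J', pl C (val J') != 0 -> (wt J <= wt J')%N) ->
  (i < j)%N -> b \in val J -> a \notin val J ->
  alpha a = (m + U_(i))%MM -> alpha b = (m + U_(j))%MM ->
  exists (l : nat) (J' : midx M e), [/\ (0 < l)%N, (wt J' < wt J)%N
    & pl ((submx_ t (shear K i j *m weights n t l%:R))^T *m C) (val J') != 0].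
Proof.
move=> hJ min ij bJ aJ ea eb; have [A [A1 A2 A3]] := reduction hJ min.
have [J' eJ] := midx_exchange bJ aJ.
have ne : i != j by apply: contraTneq ij => ->; rewrite ltnn.
have t0 : (0 < t)%N by rewrite -(mdeg_alpha a) ea mdegU.
have sab : alpha b = shift i j 1 (alpha a).
  by rewrite /shift ea eb !mulm1n addmK.
have ai : (1 <= alpha a i)%N by rewrite ea mnmDE mnm1E eqxx addn1.
have wab : (w (alpha a) < w (alpha b))%N.
  by rewrite sab; have := pwt_shift t0 ij ai => -[h1 h2]; rewrite ltn_neqAle h1 h2.
have lt : (wt J' < wt J)%N by have := wt_exchange bJ aJ eJ; lia.
pose T x y := submx_ t (shear K i j) y x.
have T1 x : T x x = 1.
  by rewrite /T (@submx_shear _ _ _ i j x x 0) ?bin0 // /shift !mulm0n subm0 addm0.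
have Tab : T a b != 0.
  rewrite /T (@submx_shear _ _ _ i j a b 1) // bin1.
  by apply/eqP => h0; have := @natr_fieldI K io (alpha a i) 0%N h0 => h1; rewrite h1 in ai.
have Tw x y : T x y != 0 -> x != y -> (w (alpha x) < w (alpha y))%N.
  move=> /(submx_shear_neq0 ne)[s hs e1] xy; have [h1 h2] := pwt_shift t0 ij hs.
  rewrite e1 ltn_neqAle h1 h2 andbT; apply: contra xy => /eqP s0.
  by apply/eqP/(@alpha_inj n t); rewrite e1 s0 /shift !mulm0n subm0 addm0.
have Tb x : T x b != 0 -> x != b -> x != a -> (w (alpha x) < w (alpha a))%N.
  move=> /(submx_shear_neq0 ne)[[|s] hs e1] xb xa.
    case/eqP: xb; apply: (@alpha_inj n t).
    by rewrite e1 /shift !mulm0n subm0 addm0.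
  have ex : alpha a = shift i j s (alpha x).
    apply: (@addIm _ U_(j)%MM); rewrite [LHS](_ : _ = (alpha b + U_(i))%MM); last first.
      by rewrite ea eb -!addmA [(U_(i) + _)%MM]addmC.
    rewrite e1; apply/mnmP => l; rewrite /shift !mnmDE !mnmBE !mulmnE !mnm1E.
    case: (eqVneq i l) hs => [<- hs|_ _]; last by lia.
    by rewrite (negbTE (_ : j != i)) 1?eq_sym //; lia.
  have [h1 h2] := pwt_shift t0 ij (ltnW hs); rewrite ex ltn_neqAle h1 h2 andbT.
  apply: contra xa => /eqP s0; apply/eqP/(@alpha_inj n t); rewrite ex s0.
  by rewrite /shift !mulm0n subm0 addm0.
(* The powers of the parameter belonging to [J] are pulled out of the columns. The truncated
   exponents are exact where [A] is nonzero, and at 0 only the terms with [z] equal to the column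
   survive. *)
pose Q : 'M[{poly K}]_e := \matrix_(x, y) \sum_z (T (elt J' x) z * A z (elt J y))%:P *
   'X^(w (alpha z) - w (alpha (elt J y))).
have Q0 : \det (map_mx (horner_eval 0) Q) != 0.
  apply/negP => /det0P[u u0 uQ].
  have QE x y : map_mx (horner_eval 0) Q x y = T (elt J' x) (elt J y).
    rewrite !mxE /horner_eval horner_sum (bigD1 (elt J y)) //= subnn expr0 mulr1 hornerC.
    rewrite A2 ?elt_in // eqxx mulr1 big1 ?addr0 // => z zy; rewrite hornerM hornerC hornerXn expr0n.
    have [->|Az] := eqVneq (A z (elt J y)) 0; first by rewrite mulr0 mul0r.
    rewrite subn_eq0; case: leqP => [h|_]; last by rewrite mulr0.
    have := A3 z _ (elt_in J y) Az; rewrite leq_eqVlt ltnNge h orbF => /eqP/alpha_pwt_inj eyz.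
    by rewrite eyz eqxx in zy.
  have [x0 hx0] : exists x, u 0 x != 0 by apply/rV0Pn.
  pose x := [arg min_(x < x0 | u 0 x != 0) w (alpha (elt J' x))].
  have [ux xmin] : u 0 x != 0 /\ forall y, u 0 y != 0 -> (w (alpha (elt J' x)) <= w (alpha (elt J' y)))%N.
    by rewrite /x; case: arg_minnP.
  have hx : elt J' x \in a |: (val J :\ b) by rewrite -eJ elt_in.
  (* A column that, among the rows in the support of [u], meets only the row [x] of least weight:
     the shear maps monomials to themselves plus heavier ones. Since [a] is not in [J], the row [a]
     is paired with [b], whose other sources are [b] itself, which is not in [J'], and monomials
     lighter than [a]. *)
  pose px := if elt J' x == a then b else elt J' x.
  have [y hy] : exists y, elt J y = px.
    apply: eltP; rewrite /px; case: eqP => [//|/eqP xa]; move: hx.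
    by rewrite !inE (negbTE xa) => /andP[].
  have := congr1 (fun v : 'rV_e => v 0 y) uQ; rewrite !mxE (bigD1 x) //= big1 ?addr0.
    rewrite QE hy => /eqP; rewrite mulf_eq0 (negbTE ux) /= /px; case: (eqVneq (elt J' x) a) => [->|_].
      by rewrite (negbTE Tab).
    by rewrite T1 oner_eq0.
  move=> z zx; rewrite QE hy; have [->|uz] := eqVneq (u 0 z) 0; first by rewrite mul0r.
  have le := xmin _ uz; have [->|Tz] := eqVneq (T (elt J' z) px) 0; first by rewrite mulr0.
  have nzx : elt J' z != elt J' x by apply: contra zx => /eqP/elt_inj ->.
  exfalso; move: Tz; rewrite /px; case: (eqVneq (elt J' x) a) => [ex|_] Tz; last first.
    by have := Tw _ _ Tz nzx; rewrite ltnNge le.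
  have hz : elt J' z \in a |: (val J :\ b) by rewrite -eJ elt_in.
  have zb : elt J' z != b.
    apply: contraTneq hz => ->; rewrite !inE eqxx orbF; apply: contraTneq wab => ->.
    by rewrite ltnn.
  have nza : elt J' z != a by rewrite -ex.
  by have := Tb _ Tz zb nza; rewrite -ex ltnNge le.
have detQ0 : \det Q != 0 by apply: contraNneq Q0 => h0; rewrite det_map_mx h0 rmorph0.
have [l l0 hl] := poly_nat_nonroot io detQ0.
exists l, J'; split=> //; rewrite -pl_det.
have -> : rowsub (elt J') ((submx_ t (shear K i j *m weights n t l%:R))^T *m C) =
  map_mx (horner_eval l%:R) Q *m diag_mx (\row_y l%:R ^+ w (alpha (elt J y))) *m rowsub (elt J) C.
  apply/matrixP => x c; rewrite submx_comp trmx_mul !mxE.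
  transitivity (\sum_z T (elt J' x) z * l%:R ^+ w (alpha z) * C z c).
    apply: eq_bigr => z _; congr (_ * _).
    by rewrite submx_weights tr_diag_mx mul_mx_diag [LHS]mxE [(\row__ _) _ _]mxE [_^T _ _]mxE.
  have big_elt (X : 'I_M -> K) : \sum_(y in val J) X y = \sum_y X (elt J y).
    rewrite -[in LHS](elt_imset J) big_imset /=; last by move=> y y' _ _; exact: elt_inj.
    by apply: eq_bigl => y; rewrite inE.
  under eq_bigr => z _ do rewrite A1 big_elt mulr_sumr.
  rewrite exchange_big /=; apply: eq_bigr => y _; rewrite mul_mx_diag !mxE /horner_eval horner_sum.
  rewrite !mulr_suml; apply: eq_bigr => z _; rewrite hornerM hornerC hornerXn.
  have [->|Az] := eqVneq (A z (elt J y)) 0; first by rewrite mulr0 !mul0r mulr0.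
  by rewrite -[w (alpha z) in LHS](subnK (A3 _ _ (elt_in J y) Az)) exprD; ring.
rewrite !det_mulmx !mulf_neq0 //.
- by rewrite det_map_mx.
- rewrite det_diag; apply/prodf_neq0 => y _; rewrite mxE expf_neq0 //.
  by apply/eqP => h0; have := @natr_fieldI K io l 0%N h0 => h1; rewrite h1 in l0.
by rewrite pl_det.
Qed.

Lemma shear_unit (i j : 'I_n.+1) (l : nat) : i != j -> (0 < l)%N ->
  shear rat i j *m weights n t l%:R \in unitmx.
Proof.
move=> ij l0; rewrite unitmx_mul; apply/andP; split.
  suff: shear rat i j *m (1%:M - delta_mx i j) = 1%:M by case/mulmx1_unit.
  rewrite mulmxBr mulmx1 mulmxDl mul1mx mul_delta_mx_cond eq_sym (negbTE ij) mulr0n addr0.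
  by rewrite addrK.
rewrite unitmxE det_diag unitfE; apply/prodf_neq0 => y _; rewrite mxE expf_neq0 //.
by rewrite pnatr_eq0 -lt0n.
Qed.

(** A descent on weight in place of a generic choice: as long as a nonvanishing minor of least
    weight is not Borel, [shear_exchange] produces a lighter one. Every substitution used has
    rational entries, so [g] does not involve [K]. *)
Theorem generic_borel C : (exists J, pl C (val J) != 0) ->
  exists (g : 'M[rat]_n.+1) J (N : pred 'X_{1..n.+1}),
  [/\ g \in unitmx, borel t N, val J = [set h | N (alpha h)]
    & pl ((submx_ t (map_mx io g))^T *m C) (val J) != 0].
Proof.
move=> [J0 hJ0]; apply: contrapT => no.
suff H : forall s g J, (wt J < s)%N -> g \in unitmx ->
    pl ((submx_ t (map_mx io g))^T *m C) (val J) != 0 -> False.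
  apply: (H (wt J0).+1 1%:M J0); rewrite ?unitmx1 //.
  by rewrite map_mx1 submx1 trmx1 mul1mx.
elim=> // s IH g J hs ug hJ.
have min J' : pl ((submx_ t (map_mx io g))^T *m C) (val J') != 0 -> (wt J <= wt J')%N.
  by move=> h; rewrite leqNgt; apply/negP => lt; apply: (IH g J') => //; apply: leq_trans lt _.
case: no; exists g, J, (fun m => [exists h in val J, alpha h == m]); split=> //; last first.
  apply/setP => h; rewrite inE; apply/idP/existsP => [hh|[h' /andP[hh /eqP/alpha_inj <-]]] //.
  by exists h; rewrite hh eqxx.
move=> m i j ij dm /existsP[b /andP[bJ /eqP eb]].
have [a ea] : exists a : 'I_M, alpha a = (m + U_(i))%MM by apply: alphaP; rewrite mdegU.
apply/existsP; exists a; rewrite ea eqxx andbT; apply: contrapT => /negP aJ.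
have [l [J' [l0 lt h']]] := shear_exchange hJ min ij bJ aJ ea eb.
apply: (IH (shear rat i j *m weights n t l%:R *m g) J').
- exact: leq_trans lt _.
- rewrite unitmx_mul ug andbT; apply: shear_unit => //.
  by apply: contraTneq ij => ->; rewrite ltnn.
have eh : map_mx io (shear rat i j *m weights n t l%:R) = shear K i j *m weights n t l%:R.
  rewrite map_mxM /shear map_mxD map_mx1 map_delta_mx; congr (_ *m _).
  by rewrite /weights map_diag_mx; congr diag_mx; apply/rowP => y; rewrite !mxE rmorphXn rmorph_nat.
by rewrite map_mxM eh (submx_comp t (map_mx io g) (shear K i j *m weights n t l%:R)) trmx_mul -mulmxA.
Qed.

End GenericInitial.

(** * Values and degree of the Gotzmann expression *)

Section GotzmannValues.

Lemma binomial_poly_val (c : int) (x t M : nat) : t%:Z + c = M%:Z -> (x <= M)%N ->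
  (binomial_poly (c%:~R) x).[t%:R] = 'C(M, x)%:R.
Proof.
move=> e xM; rewrite /binomial_poly hornerZ horner_prod.
have -> : \prod_(j < x) ('X + (c%:~R - j%:R)%:P).[t%:R] = (M ^_ x)%:R :> rat.
  rewrite ffact_prod natr_prod; apply: eq_bigr => j _.
  rewrite hornerD hornerX hornerC addrA natrB; last by apply: ltnW; apply: leq_trans xM.
  congr (_ - _); rewrite -[t%:R]/((t%:Z)%:~R) -intrD e //.
by rewrite -bin_ffact natrM mulrC mulfK // pnatr_eq0 -lt0n fact_gt0.
Qed.

Lemma gval_sum t a : (size a <= t)%N ->
  gval t a = (\sum_(i < size a) 'C(t - i + nth 0 a i, nth 0 a i))%N.
Proof.
elim: a t => [|x a IH] t /= ht; first by rewrite big_ord0.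
rewrite big_ord_recl /= subn0; congr (_ + _)%N; case: t ht => // t ht; exact: IH.
Qed.

Lemma hilbert_value (pt : {poly rat}) (a : seq nat) (t : nat) :
  pt = \sum_(i < size a) binomial_poly ((nth 0%N a i)%:R - i%:R) (nth 0%N a i) ->
  (size a <= t)%N -> pt.[t%:R] = (gval t a)%:R.
Proof.
move=> -> ht; rewrite horner_sum gval_sum // natr_sum; apply: eq_bigr => i _.
have it : (i <= t)%N by apply: leq_trans ht; apply: ltnW.
rewrite -(@binomial_poly_val ((nth 0%N a i)%:Z - i%:Z) _ t); first by rewrite intrB.
  by rewrite PoszD -subzn //; ring.
by rewrite leq_addl.
Qed.

Lemma hval_gval (pt : {poly rat}) (a : seq nat) (t : nat) :
  pt = \sum_(i < size a) binomial_poly ((nth 0%N a i)%:R - i%:R) (nth 0%N a i) ->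
  (size a <= t)%N -> hval pt t = gval t a.
Proof. by move=> e h; rewrite /hval (hilbert_value e h) Num.Theory.natrK. Qed.

(** The terms with the largest exponent all contribute the same positive coefficient in that degree,
    so they cannot cancel, and the largest exponent is at most the degree. *)
Lemma gotzmann_degree (pt : {poly rat}) (a : seq nat) (d : nat) :
  pt = \sum_(i < size a) binomial_poly ((nth 0%N a i)%:R - i%:R) (nth 0%N a i) ->
  sorted geq a -> size pt = d.+1 -> all (fun x => x <= d)%N a.
Proof.
move=> e sa zp; case: a e sa => [//|x0 a] e sa.
set b := x0 :: a in e sa *; have hmax y : y \in b -> (y <= x0)%N.
  rewrite inE => /orP[/eqP ->//|ya]; move: sa; rewrite /b /= (path_sortedE (rev_trans leq_trans)).
  by case/andP => /allP h _; exact: h.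
have monic c x : binomial_poly c x = (x`!%:R)^-1 *: \prod_(j < x) ('X - (- (c - j%:R))%:P).
  by rewrite /binomial_poly; congr (_ *: _); apply: eq_bigr => j _; rewrite polyCN opprK.
have size_b c x : size (\prod_(j < x) ('X - (- (c - j%:R))%:P) : {poly rat}) = x.+1.
  by rewrite size_prod_XsubC /index_enum -enumT size_enum_ord.
have co c x : (x <= x0)%N -> (binomial_poly c x)`_x0 = if x == x0 then (x0`!%:R)^-1 else 0.
  move=> le; rewrite monic coefZ; case: eqP => [->|/eqP ne].
    have := monic_prod_XsubC (index_enum 'I_x0) predT (fun j => - (c - j%:R)).
    by move/monicP; rewrite /lead_coef size_b => ->; rewrite mulr1.
  by rewrite nth_default ?mulr0 // size_b ltn_neqAle ne.
suff h : pt`_x0 != 0.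
  apply/allP => y /hmax h'; apply: leq_trans h' _; rewrite -ltnS -zp.
  by rewrite ltnNge; apply: contra h => /(nth_default 0) ->.
rewrite e coef_sum; apply/lt0r_neq0; rewrite (bigD1 ord0) //= co // eqxx.
apply: ltr_pwDl; first by rewrite invr_gt0 ltr0n fact_gt0.
apply: sumr_ge0 => i _; rewrite co; last by apply: hmax; apply: mem_nth.
by case: ifP => _ //; rewrite invr_ge0 ler0n.
Qed.

End GotzmannValues.

Lemma pihomogMX n (A : comNzRingType) (u : 'X_{1..n}) (f : {mpoly A[n]}) t :
  pihomog [measure of mdeg] t ('X_[u] * f) =
  if (mdeg u <= t)%N then 'X_[u] * pihomog [measure of mdeg] (t - mdeg u) f else 0.
Proof.
rewrite [f in LHS]mpolyE [f in RHS]mpolyE mulr_sumr !raddf_sum /= mulr_sumr.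
rewrite -[RHS]/(if _ then \sum_(m <- msupp f) _ else 0).
transitivity (\sum_(m <- msupp f) if (mdeg u <= t)%N then
  'X_[u] * pihomog [measure of mdeg] (t - mdeg u) (f@_m *: 'X_[m]) else 0); last first.
  by case: ifP => _ //; rewrite big1.
apply: eq_bigr => m _; rewrite -scalerAr -mpolyXD !linearZ /= !pihomogX /= mdegD.
case: leqP => [le|lt].
  rewrite -scalerAr; congr (_ *: _); rewrite -(eqn_add2l (mdeg u) (mdeg m)) subnKC //.
  by case: eqP => _; rewrite ?mulr0 // mpolyXD.
by rewrite gtn_eqF ?scaler0 // (leq_trans lt) // leq_addr.
Qed.

Section Sections.
Context (n : nat) (A : comNzRingType).
Local Notation S := {mpoly A[n.+1]}.
Implicit Types (f : S) (X : charts n A).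

(** The saturated homogeneous ideal of [X]. Collecting all degrees in one submodule lets it serve as
    the single [I] of the freeness statements. *)
Definition secs X f := forall t i, X i (pihomog [measure of mdeg] t f).

Lemma secs_homog X t f : closed_subscheme X -> f \is t.-homog ->
  secs X f <-> forall i, X i f.
Proof.
move=> [hX _ _] hf; split=> [h i|h s i]; first by have := h t i; rewrite pihomog_dE.
have [<-|ne] := eqVneq t s; first by rewrite pihomog_dE.
by rewrite (pihomog_ne0 ne hf); case: (hX i).
Qed.

Lemma subm_secs X : closed_subscheme X -> subm (secs X).
Proof.
move=> [hX _ _]; split=> [t i|u v hu hv t i|c u hu t i]; case: (hX i) => h0 hD hM.
- by rewrite pihomog0.
- by rewrite pihomogD; apply: hD; [exact: hu|exact: hv].
by rewrite linearZ /= -mul_mpolyC; apply: hM; exact: hu.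
Qed.

Lemma secs_mulX X (u : 'X_{1..n.+1}) f : closed_subscheme X -> secs X f -> secs X ('X_[u] * f).
Proof.
move=> [hX _ _] h t i; rewrite pihomogMX; case: (hX i) => h0 hD hM.
by case: ifP => _ //; apply: hM; exact: h.
Qed.

Lemma ideal_expX1 (I : S -> Prop) (i : 'I_n.+1) e : is_ideal I -> I ('X_i - 1) -> I ('X_i ^+ e - 1).
Proof.
move=> [h0 hD hM] h1; elim: e => [|e IH]; first by rewrite expr0 subrr.
rewrite exprS (_ : _ - 1 = 'X_i * ('X_i ^+ e - 1) + ('X_i - 1)); last by ring.
by apply: hD => //; exact: hM.
Qed.

Lemma chart_cancel (I : S -> Prop) (i : 'I_n.+1) e f : is_ideal I -> I ('X_i - 1) ->
  I ('X_i ^+ e * f) <-> I f.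
Proof.
move=> hI h1; have [_ hD hM] := hI; split; last exact: hM.
move=> h; rewrite (_ : f = 'X_i ^+ e * f + (- f) * ('X_i ^+ e - 1)); last by ring.
by apply: hD => //; apply: hM; exact: ideal_expX1.
Qed.

Lemma secs_sat X f e t : closed_subscheme X -> f \is t.-homog ->
  (forall u, mdeg u = e -> secs X ('X_[u] * f)) -> secs X f.
Proof.
move=> cX hf h; apply/(secs_homog cX hf) => i.
have du : mdeg (U_(i) *+ e : 'X_{1..n.+1})%MM = e by rewrite mdegMn mdeg1 mul1n.
have := h _ du; rewrite (secs_homog cX (homogXM du hf)) => /(_ i).
by have [hX h1 _] := cX; rewrite -mpolyXn; move/(chart_cancel e f (hX i) (h1 i)).
Qed.

End Sections.

Lemma subm_lsub n (R : comNzRingType) (g : 'M[R]_n.+1) (I : {mpoly R[n.+1]} -> Prop) : subm I -> subm (fun f => I (lsub g f)).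
Proof.
by move=> [h0 hD hZ]; split=> [|u v hu hv|c u hu]; rewrite ?linear0 ?linearD ?linearZ //=; [exact: hD|exact: hZ].
Qed.

Lemma submx_unit n t (R : comUnitRingType) (M : 'M[R]_n.+1) :
  M \in unitmx -> submx_ t M \in unitmx.
Proof.
move=> uM; have e : submx_ t M *m submx_ t (invmx M) = 1%:M.
  by rewrite -submx_comp mulVmx // submx1.
exact: (mulmx1_unit e).1.
Qed.

(** * Generic initial sets of subschemes over a field *)

Section FieldDimension.
Context (K : fieldType) (n t e : nat).
Local Notation S := {mpoly K[n.+1]}.
Context (C : 'M[K]_(nmon n t, e)).

Lemma full_rank_minor (B : 'M[K]_(e, nmon n t)) : B *m C = 1%:M ->
  exists J : midx (nmon n t) e, pl C (val J) != 0.
Proof.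
move=> BC; have fC : row_full C by apply/row_fullP; exists B.
pose f := fullrankfun fC; have fi : injective f := @fullrankfun_inj _ _ _ _ fC.
have h : #|f @: setT| == e by rewrite card_imset // cardsT card_ord.
exists (exist (fun J0 : {set 'I__} => #|J0| == e) _ h); set J := exist _ _ _.
rewrite -pl_det -unitfE -unitmxE -row_full_unit; apply/row_fullP.
have uf : rowsub f C \in unitmx by exact: fullrowsub_unit.
have hx i : exists a, elt J a = f i by apply: eltP; apply: imset_f.
have [s hs] := choice hx.
exists (invmx (rowsub f C) *m (\matrix_(i, a) (a == s i)%:R)).
rewrite -mulmxA (_ : _ *m rowsub _ _ = rowsub f C) ?mulVmx //; apply/matrixP => i c.
rewrite !mxE (bigD1 (s i)) //= !mxE eqxx mul1r hs big1 ?addr0 // => a ne.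
by rewrite mxE (negbTE ne) mul0r.
Qed.

Context (I : S -> Prop) (N : pred 'X_{1..n.+1}).
Hypothesis sI : subm I.
Hypothesis IC : forall f, f \is t.-homog -> I f <-> kerf C f.
Hypothesis fullC : exists B : 'M[K]_(e, nmon n t), B *m C = 1%:M.
Hypothesis spanN : forall f, f \is t.-homog -> exists2 h, supported t N h & I (f - h).

Let J := [set h : 'I_(nmon n t) | N (alpha h)].
Let CJ : 'M[K]_(#|J|, e) := rowsub (fun i => enum_val i) C.

Lemma cntJ : cnt t 0 N = #|J|.
Proof.
rewrite /cnt count_alpha; apply: eq_card => l; rewrite !inE.
by rewrite (_ : supge 0 _) ?andbT //; apply/supgeP.
Qed.

Lemma supported_row h c : supported t N h ->
  \sum_x h@_(alpha x) * C x c = ((\row_i h@_(alpha (enum_val (i : 'I_#|J|)))) *m CJ) 0 c.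
Proof.
move=> hh; rewrite mxE (bigID (mem J)) /= [X in _ + X]big1 ?addr0 => [|x]; last first.
  rewrite inE => Nx; have [->|/hh[_]] := eqVneq h@_(alpha x) 0; first by rewrite mul0r.
  by rewrite (negbTE Nx).
by rewrite big_enum_val; apply: eq_bigr => i _; rewrite !mxE.
Qed.

(** Modulo [I] every form is a combination of monomials of [N], so [C] keeps its full column rank
    when restricted to their rows. *)
Lemma CJ_full : row_full CJ.
Proof.
have [B BC] := fullC; apply/row_fullP.
have hx c : exists u : 'rV[K]_#|J|, u *m CJ = row c 1%:M.
  pose f : S := pv (fun x => B c x).
  have [h hh If] := spanN (pv_homog _ : f \is t.-homog).
  exists (\row_i h@_(alpha (enum_val (i : 'I_#|J|)))); apply/rowP => c'; rewrite -supported_row //.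
  have hf : f - h \is t.-homog by apply: rpredB (supported_homog hh); exact: pv_homog.
  have [_ /(_ c')] := (IC hf).1 If; under eq_bigr => x _ do rewrite mcoeffB pvE mulrBl.
  rewrite sumrB => /eqP; rewrite subr_eq0 => /eqP <-.
  by rewrite -BC !mxE.
have [u hu] := choice hx; exists (\matrix_c u c).
by apply/row_matrixP => c; rewrite row_mul rowK.
Qed.

Lemma spanning_card : (e <= cnt t 0 N)%N.
Proof. by rewrite cntJ -(eqP CJ_full) rank_leq_row. Qed.

Lemma spanning_free : (cnt t 0 N <= e)%N -> free_mod t I N.
Proof.
rewrite cntJ => le; split=> // h hh /(IC (supported_homog hh))[_ kh].
have fr : row_free CJ.
  by rewrite /row_free (eqP CJ_full); have := spanning_card; rewrite cntJ eqn_leq le => ->.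
have r0 : \row_i h@_(alpha (enum_val (i : 'I_#|J|))) = 0 :> 'rV[K]_#|J|.
  by apply: (row_free_inj fr); apply/rowP => c; rewrite mul0mx -supported_row // kh mxE.
rewrite (homog_pv (supported_homog hh)) /pv big1 // => x _.
have [->|h0] := eqVneq h@_(alpha x) 0; first by rewrite scale0r.
have xJ : x \in J by rewrite inE; case: (hh _ h0).
by have := congr1 (fun v : 'rV_#|J| => v 0 (enum_rank_in xJ x)) r0;
  rewrite !mxE enum_rankK_in // => ->; rewrite scale0r.
Qed.

End FieldDimension.

Section FieldHilbert.
Context (K : fieldType) (io : {rmorphism rat -> K}) (n : nat) (pt : {poly rat}) (a : seq nat).
Local Notation S := {mpoly K[n.+1]}.
Local Notation r := (size a).
Hypothesis sa : sorted geq a.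
Hypothesis hpt : forall t, (r <= t)%N -> pt.[t%:R] = (gval t a)%:R.
Context (Y : charts n K).
Hypothesis cY : closed_subscheme Y.

(** Row [h] of [C] holds the coordinates of the monomial [alpha h] in the given basis of the
    quotient; the coefficients of the basis forms themselves give the left inverse. *)
Lemma sections_matrix t e (b : 'I_e -> S) : (forall i, b i \is t.-homog) ->
  (forall f, f \is t.-homog -> exists! c : 'rV[K]_e, ideal_sections Y t (f - \sum_i c 0 i *: b i)) ->
  exists C : 'M[K]_(nmon n t, e), (exists B : 'M[K]_(e, nmon n t), B *m C = 1%:M) /\
    forall f, f \is t.-homog -> secs Y f <-> kerf C f.
Proof.
move=> hb hu; have [sS0 sSD sSZ] := subm_secs cY.
have hbs (c : 'rV[K]_e) : \sum_i c 0 i *: b i \is t.-homog.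
  by apply: rpred_sum => i _; apply: rpredZ.
have IS f : f \is t.-homog -> ideal_sections Y t f <-> secs Y f.
  by move=> hf; rewrite (secs_homog cY hf); split=> [[]|].
have uq f (c c' : 'rV[K]_e) : f \is t.-homog -> secs Y (f - \sum_i c 0 i *: b i) ->
    secs Y (f - \sum_i c' 0 i *: b i) -> c = c'.
  move=> hf h h'; have [c0 [_ hc0]] := hu f hf.
  have H (x : 'rV[K]_e) : secs Y (f - \sum_i x 0 i *: b i) -> c0 = x.
    by move=> h1; apply: hc0; apply: (proj2 (IS _ _)) => //; apply: rpredB => //; exact: hbs.
  exact: etrans (esym (H _ h)) (H _ h').
have ex f : exists c : 'rV[K]_e, f \is t.-homog -> secs Y (f - \sum_i c 0 i *: b i).
  have [hf|nf] := boolP (f \is t.-homog); last by exists 0.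
  by have [c [hc _]] := hu f hf; exists c => _; apply: (proj1 (IS _ _) hc);
      apply: rpredB => //; exact: hbs.
have [co hco] := choice ex.
pose C : 'M[K]_(nmon n t, e) := \matrix_h co 'X_[alpha h].
have cE f : f \is t.-homog -> co f = (\row_h f@_(alpha h)) *m C.
  move=> hf; apply: (uq f) => //; first exact: hco.
  rewrite [X in X - _](homog_pv hf) /pv.
  have -> : \sum_i ((\row_h f@_(alpha h)) *m C) 0 i *: b i =
            \sum_(h : 'I_(nmon n t)) f@_(alpha h) *: \sum_i co 'X_[alpha h] 0 i *: b i.
    under [RHS]eq_bigr => h _ do rewrite scaler_sumr.
    rewrite exchange_big /=; apply: eq_bigr => i _; rewrite mxE scaler_suml.
    by apply: eq_bigr => h _; rewrite !mxE scalerA.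
  rewrite -sumrB; apply: subm_sum => [|h _]; first exact: subm_secs.
  by rewrite -scalerBr; apply: sSZ; apply: hco; apply: homogX; exact: mdeg_alpha.
exists C; split.
  exists (\matrix_(i, h) (b i)@_(alpha h)); apply/row_matrixP => i.
  rewrite row_mul row1 -(_ : co (b i) = delta_mx 0 i).
    by rewrite cE //; congr (_ *m _); apply/rowP => h; rewrite !mxE.
  apply: (uq (b i)) => //; first exact: hco.
  rewrite (bigD1 i) //= mxE !eqxx scale1r big1 ?addr0 ?subrr // => j ne.
  by rewrite mxE (negbTE ne) andbF scale0r.
move=> f hf; have e0 c : \sum_h f@_(alpha h) * C h c = co f 0 c.
  by rewrite cE // [RHS]mxE; apply: eq_bigr => h _; congr (_ * _); rewrite mxE.
split=> [h|[_ h]].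
  split=> // c; rewrite e0 (uq f (co f) 0) ?mxE //; first exact: hco.
  by rewrite big1 ?subr0 // => i _; rewrite mxE scale0r.
have := hco f hf; rewrite (_ : co f = 0); last by apply/rowP => c; rewrite -e0 h mxE.
by rewrite big1 ?subr0 // => i _; rewrite mxE scale0r.
Qed.

Hypothesis hY : has_hilbert_polynomial Y pt.

(** The generic set [N1] is taken in one large degree, where its size is the value of the
    polynomial. Its growth is then forced to be minimal, so it persists upwards, and [descend] finds
    the set in degree [r] from which it grows. *)
Theorem field_generic_initial : exists (g : 'M[rat]_n.+1) (N : pred 'X_{1..n.+1}) T,
  [/\ g \in unitmx, borel r N, cnt r 0 N = gval r a, cnt r.+1 0 (grow N) = gval r.+1 a
    & forall t, (T <= t)%N ->
      free_mod (t + r) (fun f => secs Y (lsub (map_mx io g) f)) (iter t grow N)].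
Proof.
have [T0 hT] := hY.
have hC t : (T0 <= t + r)%N -> exists C : 'M[K]_(nmon n (t + r), gval (t + r) a),
    (exists B : 'M[K]_(_, nmon n (t + r)), B *m C = 1%:M) /\
    forall f, f \is (t + r)%N.-homog -> secs Y f <-> kerf C f.
  move=> /hT[e [b [he hb hu]]]; have ee : e = gval (t + r) a.
    by apply/eqP; rewrite -(eqr_nat rat) he hpt ?leq_addl.
  by case: _ / ee b hb hu {he} => b hb hu; exact: (sections_matrix hb hu).
have [C1 [[B1 BC1] IC1]] := hC T0 (leq_addr _ _).
have [J0 hJ0] := full_rank_minor BC1.
have [g [J [N1 [ug bN1 JE hJ]]]] := generic_borel io (ex_intro _ J0 hJ0).
pose I f := secs Y (lsub (map_mx io g) f).
have sI : subm I by apply: subm_lsub; exact: subm_secs.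
have uG t : submx_ t (map_mx io g) \in unitmx by apply: submx_unit; rewrite map_unitmx.
have hC' t : (T0 <= t + r)%N -> exists C : 'M[K]_(nmon n (t + r), gval (t + r) a),
    (exists B : 'M[K]_(_, nmon n (t + r)), B *m C = 1%:M) /\
    forall f, f \is (t + r)%N.-homog -> I f <-> kerf C f.
  move=> /hC[C [[B BC] IC]]; exists ((submx_ (t + r) (map_mx io g))^T *m C); split.
    exists (B *m invmx (submx_ (t + r) (map_mx io g))^T).
    by rewrite mulmxA mulmxKV ?unitmx_tr.
  by move=> f hf; rewrite kerf_lsub // -IC //; exact: lsub_homog.
have fr1 : free_mod (T0 + r) I N1.
  have uJ : pl ((submx_ (T0 + r) (map_mx io g))^T *m C1) (val J) \is a GRing.unit by rewrite unitfE.
  have [h1 h2] := kerf_free_mod JE uJ.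
  have e f : f \is (T0 + r)%N.-homog -> I f <-> kerf ((submx_ (T0 + r) (map_mx io g))^T *m C1) f.
    by move=> hf; rewrite kerf_lsub // -IC1 //; exact: lsub_homog.
  split=> [f hf|h hh Ih]; last by apply: h2 => //; apply/e => //; exact: supported_homog hh.
  have [h hh kh] := h1 f hf; exists h => //; apply/e => //.
  by apply: rpredB => //; exact: supported_homog hh.
have [f hf] := free_mod_marked sI fr1.
have span s g0 : g0 \is (s + (T0 + r))%N.-homog ->
    exists2 h, supported (s + (T0 + r)) (iter s grow N1) h & I (g0 - h).
  apply: (marked_span (fun al da Na => (hf al da Na).2) sI) => ga al _ da Na.
  rewrite /I rmorphM /=; have [h _] := hf al da Na.
  rewrite [lsub _ 'X_[ga]](homog_pv (lsub_homog _ (homogX K (erefl (mdeg ga))))) mulr_suml.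
  apply: subm_sum => [|x _]; first exact: subm_secs.
  rewrite -scalerAl; case: (subm_secs cY) => _ _; apply; exact: secs_mulX.
have cnt1 : cnt (T0 + r) 0 N1 = gval (T0 + r) a by exact: (cnt_midx JE).
have za : (r <= T0 + r)%N by exact: leq_addl.
(* At most this by Macaulay's bound; at least this because [grow N1] spans a quotient of the
   dimension given by the polynomial. *)
have cnt2 : cnt (T0 + r).+1 0 (grow N1) = gval (T0 + r).+1 a.
  apply/eqP; rewrite eqn_leq macaulay ?cnt1 //=.
  have [|C [fC IC]] := hC' T0.+1; first by rewrite addSn; apply: leq_trans (leqnSn _); apply: leq_addr.
  by apply: (spanning_card (t := T0.+1 + r) IC fC) => f0 hf0; exact: (span 1%N).
have frs s : free_mod (s + (T0 + r)) I (iter s grow N1).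
  have [|C [fC IC]] := hC' (s + T0)%N; first by rewrite -addnA addnCA leq_addr.
  rewrite -addnA in C fC IC; apply: (spanning_free IC fC) => [f0 hf0|]; first exact: span.
  by rewrite (@persistence n (T0 + r) N1 a s bN1 sa za cnt1 cnt2).
have [N bN [cN eN]] := descend bN1 sa (leqnn _) cnt1 cnt2.
have eNs s : forall m, mdeg m = (s + (T0 + r))%N -> iter s grow N1 m = iter (s + T0) grow N m.
  by move=> m dm; rewrite (eq_grow_iter eN) // iterD.
have cle s : (cnt (s + r) 0 (iter s grow N) <= gval (s + r) a)%N.
  elim: s => [|s IH]; first by rewrite cN.
  by apply: macaulay IH => //; [exact: borel_iter|exact: leq_addl].
(* Equality at the top degree is carried down one degree at a time by [macaulay_eq]; it is needed in
   degree [r + 1]. *)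
have ceq s : (s <= T0.+1)%N -> cnt (s + r) 0 (iter s grow N) = gval (s + r) a.
  move=> /subnKC; move: (T0.+1 - s)%N => x; elim: x s => [|x IH] s.
    rewrite addn0 => ->; rewrite addSn -cnt2; apply: eq_cnt => m dm _.
    by rewrite -[T0.+1]add1n -eNs // dm.
  rewrite addnS -addSn => /IH h; apply: macaulay_eq h => //; first exact: borel_iter.
  exact: leq_addl.
exists g, N, T0; split=> //; first exact: (ceq 1%N).
move=> t ht; have [h1 h2] := frs (t - T0)%N; rewrite addnA subnK // in h1 h2.
have e m : mdeg m = (t + r)%N -> iter (t - T0) grow N1 m = iter t grow N m.
  by move=> dm; rewrite eNs ?subnK // dm addnA subnK.
split=> [f0 hf0|h hh Ih].
  have [h hh Ih] := h1 f0 hf0; exists h => //; apply: supportedW hh => m dm; by rewrite e.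
by apply: h2 => //; apply: supportedW hh => m dm; rewrite e.
Qed.

End FieldHilbert.

(** * Localization *)

Section MaximalIdeals.
Context (A : comNzRingType).
Implicit Types (I m : A -> Prop).

Definition maximal_ideal m :=
  [/\ is_ideal m, ~ m 1 & forall x, ~ m x -> exists y, m (x * y - 1)].

Lemma idealN I x : is_ideal I -> I x -> I (- x).
Proof. by move=> [_ _ hM] h; rewrite -mulN1r; exact: hM. Qed.

Lemma idealB I x y : is_ideal I -> I x -> I y -> I (x - y).
Proof. by move=> hI hx hy; case: (hI) => _ hD _; apply: hD => //; exact: idealN. Qed.

Lemma ideal_sum I (T : Type) (s : seq T) (P : pred T) (F : T -> A) : is_ideal I ->
  (forall i, P i -> I (F i)) -> I (\sum_(i <- s | P i) F i).
Proof. by move=> [h0 hD _] h; apply: big_ind. Qed.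

Lemma maximal_idealM m u v : maximal_ideal m -> ~ m u -> ~ m v -> ~ m (u * v).
Proof.
move=> [[_ mD mM] m1 hm] /hm[x hx] nv huv; apply: nv.
have -> : v = x * (u * v) + (- v) * (u * x - 1) by ring.
by apply: mD; exact: mM.
Qed.

Lemma maximal_ideal_prod m (T : Type) (s : seq T) (P : pred T) (F : T -> A) : maximal_ideal m ->
  (forall i, P i -> ~ m (F i)) -> ~ m (\prod_(i <- s | P i) F i).
Proof.
move=> hm; case: (hm) => _ m1 _ h; apply: (big_ind (fun x => ~ m x)) => //.
by move=> x y; exact: maximal_idealM.
Qed.

Lemma exists_maximal_ideal I : is_ideal I -> ~ I 1 ->
  exists2 m, maximal_ideal m & forall x, I x -> m x.
Proof.
move=> hI nI1.
pose T := {J : A -> Prop | is_ideal J /\ ~ J 1 /\ forall x, I x -> J x}.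
pose R (s t : T) := `[< forall x, sval s x -> sval t x >].
have RP s t : reflect (forall x, sval s x -> sval t x) (R s t) by exact: asboolP.
have [|r s t /RP rs /RP st|s t /RP st /RP ts|B hB|[m [im [m1 Im]]] hmax] := @classical_sets.Zorn T R.
- by move=> t; apply/RP.
- by apply/RP => x /rs /st.
- case: s t st ts => [s Ps] [t Pt] /= st ts; apply: eq_exist.
  by apply: funext => x; apply: propext; split; [exact: st|exact: ts].
- have [[s0 Bs0]|nB] := pselect (exists s, B s); last first.
    by exists (exist _ I (conj hI (conj nI1 (fun _ h => h)))) => s Bs; case: nB; exists s.
  pose U x := exists2 s, B s & sval s x.
  suff hU : is_ideal U /\ ~ U 1 /\ forall x, I x -> U x.
    by exists (exist _ U hU) => s Bs; apply/RP => x sx; exists s.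
  split; last first.
    split; first by move=> [s _]; case: (svalP s) => _ [].
    by move=> x Ix; exists s0 => //; case: (svalP s0) => _ [_]; exact.
  split.
  + by exists s0 => //; case: (svalP s0) => -[].
  + move=> x y [s Bs sx] [t Bt ty]; have [/RP st|/RP ts] := hB s t Bs Bt.
      by exists t => //; case: (svalP t) => -[_ hD _] _; apply: hD => //; exact: st.
    by exists s => //; case: (svalP s) => -[_ hD _] _; apply: hD => //; exact: ts.
  + by move=> a x [s Bs sx]; exists s => //; case: (svalP s) => -[_ _ hM] _; exact: hM.
exists m => //; split=> // x nx; apply: contrapT => no.
case: (im) => m0 mD mM.
pose J z := exists2 a, m (z - x * a) & True.
have hJ : is_ideal J /\ ~ J 1 /\ forall x, I x -> J x.
  split; last first.
    split; first by move=> [a ha _]; apply: no; exists a; rewrite -opprB; exact: idealN.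
    by move=> z Iz; exists 0 => //; rewrite mulr0 subr0; apply (Im z Iz).
  split; first by exists 0; rewrite // mulr0 subr0.
    move=> y z [a ha _] [b hb _]; exists (a + b) => //.
    by rewrite mulrDr opprD addrACA; exact: mD.
  by move=> c z [a ha _]; exists (c * a) => //; rewrite mulrCA -mulrBr; exact: mM.
have /hmax eJ : R (exist _ m (conj im (conj m1 Im))) (exist _ J hJ).
  by apply/RP => z /= mz; exists 0 => //; rewrite mulr0 subr0.
apply: nx; have /(congr1 (fun t : T => sval t x)) /= <- := eJ.
by exists 1 => //; rewrite mulr1 subrr.
Qed.

Lemma ideal_local_global I : is_ideal I ->
  (forall m, maximal_ideal m -> exists2 u, ~ m u & I u) -> I 1.
Proof.
move=> hI h; apply: contrapT => /(exists_maximal_ideal hI)[m hm Im].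
by have [u nu /Im] := h m hm.
Qed.

Lemma ideal_gen_ideal (S : A -> Prop) : is_ideal (ideal_gen S).
Proof.
split=> [I [] //|x y hx hy I hI hS|c x hx I hI hS].
  by case: (hI) => _ hD _; apply: hD; [exact: hx|exact: hy].
by case: (hI) => _ _ hM; apply: hM; exact: hx.
Qed.

(** The elements killed by something outside [m] form an ideal. Finitely many generators have a
    common annihilator outside [m], the product of their own. *)
Lemma noetherian_torsion m : noetherian A -> maximal_ideal m ->
  exists2 s, ~ m s & forall x u, ~ m u -> u * x = 0 -> s * x = 0.
Proof.
move=> nA hm; pose T x := exists2 u, ~ m u & u * x = 0.
have hT : is_ideal T.
  split; first by exists 1; rewrite ?mulr0 //; case: hm.
    move=> x y [u hu ux] [v hv vy]; exists (u * v); first exact: maximal_idealM.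
    by rewrite mulrDr mulrAC ux mul0r add0r -mulrA vy mulr0.
  by move=> c x [u hu ux]; exists u => //; rewrite mulrCA ux mulr0.
have [s hs] := nA _ hT.
have sT x : x \in s -> T x by move=> xs; apply/hs => I _; exact.
have hu x : exists u, ~ m u /\ (x \in s -> u * x = 0).
  have [/sT[u hu ux]|_] := boolP (x \in s); first by exists u.
  by exists 1; split=> //; case: hm.
have [u hu'] := choice hu; exists (\prod_(x <- s) u x).
  by apply: maximal_ideal_prod => // x _; case: (hu' x).
move=> x v hv vx; have /hs hx : T x by exists v.
apply: (hx (fun x => (\prod_(x <- s) u x) * x = 0)); first split.
- by rewrite mulr0.
- by move=> y z hy hz; rewrite mulrDr hy hz addr0.
- by move=> a y hy; rewrite mulrCA hy mulr0.
move=> y ys; rewrite (big_rem y) //= mulrAC; have [_ ->] := hu' y => //.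
by rewrite mul0r.
Qed.

End MaximalIdeals.

Section QuotientModule.
Context (A : comNzRingType) (V : lmodType A) (Q : V -> Prop) (sQ : subm Q).
Local Open Scope quotient_scope.

Definition modeq (x y : V) := `[< Q (x - y) >].

Lemma modeq_refl : reflexive modeq.
Proof. by move=> x; apply/asboolP; rewrite subrr; case: sQ. Qed.

Lemma modeq_sym : ssrbool.symmetric modeq.
Proof.
by move=> x y; apply/asboolP/asboolP => h; rewrite -opprB; exact: submN.
Qed.

Lemma modeq_trans : transitive modeq.
Proof.
move=> y x z /asboolP h1 /asboolP h2; apply/asboolP.
by case: sQ => _ hD _; have := hD _ _ h1 h2; rewrite addrA subrK.
Qed.

Definition modeq_equiv := EquivRel modeq modeq_refl modeq_sym modeq_trans.
Definition quomod := {eq_quot modeq_equiv}.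
HB.instance Definition _ := Choice.on quomod.

Definition qpi (x : V) : quomod := \pi_({eq_quot modeq_equiv}) x.
Definition qrep (x : quomod) : V := @repr _ {eq_quot modeq_equiv} x.

Lemma qpi_eq x y : qpi x = qpi y <-> Q (x - y).
Proof.
split=> [h|h]; last by apply/eqmodP => /=; exact/asboolP.
by have /eqmodP/= /asboolP := h.
Qed.

Lemma qrepK x : qpi (qrep x) = x.
Proof. exact: reprK. Qed.

Lemma qrep_pi x : Q (qrep (qpi x) - x).
Proof. by apply/qpi_eq; rewrite qrepK. Qed.

Definition qadd (x y : quomod) := qpi (qrep x + qrep y).
Definition qopp (x : quomod) := qpi (- qrep x).
Definition qscale (a : A) (x : quomod) := qpi (a *: qrep x).

Lemma qaddE x y : qadd (qpi x) (qpi y) = qpi (x + y).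
Proof.
by apply/qpi_eq; case: sQ => _ hD _; rewrite opprD addrACA; apply: hD; exact: qrep_pi.
Qed.

Lemma qoppE x : qopp (qpi x) = qpi (- x).
Proof. by apply/qpi_eq; rewrite -opprD; apply: submN => //; exact: qrep_pi. Qed.

Lemma qscaleE a x : qscale a (qpi x) = qpi (a *: x).
Proof. by apply/qpi_eq; case: sQ => _ _ hZ; rewrite -scalerBr; apply: hZ; exact: qrep_pi. Qed.

Lemma qind (P : quomod -> Prop) : (forall x, P (qpi x)) -> forall x, P x.
Proof. by move=> h x; rewrite -(qrepK x). Qed.

Lemma qaddA : associative qadd.
Proof. by do 3!elim/qind=> ?; rewrite !qaddE addrA. Qed.
Lemma qaddC : commutative qadd.
Proof. by do 2!elim/qind=> ?; rewrite !qaddE addrC. Qed.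
Lemma qadd0 : left_id (qpi 0) qadd.
Proof. by elim/qind=> ?; rewrite !qaddE add0r. Qed.
Lemma qaddN : left_inverse (qpi 0) qopp qadd.
Proof. by elim/qind=> ?; rewrite qoppE qaddE addNr. Qed.
HB.instance Definition _ := GRing.isZmodule.Build quomod qaddA qaddC qadd0 qaddN.

Lemma qscaleA a b x : qscale a (qscale b x) = qscale (a * b) x.
Proof. by elim/qind: x => x; rewrite !qscaleE scalerA. Qed.
Lemma qscale1 : left_id 1 qscale.
Proof. by elim/qind=> x; rewrite qscaleE scale1r. Qed.
Lemma qscaleDr : right_distributive qscale +%R.
Proof.
move=> a; do 2!elim/qind=> ?.
by rewrite -[qpi _ + _]/(qadd _ _) -[qscale _ _ + _]/(qadd _ _) qaddE !qscaleE qaddE scalerDr.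
Qed.
Lemma qscaleDl v : {morph qscale^~ v : a b / a + b}.
Proof.
move=> a b; elim/qind: v => v.
by rewrite -[RHS]/(qadd _ _) !(qaddE, qscaleE) scalerDl.
Qed.
HB.instance Definition _ := GRing.Zmodule_isLmodule.Build A quomod
  qscaleA qscale1 qscaleDr qscaleDl.

Lemma qpi_is_linear : linear qpi.
Proof. by move=> a x y; rewrite -[RHS]/(qadd (qscale a _) _) qscaleE qaddE. Qed.
HB.instance Definition _ := GRing.isLinear.Build A V quomod _ qpi qpi_is_linear.

Lemma qpi_eq0 x : qpi x = 0 <-> Q x.
Proof. by rewrite -[0]/(qpi 0) qpi_eq subr0. Qed.

End QuotientModule.

Section ResidueField.
Context (A : comNzRingType) (m : A -> Prop) (hm : maximal_ideal m).

Lemma subm_ideal (I : A -> Prop) : is_ideal I -> subm (V := A^o) I.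
Proof. by move=> [h0 hD hM]; split=> // a x; exact: hM. Qed.

Let im : subm (V := A^o) m. Proof. by apply: subm_ideal; case: hm. Qed.

Definition resf := quomod im.
HB.instance Definition _ := GRing.Zmodule.on resf.
Definition respi : A -> resf := qpi im.
Definition resmul (x y : resf) : resf := respi (qrep x * qrep y).

Lemma respi_eq x y : respi x = respi y <-> m (x - y).
Proof. exact: qpi_eq. Qed.

Lemma resmulE x y : resmul (respi x) (respi y) = respi (x * y).
Proof.
apply/respi_eq; case: hm => -[_ hD hM] _ _.
set a := qrep _; set b := qrep _.
have ha : m (a - x) by exact: qrep_pi.
have hb : m (b - y) by exact: qrep_pi.
have -> : a * b - x * y = b * (a - x) + x * (b - y) by ring.
by apply: hD; exact: hM.
Qed.

Lemma resind (P : resf -> Prop) : (forall x, P (respi x)) -> forall x, P x.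
Proof. by move=> h x; have := h (qrep x); rewrite /respi qrepK. Qed.

Lemma respiD x y : respi (x + y) = respi x + respi y.
Proof. by rewrite /respi raddfD. Qed.

Lemma resmulA : associative resmul.
Proof. by do 3!elim/resind=> ?; rewrite !resmulE mulrA. Qed.
Lemma resmulC : commutative resmul.
Proof. by do 2!elim/resind=> ?; rewrite !resmulE mulrC. Qed.
Lemma resmul1 : left_id (respi 1) resmul.
Proof. by elim/resind=> ?; rewrite resmulE mul1r. Qed.
Lemma resmulD : left_distributive resmul +%R.
Proof.
have E u v : respi u + respi v = respi (u + v) by rewrite respiD.
by move=> x y z; elim/resind: x => x; elim/resind: y => y; elim/resind: z => z;
  rewrite E !resmulE E mulrDl.
Qed.
Lemma res1_neq0 : respi 1 != 0.
Proof. by apply/eqP => /(qpi_eq0 im); case: hm. Qed.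
HB.instance Definition _ := GRing.Zmodule_isComNzRing.Build resf
  resmulA resmulC resmul1 resmulD res1_neq0.

Definition resinv (x : resf) : resf :=
  if pselect (exists y, resmul y x = respi 1) is left h then sval (cid h) else 0.

Lemma resmulV x : x != 0 -> resmul (resinv x) x = respi 1.
Proof.
elim/resind: x => x /eqP nx; rewrite /resinv; case: pselect => [h|]; first exact: (svalP (cid h)).
case; case: hm => _ _ /(_ x)[|y hy]; first by move=> h; apply: nx; exact/(qpi_eq0 im).
by exists (respi y); rewrite resmulE; apply/respi_eq; rewrite mulrC.
Qed.
Lemma resinv0 : resinv 0 = 0.
Proof.
rewrite /resinv; case: pselect => // -[y h]; exfalso; move: res1_neq0 => /eqP; apply; rewrite -h.
by elim/resind: y {h} => y; rewrite -[X in resmul _ X]/(respi 0) resmulE mulr0.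
Qed.
HB.instance Definition _ := GRing.ComNzRing_isField.Build resf resmulV resinv0.

Lemma respi_monoid : monoid_morphism respi.
Proof. by split=> // x y; rewrite -[RHS]/(resmul _ _) resmulE. Qed.
HB.instance Definition _ := GRing.isZmodMorphism.Build A resf respi
  (fun x y => raddfB (qpi im) x y).
HB.instance Definition _ := GRing.isMonoidMorphism.Build A resf respi respi_monoid.

Lemma respi_eq0 x : respi x = 0 <-> m x.
Proof. exact: qpi_eq0. Qed.

Lemma respi_surj (z : resf) : exists x, respi x = z.
Proof. by elim/resind: z => x; exists x. Qed.

Lemma respi_residue_field : residue_field (respi : {rmorphism A -> resf}).
Proof.
move=> z; have [x <-] := respi_surj z; exists x, 1.
by rewrite rmorph1 oner_neq0 divr1.
Qed.

End ResidueField.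

Section Localization.
Context (A : comNzRingType) (m : A -> Prop) (hm : maximal_ideal m).
Local Open Scope quotient_scope.

Let m1 : ~ m 1. Proof. by case: hm. Qed.

(* A pair stands for the fraction [x.1 / x.2], or [x.1 / 1] if [x.2] is in [m]. *)
Definition den (x : A * A) : A := if `[< m x.2 >] then 1 else x.2.

Lemma denP x : ~ m (den x).
Proof. by rewrite /den; case: asboolP. Qed.

Lemma denE a s : ~ m s -> den (a, s) = s.
Proof. by rewrite /den /=; case: asboolP. Qed.

Definition loceq (x y : A * A) :=
  `[< exists2 u, ~ m u & u * (x.1 * den y - y.1 * den x) = 0 >].

Lemma loceq_refl : reflexive loceq.
Proof. by move=> x; apply/asboolP; exists 1; rewrite // subrr mulr0. Qed.

Lemma loceq_sym : ssrbool.symmetric loceq.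
Proof.
by move=> x y; apply/asboolP/asboolP => -[u hu h]; exists u => //; rewrite -opprB mulrN h oppr0.
Qed.

Lemma loceq_trans : transitive loceq.
Proof.
move=> y x z /asboolP[u hu h1] /asboolP[v hv h2]; apply/asboolP.
exists (u * v * den y); first by apply: maximal_idealM => //; [exact: maximal_idealM|exact: denP].
have -> : u * v * den y * (x.1 * den z - z.1 * den x) =
  v * den z * (u * (x.1 * den y - y.1 * den x)) + u * den x * (v * (y.1 * den z - z.1 * den y)) by ring.
by rewrite h1 h2 !mulr0 addr0.
Qed.

Definition loceq_equiv := EquivRel loceq loceq_refl loceq_sym loceq_trans.
Definition loc := {eq_quot loceq_equiv}.
HB.instance Definition _ := Choice.on loc.

Definition lfrac (a s : A) : loc := \pi_({eq_quot loceq_equiv}) (a, s).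

Lemma lfrac_eq a s b t : ~ m s -> ~ m t ->
  lfrac a s = lfrac b t <-> exists2 u, ~ m u & u * (a * t - b * s) = 0.
Proof.
move=> hs ht; split=> [h|h]; last by apply/eqmodP/asboolP; rewrite /= !denE.
by have /eqmodP/asboolP := h; rewrite /= !denE.
Qed.

Lemma lfrac_ind (P : loc -> Prop) : (forall a s, ~ m s -> P (lfrac a s)) -> forall x, P x.
Proof.
move=> h x; rewrite -[x]reprK; case: (repr x) => a s.
have -> : \pi_({eq_quot loceq_equiv}) (a, s) = lfrac a (den (a, s)).
  apply/eqmodP/asboolP; exists 1 => //=; rewrite (denE a (@denP (a, s))) subrr mulr0 //.
exact/h/denP.
Qed.

Definition lift2 (F G : A -> A -> A -> A -> A) (x y : loc) : loc :=
  lfrac (F (repr x).1 (den (repr x)) (repr y).1 (den (repr y)))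
        (G (repr x).1 (den (repr x)) (repr y).1 (den (repr y))).

Lemma lrepr a s : ~ m s -> exists2 u, ~ m u &
  u * ((repr (lfrac a s)).1 * s - a * den (repr (lfrac a s))) = 0.
Proof.
move=> hs; have : \pi_({eq_quot loceq_equiv}) (repr (lfrac a s)) = lfrac a s by rewrite reprK.
by move/eqmodP/asboolP; rewrite /= denE.
Qed.

Definition ladd := lift2 (fun a s b t => a * t + b * s) (fun a s b t => s * t).
Definition lmul := lift2 (fun a s b t => a * b) (fun a s b t => s * t).
Definition lopp (x : loc) : loc := lfrac (- (repr x).1) (den (repr x)).

Lemma laddE a s b t : ~ m s -> ~ m t -> ladd (lfrac a s) (lfrac b t) = lfrac (a * t + b * s) (s * t).
Proof.
move=> hs ht; have [u hu e1] := lrepr a hs; have [v hv e2] := lrepr b ht.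
rewrite /ladd /lift2; set x := repr _ in e1 *; set y := repr _ in e2 *.
apply/lfrac_eq; [by apply: maximal_idealM => //; exact: denP|exact: maximal_idealM|].
exists (u * v); first exact: maximal_idealM.
rewrite [LHS](_ : _ = v * den y * t * (u * (x.1 * s - a * den x)) + u * den x * s * (v * (y.1 * t - b * den y))); last by ring.
by rewrite e1 e2 !mulr0 addr0.
Qed.

Lemma lmulE a s b t : ~ m s -> ~ m t -> lmul (lfrac a s) (lfrac b t) = lfrac (a * b) (s * t).
Proof.
move=> hs ht; have [u hu e1] := lrepr a hs; have [v hv e2] := lrepr b ht.
rewrite /lmul /lift2; set x := repr _ in e1 *; set y := repr _ in e2 *.
apply/lfrac_eq; [by apply: maximal_idealM => //; exact: denP|exact: maximal_idealM|].
exists (u * v); first exact: maximal_idealM.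
rewrite [LHS](_ : _ = v * y.1 * t * (u * (x.1 * s - a * den x)) + u * a * den x * (v * (y.1 * t - b * den y))); last by ring.
by rewrite e1 e2 !mulr0 addr0.
Qed.

Lemma loppE a s : ~ m s -> lopp (lfrac a s) = lfrac (- a) s.
Proof.
move=> hs; have [u hu e1] := lrepr a hs.
apply/lfrac_eq => //; first exact: denP.
by exists u => //; rewrite !mulNr -opprD mulrN e1 oppr0.
Qed.

Ltac loc_nm := by repeat (apply: maximal_idealM => //).
Ltac loc_tac := repeat (elim/lfrac_ind => ? ? ?);
  rewrite ?(laddE, lmulE, loppE); try loc_nm;
  apply/lfrac_eq; try loc_nm; exists 1; [by []|ring].

Lemma laddA : associative ladd. Proof. loc_tac. Qed.
Lemma laddC : commutative ladd. Proof. loc_tac. Qed.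
Lemma ladd0 : left_id (lfrac 0 1) ladd. Proof. loc_tac. Qed.
Lemma laddN : left_inverse (lfrac 0 1) lopp ladd. Proof. loc_tac. Qed.
HB.instance Definition _ := GRing.isZmodule.Build loc laddA laddC ladd0 laddN.

Lemma lmulA : associative lmul. Proof. loc_tac. Qed.
Lemma lmulC : commutative lmul. Proof. loc_tac. Qed.
Lemma lmul1 : left_id (lfrac 1 1) lmul. Proof. loc_tac. Qed.
Lemma lmulD : left_distributive lmul +%R.
Proof.
have h : left_distributive lmul ladd by loc_tac.
exact: h.
Qed.
Lemma l1_neq0 : lfrac 1 1 != 0.
Proof.
apply/eqP => /(lfrac_eq 1 0 m1 m1)[u hu]; rewrite mulr1 mul0r subr0 mulr1 => u0.
by apply: hu; rewrite u0; case: hm => -[].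
Qed.
HB.instance Definition _ := GRing.Zmodule_isComNzRing.Build loc lmulA lmulC lmul1 lmulD l1_neq0.

Definition locpi (a : A) : loc := lfrac a 1.

Lemma locpi_zmod : zmod_morphism locpi.
Proof.
move=> x y; rewrite -[RHS]/(ladd _ (lopp _)) loppE // laddE // mulr1.
by rewrite /locpi !mulr1.
Qed.
Lemma locpi_monoid : monoid_morphism locpi.
Proof. by split=> // x y; rewrite -[RHS]/(lmul _ _) lmulE // mulr1. Qed.
HB.instance Definition _ := GRing.isZmodMorphism.Build A loc locpi locpi_zmod.
HB.instance Definition _ := GRing.isMonoidMorphism.Build A loc locpi locpi_monoid.

Lemma locpi_eq0 a : locpi a = 0 <-> exists2 u, ~ m u & u * a = 0.
Proof.
rewrite -[0]/(lfrac 0 1) lfrac_eq //; split=> -[u hu h]; exists u => //.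
  by move: h; rewrite mulr1 mul0r subr0.
by rewrite mulr1 mul0r subr0.
Qed.

Definition lunit : pred loc := fun x => `[< exists y, lmul y x = lfrac 1 1 >].
Definition linv (x : loc) : loc :=
  if pselect (exists y, lmul y x = lfrac 1 1) is left h then sval (cid h) else x.

Lemma lmulV : {in lunit, left_inverse 1 linv *%R}.
Proof.
move=> x /asboolP h; rewrite /linv; case: pselect => // h'.
exact: (svalP (cid h')).
Qed.
Lemma lunitPl x y : y * x = 1 -> lunit x.
Proof. by move=> h; apply/asboolP; exists y. Qed.
Lemma linv_out : {in [predC lunit], linv =1 id}.
Proof. by move=> x /asboolP h; rewrite /linv; case: pselect. Qed.
HB.instance Definition _ := GRing.ComNzRing_hasMulInverse.Build loc lmulV lunitPl linv_out.

Lemma locpi_unit a : (locpi a \is a GRing.unit) <-> ~ m a.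
Proof.
split=> [/unitrP[y [h _]] ma|na].
  move: h; elim/lfrac_ind: y => b s hs; rewrite -[_ * _]/(lmul _ _) lmulE // mulr1.
  move/(lfrac_eq _ _ hs m1) => [u hu]; rewrite mulr1 mul1r => h; case: hm => -[m0 mD mM] _ _.
  have : m (u * (b * a - s)) by rewrite h.
  rewrite mulrBr => h2; apply: (maximal_idealM hm hu hs).
  have -> : u * s = u * b * a - (u * (b * a) - u * s) by ring.
  by apply: idealB => //; exact: mM.
apply/unitrP; exists (lfrac 1 a); suff h : lfrac 1 a * locpi a = 1 by split; rewrite // mulrC.
rewrite -[_ * _]/(lmul _ _) lmulE //; apply/lfrac_eq => //; first by rewrite mulr1.
by exists 1 => //; ring.
Qed.

Lemma loc_surj (x : loc) : exists a s, ~ m s /\ locpi s * x = locpi a.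
Proof.
elim/lfrac_ind: x => a s hs; exists a, s; split=> //.
rewrite -[_ * _]/(lmul _ _) lmulE // mul1r; apply/lfrac_eq => //; exists 1 => //; ring.
Qed.

End Localization.

(** * From the Hilbert functor to the equations *)

Lemma mcoeff_pihomog n (A : nzRingType) t (f : {mpoly A[n]}) m :
  (pihomog [measure of mdeg] t f)@_m = if mdeg m == t then f@_m else 0.
Proof.
have [e|ne] := eqVneq (mdeg m) t; last by rewrite (dhomog_nemf_coeff (pihomogP _ _ _)).
pose k := maxn (msize f) t.+1; have ht : (t < k)%N by exact: leq_maxr.
rewrite [in RHS](pihomog_partitionE (mf := [measure of mdeg]) (leq_maxl (msize f) t.+1)).
rewrite -/k [RHS](raddf_sum (mcoeff m)) (bigD1 (Ordinal ht)) //= big1 ?addr0 // => s ne.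
have ms : mdeg m != s.
  by rewrite e; apply: contra ne => /eqP es; apply/eqP/val_inj; rewrite /= es.
exact: (dhomog_nemf_coeff (pihomogP _ _ _) ms).
Qed.

Section Homogenization.
Context (n : nat) (A : comNzRingType).
Local Notation S := {mpoly A[n.+1]}.
Implicit Types (f : S) (i : 'I_n.+1).

(* The form of degree [T] which dehomogenizes to [f] in the chart [i]; the terms
   of degree larger than [T] are lost. *)
Definition hmg i T f : S :=
  \sum_(t < T.+1) 'X_i ^+ (T - t) * pihomog [measure of mdeg] t f.

Lemma hmg_is_linear i T : linear (hmg i T).
Proof.
move=> c f g; rewrite /hmg scaler_sumr -big_split /=; apply: eq_bigr => t _.
by rewrite linearP mulrDr -scalerAr.
Qed.

HB.instance Definition _ i T := GRing.isLinear.Build A S S _ (hmg i T) (hmg_is_linear i T).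

Lemma hmg_homog i T f : hmg i T f \is T.-homog.
Proof.
apply: rpred_sum => t _; have tT : (t <= T)%N by rewrite -ltnS.
have h : 'X_i ^+ (T - t) * pihomog [measure of mdeg] t f \is (T - t + t)%N.-homog.
  by rewrite mpolyXn; apply: homogXM; [rewrite mdegMn mdeg1 mul1n|exact: pihomogP].
by rewrite subnK in h.
Qed.

Lemma hmg_of_homog i T t f : f \is t.-homog -> (t <= T)%N -> hmg i T f = 'X_i ^+ (T - t) * f.
Proof.
move=> hf tT; have h : (t < T.+1)%N by [].
rewrite /hmg (bigD1 (Ordinal h)) //= pihomog_dE // big1 ?addr0 // => s ne.
rewrite (pihomog_ne0 _ hf) ?mulr0 //; apply: contra ne => /eqP e.
by apply/eqP/val_inj; rewrite /= e.
Qed.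

Lemma hmg_mod (I : S -> Prop) i T f : is_ideal I -> I ('X_i - 1) -> (msize f <= T.+1)%N ->
  I (hmg i T f - f).
Proof.
move=> hI h1 hs; rewrite [f in _ - f](pihomog_partitionE (mf := [measure of mdeg]) (k := T.+1)) //.
rewrite /hmg -sumrB; apply: ideal_sum => // t _.
rewrite -[X in _ - X]mul1r -mulrBl mulrC; case: (hI) => _ _; apply.
exact: ideal_expX1.
Qed.

Lemma hmg_mem (I : S -> Prop) i T f : is_ideal I -> I ('X_i - 1) -> (msize f <= T.+1)%N ->
  I (hmg i T f) <-> I f.
Proof.
move=> hI h1 hs; have h := hmg_mod hI h1 hs; case: (hI) => _ hD _; split=> h'.
  by rewrite -[f](subKr (hmg i T f)); apply: idealB.
by rewrite -[hmg _ _ _](subrK f); apply: hD.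
Qed.

Lemma hmg_mulX i T (u : 'X_{1..n.+1}) f :
  hmg i (mdeg u + T) ('X_[u] * f) = 'X_[u] * hmg i T f.
Proof.
rewrite /hmg mulr_sumr -(big_mkord predT (fun t => 'X_i ^+ (mdeg u + T - t) *
  pihomog [measure of mdeg] t ('X_[u] * f))) /=.
rewrite -addnS big_nat (big_cat_nat _ (n := mdeg u)) ?leq_addr //= big1_seq ?add0r; last first.
  move=> t; rewrite mem_index_iota => /andP[_ /andP[_ h]].
  by rewrite pihomogMX leqNgt h mulr0.
rewrite -{1}[mdeg u]add0n big_addn addKn big_mkord; apply: eq_big => [t|t _].
  by rewrite addnC ltn_add2l ltn_ord.
by rewrite pihomogMX leq_addl addnK [(t + mdeg u)%N]addnC subnDl mulrCA.
Qed.

End Homogenization.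

Lemma pihomog_map n (A B : comNzRingType) (phi : {rmorphism A -> B}) t (f : {mpoly A[n]}) :
  map_mpoly phi (pihomog [measure of mdeg] t f) = pihomog [measure of mdeg] t (map_mpoly phi f).
Proof.
apply/mpolyP => m; rewrite mcoeff_map_mpoly !mcoeff_pihomog mcoeff_map_mpoly.
by case: (mdeg m == t); [reflexivity|exact: rmorph0].
Qed.

Lemma hmg_map n (A B : comNzRingType) (phi : {rmorphism A -> B}) i T (f : {mpoly A[n.+1]}) :
  map_mpoly phi (hmg i T f) = hmg i T (map_mpoly phi f).
Proof.
rewrite /hmg rmorph_sum; apply: eq_bigr => t _.
by rewrite /= rmorphM rmorphXn /= map_mpolyX pihomog_map.
Qed.

Lemma homog_map n (A B : comNzRingType) (phi : {rmorphism A -> B}) t (f : {mpoly A[n]}) :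
  f \is t.-homog -> map_mpoly phi f \is t.-homog.
Proof. by move=> h; rewrite -(pihomog_dE h) pihomog_map; exact: pihomogP. Qed.

Section SurjectiveBaseChange.
Context (n : nat) (A B : comNzRingType) (phi : {rmorphism A -> B}).
Hypothesis surj : forall b, exists a, phi a = b.
Context (X : charts n A) (cX : closed_subscheme X).

Lemma map_mpoly_surj m (f : {mpoly B[m]}) : exists2 f0 : {mpoly A[m]}, map_mpoly phi f0 = f &
  forall u, f@_u = 0 -> f0@_u = 0.
Proof.
have [s hs] := choice surj; exists (\sum_(u <- msupp f) s f@_u *: 'X_[u]).
  rewrite rmorph_sum [RHS]mpolyE; apply: eq_bigr => u _ /=.
  by rewrite map_mpolyZ map_mpolyX hs.
move=> u h; rewrite raddf_sum big1_seq // => v /andP[_ hv] /=.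
rewrite mcoeffZ mcoeffX; case: eqP => [e|_]; last by rewrite mulr0.
by move: hv; rewrite e mcoeff_msupp h eqxx.
Qed.

Lemma base_changeP i g : base_change phi X i g <-> exists2 f, X i f & g = map_mpoly phi f.
Proof.
case: cX => hX _ _; have [h0 hD hM] := hX i; split; last by move=> h I hI; apply.
move=> h; apply: (h (fun g => exists2 f, X i f & g = map_mpoly phi f)) => //.
split; first by exists 0; rewrite ?rmorph0.
  by move=> x y [f Xf ->] [f' Xf' ->]; exists (f + f'); rewrite ?rmorphD //; exact: hD.
move=> a x [f Xf ->]; have [a0 <- _] := map_mpoly_surj a.
by exists (a0 * f); rewrite ?rmorphM //; exact: hM.
Qed.

Lemma base_change_hmg i g t : g \is t.-homog -> base_change phi X i g ->
  exists e F, [/\ F \is (e + t)%N.-homog, X i F & map_mpoly phi F = 'X_i ^+ e * g].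
Proof.
move=> hg /base_changeP[f Xf eg]; case: cX => hX h1 _.
pose T := maxn (msize f) t; have tT : (t <= T)%N by exact: leq_maxr.
exists (T - t)%N, (hmg i T f); split.
- by rewrite subnK //; exact: hmg_homog.
- by apply/hmg_mem => //; apply: leq_trans (leq_maxl _ _) (leqnSn _).
by rewrite hmg_map -eg (hmg_of_homog _ hg).
Qed.

Lemma chart_glue i t F : F \is t.-homog -> X i F -> exists e, forall j, X j ('X_i ^+ e * F).
Proof.
move=> hF XF; case: cX => hX h1 hg; have h j : exists e, X j ('X_i ^+ e * F).
  by apply: (hg i j t F hF); exists 0%N; rewrite expr0 mul1r.
have [e he] := choice h; exists (\max_j e j)%N => j.
have le : (e j <= \max_j e j)%N by exact: leq_bigmax.
by rewrite -(subnK le) exprD -mulrA; case: (hX j) => _ _; apply.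
Qed.

(** After multiplication by a power of [x_i], a form of the base-changed chart lifts to a form of
    the chart over [A]; gluing is done there and mapped back. *)
Lemma base_change_closed : closed_subscheme (base_change phi X).
Proof.
case: (cX) => hX h1 hg; have hI i : is_ideal (base_change phi X i) by exact: ideal_gen_ideal.
have h1' i : base_change phi X i ('X_i - 1).
  by move=> I hI' h; apply: h; exists ('X_i - 1) => //; rewrite rmorphB rmorph1 /= map_mpolyX.
split=> // i j t f hf [m hm].
have hf' : 'X_j ^+ m * f \is (m + t)%N.-homog.
  by rewrite mpolyXn; apply: homogXM => //; rewrite mdegMn mdeg1 mul1n.
have [e [F [hF XF eF]]] := base_change_hmg hf' hm.
have [b hb] := chart_glue hF XF; exists (b + e)%N.
apply/(chart_cancel m _ (hI j) (h1' j)).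
apply/base_changeP; exists ('X_i ^+ b * F); first exact: hb.
by rewrite rmorphM rmorphXn /= map_mpolyX eF exprD; ring.
Qed.

Lemma secs_base_change_lift i t g : g \is t.-homog -> secs (base_change phi X) g ->
  exists e F, [/\ F \is (e + t)%N.-homog, secs X F & map_mpoly phi F = 'X_i ^+ e * g].
Proof.
move=> hg /(secs_homog base_change_closed hg)/(_ i) /(base_change_hmg hg)[e [F [hF XF eF]]].
have [b hb] := chart_glue hF XF.
have hbF : 'X_i ^+ b * F \is (b + e + t)%N.-homog.
  by rewrite -addnA mpolyXn; apply: homogXM => //; rewrite mdegMn mdeg1 mul1n.
exists (b + e)%N, ('X_i ^+ b * F); split=> //; first by apply/(secs_homog cX hbF).
by rewrite rmorphM rmorphXn /= map_mpolyX eF exprD mulrA.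
Qed.

End SurjectiveBaseChange.

Section LocalSections.
Context (n : nat) (A : comNzRingType) (m : A -> Prop) (hm : maximal_ideal m).
Local Notation R := (loc hm).
Local Notation ll := (locpi hm).
Local Notation lm := (map_mpoly (locpi hm)).

(** The last clause keeps the support from growing, so that homogeneous or standard forms stay so
    when denominators are cleared. *)
Lemma mpoly_clear_den (f : {mpoly R[n]}) : exists s (f0 : {mpoly A[n]}),
  [/\ ~ m s, ll s *: f = lm f0 & forall u, f@_u = 0 -> f0@_u = 0].
Proof.
have hu u : exists x : A * A, ~ m x.2 /\ ll x.2 * f@_u = ll x.1.
  by have [a [s [hs e]]] := loc_surj f@_u; exists (a, s).
have [x hx] := choice hu.
exists (\prod_(u <- msupp f) (x u).2),
  (\sum_(u <- msupp f) ((x u).1 * \prod_(v <- rem u (msupp f)) (x v).2) *: 'X_[u]); split.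
- by apply: maximal_ideal_prod => // u _; case: (hx u).
- rewrite rmorph_sum [X in _ *: X = _](mpolyE f) scaler_sumr big_seq [RHS]big_seq; apply: eq_bigr => u uf /=.
  rewrite map_mpolyZ map_mpolyX scalerA (big_rem u) //= !rmorphM; congr (_ *: _).
  by rewrite /=; have [_ <-] := hx u; ring.
move=> u h; rewrite raddf_sum big1_seq // => v /andP[_ hv] /=.
rewrite mcoeffZ mcoeffX; case: eqP => [e|_]; last by rewrite mulr0.
by move: hv; rewrite e mcoeff_msupp h eqxx.
Qed.

Lemma mpoly_torsion (f : {mpoly A[n]}) : lm f = 0 -> exists2 u, ~ m u & u *: f = 0.
Proof.
move=> h; have hu v : exists u, ~ m u /\ u * f@_v = 0.
  have /locpi_eq0[u hu e] : ll f@_v = 0 by rewrite -mcoeff_map_mpoly h mcoeff0.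
  by exists u.
have [u hu'] := choice hu; exists (\prod_(v <- msupp f) u v).
  by apply: maximal_ideal_prod => // v _; case: (hu' v).
apply/mpolyP => v; rewrite mcoeffZ mcoeff0.
have [vf|/memN_msupp_eq0 ->] := boolP (v \in msupp f); last by rewrite mulr0.
by rewrite (big_rem v) //= mulrAC; case: (hu' v) => _ ->; rewrite mul0r.
Qed.

End LocalSections.

Section LocalIdeal.
Context (n : nat) (A : comNzRingType) (m : A -> Prop) (hm : maximal_ideal m).
Local Notation R := (loc hm).
Local Notation ll := (locpi hm).
Local Notation lm := (map_mpoly (locpi hm)).
Implicit Types (I : {mpoly A[n.+1]} -> Prop).

(** The localization of [I] at [m], described by a single denominator so that membership can be
    cleared back to [A]. *)
Definition locl I (f : {mpoly R[n.+1]}) := exists u f0, [/\ ~ m u, I f0 & ll u *: f = lm f0].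

Lemma ll_unit u : ~ m u -> ll u \is a GRing.unit.
Proof. by move=> h; apply/locpi_unit. Qed.

Lemma subm_locl I : subm I -> subm (locl I).
Proof.
move=> [h0 hD hZ]; have m1 : ~ m 1 by case: hm.
split.
- by exists 1, 0; split=> //; rewrite scaler0 rmorph0.
- move=> f g [u [f0 [hu If ef]]] [v [g0 [hv Ig eg]]].
  exists (u * v), (v *: f0 + u *: g0); split; first exact: maximal_idealM.
    by apply: hD; exact: hZ.
  by rewrite scalerDr rmorphD /= !map_mpolyZ -ef -eg !scalerA rmorphM mulrC.
move=> c f [u [f0 [hu If ef]]]; have [a [s [hs ea]]] := loc_surj c.
exists (s * u), (a *: f0); split; [exact: maximal_idealM|exact: hZ|].
by rewrite map_mpolyZ /= -ef -ea !scalerA rmorphM; congr (_ *: _); ring.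
Qed.

Lemma mem_locl I f : I f -> locl I (lm f).
Proof. by move=> h; exists 1, f; split=> //; [case: hm|rewrite rmorph1 scale1r]. Qed.

Lemma locl_map I f : subm I -> locl I (lm f) <-> exists2 u, ~ m u & I (u *: f).
Proof.
move=> [_ _ hZ]; split=> [[u [f0 [hu If ef]]]|[u hu h]]; last first.
  by exists u, (u *: f); split=> //; rewrite map_mpolyZ.
have [v hv] : exists2 v, ~ m v & v *: (u *: f - f0) = 0.
  by apply: mpoly_torsion; rewrite rmorphB /= map_mpolyZ ef subrr.
rewrite scalerBr scalerA => /eqP; rewrite subr_eq0 => /eqP e.
by exists (v * u); [exact: maximal_idealM|rewrite e; exact: hZ].
Qed.

Lemma locl_mulX I (u : 'X_{1..n.+1}) f : (forall f, I f -> I ('X_[u] * f)) ->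
  locl I f -> locl I ('X_[u] * f).
Proof.
move=> hI [v [f0 [hv If ef]]]; exists v, ('X_[u] * f0); split; [exact hv|exact (hI _ If)|].
by rewrite scalerAr ef rmorphM /= map_mpolyX.
Qed.

(** Only the finitely many monomials of degree [e] are tested, so the product of their denominators
    serves for all of them at once. *)
Lemma locl_sat I f e t : subm I ->
  (forall f t, f \is t.-homog -> (forall u, mdeg u = e -> I ('X_[u] * f)) -> I f) ->
  f \is t.-homog -> (forall u, mdeg u = e -> locl I ('X_[u] * f)) -> locl I f.
Proof.
move=> sI hI hf hu; have [s [f0 [hs ef h0]]] := mpoly_clear_den f.
have hf0 : f0 \is t.-homog.
  apply/dhomogP => v; rewrite mcoeff_msupp => nz; apply/eqP; apply: contraNT nz => ne.
  by rewrite h0 // (dhomog_nemf_coeff hf).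
have hw u : exists w, ~ m w /\ (mdeg u = e -> I (w *: ('X_[u] * f0))).
  have [du|ne] := eqVneq (mdeg u) e; last first.
    by exists 1; split=> [|du]; [case: hm|rewrite du eqxx in ne].
  have : locl I (lm ('X_[u] * f0)).
    rewrite rmorphM /= map_mpolyX -ef -scalerAr; case: (subm_locl sI) => _ _; apply.
    exact: hu.
  by move/(locl_map _ sI) => [w nw Iw]; exists w.
have [w hw'] := choice hw; pose W := \prod_(u <- monomials n e) w u.
have nW : ~ m W by apply: maximal_ideal_prod => // u _; case: (hw' u).
exists (W * s), (W *: f0); split; first exact: maximal_idealM.
  apply: (hI _ t); first exact: rpredZ.
  move=> u du; rewrite -scalerAr /W (big_rem u) /=; last by rewrite mem_monomials du.
  rewrite mulrC -scalerA; case: sI => _ _; apply; case: (hw' u) => _; exact.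
by rewrite map_mpolyZ -ef scalerA rmorphM.
Qed.

End LocalIdeal.

(** The subspace is given by a predicate. A matrix of greatest rank with rows in it spans it, and if
    that rank were less than [M], a column of the cokernel would be a nonzero functional vanishing
    on it. *)
Lemma subspace_full (K : fieldType) M (U : 'rV[K]_M -> Prop) : subm U ->
  (forall d : 'rV[K]_M, (forall u, U u -> \sum_h u 0 h * d 0 h = 0) -> d = 0) -> forall u, U u.
Proof.
move=> sU hd; have comb (B : 'M[K]_M) (u : 'rV_M) : (forall i, U (row i B)) -> (u <= B)%MS -> U u.
  move=> hB /submxP[w ->]; rewrite mulmx_sum_row; apply: subm_sum => // i _.
  by case: sU => _ _; apply.
pose P s := `[< exists B : 'M[K]_M, (forall i, U (row i B)) /\ \rank B = s >].
have P0 : exists s, P s.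
  exists 0%N; apply/asboolP; exists 0; rewrite mxrank0; split=> // i.
  by rewrite row0; case: sU.
have Pb s : P s -> (s <= M)%N by move=> /asboolP[B [_ <-]]; exact: rank_leq_row.
case: (ex_maxnP P0 Pb) => s /asboolP[B [UB rB]] smax.
have sub u : U u -> (u <= B)%MS.
  move=> Uu; have hX i : U (row i <<col_mx B u>>%MS).
    have : (row i <<col_mx B u>> <= col_mx B u)%MS by rewrite (submx_trans (row_sub _ _)) // genmxE.
    move/submxP => [w ->]; rewrite -[w]hsubmxK mul_row_col.
    case: (sU) => _ hD hZ; apply: (hD).
      by apply: (comb B) => //; exact: submxMl.
    rewrite mulmx_sum_row; apply: subm_sum => // l _; apply: (hZ).
    by rewrite ord1 row_id.
  have /smax : P (\rank <<col_mx B u>>%MS) by apply/asboolP; exists <<col_mx B u>>%MS.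
  rewrite mxrank_gen -addsmxE -rB => le.
  have : (B + u <= B)%MS by rewrite -(geq_leqif (mxrank_leqif_sup (addsmxSl B u))).
  by rewrite addsmx_sub => /andP[].
have fB : row_full B.
  apply/negPn/negP => nf; have k0 : cokermx B != 0.
    apply: contraNneq nf => k0; have := mxrank_coker B; rewrite k0 mxrank0 => /esym/eqP.
    by rewrite subn_eq0 -col_leq_rank.
  have [x [y hxy]] : exists x y, cokermx B x y != 0.
    apply: contrapT => no; case/negP: k0; apply/eqP/matrixP => x y; rewrite [RHS]mxE; apply/eqP.
    by apply: contrapT => /negP h; apply: no; exists x, y.
  have /matrixP/(_ 0 x) : (col y (cokermx B))^T = 0.
    apply: hd => u /sub/submxP[w ->].
    transitivity (((w *m B) *m col y (cokermx B)) 0 0).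
      by rewrite [RHS]mxE; apply: eq_bigr => h _; congr (_ * _); rewrite mxE.
    by rewrite colE mulmxA -[w *m _ *m _]mulmxA mulmx_coker mulmx0 mul0mx mxE.
  by rewrite mxE [col _ _ _ _]mxE [RHS]mxE => h; rewrite h eqxx in hxy.
by move=> u; apply: (comb B) => //; exact: submx_full.
Qed.

Lemma linear_pack (A : comNzRingType) (V W : lmodType A) (f : V -> W) : linear f ->
  exists L : {linear V -> W}, forall x, L x = f x.
Proof.
move=> h; pose F0 := GRing.isLinear.Build A V W _ f h.
pose L : {linear V -> W} := HB.pack f F0.
by exists L.
Qed.

Lemma subm_preimage n (A B : comNzRingType) (phi : {rmorphism A -> B}) (J : {mpoly B[n]} -> Prop) :
  is_ideal J -> subm (fun f : {mpoly A[n]} => J (map_mpoly phi f)).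
Proof.
move=> [h0 hD hM]; split; first by rewrite rmorph0.
  by move=> u v hu hv; rewrite rmorphD; exact: hD.
by move=> c v hv; rewrite map_mpolyZ -mul_mpolyC; exact: hM.
Qed.

Lemma preimage_scale n (A B : comNzRingType) (phi : {rmorphism A -> B}) (J : {mpoly B[n]} -> Prop)
  (c : A) f : is_ideal J -> phi c = 0 -> J (map_mpoly phi (c *: f)).
Proof. by move=> [h0 _ _] hc; rewrite map_mpolyZ hc scale0r. Qed.

Lemma map_sum_lsub n D (A B : comNzRingType) (phi : {rmorphism A -> B}) (M : 'M[A]_n.+1)
  (a : 'I_(nmon n D) -> A) :
  map_mpoly phi (\sum_h a h *: lsub M 'X_[alpha h]) =
  lsub (map_mx phi M) (pv (fun h => phi (a h))).
Proof.
rewrite rmorph_sum linear_sum; apply: eq_bigr => h _ /=.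
by rewrite map_mpolyZ linearZ /= lsub_map map_mpolyX.
Qed.

(** * Lifting freeness from the residue field to the local ring *)

Section ForwardLocal.
Context (A : comNzRingType) (qA : {rmorphism rat -> A}) (n : nat).
Context (X : charts n A) (m : A -> Prop) (hm : maximal_ideal m).
Hypothesis cX : closed_subscheme X.
Hypothesis fX : forall i, flat_quotient (X i).
Local Notation K := (resf hm).
Local Notation R := (loc hm).
Local Notation pr := (respi hm : {rmorphism A -> resf hm}).
Local Notation ll := (locpi hm : {rmorphism A -> loc hm}).
Local Notation YK := (base_change pr X).
Context (g : 'M[rat]_n.+1).
Local Notation gA := (map_mx qA g).
Local Notation gK := (map_mx pr gA).
Local Notation gR := (map_mx ll gA).

Lemma closed_YK : closed_subscheme YK.
Proof. exact: (base_change_closed (respi_surj (hm := hm)) cX). Qed.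

Section Degree.
Context (D : nat) (Nt : pred 'X_{1..n.+1}).
Local Notation M := (nmon n D).

(** The coefficients [c] of [H] embed the quotient of [A^M] by their syzygies [Ker] into [A]. There
    the relation given by [XH] is the image of the tensor that pairs the basis vectors with the
    substituted monomials, so flatness kills this tensor. A functional over the residue field that
    vanishes on [Ker] then gives a relation in the fibre, which independence excludes. So [Ker]
    fills the residue space, and Nakayama's determinant trick makes [c] vanish near [m]. *)
Lemma flat_independent (H : {mpoly A[n.+1]}) :
  (forall h, supported D Nt h -> secs YK (lsub gK h) -> h = 0) ->
  supported D Nt H -> secs X (lsub gA H) -> map_mpoly ll H = 0.
Proof.
move=> indK hH XH; pose c (h : 'I_M) := H@_(alpha h).
pose Ker (v : 'rV[A]_M) := \sum_h v 0 h * c h = 0.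
have sKer : subm Ker.
  split; rewrite /Ker.
  - by rewrite big1 // => h _; rewrite mxE mul0r.
  - move=> u v hu hv; under eq_bigr => h _ do rewrite mxE mulrDl.
    by rewrite big_split /= hu hv addr0.
  move=> x v hv; under eq_bigr => h _ do rewrite mxE -mulrA.
  by rewrite -mulr_sumr hv mulr0.
pose U (u : 'rV[K]_M) := exists2 v, Ker v & map_mx pr v = u.
have sU : subm U.
  case: (sKer) => k0 kD kZ; split.
  - by exists 0; rewrite ?map_mx0.
  - by move=> _ _ [u hu <-] [v hv <-]; exists (u + v); rewrite ?map_mxD //; exact: kD.
  move=> x _ [v hv <-]; have [x0 <-] := respi_surj x.
  by exists (x0 *: v); rewrite ?map_mxZ //; exact: kZ.
have annU (d : 'rV[K]_M) : (forall u, U u -> \sum_h u 0 h * d 0 h = 0) -> d = 0.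
  move=> hd; have [de hde] := choice (fun h : 'I_M => respi_surj (d 0 h)).
  have kd v : Ker v -> m (\sum_h de h * v 0 h).
    move=> kv; apply/(respi_eq0 hm); rewrite rmorph_sum /=.
    transitivity (\sum_h (map_mx pr v) 0 h * d 0 h); last by apply: hd; exists v.
    by apply: eq_bigr => h _; rewrite rmorphM mxE mulrC /= hde.
  have d0 h : ~~ Nt (alpha h) -> d 0 h = 0.
    move=> Nh; have k1 : Ker (delta_mx 0 h).
      rewrite /Ker (bigD1 h) //= mxE !eqxx mul1r big1 => [|x ne]; last first.
        by rewrite mxE (negbTE ne) andbF mul0r.
      by rewrite addr0; apply/eqP; apply: contraNT Nh => /hH[].
    have := kd _ k1; rewrite (bigD1 h) //= mxE !eqxx mulr1 big1 => [|x ne]; last first.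
      by rewrite mxE (negbTE ne) andbF mulr0.
    by rewrite addr0 => /(respi_eq0 hm); rewrite -hde.
  pose y (h : 'I_M) : {mpoly A[n.+1]} := lsub gA 'X_[alpha h].
  pose phi (x : quomod sKer) : A^o := \sum_h qrep x 0 h * c h.
  have phiE v : phi (qpi sKer v) = \sum_h v 0 h * c h.
    rewrite /phi; apply/eqP; rewrite -subr_eq0 -sumrB; apply/eqP.
    apply: etrans (qrep_pi sKer v : Ker _); apply: eq_bigr => h _.
    by rewrite !mxE mulrBl.
  have [L hL] : exists L : {linear quomod sKer -> A^o}, forall x, L x = phi x.
    apply: linear_pack => x u v; rewrite -(qrepK u) -(qrepK v) -linearP !phiE.
    rewrite [x *: (\sum_h _)](_ : _ = x * \sum_h qrep u 0 h * c h) // mulr_sumr -big_split /=.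
    by apply: eq_bigr => h _; rewrite !mxE mulrDl mulrA.
  have injL : injective L.
    move=> u v; rewrite !hL => e; rewrite -(qrepK u) -(qrepK v); apply/qpi_eq.
    rewrite /Ker; under eq_bigr => h _ do rewrite !mxE mulrBl.
    by rewrite sumrB; apply/eqP; rewrite subr_eq0; apply/eqP.
  pose s := [seq (qpi sKer (delta_mx 0 h), y h) | h <- enum 'I_M].
  have YKd j : YK j (lsub gK (pv (fun h => d 0 h))).
    pose Q2 (f : {mpoly A[n.+1]}) := YK j (map_mpoly pr f).
    have iY : is_ideal (YK j) by case: closed_YK.
    have sQ2 : subm Q2 := subm_preimage pr iY.
    (* The bilinear map by which the vanishing tensor is tested: the lift [de] of the functional
       applied to the first factor, times the second, modulo the polynomials that vanish on the
       fibre. It is well defined on the quotient because [de] sends [Ker] into [m]. *)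
    pose b (x : quomod sKer) (f : {mpoly A[n.+1]}) : quomod sQ2 :=
      qpi sQ2 ((\sum_h de h * qrep x 0 h) *: f).
    have bE v f : b (qpi sKer v) f = qpi sQ2 ((\sum_h de h * v 0 h) *: f).
      apply/qpi_eq; rewrite -scalerBl; apply: (preimage_scale _ iY).
      apply/respi_eq0; rewrite -sumrB.
      rewrite (eq_bigr (fun h => de h * (qrep (qpi sKer v) - v) 0 h)).
        by apply: kd; exact: qrep_pi.
      by move=> h _; rewrite !mxE mulrBr.
    have tz : tensor_zero (X j) [seq (L z.1, z.2) | z <- s].
      move=> P b' lb1 lb2 hQ; rewrite -map_comp big_map big_enum /=.
      have [B1 hB1] := linear_pack (lb2 1).
      rewrite (eq_bigr (fun h => B1 (c h *: y h))); last first.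
        move=> h _; have [B2 hB2] := linear_pack (lb1 (y h)).
        rewrite linearZ /= hB1 hL phiE (bigD1 h) //= mxE !eqxx mul1r big1 ?addr0 => [|x ne].
          have e1 : c h *: (1 : A^o) = c h by exact: mulr1.
          by rewrite -(hB2 (c h)) -[X in B2 X]e1 linearZ /= hB2.
        by rewrite mxE (negbTE ne) andbF mul0r.
      rewrite -linear_sum hB1; apply: hQ.
      have := (secs_homog cX (lsub_homog gA (supported_homog hH))).1 XH j.
      rewrite [H](homog_pv (supported_homog hH)) linear_sum.
      by under eq_bigr => h _ do rewrite linearZ.
    have := fX injL tz; move/(_ (quomod sQ2) b).
    rewrite big_map big_enum /= => tz0.
    have : qpi sQ2 (\sum_h de h *: y h) = 0.
      rewrite linear_sum -[RHS]tz0.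
      - apply: eq_bigr => h _; rewrite bE (bigD1 h) //= mxE !eqxx mulr1 big1 ?addr0 // => x ne.
        by rewrite mxE (negbTE ne) andbF mulr0.
      - move=> f x u v; rewrite -(qrepK u) -(qrepK v) -linearP !bE -linearP; congr (qpi _ _).
        rewrite scalerA -scalerDl; congr (_ *: _); rewrite mulr_sumr -big_split /=.
        by apply: eq_bigr => h _; rewrite !mxE; ring.
      - move=> v x f f'; rewrite /b -linearP; congr (qpi _ _).
        by rewrite scalerDr !scalerA mulrC.
      move=> v f Xf; rewrite /b; apply/qpi_eq0; case: (sQ2) => _ _; apply.
      by move=> I _; apply; exists f.
    move/(qpi_eq0 sQ2) => h; have := h; rewrite /Q2 map_sum_lsub.
    by rewrite (eq_pv (w := fun h => d 0 h) hde).
  have hd0 : pv (fun h => d 0 h) = 0.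
    apply: indK; last by apply/(secs_homog closed_YK (lsub_homog gK (pv_homog _))).
    move=> u nz; have du : mdeg u = D.
      by apply/eqP; apply: contraNT nz => ne; rewrite (dhomog_nemf_coeff (pv_homog _)).
    split=> //; have [x ex] := alphaP du; rewrite -ex pvE in nz *.
    by apply: contraNT nz => Nx; rewrite d0.
  by apply/rowP => h; rewrite mxE -(pvE (fun h => d 0 h)) hd0 mcoeff0.
(* Syzygies of [c] that lift the basis vectors of the residue space; they form a matrix that is
   invertible at [m] and annihilates [c]. *)
have /choice[kap hkap] : forall h : 'I_M, exists v, Ker v /\ map_mx pr v = delta_mx 0 h.
  by move=> h; have [v kv ev] := subspace_full sU annU (delta_mx 0 h); exists v.
pose W := \matrix_(x, y) kap x 0 y.
have W1 : map_mx pr W = 1%:M.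
  apply/row_matrixP => x; rewrite row1 -map_row rowK; case: (hkap x) => _ <-.
  by apply/rowP => y; rewrite !mxE.
have nW : ~ m (\det W).
  move=> /(respi_eq0 hm); rewrite -det_map_mx W1 det1 => /eqP.
  by rewrite (oner_eq0 K).
have Wc : W *m (\col_h c h) = 0.
  apply/colP => x; rewrite !mxE; case: (hkap x) => kx _; rewrite -[RHS]kx.
  by apply: eq_bigr => h _; rewrite !mxE.
have dc h : \det W * c h = 0.
  have := congr1 (mulmx (\adj W)) Wc; rewrite mulmxA mul_adj_mx mulmx0 mul_scalar_mx.
  by move/colP/(_ h); rewrite !mxE.
apply/mpolyP => u; rewrite mcoeff_map_mpoly mcoeff0.
have [->|/hH[du _]] := eqVneq H@_u 0; first exact: rmorph0.
have [x <-] := alphaP du; apply/locpi_eq0; exists (\det W); [exact: nW|exact: dc].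
Qed.

Lemma locl_independent (h : {mpoly R[n.+1]}) :
  (forall h, supported D Nt h -> secs YK (lsub gK h) -> h = 0) ->
  supported D Nt h -> locl (hm := hm) (secs X) (lsub gR h) -> h = 0.
Proof.
move=> indK hh Ih; have [s [H [hs eH H0]]] := mpoly_clear_den h.
have sS := subm_secs cX; have hH : supported D Nt H.
  by move=> u nz; apply: hh; apply: contraNneq nz => /H0 ->.
have : locl (hm := hm) (secs X) (map_mpoly ll (lsub gA H)).
  by rewrite lsub_map -eH linearZ; case: (subm_locl hm sS) => _ _; apply.
move/(locl_map hm _ sS) => [u hu]; rewrite -linearZ /= => XH.
have huH : supported D Nt (u *: H) by move=> v; rewrite mcoeffZ => nz; apply: hH; apply: contraNneq nz => ->; rewrite mulr0.
have := flat_independent indK huH XH; rewrite map_mpolyZ /= -eH scalerA -rmorphM => /(congr1 (fun f => (ll (u * s))^-1 *: f)).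
rewrite scalerA mulVr ?scale1r ?scaler0 //; apply: ll_unit; exact: maximal_idealM.
Qed.

(** [W] has the lifted relations in its nonstandard rows and unit vectors in the standard ones.
    Modulo [m] it is [1 + E], where [E] has only nonstandard rows and standard columns, so [E] has
    square 0 and [W] is invertible over the local ring. *)
Lemma nakayama_span :
  (forall f, f \is D.-homog -> exists2 h, supported D Nt h & secs YK (lsub gK (f - h))) ->
  (forall f, f \is D.-homog -> secs YK f ->
     exists F, [/\ F \is D.-homog, secs X F & map_mpoly pr F = f]) ->
  g \in unitmx ->
  forall f : {mpoly R[n.+1]}, f \is D.-homog ->
  exists2 h, supported D Nt h & locl (hm := hm) (secs X) (lsub gR (f - h)).
Proof.
move=> spanK liftK ug f hf; have gAV : map_mx qA (invmx g) *m gA = 1%:M.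
  by rewrite -map_mxM mulVmx // map_mx1.
have gAV' : gA *m map_mx qA (invmx g) = 1%:M by rewrite -map_mxM mulmxV // map_mx1.
have hG (x : 'I_M) : exists G : {mpoly A[n.+1]}, [/\ G \is D.-homog, secs X (lsub gA G)
    & supported D Nt ('X_[alpha x] - map_mpoly pr G)].
  have hx := homogX K (mdeg_alpha x).
  have [h hh Yh] := spanK _ hx.
  have hxh : 'X_[alpha x] - h \is D.-homog by apply: rpredB => //; exact: supported_homog hh.
  have [F [hF XF eF]] := liftK _ (lsub_homog gK hxh) Yh.
  exists (lsub (map_mx qA (invmx g)) F); split; first exact: lsub_homog.
    by rewrite lsub_comp gAV lsub1.
  rewrite lsub_map eF lsub_comp -map_mxM gAV' map_mx1 lsub1 subKr //.
have [G hG'] := choice hG.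
pose W : 'M[A]_M := \matrix_(x, y) if Nt (alpha x) then (x == y)%:R else (G x)@_(alpha y).
have uW : map_mx ll W \in unitmx.
  rewrite unitmxE det_map_mx; apply: ll_unit => /(respi_eq0 hm); rewrite -det_map_mx.
  pose E := map_mx pr W - 1%:M.
  have EE x y : E x y != 0 -> ~~ Nt (alpha x) /\ Nt (alpha y).
    rewrite !mxE; case: ifP => Nx; first by rewrite rmorph_nat subrr eqxx.
    case: (hG' x) => _ _ hs nz; split=> //.
    have : ('X_[alpha x] - map_mpoly pr (G x))@_(alpha y) != 0.
      rewrite mcoeffB mcoeffX mcoeff_map_mpoly (inj_eq (@alpha_inj n D)).
      by rewrite -opprB oppr_eq0.
    by move/hs => [].
  have E2 : E *m E = 0.
    apply/matrixP => x y; rewrite mxE [RHS]mxE big1 // => z _.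
    have [->|/EE[_ Nz]] := eqVneq (E x z) 0; first by rewrite mul0r.
    have [->|/EE[nz _]] := eqVneq (E z y) 0; first by rewrite mulr0.
    by rewrite Nz in nz.
  have /mulmx1_unit[h _] : map_mx pr W *m (1%:M - E) = 1%:M.
    rewrite -[map_mx pr W](subrK 1%:M) -/E mulmxBr mulmx1 mulmxDl E2 mul1mx add0r.
    by rewrite [E + _]addrC addrK.
  by move=> e; move: h; rewrite unitmxE e unitr0.
pose v : 'rV[R]_M := \row_x f@_(alpha x).
pose w := v *m invmx (map_mx ll W).
have ev : w *m map_mx ll W = v by rewrite mulmxKV.
have ef : f = \sum_x w 0 x *: pv (fun y => ll (W x y)).
  rewrite -pv_lin {1}(homog_pv hf); apply: eq_pv => y.
  have := congr1 (fun u : 'rV_M => u 0 y) ev; rewrite mxE [RHS]mxE => <-.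
  by apply: eq_bigr => x _; rewrite [map_mx _ _ _ _]mxE.
exists (\sum_(x | Nt (alpha x)) w 0 x *: 'X_[alpha x]).
  apply: subm_sum => [|x Nx]; first exact: subm_supported.
  by case: (subm_supported R D Nt) => _ _; apply; apply: supportedX; rewrite ?mdeg_alpha.
have -> : f - \sum_(x | Nt (alpha x)) w 0 x *: 'X_[alpha x] =
    \sum_(x | ~~ Nt (alpha x)) w 0 x *: map_mpoly ll (G x).
  rewrite [in LHS]ef (bigID (fun x => Nt (alpha x))) /= addrAC -sumrB big1 ?add0r => [|x Nx].
    apply: eq_bigr => x Nx; congr (_ *: _); case: (hG' x) => hGx _ _.
    rewrite (homog_pv (homog_map ll hGx)); apply: eq_pv => y.
    by rewrite mcoeff_map_mpoly mxE (negbTE Nx).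
  rewrite -scalerBr (_ : pv _ = 'X_[alpha x]) ?subrr ?scaler0 //.
  rewrite /pv (bigD1 x) //= mxE Nx eqxx rmorph1 scale1r big1 ?addr0 // => y ne.
  by rewrite mxE Nx eq_sym (negbTE ne) rmorph0 scale0r.
have sL := subm_locl hm (subm_secs cX).
rewrite linear_sum; apply: subm_sum => // x _; rewrite linearZ /=.
case: (sL) => _ _; apply; rewrite -lsub_map; apply: mem_locl.
by case: (hG' x).
Qed.

End Degree.

End ForwardLocal.

Lemma lsub_mulX_mem n (R : comNzRingType) (I : {mpoly R[n.+1]} -> Prop) (M : 'M[R]_n.+1) f v :
  subm I -> (forall u, mdeg u = mdeg v -> I ('X_[u] * f)) -> I (lsub M 'X_[v] * f).
Proof.
move=> sI h; rewrite (homog_pv (lsub_homog M (homogX R (erefl (mdeg v))))) mulr_suml.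
apply: subm_sum => // x _; rewrite -scalerAl; case: sI => _ _; apply; apply: h.
exact: mdeg_alpha.
Qed.

Section ForwardMain.
Context (A : comNzRingType) (qA : {rmorphism rat -> A}) (n : nat).
Context (X : charts n A) (m : A -> Prop) (hm : maximal_ideal m).
Hypothesis cX : closed_subscheme X.
Local Notation K := (resf hm).
Local Notation R := (loc hm).
Local Notation pr := (respi hm : {rmorphism A -> resf hm}).
Local Notation ll := (locpi hm : {rmorphism A -> loc hm}).
Local Notation YK := (base_change pr X).

Definition liftable D (f : {mpoly K[n.+1]}) :=
  exists F, [/\ F \is D.-homog, secs X F & map_mpoly pr F = f].

Lemma subm_liftable D : subm (liftable D).
Proof.
have [s0 sD sZ] := subm_secs cX; split.
- by exists 0; rewrite rpred0 rmorph0; split.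
- move=> _ _ [F [hF XF <-]] [F' [hF' XF' <-]]; exists (F + F').
  by rewrite rpredD // rmorphD; split=> //; exact: sD.
move=> c _ [F [hF XF <-]]; have [c0 <-] := respi_surj c; exists (c0 *: F).
by rewrite rpredZ // map_mpolyZ; split=> //; exact: sZ.
Qed.

Lemma liftable_mulX D (u : 'X_{1..n.+1}) f : liftable D f -> liftable (mdeg u + D) ('X_[u] * f).
Proof.
move=> [F [hF XF <-]]; exists ('X_[u] * F); split; first exact: homogXM.
  exact: secs_mulX.
by rewrite rmorphM /= map_mpolyX.
Qed.

Lemma exists_large_exponent s E (u : 'X_{1..n.+1}) : mdeg u = s -> (n.+1 * E <= s)%N ->
  exists i, (E <= u i)%N.
Proof.
move=> du le; apply: contrapT => no.
have : (\sum_(i < n.+1) (u i).+1 <= \sum_(i < n.+1) E)%N.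
  apply: leq_sum => i _; rewrite ltnNge; apply/negP => h; apply: no; by exists i.
under eq_bigr => i _ do rewrite -addn1.
rewrite big_split /= -mdegE du !sum_nat_const card_ord muln1; lia.
Qed.

Section Lifting.
Context (g : 'M[rat]_n.+1) (ug : g \in unitmx) (r T1 : nat) (N : pred 'X_{1..n.+1}).
Local Notation gA := (map_mx qA g).
Local Notation gK := (map_mx pr gA).
Hypothesis hfree : forall t, (T1 <= t)%N ->
  free_mod (t + r) (fun f => secs YK (lsub gK f)) (iter t grow N).

Let I' (f : {mpoly K[n.+1]}) := secs YK (lsub gK f).

(** In large degrees the sections of the fibre are generated by the marked basis of one degree [D],
    and every basis form lifts after multiplication by a power of [x_i], for each [i]. A monomial of
    degree at least [(n + 1) E] is divisible by some [x_i^E], so in high degrees all multiples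
    lift. *)
Lemma secs_lift : exists T2, forall t, (T2 <= t)%N -> forall f, f \is (t + r)%N.-homog ->
  secs YK f -> liftable (t + r) f.
Proof.
have cY : closed_subscheme YK by exact: closed_YK.
have sI : subm I' by apply: subm_lsub; exact: subm_secs.
have [fm hfm] := free_mod_marked sI (hfree (leqnn T1)).
set D := (T1 + r)%N in fm hfm.
have hfh al : mdeg al = D -> ~~ iter T1 grow N al -> fm al \is D.-homog.
  move=> da Na; rewrite -[fm al](subKr 'X_[al]); apply: rpredB; first exact: homogX.
  by apply: supported_homog; exact: (hfm al da Na).2.
have ex (z : 'X_{1..n.+1} * 'I_n.+1) : exists e, mdeg z.1 = D -> ~~ iter T1 grow N z.1 ->
    liftable (e + D) ('X_(z.2) ^+ e * lsub gK (fm z.1)).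
  case: z => al i /=; have [da|ne] := eqVneq (mdeg al) D; last first.
    by exists 0%N => da; rewrite da eqxx in ne.
  have [Na|Na] := boolP (iter T1 grow N al); first by exists 0%N.
  have [h _] := hfm al da Na.
  have [e [F [hF XF eF]]] := secs_base_change_lift (respi_surj (hm := hm)) cX i (lsub_homog gK (hfh al da Na)) h.
  by exists e => _ _; exists F.
have [ee hee] := choice ex.
pose E := (\max_(i < n.+1) \max_(al <- monomials n D) ee (al, i))%N.
have hE al (i : 'I_n.+1) : mdeg al = D -> ~~ iter T1 grow N al ->
    liftable (E + D) ('X_i ^+ E * lsub gK (fm al)).
  move=> da Na; have le : (ee (al, i) <= E)%N.
    apply: leq_trans (leq_bigmax i) => /=.
    by rewrite (big_rem al) /= ?leq_maxl // mem_monomials da.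
  have := liftable_mulX (U_(i) *+ (E - ee (al, i)))%MM (hee (al, i) da Na).
  by rewrite mdegMn mdeg1 mul1n addnA subnK // -mpolyXn mulrA -exprD subnK.
exists (T1 + n.+1 * E)%N => t ht f hf Yf.
have gKV : map_mx pr (map_mx qA (invmx g)) *m gK = 1%:M.
  by rewrite -!map_mxM mulVmx // !map_mx1.
pose f' := lsub (map_mx pr (map_mx qA (invmx g))) f.
have ef : lsub gK f' = f by rewrite lsub_comp gKV lsub1.
have If' : I' f' by rewrite /I' ef.
pose s := (t - T1)%N; have es : (s + T1)%N = t by rewrite subnK // (leq_trans _ ht) // leq_addr.
pose G w := exists ga al, [/\ mdeg ga = s, mdeg al = D, ~~ iter T1 grow N al & w = 'X_[ga] * fm al].
have hf' : f' \is (s + D)%N.-homog by rewrite addnA es; exact: lsub_homog.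
have [|||h hh Qh] := @marked_span n K D (iter T1 grow N) fm _ s (span G) _ _ f' hf'.
- by move=> al da Na; exact: (hfm al da Na).2.
- exact: subm_span.
- by move=> ga al dg da Na; apply: mem_span; exists ga, al.
have GI w : span G w -> I' w.
  move=> hw; apply: (hw I' sI) => _ [ga [al [dg da Na ->]]]; rewrite /I' rmorphM.
  apply: lsub_mulX_mem => [|u _]; first exact: subm_secs.
  have [h1 _] := hfm al da Na; exact: (secs_mulX u cY h1).
have h0 : h = 0.
  have [_ ind] := hfree (leq_addl s T1); apply: ind.
    by rewrite iterD -addnA.
  by apply: (subm_sub sI) If'; exact: GI.
rewrite h0 subr0 in Qh; rewrite -ef.
apply: (Qh (fun w => liftable (t + r) (lsub gK w))).
  by apply: subm_lsub; exact: subm_liftable.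
move=> _ [ga [al [dg da Na ->]]]; rewrite rmorphM /=.
rewrite [lsub _ 'X_[ga]](homog_pv (lsub_homog _ (homogX K dg))) mulr_suml.
apply: subm_sum => [|x _]; first exact: subm_liftable.
rewrite -scalerAl; case: (subm_liftable (t + r)) => _ _; apply.
have [|i hi] := @exists_large_exponent s E (alpha x) (mdeg_alpha x); first by rewrite /s; lia.
have le : (U_(i) *+ E <= alpha x)%MM.
  by apply/mnm_lepP => l; rewrite mulmnE mnm1E; case: eqP => [<-|_] //; rewrite mul1n.
have := liftable_mulX (alpha x - U_(i) *+ E)%MM (hE al i da Na).
have -> : (mdeg (alpha x - U_(i) *+ E) + (E + D))%N = (t + r)%N.
  have := mdeg_alpha x; rewrite -{1}(submK le) mdegD mdegMn mdeg1 mul1n /D -es; lia.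
by rewrite mulrA mpolyXn -mpolyXD submK.
Qed.

End Lifting.

Hypothesis fX : forall i, flat_quotient (X i).
Context (pt : {poly rat}) (a : seq nat).
Local Notation r := (size a).
Hypothesis sa : sorted geq a.
Hypothesis hpt : forall t, (r <= t)%N -> pt.[t%:R] = (gval t a)%:R.
Hypothesis hY : has_hilbert_polynomial YK pt.

(** Spanning by [nakayama_span] and independence by flatness hold only in degrees beyond [T1] and
    [T2]; the localized ideal is saturated, and [free_mod_descend] brings freeness down to degree
    [r]. *)
Theorem forward_local : exists (g : 'M[rat]_n.+1) (N : pred 'X_{1..n.+1}),
  [/\ g \in unitmx, borel r N, cnt r 0 N = gval r a, cnt r.+1 0 (grow N) = gval r.+1 a
    & forall t, free_mod (t + r)
        (fun f => locl (hm := hm) (secs X) (lsub (map_mx ll (map_mx qA g)) f)) (iter t grow N)].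
Proof.
have cY : closed_subscheme YK by exact: closed_YK.
have [g [N [T1 [ug bN c1 c2 fr]]]] :=
  @field_generic_initial K (pr \o qA) n pt a sa hpt YK cY hY.
exists g, N; split=> //.
have hfree t : (T1 <= t)%N -> free_mod (t + r)
    (fun f => secs YK (lsub (map_mx pr (map_mx qA g)) f)) (iter t grow N).
  by move=> ht; rewrite -map_mx_comp; exact: fr.
have [T2 hT2] := secs_lift ug hfree.
have sS := subm_secs cX; have sL := subm_locl hm sS.
set gR := map_mx ll (map_mx qA g).
have gRV : map_mx ll (map_mx qA (invmx g)) *m gR = 1%:M.
  by rewrite -!map_mxM mulVmx // !map_mx1.
have gRV' : gR *m map_mx ll (map_mx qA (invmx g)) = 1%:M.
  by rewrite -!map_mxM mulmxV // !map_mx1.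
have LX u f : locl (hm := hm) (secs X) f -> locl (hm := hm) (secs X) ('X_[u] * f).
  by apply: locl_mulX => f0; exact: secs_mulX.
move=> t; apply: (@free_mod_descend n R r N _ _ _ _ (maxn T1 T2) t).
- exact: subm_lsub.
- move=> u f h; rewrite rmorphM /=.
  by apply: lsub_mulX_mem => // v _; exact: LX.
- move=> f e s hf h; apply: (locl_sat (e := e) (t := s)) => //; first by move=> *; apply: secs_sat; eauto.
    exact: lsub_homog.
  move=> u du; rewrite -['X_[u]](lsub1) -gRV -lsub_comp.
  rewrite (homog_pv (lsub_homog _ (homogX R du))) linear_sum mulr_suml.
  apply: subm_sum => // x _ /=; rewrite linearZ -scalerAl; case: (sL) => _ _; apply.
  by rewrite /= -rmorphM; apply: h; exact: mdeg_alpha.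
move=> s hs; have s1 : (T1 <= s)%N by apply: leq_trans hs; exact: leq_maxl.
have s2 : (T2 <= s)%N by apply: leq_trans hs; exact: leq_maxr.
have [h1 h2] := hfree s s1; split.
  move=> f hf; apply: nakayama_span => //; exact: hT2.
by move=> h hh Ih; exact: (locl_independent cX fX h2 hh Ih).
Qed.

End ForwardMain.

Section EvaluationChange.
Context (k : fieldType) (N p : nat).

Lemma evp_rmorph (R R' : comNzRingType) (io : {rmorphism k -> R}) (io' : {rmorphism k -> R'})
  (f : {rmorphism R -> R'}) (C : 'M[R]_(N, p)) (F : plring k N p) :
  (forall c, f (io c) = io' c) -> f (evp io C F) = evp io' (map_mx f C) F.
Proof.
move=> h; apply: (mpoly_morph_ext (f := f \o evp io C) (g := evp io' (map_mx f C))) => [c|v] /=.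
  by rewrite !mmapC h.
rewrite !mmapX !mmap1U -det_map_mx; congr (\det _); apply/matrixP => a b.
by rewrite !mxE.
Qed.

Context (R : comNzRingType) (io : {rmorphism k -> R}).
Implicit Types (C : 'M[R]_(N, p)) (F : plring k N p).

Lemma evp_proportional C C' y e F : F \is e.-homog ->
  (forall I : midx N p, pl C' (val I) = y * pl C (val I)) -> evp io C' F = y ^+ e * evp io C F.
Proof.
move=> hF h; rewrite (mpolyE F) !rmorph_sum mulr_sumr /= big_seq [RHS]big_seq.
apply: eq_bigr => m mF; rewrite /= !mmapZ !mmapX mulrCA; congr (_ * _).
have em : mdeg m = e := dhomog_mf hF mF.
rewrite /mmap1 -em mdegE -prodrXr -big_split /=; apply: eq_bigr => i _.
by rewrite !pl_det h exprMn.
Qed.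

Lemma evp_scale_mx C x e F : F \is e.-homog -> evp io (x *: C) F = x ^+ (p * e) * evp io C F.
Proof.
move=> hF; rewrite exprM; apply: evp_proportional => // I.
rewrite -!pl_det -detZ; congr (\det _); apply/matrixP => a b; by rewrite !mxE.
Qed.

Lemma evp_mulmx C (D : 'M[R]_p) e F : F \is e.-homog ->
  evp io (C *m D) F = (\det D) ^+ e * evp io C F.
Proof.
move=> hF; apply: evp_proportional => // I.
rewrite -!pl_det mulrC -det_mulmx; congr (\det _); apply/matrixP => a b.
by rewrite !mxE; apply: eq_bigr => c _; rewrite !mxE.
Qed.

End EvaluationChange.

Section CoordinateChange.
Context (k : fieldType) (fq : {rmorphism rat -> k}) (hfq : forall x, fq x = ratr x).
Context (n : nat) (pt : {poly rat}) (d r : nat).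
Context (R : comNzRingType) (io : {rmorphism k -> R}).
Local Notation p := (hval pt r).
Implicit Types (C : 'M[R]_(nmon n r, p)).

Lemma coord_change_submx (g : 'M[rat]_n.+1) :
  map_mx io (coord_change k r g) = submx_ r (map_mx (io \o fq) g).
Proof.
rewrite map_mx_comp -submx_map; congr (map_mx io _); apply/matrixP => l j; rewrite !mxE.
congr (mcoeff _ _); rewrite /lsub; congr (_ \mPo _); apply: eq_mktuple => i.
by apply: eq_bigr => a _; rewrite mxE hfq.
Qed.

(** By Cauchy-Binet, translating an equation is the same as moving the point by the transposed
    substitution. *)
Lemma evp_gact C (g : 'M[rat]_n.+1) (F : plring k (nmon n r) p) :
  evp io C (gact g F) = evp io ((submx_ r (map_mx (io \o fq) g))^T *m C) F.
Proof.
rewrite -coord_change_submx /gact; set t := (X in _ \mPo X).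
apply: (mpoly_morph_ext (f := evp io C \o comp_mpoly t) (g := evp io _)) => [c|v] /=.
  by rewrite comp_mpolyC !mmapC.
rewrite comp_mpolyXU -tnth_nth tnth_mktuple -[mmap _ _ _]/(evp io C _) rmorph_sum.
rewrite mmapX mmap1U pl_det -cauchy_binet; apply: eq_bigr => I _ /=.
rewrite -[mmap _ _ _]/(evp io C _) evp_scale evp_Delta; congr (_ * _).
by rewrite -det_map_mx; congr (\det _); apply/matrixP => a b; rewrite !mxE.
Qed.

Lemma evp_frakH C : (forall F, frakH k n pt d r F -> evp io C F = 0) <->
  (forall g F0, g \in unitmx -> frakh1 d F0 \/ frakh2 d F0 ->
     evp io ((submx_ r (map_mx (io \o fq) g))^T *m C) F0 = 0).
Proof.
split=> h.
  move=> g F0 ug h0; rewrite -evp_gact; apply: h; move=> I _; apply; right.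
  by exists g, F0.
move=> F; apply: evp_ideal_gen => _ [/evp_plucker //|[g [F0 [ug h0 ->]]]].
by rewrite evp_gact; exact: h.
Qed.

End CoordinateChange.

(** * Passage from general to arbitrary coordinates along a line *)

Section Lines.
Context (R : comUnitRingType) (qR : {rmorphism rat -> R}) (K : fieldType) (rho : {rmorphism R -> K}).
Hypothesis unit_rho : forall x, (x \is a GRing.unit) = (rho x != 0).

Lemma natr_diff_unit (a b : nat) : a != b -> (b%:R - a%:R : R) \is a GRing.unit.
Proof.
move=> ne; rewrite -(rmorph_nat qR) -[a%:R](rmorph_nat qR) -rmorphB; apply: rmorph_unit.
by rewrite unitfE subr_eq0 eqr_nat eq_sym.
Qed.

(** Among the first [size P + size QK] natural numbers, fewer than [size QK] make [Q] a nonunit,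
    since they are distinct roots of its residue. At all the others [P] vanishes, and since
    differences of distinct integers are units, a nonzero [P] cannot have so many roots. *)
Lemma poly_vanish (P Q : {poly R}) : Q.[1] \is a GRing.unit ->
  (forall c : nat, Q.[c%:R] \is a GRing.unit -> P.[c%:R] = 0) -> P = 0.
Proof.
move=> Q1 h; apply/eqP/negPn/negP => P0; pose QK := map_poly rho Q.
have QKE c : rho Q.[c%:R] = QK.[c%:R] by rewrite -horner_map rmorph_nat.
have QK0 : QK != 0.
  apply: contraTneq Q1 => e; rewrite unit_rho negbK.
  by rewrite -[1]/(1%:R) QKE e horner0.
pose s := iota 0 (size P + size QK).
pose bad := [seq c <- s | QK.[c%:R] == 0].
have inj : injective (fun c : nat => c%:R : K) := natr_fieldI (rho \o qR).
have lt : (size bad < size QK)%N.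
  rewrite -(size_map (fun c : nat => c%:R : K)); apply: max_poly_roots => //.
    by apply/allP => _ /mapP[c hc ->]; move: hc; rewrite mem_filter => /andP[].
  by rewrite map_inj_uniq // filter_uniq ?iota_uniq.
pose good := [seq c <- s | QK.[c%:R] != 0].
have : (size [seq c%:R : R | c <- good] < size P)%N.
  apply: max_ring_poly_roots => //.
    apply/allP => _ /mapP[c hc ->]; apply/eqP/h; rewrite unit_rho QKE.
    by move: hc; rewrite mem_filter => /andP[].
  have : uniq good by rewrite filter_uniq ?iota_uniq.
  elim: good => //= c l IH /andP[cl ul]; rewrite IH // andbT.
  apply/allP => _ /mapP[c' hc' ->]; rewrite /diff_roots mulrC eqxx /=.
  by apply: natr_diff_unit; apply: contraNneq cl => ->.
rewrite size_map; have := count_predC (fun c : nat => QK.[c%:R] == 0) s.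
by rewrite -!size_filter -/bad -/good size_iota; lia.
Qed.

End Lines.

Section LineExtension.
Context (k : fieldType) (n : nat) (pt : {poly rat}) (d r p1 : nat).
Context (R : comUnitRingType) (io : {rmorphism k -> R}) (K : fieldType) (rho : {rmorphism R -> K}).
Hypothesis unit_rho : forall x, (x \is a GRing.unit) = (rho x != 0).
Context (qR : {rmorphism rat -> R}).
Local Notation p := (hval pt r).
Context (C : 'M[R]_(nmon n r, p)) (C1 : 'M[R]_(nmon n r.+1, p1)).
Context (J : midx (nmon n r) p) (J1 : midx (nmon n r.+1) p1) (g1 : 'M[R]_n.+1).
Hypothesis hJ : pl ((submx_ r g1)^T *m C) (val J) \is a GRing.unit.
Hypothesis hJ1 : pl ((submx_ r.+1 g1)^T *m C1) (val J1) \is a GRing.unit.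
Hypothesis hX : forall (i : 'I_n.+1) f, kerf C f -> kerf C1 ('X_i * f).
Hypothesis hZ : (#|Zset n d r :\: val J1| <= qsecond n pt d r)%N.

(** The line runs from [g] at parameter 0 to [g1] at parameter 1, where both minors are units. At
    every integer where they stay units [frakh_vanish] applies, so the equation is identically 0
    along the line, in particular at [g]. *)
Lemma frakh_vanish_all g F0 : frakh1 d F0 \/ frakh2 d F0 -> evp io ((submx_ r g)^T *m C) F0 = 0.
Proof.
move=> hF0; pose G : 'M[{poly R}]_n.+1 := map_mx polyC g + 'X *: map_mx polyC (g1 - g).
pose gc (c : R) := g + c *: (g1 - g).
have Gc c : map_mx (horner_eval c) G = gc c.
  by apply/matrixP => i j; rewrite !mxE /horner_eval !hornerE.
have GcC m q (X : 'M[R]_(m, q)) c : map_mx (horner_eval c) (map_mx polyC X) = X.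
  by apply/matrixP => i j; rewrite !mxE /horner_eval hornerC.
pose CX := (submx_ r G)^T *m map_mx polyC C.
pose C1X := (submx_ r.+1 G)^T *m map_mx polyC C1.
have CXc c : map_mx (horner_eval c) CX = (submx_ r (gc c))^T *m C.
  by rewrite map_mxM -map_trmx submx_map Gc GcC.
have C1Xc c : map_mx (horner_eval c) C1X = (submx_ r.+1 (gc c))^T *m C1.
  by rewrite map_mxM -map_trmx submx_map Gc GcC.
pose ioX := (polyC \o io : {rmorphism k -> {poly R}}).
have hio c x : horner_eval c (ioX x) = io x by rewrite /horner_eval /= hornerC.
have Fc F c : (evp ioX CX F).[c] = evp io ((submx_ r (gc c))^T *m C) F.
  by rewrite -[LHS]/(horner_eval c _) (evp_rmorph CX F (hio c)) CXc.
have F1c F c : (evp ioX C1X F).[c] = evp io ((submx_ r.+1 (gc c))^T *m C1) F.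
  by rewrite -[LHS]/(horner_eval c _) (evp_rmorph C1X F (hio c)) C1Xc.
have gc1 : gc 1 = g1 by rewrite /gc scale1r addrC subrK.
have P0 : evp ioX CX F0 = 0.
  apply: (@poly_vanish R qR K rho unit_rho _ (evp ioX CX (Delta (val J)) * evp ioX C1X (Delta (val J1)))).
    by rewrite hornerM Fc F1c !evp_Delta gc1 unitrM hJ.
  move=> c; rewrite hornerM Fc F1c !evp_Delta unitrM => /andP[u1 u2]; rewrite Fc.
  apply: (@frakh_vanish k n pt d r R io p1 _ _ J J1 u1 u2) => // i v hv c'.
  have kv : kerf C (lsub (gc c%:R) (pv v)).
    apply/kerf_lsub; first exact: pv_homog.
    by split=> [|x]; [exact: pv_homog|rewrite -[RHS](hv x); apply: eq_bigr => h _; rewrite pvE].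
  have : kerf ((submx_ r.+1 (gc c%:R))^T *m C1) ('X_i * pv v).
    have hXv : 'X_i * pv v \is r.+1.-homog.
      by apply: (homogXM (t := 1)); [rewrite mdeg1|exact: pv_homog].
    apply/kerf_lsub => //; rewrite rmorphM; apply: lsub_mulX_mem; first exact: subm_kerf.
    move=> u; rewrite mdeg1 => du; have [j ->] : exists j : 'I_n.+1, u = U_(j)%MM.
      have u0 : u != 0%MM by rewrite -mdeg_eq0 du.
      exists (mmin u); rewrite -[LHS](rmK u0) (_ : rm u = 0%MM) ?add0m //.
      by apply/eqP; rewrite -mdeg_eq0 mdeg_rm du.
    exact: hX.
  move=> [_ /(_ c')] e; apply: etrans e; rewrite pv_mulX; apply: eq_bigr => j _; congr (_ * _).
  by symmetry; exact: (pvE (fun x => \sum_l v l * Xi R i l x) j).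
have := Fc F0 0; rewrite P0 horner0 => ->; rewrite /gc scale0r addr0 //.
Qed.

End LineExtension.

Lemma frac_sub (K : fieldType) (a b s t : K) : s != 0 -> t != 0 ->
  (a * t - b * s) / (s * t) = a / s - b / t.
Proof. by move=> hs ht; field; rewrite hs ht. Qed.

Section LocalResidue.
Context (A : comNzRingType) (m : A -> Prop) (hm : maximal_ideal m).
Local Notation R := (loc hm).
Local Notation K := (resf hm).

Lemma loc_residue : exists rho : {rmorphism R -> K},
  (forall x, (x \is a GRing.unit) = (rho x != 0)) /\ forall a, rho (locpi hm a) = respi hm a.
Proof.
have ex (x : R) : exists z : A * A, ~ m z.2 /\ locpi hm z.2 * x = locpi hm z.1.
  by have [a [s [hs e]]] := loc_surj x; exists (a, s).
have [z hz] := choice ex.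
have nz s : ~ m s -> respi hm s != 0 by move=> h; apply/eqP => /(respi_eq0 hm).
pose f (x : R) : K := respi hm (z x).1 / respi hm (z x).2.
have fE x a s : ~ m s -> locpi hm s * x = locpi hm a -> f x = respi hm a / respi hm s.
  move=> hs e; have [hs' e'] := hz x; apply/eqP; rewrite eqr_div ?nz // -!rmorphM.
  have : locpi hm ((z x).1 * s - a * (z x).2) = 0.
    by rewrite rmorphB !rmorphM /= -e -e' ; apply/eqP; rewrite subr_eq0; apply/eqP; ring.
  move/locpi_eq0 => [u hu eu]; rewrite -subr_eq0 -rmorphB; apply/eqP/(respi_eq0 hm).
  apply: contrapT => h; apply: (maximal_idealM hm hu h); rewrite eu.
  by case: hm => -[].
have f1 : f 1 = 1 by rewrite (fE 1 1 1) ?rmorph1 ?divr1 ?mulr1 //; case: hm.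
have fB : zmod_morphism f.
  move=> x y; have [hs e] := hz x; have [ht e'] := hz y.
  rewrite (fE (x - y) ((z x).1 * (z y).2 - (z y).1 * (z x).2) ((z x).2 * (z y).2)).
  - by rewrite rmorphB !rmorphM /= frac_sub //; exact: nz.
  - exact: maximal_idealM.
  by rewrite rmorphB !rmorphM /= -e -e'; ring.
have fM : monoid_morphism f.
  split=> // x y; have [hs e] := hz x; have [ht e'] := hz y.
  rewrite (fE (x * y) ((z x).1 * (z y).1) ((z x).2 * (z y).2)).
  - by rewrite !rmorphM /f /= mulf_div.
  - exact: maximal_idealM.
  by rewrite !rmorphM /= -e -e'; ring.
pose F0 := GRing.isZmodMorphism.Build R K f fB.
pose F1 := GRing.isMonoidMorphism.Build R K f fM.
pose rho : {rmorphism R -> K} := HB.pack f F0 F1.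
exists rho; split=> [x|a]; last first.
  by rewrite -[LHS]/(f _) (fE _ a 1) ?rmorph1 ?divr1 ?mul1r //; case: hm.
rewrite -[rho x]/(f x); have [hs e] := hz x.
rewrite /f mulf_eq0 invr_eq0 (negbTE (nz _ hs)) orbF.
have -> : (x \is a GRing.unit) = (locpi hm (z x).1 \is a GRing.unit).
  by rewrite -e unitrM (ll_unit hm hs).
apply/idP/idP => [/locpi_unit|h]; first exact: nz.
by apply/locpi_unit => h'; case/eqP: h; apply/(respi_eq0 hm).
Qed.

End LocalResidue.

(** A converse of [kerf_free_mod]: the rows of [C] are the coordinates of all monomials in the
    standard ones, so the block at [J] is the identity. *)
Lemma free_mod_matrix n t p (R : comUnitRingType) (I : {mpoly R[n.+1]} -> Prop) N : subm I ->
  free_mod t I N -> cnt t 0 N = p -> exists (C : 'M[R]_(nmon n t, p)) (J : midx (nmon n t) p),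
  [/\ val J = [set h | N (alpha h)], rowsub (elt J) C = 1%:M
    & forall f, f \is t.-homog -> I f <-> kerf C f].
Proof.
move=> sI [h1 h2] ct.
have hJ : #|[set h : 'I_(nmon n t) | N (alpha h)]| == p.
  by rewrite -ct /cnt count_alpha; apply/eqP/eq_card => l; rewrite !inE
    (_ : supge 0 _) ?andbT //; apply/supgeP.
pose J : midx (nmon n t) p := exist (fun J0 : {set 'I_(nmon n t)} => #|J0| == p) _ hJ.
have ex (x : 'I_(nmon n t)) : exists h, supported t N h /\ I ('X_[alpha x] - h).
  by have [|h hh Ih] := h1 'X_[alpha x]; [apply: homogX; exact: mdeg_alpha|exists h].
have [h hh] := choice ex.
pose C : 'M[R]_(nmon n t, p) := \matrix_(x, b) (h x)@_(alpha (elt J b)).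
have eJ b : N (alpha (elt J b)) by have := elt_in J b; rewrite inE.
have hX x : N (alpha x) -> h x = 'X_[alpha x].
  move=> Nx; apply/eqP; rewrite -subr_eq0 -oppr_eq0 opprB; apply/eqP/h2; last by case: (hh x).
  by apply: (submB (subm_supported R t N)) (hh x).1; apply: supportedX => //; exact: mdeg_alpha.
exists C, J; split=> //.
  apply/matrixP => b b'; rewrite !mxE hX // mcoeffX (inj_eq (@alpha_inj n t)).
  by rewrite (inj_eq (@elt_inj _ _ J)).
move=> f hf; pose hf0 := \sum_x f@_(alpha x) *: h x.
have I0 : I (f - hf0).
  rewrite [f in f - _](homog_pv hf) -sumrB; apply: subm_sum => // x _.
  by rewrite -scalerBr; case: sI => _ _; apply; case: (hh x).
have s0 : supported t N hf0.
  apply: subm_sum => [|x _]; first exact: subm_supported.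
  by case: (subm_supported R t N) => _ _; apply; case: (hh x).
have hC b : \sum_x f@_(alpha x) * C x b = hf0@_(alpha (elt J b)).
  rewrite /hf0 (raddf_sum (mcoeff _)); apply: eq_bigr => x _.
  by rewrite mxE; symmetry; exact: mcoeffZ.
split=> [If|[_ kf]].
  split=> // b; rewrite hC (h2 hf0) ?mcoeff0 //; exact: (subm_sub sI I0 If).
suff z0 : hf0 = 0 by rewrite z0 subr0 in I0.
suff : (hf0 : {mpoly R[n.+1]}) = 0 by [].
apply/mpolyP => u; rewrite mcoeff0.
have [//|nz] := eqVneq hf0@_u 0; have [du Nu] := s0 _ nz; have [x ex'] := alphaP du.
have [b eb] : exists b, elt J b = x by apply: eltP; rewrite inE ex'.
by rewrite -ex' -eb -hC kf.
Qed.

Lemma lsub_clear n (A B : comNzRingType) (phi : {rmorphism A -> B}) (M M' : 'M[A]_n.+1) s q H h :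
  M' *m M = 1%:M -> phi s *: h = map_mpoly phi H ->
  map_mpoly phi (s *: q - lsub M H) =
  phi s *: lsub (map_mx phi M) (map_mpoly phi (lsub M' q) - h).
Proof.
move=> e eh; rewrite linearB /= -lsub_map lsub_comp e lsub1 scalerBr -linearZ /= eh -lsub_map.
by rewrite rmorphB /= map_mpolyZ.
Qed.

Lemma lsub_expand n t (R : comNzRingType) (M : 'M[R]_n.+1) (f : {mpoly R[n.+1]}) : f \is t.-homog ->
  lsub M f = \sum_(x : 'I_(nmon n t)) f@_(alpha x) *: lsub M 'X_[alpha x].
Proof.
move=> hf; rewrite [in LHS](homog_pv hf) linear_sum.
by apply: eq_bigr => x _; rewrite /= linearZ.
Qed.

Section ForwardGlobal.
Context (k : fieldType) (fq : {rmorphism rat -> k}) (hfq : forall x, fq x = ratr x).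
Context (n : nat) (pt : {poly rat}) (d : nat) (a : seq nat).
Local Notation r := (size a).
Local Notation p := (hval pt r).
Local Notation p1 := (hval pt r.+1).
Hypothesis sa : sorted geq a.
Hypothesis ad : all (fun x => x <= d)%N a.
Hypothesis hpt : forall t, (r <= t)%N -> pt.[t%:R] = (gval t a)%:R.
Hypothesis hv : forall t, (r <= t)%N -> hval pt t = gval t a.
Context (A : comAlgType k) (nA : noetherian A) (X : charts n A).
Hypothesis hX : hilbert_functor pt X.

Definition qalg : {rmorphism rat -> A} := (in_alg A \o fq : {rmorphism rat -> A}).

Let cX : closed_subscheme X. Proof. by case: hX. Qed.

Lemma hilbert_forward (m : A -> Prop) (hm : maximal_ideal m) :
  exists (g : 'M[rat]_n.+1) (N : pred 'X_{1..n.+1}),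
  [/\ g \in unitmx, borel r N, cnt r 0 N = p, cnt r.+1 0 (grow N) = p1
    & forall t, free_mod (t + r)
        (fun f => locl (hm := hm) (secs X) (lsub (map_mx (locpi hm) (map_mx qalg g)) f)) (iter t grow N)].
Proof.
have [_ fX fib] := hX.
have hY := fib _ (respi hm : {rmorphism A -> resf hm}) (respi_residue_field (hm := hm)).
rewrite !hv //.
exact: (forward_local qalg cX fX sa hpt hY).
Qed.

Lemma scrH_secs (v : 'rV[A]_(nmon n r)) : scrH X v <-> secs X (pv (fun j => v 0 j)).
Proof.
have hh := pv_homog (fun j => v 0 j).
split=> [[_ h]|/(secs_homog cX hh) h]; first by apply/(secs_homog cX hh).
by split.
Qed.

(** The matrices of degrees [r] and [r + 1] are found in the coordinates [gR] and transported back,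
    so that one [C] describes the point and [frakh_vanish_all] tests it in every coordinate
    system. *)
Lemma local_matrix (m : A -> Prop) (hm : maximal_ideal m) :
  exists (C : 'M[loc hm]_(nmon n r, p)) (B : 'M[loc hm]_(p, nmon n r)),
  [/\ forall f, f \is r.-homog -> locl (hm := hm) (secs X) f <-> kerf C f, B *m C = 1%:M
    & forall F, frakH k n pt d r F -> evp (locpi hm \o in_alg A : {rmorphism k -> loc hm}) C F = 0].
Proof.
have [g [N [ug bN c1 c2 fr]]] := hilbert_forward hm.
have sL := subm_locl hm (subm_secs cX).
set gR := map_mx (locpi hm) (map_mx qalg g) in fr.
pose gV := map_mx (locpi hm) (map_mx qalg (invmx g)).
have gVg : gV *m gR = 1%:M by rewrite -!map_mxM mulVmx // !map_mx1.
have ggV : gR *m gV = 1%:M by rewrite -!map_mxM mulmxV // !map_mx1.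
have [C' [J [JE CJ IC]]] := free_mod_matrix (subm_lsub gR sL) (fr 0%N) c1.
have [C1' [J1 [J1E C1J IC1]]] := free_mod_matrix (subm_lsub gR sL) (fr 1%N) c2.
have conv t q (D : 'M[loc hm]_(nmon n t, q)) :
    (forall f, f \is t.-homog -> locl (hm := hm) (secs X) (lsub gR f) <-> kerf D f) ->
    forall f, f \is t.-homog -> locl (hm := hm) (secs X) f <-> kerf ((submx_ t gV)^T *m D) f.
  move=> h f hf; rewrite kerf_lsub // -h; last exact: lsub_homog.
  by rewrite lsub_comp gVg lsub1.
have back t q (D : 'M[loc hm]_(nmon n t, q)) : (submx_ t gR)^T *m ((submx_ t gV)^T *m D) = D.
  by rewrite mulmxA -trmx_mul -submx_comp ggV submx1 trmx1 mul1mx.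
pose C := (submx_ r gV)^T *m C'; pose C1 := (submx_ r.+1 gV)^T *m C1'.
have hC := conv r p C' IC; have hC1 := conv r.+1 p1 C1' IC1.
exists C, (rowsub (elt J) (submx_ r gR)^T); split=> //.
  by rewrite mul_rowsub_mx back.
have [rho [hrho _]] := loc_residue hm.
apply/(evp_frakH hfq d) => g0 F0 _ h0.
apply: (@frakh_vanish_all k n pt d r p1 (loc hm) _ (resf hm) rho hrho
  (locpi hm \o qalg) C C1 J J1 gR) => //.
- by rewrite back -pl_det CJ det1 unitr1.
- by rewrite back -pl_det C1J det1 unitr1.
- move=> i f kf; have [hf _] := kf.
  have hXf : 'X_i * f \is r.+1.-homog by apply: (homogXM (t := 1)); rewrite ?mdeg1.
  by apply/(hC1 _ hXf); apply: locl_mulX; [move=> *; exact: secs_mulX|apply/(hC _ hf)].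
have hd u : mdeg u = r -> N u -> ~~ supge d.+1 u.
  by apply: (@borel_no_last n r N a) => //; rewrite c1 hv.
have sub : val J1 \subset Zset n d r.
  by apply/subsetP => l; rewrite J1E inE mmin_Zset; exact: grow_Zset.
by rewrite cardsD (setIidPr sub) (eqP (valP J1)) qsecond_Zset.
Qed.

Lemma scrH_submodule : submodule (scrH X (r := r)).
Proof.
have [s0 sD sZ] := subm_secs cX; split.
- apply/scrH_secs; rewrite (_ : pv _ = 0) //.
  by rewrite /pv big1 // => h _; rewrite mxE scale0r.
- move=> u v /scrH_secs hu /scrH_secs hv'; apply/scrH_secs.
  rewrite (_ : pv _ = pv (fun j => u 0 j) + pv (fun j => v 0 j)); first exact: sD.
  by rewrite /pv -big_split; apply: eq_bigr => h _; rewrite mxE scalerDl.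
move=> c v /scrH_secs h; apply/scrH_secs.
rewrite (_ : pv _ = c *: pv (fun j => v 0 j)); first exact: sZ.
by rewrite /pv scaler_sumr; apply: eq_bigr => x _; rewrite mxE scalerA.
Qed.

Lemma pv_row (q : nat) (u : 'I_q -> A) (W : 'M[A]_(q, nmon n r)) :
  pv (fun y => \sum_b u b * W b y) = \sum_b u b *: pv (fun y => W b y).
Proof. exact: pv_lin. Qed.

(** The rows of [E] are the substituted standard monomials. They are a basis of the quotient after
    localization at [m]; clearing the denominators of finitely many relations makes them one over an
    open set [D(f)]. *)
Lemma scrH_grassmann : grassmann_functor p (scrH X (r := r)).
Proof.
split; first exact: scrH_submodule.
apply: ideal_local_global => [|m hm]; first exact: ideal_gen_ideal.
have [g [N [ug bN c1 _ fr]]] := hilbert_forward hm.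
have sS := subm_secs cX; have sL := subm_locl hm sS.
set gA := map_mx qalg g in fr; set gR := map_mx (locpi hm) gA in fr.
have gVg : map_mx qalg (invmx g) *m gA = 1%:M by rewrite -map_mxM mulVmx // map_mx1.
have [C' [J [JE CJ IC]]] := free_mod_matrix (subm_lsub gR sL) (fr 0%N) c1.
pose E : 'M[A]_(p, nmon n r) := (colsub (elt J) (submx_ r gA))^T.
have eE b : pv (fun y => E b y) = lsub gA 'X_[alpha (elt J b)].
  rewrite [RHS](@homog_pv _ r); last by apply: lsub_homog; apply: homogX; exact: mdeg_alpha.
  by apply: eq_pv => y; rewrite !mxE.
have NJ b : N (alpha (elt J b)) by have := elt_in J b; rewrite JE inE.
have span1 (j : 'I_(nmon n r)) : exists z : A * 'rV[A]_p, ~ m z.1 /\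
    secs X (z.1 *: 'X_[alpha j] - \sum_b z.2 0 b *: pv (fun y => E b y)).
  have hj : lsub (map_mx qalg (invmx g)) 'X_[alpha j] \is r.-homog.
    by apply: lsub_homog; apply: homogX; exact: mdeg_alpha.
  have [h hh Ih] := (fr 0%N).1 _ (homog_map (locpi hm) hj).
  have [s [H [hs eH H0]]] := mpoly_clear_den h.
  have hH : supported r N H by move=> u nz; apply: hh; apply: contraNneq nz => /H0 ->.
  have : locl (hm := hm) (secs X) (map_mpoly (locpi hm) (s *: 'X_[alpha j] - lsub gA H)).
    rewrite (lsub_clear (h := h) _ gVg eH).
    by case: sL => _ _; apply.
  move/(locl_map hm _ sS) => [u hu hS].
  exists (u * s, \row_b (u * H@_(alpha (elt J b)))); split; first exact: maximal_idealM.
  have <- : u *: (s *: 'X_[alpha j] - lsub gA H) =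
    (u * s) *: 'X_[alpha j] - \sum_b (\row_b (u * H@_(alpha (elt J b)))) 0 b *: pv (fun y => E b y).
    rewrite scalerBr scalerA; congr (_ - _).
    rewrite (lsub_expand _ (supported_homog hH)) scaler_sumr.
    rewrite (bigID (mem (val J))) /= [X in _ + X]big1 ?addr0 => [|x]; last first.
      rewrite JE inE => Nx; have [->|/hH[_ Nx']] := eqVneq H@_(alpha x) 0.
        by rewrite scale0r scaler0.
      by rewrite /= Nx' in Nx.
    rewrite -[in LHS](elt_imset J) big_imset /=; last by move=> y y' _ _; exact: elt_inj.
    rewrite big_mkcond /=; apply: eq_bigr => b _; by rewrite inE eE mxE scalerA.
  exact: hS.
have [z hz] := choice span1.
have [s0 ns0 tors] := noetherian_torsion nA hm.
(* The second factor clears the denominators of the spanning relations. The factor [s0] kills all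
   torsion at [m] at once, as independence over [D(f)] requires; this is where [A] has to be
   noetherian. *)
pose f := s0 * \prod_j (z j).1.
exists f.
  by apply: maximal_idealM => //; apply: maximal_ideal_prod => // j _; case: (hz j).
move=> I' _; apply; exists E; split=> [v|c Lc].
  pose q j := s0 * \prod_(i | i != j) (z i).1.
  have ef j : f = q j * (z j).1.
    by rewrite /f /q [X in _ * X = _](bigD1 j) //=; ring.
  exists 1%N, (\row_b \sum_j v 0 j * q j * (z j).2 0 b); rewrite expr1; apply/scrH_secs.
  rewrite (_ : pv _ = \sum_j (v 0 j * q j) *:
      ((z j).1 *: 'X_[alpha j] - \sum_b (z j).2 0 b *: pv (fun y => E b y))).
    apply: subm_sum => // j _; case: sS => _ _; apply; by case: (hz j).
  rewrite (eq_bigr (fun j => (v 0 j * f) *: 'X_[alpha j] -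
     \sum_b (v 0 j * q j * (z j).2 0 b) *: pv (fun y => E b y))); last first.
    move=> j _; rewrite scalerBr scalerA -mulrA -ef scaler_sumr; congr (_ - _).
    by apply: eq_bigr => b _; rewrite scalerA.
  rewrite sumrB exchange_big /=.
  under [X in _ = _ - X]eq_bigr => b _ do rewrite -scaler_suml.
  rewrite -pv_row /pv -sumrB; apply: eq_bigr => y _; rewrite -scalerBl; congr (_ *: _).
  rewrite !mxE mulrC; congr (_ - _); apply: eq_bigr => b _; congr (_ * _).
  by rewrite mxE.
exists 1%N; rewrite expr1; move/scrH_secs: Lc.
pose H : {mpoly A[n.+1]} := \sum_b c 0 b *: 'X_[alpha (elt J b)].
have -> : pv (fun y => (c *m E) 0 y) = lsub gA H.
  rewrite /H linear_sum (eq_pv (w := fun y => \sum_b c 0 b * E b y)); last by move=> y; rewrite mxE.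
  by rewrite pv_row; apply: eq_bigr => b _; rewrite eE linearZ.
move=> SH; have hH : supported r N (map_mpoly (locpi hm) H).
  rewrite rmorph_sum; apply: subm_sum => [|b _]; first exact: subm_supported.
  rewrite /= map_mpolyZ map_mpolyX; case: (subm_supported (loc hm) r N) => _ _; apply.
  by apply: supportedX => //; exact: mdeg_alpha.
have H0 : map_mpoly (locpi hm) H = 0.
  by apply: (fr 0%N).2 => //; rewrite -lsub_map; exact: mem_locl.
have cb b : locpi hm (c 0 b) = 0.
  have := congr1 (mcoeff (alpha (elt J b))) H0; rewrite mcoeff0 mcoeff_map_mpoly.
  rewrite raddf_sum (bigD1 b) //= mcoeffZ mcoeffX eqxx mulr1 big1 ?addr0 // => b' ne.
  by rewrite mcoeffZ mcoeffX (inj_eq (@alpha_inj n r)) (inj_eq (@elt_inj _ _ J)) (negbTE ne) mulr0.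
apply/rowP => b; rewrite !mxE; have /locpi_eq0[u hu e] := cb b.
by rewrite mulrAC (tors _ _ hu e) mul0r.
Qed.

(** After multiplication by a power of [f], the given coordinates [C] are [Cm] times a square
    matrix. A homogeneous equation then changes by a power of the determinant, so it vanishes
    because it does at [Cm]. *)
Lemma scrH_plucker e F : frakH k n pt d r F -> F \is e.-homog -> plucker_vanish F (scrH X (r := r)).
Proof.
move=> HF hF f E mm C [f1 f2] fC; have [_ LD LZ] := scrH_submodule.
change (exists s : nat, f ^+ s * evp (in_alg A) C F = 0); set y := evp _ _ _.
pose I x := exists s, f ^+ s * (x * y) = 0.
have iI : is_ideal I.
  split; first by exists 0%N; rewrite mul0r mulr0.
    move=> x x' [s hs] [s' hs']; exists (s + s')%N.
    by rewrite exprD mulrDl mulrDr mulrAC hs mul0r add0r -mulrA hs' mulr0.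
  by move=> c x [s hs]; exists s; rewrite -mulrA mulrCA hs mulr0.
suff [s hs] : I 1 by exists s; rewrite mul1r in hs.
apply: ideal_local_global => // m hm.
have [Cm [B [hCm BC vCm]]] := local_matrix hm.
have sS := subm_secs cX; pose CR := map_mx (locpi hm) C.
have row0 (j : 'I_(nmon n r)) : exists s, forall s', (s <= s')%N -> forall c,
    locpi hm f ^+ s' * (CR j c - (Cm *m (B *m CR)) j c) = 0.
  (* Row [j] of [1 - Cm B]. It is in the kernel of [Cm] because [B Cm = 1], hence a local section;
     with its denominators cleared it is in the submodule, and freeness over [D(f)] makes its
     product with [C] torsion. *)
  pose w : 'I_(nmon n r) -> loc hm := fun x => (j == x)%:R - (Cm *m B) j x.
  have kw : kerf Cm (pv w).
    split=> [|c]; first exact: pv_homog.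
    under eq_bigr => x _ do rewrite pvE mulrBl.
    rewrite sumrB (bigD1 j) //= eqxx mul1r big1 ?addr0 => [|x ne]; last first.
      by rewrite eq_sym (negbTE ne) mul0r.
    by have := congr1 (fun M : 'M_(_, _) => (Cm *m M) j c) BC; rewrite mulmx1 mulmxA mxE => ->; rewrite subrr.
  have [u [F0 [hu SF0 eF0]]] := (hCm _ (pv_homog w)).2 kw.
  have [v [V [hv' eV V0]]] := mpoly_clear_den (pv w).
  have hV : V \is r.-homog.
    apply/dhomogP => x; rewrite mcoeff_msupp => nz; apply/eqP; apply: contraNT nz => ne.
    by rewrite V0 // (dhomog_nemf_coeff (pv_homog w)).
  have : locl (hm := hm) (secs X) (map_mpoly (locpi hm) V).
    by rewrite -eV; case: (subm_locl hm sS) => _ _; apply; exists u, F0.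
  move/(locl_map hm _ sS) => [u' hu' SV].
  pose w0 : 'rV[A]_(nmon n r) := \row_x (u' * V@_(alpha x)).
  have Lw0 : scrH X w0.
    apply/scrH_secs; rewrite (_ : pv _ = u' *: V) //.
    rewrite [in RHS](homog_pv hV) /pv scaler_sumr; apply: eq_bigr => x _.
    by rewrite mxE scalerA.
  have ew0 x : locpi hm (w0 0 x) = locpi hm (u' * v) * w x.
    have := congr1 (mcoeff (alpha x)) eV; rewrite mcoeffZ pvE mcoeff_map_mpoly /= => e'.
    by rewrite mxE !rmorphM /= -e' mulrA.
  have Lc : scrH X ((w0 *m C) *m E).
    have h1 : scrH X (f ^+ mm *: w0) by exact: LZ.
    have h2 : scrH X (\sum_x w0 0 x *: (f ^+ mm *: delta_mx 0 x - row x C *m E)).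
      by apply: (subm_sum (Q := scrH X (r := r))) => [|x _]; [exact: scrH_submodule|exact: LZ].
    have -> : w0 *m C *m E = f ^+ mm *: w0 - \sum_x w0 0 x *: (f ^+ mm *: delta_mx 0 x - row x C *m E).
      rewrite [in w0 *m C]mulmx_sum_row mulmx_suml [X in _ = f ^+ mm *: X - _]row_sum_delta.
      rewrite scaler_sumr -sumrB; apply: eq_bigr => x _.
      by rewrite scalerBr -scalemxAl !scalerA mulrC opprB addrC subrK.
    by apply: (submB (Q := scrH X (r := r))) => //; exact: scrH_submodule.
  have [s hs] := f2 _ Lc; exists s => s' le c.
  have es : f ^+ s' *: (w0 *m C) = 0 by rewrite -(subnK le) exprD -scalerA hs scaler0.
  have := congr1 (fun M : 'rV_p => locpi hm (M 0 c)) es; rewrite !mxE rmorph0 rmorphM rmorphXn rmorph_sum /=.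
  under eq_bigr => x _ do rewrite rmorphM /= ew0 -mulrA.
  rewrite -mulr_sumr mulrCA => e'; have uu : locpi hm (u' * v) \is a GRing.unit.
    by apply: ll_unit; exact: maximal_idealM.
  apply: (mulrI uu); rewrite mulr0 -[RHS]e'; congr (_ * (_ * _)).
  rewrite /w; under [RHS]eq_bigr => x _ do rewrite mulrBl.
  rewrite sumrB; congr (_ - _).
    rewrite (bigD1 j) //= eqxx mul1r big1 ?addr0 // => x ne.
    by rewrite eq_sym (negbTE ne) mul0r.
  transitivity ((Cm *m (B *m CR)) j c); first by rewrite [RHS]mxE.
  by rewrite mulmxA mxE; apply: eq_bigr => x _; rewrite [CR _ _]mxE.
have [s hs] := choice row0; pose S := (\max_j s j)%N.
have eC : (locpi hm f ^+ S) *: CR = (locpi hm f ^+ S) *: (Cm *m (B *m CR)).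
  apply/matrixP => j c; rewrite [LHS]mxE [RHS]mxE; apply/eqP; rewrite -subr_eq0 -mulrBr.
  by apply/eqP; apply: hs; exact: leq_bigmax.
have eY : locpi hm y = evp (locpi hm \o in_alg A : {rmorphism k -> loc hm}) CR F.
  exact: evp_rmorph.
have : locpi hm (f ^+ (S * (p * e)) * y) = 0.
  rewrite rmorphM rmorphXn exprM /= eY -(evp_scale_mx _ CR _ hF) eC (evp_scale_mx _ _ _ hF).
  by rewrite (evp_mulmx _ _ _ hF) vCm // !mulr0.
by move/locpi_eq0 => [u hu e']; exists u => //; exists (S * (p * e))%N; rewrite mulrCA.
Qed.

Theorem hilbert_cut_out : cut_out (frakH k n pt d r) (scrH X (r := r)).
Proof. by split=> [|e F HF hF]; [exact: scrH_grassmann|exact: (scrH_plucker HF hF)]. Qed.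

End ForwardGlobal.

(** * Degrees of the equations *)

Section HomogeneousIdeals.
Context (k : fieldType) (n : nat).
Local Notation S := {mpoly k[n]}.

Lemma homogeneous_ideal_gen (G : S -> Prop) F e : (forall x, G x -> exists e, x \is e.-homog) ->
  ideal_gen G F -> ideal_gen G (pihomog [measure of mdeg] e F).
Proof.
move=> hG hF; have [i0 iD iM] := ideal_gen_ideal G.
apply: (hF (fun F => forall e, ideal_gen G (pihomog [measure of mdeg] e F))); first split.
- by move=> s; rewrite pihomog0.
- by move=> x y hx hy s; rewrite pihomogD; exact: iD.
- move=> a x hx s; rewrite (mpolyE a) mulr_suml raddf_sum; apply: ideal_sum => // m _ /=.
  rewrite -scalerAl linearZ /= -mul_mpolyC; apply: (iM); rewrite pihomogMX.
  by case: ifP => _ //; apply: (iM).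
move=> x Gx s; have [t hx] := hG x Gx; have [<-|ne] := eqVneq t s.
  by rewrite pihomog_dE //; move=> I _; apply.
by rewrite (pihomog_ne0 ne hx).
Qed.

Lemma homog_comp m (lq : n.-tuple {mpoly k[m]}) F e : (forall i, tnth lq i \is 1.-homog) ->
  F \is e.-homog -> (F \mPo lq) \is e.-homog.
Proof.
move=> hl hF; rewrite (mpolyE F) raddf_sum /= big_seq; apply: rpred_sum => u uF.
rewrite comp_mpolyZ; apply: rpredZ; rewrite comp_mpolyX.
have <- : (\sum_i u i)%N = e by rewrite -mdegE; exact: (dhomog_mf hF uF).
apply: (big_ind2 (fun (x : {mpoly k[m]}) s => x \is s.-homog)) => [|x s y s' hx hy|i _].
- exact: dhomog1.
- exact: dhomogM.
by rewrite -[X in X.-homog]mul1n; exact: dhomogMn.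
Qed.

End HomogeneousIdeals.

Section EquationDegrees.
Context (k : fieldType) (N p : nat).
Local Notation R := (plring k N p).

Lemma Delta_homog (J : {set 'I_N}) : (Delta J : R) \is 1.-homog.
Proof.
rewrite /Delta; case: insubP => [j _ _|_]; last exact: rpred0.
by rewrite dhomogX /= mdeg1.
Qed.

Lemma eps_homog M (K H : {set 'I_M}) (x : R) e : x \is e.-homog -> eps K H * x \is e.-homog.
Proof.
by move=> hx; rewrite /eps -signr_odd; case: odd; rewrite ?expr0 ?expr1 ?mul1r ?mulN1r ?rpredN.
Qed.

Lemma plucker_homog (F : R) : plucker_rel F -> F \is 2.-homog.
Proof.
move=> [S [K [_ _ ->]]]; apply: rpred_sum => l _; rewrite -!mulrA; do 2!apply: eps_homog.
by apply: (dhomogM (d := 1) (e := 1)); exact: Delta_homog.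
Qed.

Section Exterior.
Context (M : nat).
Local Notation ext := {ffun {set 'I_M} -> R}.

Definition chomog e (u : ext) := forall S, u S \is e.-homog.

Lemma chomog_wedge e e' u v : chomog e u -> chomog e' v -> chomog (e + e') (wedge u v).
Proof.
move=> hu hv S; rewrite ffunE; apply: rpred_sum => T _; rewrite -mulrA; apply: eps_homog.
exact: dhomogM.
Qed.

Lemma chomog_wedge1 : chomog 0 (wedge1 : ext).
Proof. by move=> S; rewrite ffunE; case: eqP => _; rewrite ?rpred0 ?dhomog1. Qed.

Lemma chomog_prod (I : Type) (s : seq I) (P : pred I) e (u : I -> ext) :
  (forall i, P i -> chomog e (u i)) ->
  chomog (\sum_(i <- s | P i) e)%N (\big[@wedge M R/wedge1]_(i <- s | P i) u i).
Proof.
move=> h; apply: (big_ind2 (fun (v : ext) s => chomog s v)) => [|x s1 y s2 hx hy|i Pi].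
- exact: chomog_wedge1.
- exact: chomog_wedge.
exact: h.
Qed.

End Exterior.
End EquationDegrees.

Section HomogeneousEquations.
Context (k : fieldType) (n : nat) (pt : {poly rat}) (d r : nat).
Local Notation p := (hval pt r).
Local Notation R := (plring k (nmon n r) p).

Lemma chomog_delta m K : chomog 1 (delta k pt m K : {ffun {set 'I_(nmon n r)} -> R}).
Proof.
move=> S; rewrite ffunE; case: ifP => _; last exact: rpred0.
by apply: eps_homog; exact: Delta_homog.
Qed.

Lemma chomog_mulx (i : 'I_n.+1) e (u : {ffun {set 'I_(nmon n r)} -> R}) :
  chomog e u -> chomog e (mulx i u : {ffun {set 'I_(nmon n r.+1)} -> R}).
Proof.
move=> hu S; rewrite ffunE; apply: rpred_sum => H _; rewrite -[e]addn0; apply: dhomogM => //.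
have := @chomog_prod k (nmon n r) p (nmon n r.+1) _ (enum H) predT 0
  (fun h => monomial1 k pt r (U_(i) + alpha h)%MM).
rewrite big1_eq; apply => h _ T; rewrite ffunE.
by case: eqP => _; rewrite ?rpred0 ?dhomog1.
Qed.

Lemma card_le_vars : (\sum_(i < n.+1 | (i <= d)%N) 1 <= d.+1)%N.
Proof.
rewrite sum1_card -(size_iota 0 d.+1) cardE -(size_map val).
apply: uniq_leq_size; first by rewrite map_inj_uniq ?enum_uniq //; exact: val_inj.
by move=> x /mapP[i]; rewrite mem_enum mem_iota => h ->.
Qed.

(** Each factor is linear in the Pluecker coordinates, whatever its exterior degree [m_i]. The
    degree is thus the number of variables used, at most [d + 1]; an element of [calW] adds one
    more. *)
Lemma wedge_product_homog s u : wedge_product d s u ->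
  exists2 e, (e <= d.+1)%N & chomog e (u : {ffun {set 'I_(nmon n r.+1)} -> R}).
Proof.
move=> [m [K [_ _ ->]]]; exists (\sum_(i < n.+1 | (i <= d)%N && (0 < m i)%N) 1)%N.
  apply: leq_trans card_le_vars; rewrite big_mkcondr /=; apply: leq_sum => i _.
  by case: ifP.
by apply: chomog_prod => i _; apply: chomog_mulx; exact: chomog_delta.
Qed.

Lemma frakh_homog (F : R) : frakh1 d F \/ frakh2 d F -> exists2 e, (e <= d.+2)%N & F \is e.-homog.
Proof.
case=> [[u [S [/wedge_product_homog[e le hu] _ ->]]]|[u [w [S [/wedge_product_homog[e le hu] hw _ ->]]]]].
  by exists e => //; apply: leq_trans le _.
exists (e + 1)%N; first by rewrite addn1.
apply: chomog_wedge => //; case: hw => [H [H' [h [h' [j [l [sgn [_ _ _ -> _]]]]]]]] T.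
rewrite ffunE; apply: rpredD; first by apply: chomog_mulx; exact: chomog_delta.
by rewrite ffunE; apply: rpredZ; apply: chomog_mulx; exact: chomog_delta.
Qed.

Lemma gact_homog (g : 'M[rat]_n.+1) (F : R) e : F \is e.-homog -> gact g F \is e.-homog.
Proof.
move=> hF; apply: homog_comp => // i; rewrite tnth_mktuple.
by apply: rpred_sum => I _; apply: rpredZ; exact: Delta_homog.
Qed.

Lemma frakH_homogeneous : homogeneous_ideal (frakH k n pt d r).
Proof.
split=> [|F hF e]; first exact: ideal_gen_ideal.
apply: homogeneous_ideal_gen hF => x [/plucker_homog|[g [F0 [_ /frakh_homog[e' _ h] ->]]]].
  by exists 2%N.
by exists e'; exact: gact_homog.
Qed.

Lemma frakH_degree : generated_in_degree (frakH k n pt d r) d.+2.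
Proof.
exists (fun F => exists (g : 'M[rat]_n.+1) (F0 : R),
  [/\ g \in unitmx, frakh1 d F0 \/ frakh2 d F0 & F = gact g F0]).
split=> // F [g [F0 [_ /frakh_homog[e le h] ->]]]; exists e => //.
exact: gact_homog.
Qed.

End HomogeneousEquations.

(** * From the equations to the Hilbert functor *)

Section ExtensionOfForms.
Context (n : nat) (A R : comNzRingType) (phi : {rmorphism A -> R}).
Implicit Types (L : {mpoly A[n.+1]} -> Prop).

Definition extend L : {mpoly R[n.+1]} -> Prop :=
  span (fun g => exists2 f, L f & g = map_mpoly phi f).

Lemma mem_extend L f : L f -> extend L (map_mpoly phi f).
Proof. by move=> h; apply: mem_span; exists f. Qed.

Lemma mulS_extend t L f : mulS t L f -> mulS t (extend L) (map_mpoly phi f).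
Proof.
have sM : subm (mulS t (extend L)) by exact: subm_span.
move=> h; apply: (h (fun f => mulS t (extend L) (map_mpoly phi f))).
  case: sM => h0 hD hZ; split; first by rewrite rmorph0.
    by move=> u v hu hv; rewrite rmorphD; exact: hD.
  by move=> c v hv; rewrite map_mpolyZ; exact: hZ.
move=> _ [ga [g [dg Lg ->]]]; rewrite rmorphM /= map_mpolyX.
by apply: mem_mulS => //; exact: mem_extend.
Qed.

End ExtensionOfForms.

Section GeneratedForms.
Context (n : nat) (R : comNzRingType).
Implicit Types (L : {mpoly R[n.+1]} -> Prop).

Lemma subm_mulS t L : subm (mulS t L). Proof. exact: subm_span. Qed.

Lemma mulS_mulX t L u f : mulS t L f -> mulS (mdeg u + t) L ('X_[u] * f).
Proof.
apply: span_map; first exact: subm_mulS.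
move=> _ [ga [g [dg Lg ->]]]; rewrite mulrA -mpolyXD; apply: mem_mulS => //.
by rewrite mdegD dg.
Qed.

Lemma mulS0 L f : subm L -> mulS 0 L f <-> L f.
Proof.
move=> sL; split=> [h|h]; last first.
  by rewrite -[f]mul1r -mpolyX0; apply: mem_mulS => //; exact: mdeg0.
apply: h => // _ [ga [g [dg Lg ->]]].
by move/eqP: dg; rewrite mdeg_eq0 => /eqP ->; rewrite mpolyX0 mul1r.
Qed.

Lemma mulS_lsub t L L' (M : 'M[R]_n.+1) f : (forall g, L g -> L' (lsub M g)) ->
  mulS t L f -> mulS t L' (lsub M f).
Proof.
move=> h hf; apply: (hf (fun f => mulS t L' (lsub M f))).
  by apply: subm_lsub; exact: subm_mulS.
move=> _ [ga [g [dg Lg ->]]]; rewrite rmorphM /=; apply: lsub_mulX_mem; first exact: subm_mulS.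
by move=> u du; apply: mem_mulS; [rewrite du|exact: h].
Qed.

Definition saturated_from r L := forall t f e, f \is (t + r)%N.-homog ->
  (forall u, mdeg u = e -> mulS (e + t) L ('X_[u] * f)) -> mulS t L f.

End GeneratedForms.

Section LocalChart.
Context (k : fieldType) (N p : nat) (A : comAlgType k) (R : comUnitRingType).
Context (K : fieldType) (phi : {rmorphism A -> R}) (rho : {rmorphism R -> K}).
Hypothesis unit_rho : forall x, (x \is a GRing.unit) = (rho x != 0).
Context (L : 'rV[A]_N -> Prop).
Hypothesis hL : grassmann_functor p L.

Let sL : subm L. Proof. by case: hL => -[]. Qed.

(** The functions [f] of the cover generate the unit ideal, so one of them is nonzero in the residue
    field and hence a unit in [R]. *)
Lemma free_at : exists (f : A) (E : 'M[A]_(p, N)), phi f \is a GRing.unit /\ free_away f L E.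
Proof.
case: hL => _ h1; apply: contrapT => no.
have h : rho (phi 1) = 0.
  apply: (h1 (fun x => rho (phi x) = 0)).
    split; first by rewrite !rmorph0.
      by move=> x y hx hy; rewrite !rmorphD /= hx hy addr0.
    by move=> a x hx; rewrite !rmorphM /= hx mulr0.
  move=> f [E hE]; apply/eqP/negPn/negP; rewrite -unit_rho => uf.
  by apply: no; exists f, E.
by move: h; rewrite !rmorph1 => /eqP; rewrite (oner_eq0 K).
Qed.

Lemma free_coordinates (f : A) (E : 'M[A]_(p, N)) : free_away f L E ->
  exists m (C : 'M[A]_(N, p)), forall j, L (f ^+ m *: delta_mx 0 j - row j C *m E).
Proof.
move=> [h _]; have hj (j : 'I_N) : exists z : nat * 'rV[A]_p, L (f ^+ z.1 *: delta_mx 0 j - z.2 *m E).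
  by have [m [c hc]] := h (delta_mx 0 j); exists (m, c).
have [z hz] := choice hj; pose M := (\max_j (z j).1)%N.
exists M, (\matrix_j (f ^+ (M - (z j).1) *: (z j).2)) => j.
have le : ((z j).1 <= M)%N by exact: leq_bigmax.
have eM : f ^+ M = f ^+ (M - (z j).1) * f ^+ (z j).1 by rewrite -exprD subnK.
rewrite rowK eM -scalerA -scalemxAl -scalerBr.
by case: sL => _ _; apply.
Qed.

Context (f : A) (E : 'M[A]_(p, N)) (m : nat) (C : 'M[A]_(N, p)).
Hypothesis uf : phi f \is a GRing.unit.
Hypothesis fE : free_away f L E.
Hypothesis fC : forall j, L (f ^+ m *: delta_mx 0 j - row j C *m E).

Lemma coordinates_mod (v : 'rV[A]_N) : L (f ^+ m *: v - (v *m C) *m E).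
Proof.
have -> : f ^+ m *: v - v *m C *m E = \sum_j v 0 j *: (f ^+ m *: delta_mx 0 j - row j C *m E).
  rewrite [v *m C]mulmx_sum_row mulmx_suml [X in f ^+ m *: X - _]row_sum_delta.
  rewrite scaler_sumr -sumrB; apply: eq_bigr => j _.
  by rewrite scalerBr -scalemxAl !scalerA mulrC.
by apply: subm_sum => // j _; case: sL => _ _; apply.
Qed.

Lemma kernel_of_mem (v : 'rV[A]_N) : L v -> map_mx phi v *m map_mx phi C = 0.
Proof.
move=> Lv; have : L ((v *m C) *m E).
  have -> : v *m C *m E = f ^+ m *: v - (f ^+ m *: v - v *m C *m E) by rewrite subKr.
  apply: submB => //; last exact: coordinates_mod.
  by case: sL => _ _; apply.
case: fE => _ h /h[s hs]; rewrite -map_mxM.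
have us : phi f ^+ s \is a GRing.unit by rewrite unitrX.
apply/rowP => c; have := congr1 (fun u : 'rV_p => phi (u 0 c)) hs.
rewrite !mxE rmorph0 rmorphM rmorphXn /= => e.
by apply: (mulrI us); rewrite e mulr0.
Qed.

Lemma coordinates_left_inverse : exists B : 'M[R]_(p, N), B *m map_mx phi C = 1%:M.
Proof.
have um : phi f ^+ m \is a GRing.unit by rewrite unitrX.
exists ((phi f ^+ m)^-1 *: map_mx phi E); rewrite -scalemxAl -map_mxM.
apply/matrixP => b c; rewrite mxE; apply: (mulrI um); rewrite mulrA divrr // mul1r.
have Lb : L (row b (f ^+ m *: 1%:M - E *m C) *m E).
  have := coordinates_mod (row b E); rewrite (_ : _ - _ = row b (f ^+ m *: 1%:M - E *m C) *m E) //.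
  by rewrite linearB linearZ /= row_mul mulmxBl -scalemxAl -[row b 1%:M *m E]row_mul mul1mx.
case: fE => _ h; have [s hs] := h _ Lb.
have us : phi f ^+ s \is a GRing.unit by rewrite unitrX.
have := congr1 (fun u : 'rV_p => phi (u 0 c)) hs.
rewrite mxE [in RHS]mxE rmorph0 rmorphM rmorphXn /= => e.
have : phi ((row b (f ^+ m *: 1%:M - E *m C)) 0 c) = 0 by apply: (mulrI us); rewrite e mulr0.
rewrite mxE [X in phi X]mxE [X in phi (_ + X)]mxE [X in phi (X + _)]mxE rmorphB /= => /eqP.
rewrite subr_eq0 => /eqP e'; rewrite [LHS]mxE -e' rmorphM rmorphXn /= !mxE.
by rewrite rmorph_nat.
Qed.

(** The sum of the multiples [w 0 j] of the rows of [C] is 0, so subtracting them does not change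
    [w]; this writes a kernel vector through elements of [L]. *)
Lemma kernel_combination (w : 'rV[R]_N) : w *m map_mx phi C = 0 ->
  w = \sum_j ((phi f ^+ m)^-1 * w 0 j) *: map_mx phi (f ^+ m *: delta_mx 0 j - row j C *m E).
Proof.
move=> hw; have um : phi f ^+ m \is a GRing.unit by rewrite unitrX.
under eq_bigr => j _ do rewrite -scalerA.
rewrite -scaler_sumr; apply/rowP => x; rewrite mxE; apply: (mulrI um); rewrite mulVKr //.
have e0 : \sum_j w 0 j *: (map_mx phi (row j C) *m map_mx phi E) = 0.
  have := congr1 (mulmx^~ (map_mx phi E)) hw.
  rewrite mul0mx [w *m _]mulmx_sum_row mulmx_suml => e; rewrite -[RHS]e.
  by apply: eq_bigr => j _; rewrite -scalemxAl map_row.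
under eq_bigr => j _ do rewrite map_mxB map_mxZ map_mxM scalerBr.
rewrite sumrB e0 subr0 summxE (bigD1 x) //= big1 ?addr0 => [|j ne]; last first.
  by rewrite !mxE /= eq_sym (negbTE ne) rmorph0 !mulr0.
by rewrite !mxE !eqxx rmorph1 mulr1 rmorphXn /= mulrC.
Qed.

End LocalChart.

Section BackwardLocal.
Context (k : fieldType) (fq : {rmorphism rat -> k}) (hfq : forall x, fq x = ratr x).
Context (n : nat) (pt : {poly rat}) (d : nat) (a : seq nat).
Local Notation r := (size a).
Local Notation p := (hval pt r).
Hypothesis sa : sorted geq a.
Hypothesis ad : all (fun x => x <= d)%N a.
Hypothesis hv : forall t, (r <= t)%N -> hval pt t = gval t a.
Hypothesis hZ : (hval pt r.+1 <= #|Zset n d r|)%N.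
Context (A : comAlgType k) (L : 'rV[A]_(nmon n r) -> Prop).
Hypothesis hL : cut_out (frakH k n pt d r) L.

Definition forms_of (f : {mpoly A[n.+1]}) := exists2 v, L v & f = pv (fun j => v 0 j).

Lemma subm_forms_of : subm forms_of.
Proof.
case: hL => -[[s0 sD sZ] _] _; split.
- by exists 0 => //; rewrite /pv big1 // => j _; rewrite mxE scale0r.
- move=> _ _ [u Lu ->] [v Lv ->]; exists (u + v); first exact: sD.
  by rewrite /pv -big_split; apply: eq_bigr => j _; rewrite mxE scalerDl.
move=> c _ [v Lv ->]; exists (c *: v); first exact: sZ.
by rewrite /pv scaler_sumr; apply: eq_bigr => j _; rewrite mxE scalerA.
Qed.

Lemma forms_of_homog f : forms_of f -> f \is r.-homog.
Proof. by move=> [v _ ->]; exact: pv_homog. Qed.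

Lemma forms_of_pv (v : 'rV[A]_(nmon n r)) : forms_of (pv (fun j => v 0 j)) <-> L v.
Proof.
split=> [[w Lw e]|Lv]; last by exists v.
rewrite (_ : v = w) //; apply/rowP => j.
by rewrite -(pvE (fun j => v 0 j)) e pvE.
Qed.

Context (R : comUnitRingType) (K : fieldType) (phi : {rmorphism A -> R}) (rho : {rmorphism R -> K}).
Hypothesis unit_rho : forall x, (x \is a GRing.unit) = (rho x != 0).
Local Notation LR := (extend phi forms_of).
Local Notation io := (phi \o in_alg A : {rmorphism k -> R}).
Local Notation gR g := (map_mx phi (map_mx (qalg fq A) g)).

Lemma local_kernel : exists (C : 'M[R]_(nmon n r, p)) (B : 'M[R]_(p, nmon n r)),
  [/\ B *m C = 1%:M, forall f, f \is r.-homog -> LR f <-> kerf C f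
    & forall g F0, g \in unitmx -> frakh1 d F0 \/ frakh2 d F0 ->
        evp io ((submx_ r (gR g))^T *m C) F0 = 0].
Proof.
case: hL => hG hF; have [f [E [uf fE]]]  := @free_at _ _ _ A R K phi rho unit_rho L hG.
have [m [C fC]] := free_coordinates hG fE.
have [B BC] := coordinates_left_inverse hG uf fE fC.
exists (map_mx phi C), B; split=> //.
  move=> g hg; split=> [h|[_ kg]].
    apply: (h (kerf (map_mx phi C))); first exact: subm_kerf.
    move=> _ [_ [v Lv ->] ->]; split=> [|c].
      by apply: homog_map; exact: pv_homog.
    have := kernel_of_mem hG uf fE fC Lv => /rowP/(_ c); rewrite mxE [RHS]mxE => e.
    rewrite -[RHS]e; apply: eq_bigr => j _; congr (_ * _).
    by rewrite mcoeff_map_mpoly pvE mxE.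
  pose w : 'rV[R]_(nmon n r) := \row_j g@_(alpha j).
  have kw : w *m map_mx phi C = 0.
    by apply/rowP => c; rewrite mxE [RHS]mxE -[RHS](kg c); apply: eq_bigr => j _; rewrite mxE.
  have ew := kernel_combination E m uf kw.
  have -> : g = pv (fun j => w 0 j) by rewrite [LHS](homog_pv hg); apply: eq_pv => j; rewrite mxE.
  have -> : pv (fun j => w 0 j) = \sum_j ((phi f ^+ m)^-1 * w 0 j) *:
      map_mpoly phi (pv (fun x => (f ^+ m *: delta_mx 0 j - row j C *m E) 0 x)).
    transitivity (pv (fun x => \sum_j ((phi f ^+ m)^-1 * w 0 j) *
        phi ((f ^+ m *: delta_mx 0 j - row j C *m E) 0 x))).
      apply: eq_pv => x; rewrite {1}ew summxE; apply: eq_bigr => j _.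
      by rewrite mxE [map_mx _ _ _ _]mxE.
    rewrite pv_lin; apply: eq_bigr => j _; congr (_ *: _).
    rewrite [RHS](homog_pv (homog_map phi (pv_homog _))); apply: eq_pv => x.
    by rewrite mcoeff_map_mpoly pvE.
  apply: subm_sum => [|j _]; first exact: subm_span.
  case: (subm_span (fun g => exists2 f, forms_of f & g = map_mpoly phi f)) => _ _; apply.
  by apply: mem_extend; exists (f ^+ m *: delta_mx 0 j - row j C *m E).
move=> g F0 ug h0; have [e _ hF0] := frakh_homog h0.
have Hg : frakH k n pt d r (gact g F0) by move=> I _; apply; right; exists g, F0.
have [s hs] := hF e _ Hg (gact_homog g hF0) f E m C fE fC.
have us : phi f ^+ s \is a GRing.unit by rewrite unitrX.
have e1 : evp io (map_mx phi C) (gact g F0) = 0.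
  apply: (mulrI us); rewrite mulr0 -(@evp_rmorph _ _ _ _ _ (in_alg A) io phi) //.
  by rewrite -rmorphXn -rmorphM /= -[RHS](rmorph0 phi) -[in RHS]hs.
have eg : map_mx (io \o fq) g = gR g by apply/matrixP => i j; rewrite !mxE.
rewrite -eg; apply: etrans e1; symmetry; exact: (evp_gact hfq).
Qed.

(** A minor in Borel position is found over the residue field, where [generic_borel] applies, and is
    a unit over [R]. The equations then give freeness in degrees [r] and [r + 1], and persistence
    gives all others. *)
Theorem backward_local : exists (g : 'M[rat]_n.+1) (N : pred 'X_{1..n.+1}),
  [/\ g \in unitmx, borel r N, forall t, cnt (t + r) 0 (iter t grow N) = gval (t + r) a
    & forall t, free_mod (t + r) (fun f => mulS t LR (lsub (gR g) f)) (iter t grow N)].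
Proof.
have [C [B [BC hC hF]]] := local_kernel.
have /full_rank_minor hJ0 : map_mx rho B *m map_mx rho C = 1%:M.
  by rewrite -map_mxM BC map_mx1.
have [g [J [N [ug bN JE hJ]]]] := generic_borel (rho \o (phi \o qalg fq A)) hJ0.
exists g, N; pose C' := (submx_ r (gR g))^T *m C.
have uJ : pl C' (val J) \is a GRing.unit.
  rewrite unit_rho -pl_det -det_map_mx map_mxsub /C' map_mxM -map_trmx submx_map.
  have -> : map_mx rho (gR g) = map_mx (rho \o (phi \o qalg fq A)) g.
    by apply/matrixP => i j; rewrite !mxE.
  by rewrite pl_det.
have hF' F : frakh1 d F \/ frakh2 d F -> evp io C' F = 0 by exact: hF.
have c1 := cnt_midx JE; rewrite hv // in c1.
have c2 := kerf_cntS bN JE uJ sa erefl ad hv hF' hZ.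
have f1 := kerf_free_mod JE uJ.
have f2 := kerf_free_modS bN JE uJ sa erefl ad hv hF' hZ.
split=> // t; first exact: persistence.
have gV : gR g *m gR (invmx g) = 1%:M by rewrite -!map_mxM mulmxV // !map_mx1.
have Vg : gR (invmx g) *m gR g = 1%:M by rewrite -!map_mxM mulVmx // !map_mx1.
have up f : kerf C' f -> LR (lsub (gR g) f).
  move=> kf; have hf := kf.1; apply/hC; first exact: lsub_homog.
  exact/kerf_lsub.
have down f : LR f -> kerf C' (lsub (gR (invmx g)) f).
  move=> Lf; have hf : f \is r.-homog.
    apply: (Lf (fun f => f \is r.-homog)) => [|_ [f0 /forms_of_homog h0 ->]]; last exact: homog_map.
    by split=> [|u v|c u]; [exact: rpred0|exact: rpredD|exact: rpredZ].
  apply/kerf_lsub; first exact: lsub_homog.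
  by rewrite lsub_comp Vg lsub1; apply/hC.
have [h1 h2] := free_mod_persistence t (subm_kerf C') (fun f kf => kf.1) f1 f2.
split=> [f hf|h hh Mh].
  have [h sh Mh] := h1 f hf; exists h => //; exact: mulS_lsub Mh.
apply: h2 => //; have := mulS_lsub down Mh.
by rewrite lsub_comp gV lsub1.
Qed.

(** Multiplication by [x_0] keeps forms standard. If all multiples of [f] of degree [e] lie in the
    ideal, so does [x_0^e] times the remainder of [f], in the general coordinates; hence the
    remainder is 0. *)
Lemma extend_saturated : saturated_from r LR.
Proof.
have [g [N [ug bN _ fr]]] := backward_local.
have gV : gR g *m gR (invmx g) = 1%:M by rewrite -!map_mxM mulmxV // !map_mx1.
have Vg : gR (invmx g) *m gR g = 1%:M by rewrite -!map_mxM mulVmx // !map_mx1.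
move=> t f e hf hu; pose f' := lsub (gR (invmx g)) f.
have ef : lsub (gR g) f' = f by rewrite lsub_comp Vg lsub1.
have [h hh Mh] := (fr t).1 f' (lsub_homog _ hf).
pose u : 'X_{1..n.+1} := (U_(ord0) *+ e)%MM; have du : mdeg u = e by rewrite mdegMn mdeg1 mul1n.
have sM t' : subm (fun f => mulS t' LR (lsub (gR g) f)) by apply: subm_lsub; exact: subm_mulS.
have mX w v t' : mulS t' LR (lsub (gR g) w) -> mulS (mdeg v + t') LR (lsub (gR g) ('X_[v] * w)).
  move=> hw; rewrite rmorphM; apply: lsub_mulX_mem; first exact: subm_mulS.
  by move=> v' dv; rewrite -dv; exact: mulS_mulX.
have Mu : mulS (e + t) LR (lsub (gR g) ('X_[u] * f')).
  rewrite rmorphM /= ef; apply: lsub_mulX_mem; first exact: subm_mulS.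
  by rewrite du.
have h0 : h = 0.
  apply: (@mulX_eq0 _ _ u); apply: (fr (e + t)%N).2.
    rewrite /u; elim: e {hu Mu du u} => [|e IH].
      by rewrite mulm0n mpolyX0 mul1r.
    rewrite mulmS mpolyXD -mulrA; exact: supported_mulX0.
  apply: (subm_sub (sM _) _ Mu); rewrite -mulrBr.
  by rewrite -{1}du; exact: mX.
by move: Mh; rewrite h0 subr0 ef.
Qed.

End BackwardLocal.

Lemma ideal_subm n (R : comNzRingType) (I : {mpoly R[n]} -> Prop) : is_ideal I -> subm I.
Proof. by move=> [h0 hD hM]; split=> // c v hv; rewrite -mul_mpolyC; exact: hM. Qed.

Section ChartsOfForms.
Context (n : nat) (A : comNzRingType) (r : nat) (L : {mpoly A[n.+1]} -> Prop).
Hypothesis homL : forall f, L f -> f \is r.-homog.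
Local Notation S := {mpoly A[n.+1]}.

Definition chart_of : charts n A := fun i => ideal_gen (fun f => L f \/ f = 'X_i - 1).

Lemma chart_of_ideal i : is_ideal (chart_of i). Proof. exact: ideal_gen_ideal. Qed.

Lemma chart_of_X1 i : chart_of i ('X_i - 1). Proof. by move=> I _; apply; right. Qed.

Lemma mem_chart_of i t f : mulS t L f -> chart_of i f.
Proof.
apply; first by apply: ideal_subm; exact: chart_of_ideal.
move=> _ [ga [g [_ Lg ->]]]; case: (chart_of_ideal i) => _ _; apply.
by move=> I _; apply; left.
Qed.

(** The condition is imposed in all large degrees rather than in one, so that it is stable under
    sums. The bound [r <= T0] keeps the subtraction [T - r] exact. *)
Lemma chart_ofP i f : chart_of i f <-> exists2 T0, (r <= T0)%N &
  forall T, (T0 <= T)%N -> mulS (T - r) L (hmg i T f).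
Proof.
split=> [hf|[T0 _ h]]; last first.
  have := h (maxn T0 (msize f)) (leq_maxl _ _) => /(@mem_chart_of i _ _).
  move/(hmg_mem (chart_of_ideal i) (@chart_of_X1 i)); apply.
  by apply: leq_trans (leq_maxr _ _) (leqnSn _).
pose Q f := exists2 T0, (r <= T0)%N & forall T, (T0 <= T)%N -> mulS (T - r) L (hmg i T f).
have sQ : subm Q.
  split.
  - exists r => // T _; rewrite linear0; exact: span0.
  - move=> u v [T hT hu] [T' hT' hv]; exists (maxn T T'); first by rewrite leq_max hT.
    move=> T2; rewrite geq_max => /andP[h1 h2]; rewrite linearD.
    by case: (subm_mulS (T2 - r) L) => _ hD _; apply: hD; [exact: hu|exact: hv].
  move=> c v [T hT hv]; exists T => // T2 h2; rewrite linearZ.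
  by case: (subm_mulS (T2 - r) L) => _ _; apply; exact: hv.
apply: (hf Q); first split.
- by case: sQ.
- by case: sQ => _ hD _; exact: hD.
- move=> a g [T0 rT hT]; rewrite (mpolyE a) mulr_suml; apply: subm_sum => // u _.
  rewrite -scalerAl; case: (sQ) => _ _; apply; exists (mdeg u + T0)%N => [|T le].
    by apply: leq_trans rT _; exact: leq_addl.
  have eT : T = (mdeg u + (T - mdeg u))%N by rewrite subnKC // (leq_trans _ le) ?leq_addr.
  rewrite {2}eT hmg_mulX (_ : T - r = mdeg u + (T - mdeg u - r))%N; last by lia.
  by apply: mulS_mulX; apply: hT; lia.
move=> g [Lg|->].
  exists r => // T rT; rewrite (hmg_of_homog _ (homL Lg) rT) mpolyXn; apply: mem_mulS => //.
  by rewrite mdegMn mdeg1 mul1n.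
(* From degree 1 on no term of ['X_i - 1] is lost, and its homogenization is 0. *)
exists (maxn r 1); first exact: leq_maxl.
move=> T; rewrite geq_max => /andP[_ T1]; rewrite linearB /=.
rewrite (hmg_of_homog i (homogX A (mdeg1 i)) T1) (hmg_of_homog i (dhomog1 _ _) (leq0n T)).
by rewrite mulr1 subn0 -exprSr subn1 prednK // subrr; exact: span0.
Qed.

Lemma chart_of_homog i t f : f \is t.-homog -> chart_of i f -> exists2 T0, (r <= T0)%N &
  forall T, (T0 <= T)%N -> (t <= T)%N -> mulS (T - r) L ('X_i ^+ (T - t) * f).
Proof.
move=> hf /chart_ofP[T0 rT h]; exists T0 => // T le le'.
by rewrite -(hmg_of_homog i hf le'); exact: h.
Qed.

Lemma chart_of_closed : closed_subscheme chart_of.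
Proof.
split=> [i|i|i j t f hf [m hm]]; [exact: chart_of_ideal|exact: chart_of_X1|].
have hX : 'X_j ^+ m * f \is (m + t)%N.-homog.
  by rewrite mpolyXn; apply: homogXM => //; rewrite mdegMn mdeg1 mul1n.
have [T0 _ h] := chart_of_homog hX hm; exists (maxn T0 (m + t) - (m + t))%N.
have := h _ (leq_maxl _ _) (leq_maxr _ _) => /(@mem_chart_of j _ _).
by rewrite mulrCA => /(chart_cancel m _ (chart_of_ideal j) (@chart_of_X1 j)).
Qed.

(** In each chart some ['X_i ^+ E * f] is generated by [L]. A monomial of degree [(n + 1) E] is
    divisible by one of these powers, so saturation applies to [f]. *)
Lemma secs_chart_of t f : saturated_from r L -> f \is (t + r)%N.-homog ->
  secs chart_of f <-> mulS t L f.
Proof.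
move=> sat hf; have secsE := secs_homog chart_of_closed hf; split=> [/secsE h|h]; last first.
  by apply/secsE => i; exact: mem_chart_of h.
have hT i : exists T0, forall T, (T0 <= T)%N -> (t + r <= T)%N -> mulS (T - r) L ('X_i ^+ (T - (t + r)) * f).
  by have [T0 _ hT0] := chart_of_homog hf (h i); exists T0.
have [T hT'] := choice hT; pose E := (\max_i T i)%N.
have hE i : mulS (E + t) L ('X_i ^+ E * f).
  have := hT' i (E + (t + r))%N; rewrite addnK addnA addnK; apply.
    by rewrite -addnA; apply: leq_trans (leq_addr _ _); exact: leq_bigmax.
  by rewrite -addnA leq_addl.
apply: (sat _ _ (n.+1 * E)%N) => // u du.
have [i hi] := exists_large_exponent du (leqnn _).
have le : (U_(i) *+ E <= u)%MM.
  by apply/mnm_lepP => l; rewrite mulmnE mnm1E; case: eqP => [<-|_] //; rewrite mul1n.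
have := mulS_mulX (u := (u - U_(i) *+ E)%MM) (hE i).
rewrite mulrA mpolyXn -mpolyXD submK // addnA.
by have := congr1 mdeg (submK le); rewrite mdegD mdegMn mdeg1 mul1n du => ->.
Qed.

End ChartsOfForms.

Section ChartBaseChange.
Context (n : nat) (A B : comNzRingType) (phi : {rmorphism A -> B}) (L : {mpoly A[n.+1]} -> Prop).

Lemma base_change_chart_of i f :
  base_change phi (chart_of L) i f <-> chart_of (extend phi L) i f.
Proof.
have iE := chart_of_ideal (extend phi L) i.
have iB : is_ideal (base_change phi (chart_of L) i) by exact: ideal_gen_ideal.
split=> h.
  apply: (h _ iE) => _ [g hg ->]; apply: (hg (fun g => chart_of (extend phi L) i (map_mpoly phi g))).
    case: iE => h0 hD hM; split; first by rewrite rmorph0.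
      by move=> x y hx hy; rewrite rmorphD; exact: hD.
    by move=> c x hx; rewrite rmorphM; exact: hM.
  move=> w [Lw|->]; last by rewrite rmorphB rmorph1 /= map_mpolyX; exact: chart_of_X1.
  by move=> I _; apply; left; exact: mem_extend.
apply: (h _ iB) => w [Lw|->].
  apply: (Lw (base_change phi (chart_of L) i)); first exact: ideal_subm.
  move=> _ [g Lg ->] I _; apply; exists g => //.
  by move=> I' _; apply; left.
move=> I _; apply; exists ('X_i - 1); first exact: chart_of_X1.
by rewrite rmorphB rmorph1 /= map_mpolyX.
Qed.

End ChartBaseChange.

Section LocalGlobal.
Context (n : nat) (A : comNzRingType) (L : {mpoly A[n.+1]} -> Prop).

Lemma locl_mulS (m : A -> Prop) (hm : maximal_ideal m) t f :
  mulS t (extend (locpi hm) L) f -> locl (hm := hm) (mulS t L) f.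
Proof.
have sM := subm_locl hm (subm_mulS t L).
apply=> // _ [ga [g [dg Lg ->]]].
apply: (span_map sM (ga := ga)) Lg => _ [f0 Lf0 ->].
rewrite -(map_mpolyX (locpi hm)) -rmorphM; apply: mem_locl.
exact: mem_mulS.
Qed.

Lemma mulS_local_global t f :
  (forall m (hm : maximal_ideal m), mulS t (extend (locpi hm) L) (map_mpoly (locpi hm) f)) ->
  mulS t L f.
Proof.
move=> h; have [s0 sD sZ] := subm_mulS t L.
have iI : is_ideal (fun x => mulS t L (x *: f)).
  split; first by rewrite scale0r.
    by move=> x y hx hy; rewrite scalerDl; exact: sD.
  by move=> c x hx; rewrite -scalerA; exact: sZ.
rewrite -[f]scale1r; apply: (ideal_local_global iI) => m hm.
by have /locl_mulS/(locl_map hm _ (subm_mulS t L)) := h m hm.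
Qed.

Lemma saturated_local_global r :
  (forall m (hm : maximal_ideal m), saturated_from r (extend (locpi hm) L)) -> saturated_from r L.
Proof.
move=> h t f e hf hu; apply: mulS_local_global => m hm.
apply: (h m hm t _ e) => [|u du]; first exact: homog_map.
by rewrite -(map_mpolyX (locpi hm)) -rmorphM; apply: mulS_extend; exact: hu.
Qed.

End LocalGlobal.

(** Rewriting by the marked basis of degree [r] leaves a standard remainder that lies in [I], and
    freeness in degree [t + r] makes it 0. *)
Lemma free_mod_generated n r t (R : comNzRingType) (N : pred 'X_{1..n.+1}) (I : {mpoly R[n.+1]} -> Prop) f :
  subm I -> (forall u f, I f -> I ('X_[u] * f)) -> free_mod r I N ->
  free_mod (t + r) I (iter t grow N) -> f \is (t + r)%N.-homog -> I f ->
  mulS t (fun g => g \is r.-homog /\ I g) f.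
Proof.
move=> sI IX f1 [_ ind] hf If; have [fm hfm] := free_mod_marked sI f1.
have hfh al : mdeg al = r -> ~~ N al -> fm al \is r.-homog.
  move=> da Na; rewrite -[fm al](subKr 'X_[al]); apply: rpredB; first exact: homogX.
  by apply: supported_homog; exact: (hfm al da Na).2.
have [|||h hh Qh] := @marked_span n R r N fm _ t (mulS t (fun g => g \is r.-homog /\ I g)) _ _ f hf.
- by move=> al da Na; exact: (hfm al da Na).2.
- exact: subm_mulS.
- by move=> ga al dg da Na; apply: mem_mulS => //; split; [exact: hfh|exact: (hfm al da Na).1].
have QI g : mulS t (fun g => g \is r.-homog /\ I g) g -> I g.
  by apply=> // _ [ga [w [_ [_ Iw] ->]]]; exact: IX.
have h0 : h = 0 by apply: ind => //; apply: (subm_sub sI) If; exact: QI.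
by rewrite h0 subr0 in Qh.
Qed.

(** An element of a chart is recovered from its homogenization, and a power of [x_i] turns that into
    a section of all charts; raising the degree by [r] brings it into the range where the sections
    agree. *)
Lemma charts_eq_secs n r (A : comNzRingType) (X Y : charts n A) :
  closed_subscheme X -> closed_subscheme Y ->
  (forall t f, f \is (t + r)%N.-homog -> secs X f <-> secs Y f) -> charts_eq X Y.
Proof.
move=> cX cY h; suff H (X' Y' : charts n A) : closed_subscheme X' -> closed_subscheme Y' ->
    (forall t f, f \is (t + r)%N.-homog -> secs X' f -> secs Y' f) -> forall i f, X' i f -> Y' i f.
  by move=> i f; split; apply: H => // t g hg; move/(h t g hg).
move=> [hX X1 gX] cY' sub i f Xf; have [hY Y1 _] := cY'.
pose T := (msize f + r)%N; have hs : (msize f <= T.+1)%N by rewrite /T; lia.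
have {}Xf : X' i (hmg i T f) by apply/hmg_mem.
have [e he] := chart_glue (And3 hX X1 gX) (hmg_homog i T f) Xf.
have hh : 'X_i ^+ e * hmg i T f \is (e + msize f + r)%N.-homog.
  by rewrite -addnA mpolyXn; apply: homogXM; [rewrite mdegMn mdeg1 mul1n|exact: hmg_homog].
have /(sub _ _ hh)/(secs_homog cY' hh)/(_ i) : secs X' ('X_i ^+ e * hmg i T f).
  exact/(secs_homog (And3 hX X1 gX) hh).
by move/(chart_cancel e _ (hY i) (Y1 i))/(hmg_mem (hY i) (Y1 i) hs).
Qed.

Section FlatCharts.
Context (n : nat) (A : comNzRingType) (r : nat) (L : {mpoly A[n.+1]} -> Prop).
Hypothesis homL : forall f, L f -> f \is r.-homog.
Local Notation S := {mpoly A[n.+1]}.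

(* Near [m], the forms [sg t v], for [v] in [idx t], are a basis of the forms of
   degree [t + r] modulo [mulS t L], and [l t v] is [u t] times the [v]-th
   coordinate. *)
Definition local_coordinates (m : A -> Prop) (u : nat -> A) (idx : nat -> seq 'X_{1..n.+1})
    (sg : nat -> 'X_{1..n.+1} -> S) (l : nat -> 'X_{1..n.+1} -> S -> A) : Prop :=
  [/\ forall t, ~ m (u t),
      forall t v a f g, l t v (a *: f + g) = a * l t v f + l t v g,
      forall t f, f \is (t + r)%N.-homog ->
        mulS t L (u t *: f - \sum_(v <- idx t) l t v f *: sg t v)
    & forall t f v, f \is (t + r)%N.-homog -> mulS t L f -> v \in idx t ->
        exists2 w, ~ m w & w * l t v f = 0].

Hypothesis hloc : forall m, maximal_ideal m ->
  exists u idx sg l, local_coordinates m u idx sg l.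

(** Near [m] the chart is a limit of free modules, the forms of degree [t + r] modulo [mulS t L].
    Taking coordinates of homogenizations gives a bilinear map that detects the vanishing of a
    tensor; coordinate by coordinate the injectivity of [phi] brings the vanishing from [M'] back to
    [M], and the coordinates rebuild [u t] times the tensor. *)
Theorem chart_of_flat i : flat_quotient (chart_of L i).
Proof.
move=> M M' phi inj s tz P b lb1 lb2 hQ; set Z := \sum_(z <- s) _.
have iI : is_ideal (fun c => c *: Z = 0).
  split; first by rewrite scale0r.
    by move=> x y hx hy; rewrite scalerDl hx hy addr0.
  by move=> x y hy; rewrite -scalerA hy scaler0.
rewrite -[Z]scale1r; apply: (ideal_local_global iI) => m hm.
have [u [idx [sg [l [nu lin spn tor]]]]] := hloc hm.
(* Families of coordinates that become torsion at [m] in all large degrees. The degree from which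
   the homogenization of a chart element lies in [mulS] depends on the element, so all degrees are
   kept and small ones are ignored. *)
pose W (F : nat * 'X_{1..n.+1} -> M') := exists T0, forall t v, (T0 <= t)%N -> v \in idx t ->
  exists2 w, ~ m w & w *: F (t, v) = 0.
have sW : subm W.
  split.
  - by exists 0%N => t v _ _; exists 1; [case: hm|rewrite scale1r].
  - move=> F G [T hT] [T' hT']; exists (maxn T T') => t v.
    rewrite geq_max => /andP[h1 h2] vt.
    have [w nw e] := hT t v h1 vt; have [w' nw' e'] := hT' t v h2 vt.
    exists (w * w'); first exact: maximal_idealM.
    by rewrite -[(F + G) _]/(F (t, v) + G (t, v)) scalerDr mulrC -scalerA e scaler0 add0r
      mulrC -scalerA e' scaler0.
  move=> c F [T hT]; exists T => t v h1 vt; have [w nw e] := hT t v h1 vt; exists w => //.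
  by rewrite -[(c *: F) _]/(c *: F (t, v)) scalerA mulrC -scalerA e scaler0.
pose b0 (y : M') (f : S) : nat * 'X_{1..n.+1} -> M' :=
  fun x => l x.1 x.2 (hmg i (x.1 + r) f) *: y.
pose b' y f : quomod sW := qpi sW (b0 y f).
have : \sum_(z <- [seq (phi z.1, z.2) | z <- s]) b' z.1 z.2 = 0.
  apply: tz.
  - move=> f c y y'; rewrite /b' -linearP; congr (qpi _ _); apply/funext => -[t v].
    rewrite -[RHS]/(c *: b0 y f (t, v) + b0 y' f (t, v)) /b0 /=.
    by rewrite scalerDr !scalerA mulrC.
  - move=> y c f f'; rewrite /b' -linearP; congr (qpi _ _); apply/funext => -[t v].
    rewrite -[RHS]/(c *: b0 y f (t, v) + b0 y f' (t, v)) /b0 /=.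
    by rewrite linearP lin scalerDl scalerA.
  move=> y f /(chart_ofP homL)[T0 _ hT]; apply/qpi_eq0; exists T0 => t v le vt.
  have hM : mulS t L (hmg i (t + r) f).
    by have := hT (t + r)%N; rewrite addnK; apply; apply: leq_trans le (leq_addr _ _).
  have [w nw e] := tor t _ v (hmg_homog _ _ _) hM vt; exists w => //.
  by rewrite /b0 /= scalerA e scale0r.
rewrite big_map /= -linear_sum => /(qpi_eq0 sW)[T0 hT0].
pose t := (T0 + \max_(z <- s) msize z.2)%N.
have hs z : z \in s -> (msize z.2 <= (t + r).+1)%N.
  move=> zs; have : (msize z.2 <= \max_(z <- s) msize z.2)%N by rewrite (big_rem z) //= leq_maxl.
  rewrite /t; lia.
pose lc (z : M * S) v := l t v (hmg i (t + r) z.2).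
have hw v : exists w, ~ m w /\ (v \in idx t -> w *: \sum_(z <- s) lc z v *: z.1 = 0).
  have [vt|vt] := boolP (v \in idx t); last by exists 1; split=> //; case: hm.
  have [w nw e] := hT0 t v (leq_addr _ _) vt; exists w; split=> // _.
  apply: inj; rewrite linear0 linearZ linear_sum -[RHS]e fct_sumE; congr (_ *: _).
  by apply: eq_bigr => z _; rewrite /= linearZ.
have [w hw'] := choice hw; exists ((\prod_(v <- idx t) w v) * u t).
  apply: maximal_idealM => //; apply: maximal_ideal_prod => // v _; by case: (hw' v).
have ez z : z \in s -> u t *: b z.1 z.2 = \sum_(v <- idx t) b (lc z v *: z.1) (sg t v).
  move=> zs; have [B hB] := linear_pack (lb2 z.1).
  transitivity (\sum_(v <- idx t) lc z v *: b z.1 (sg t v)); last first.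
    apply: eq_bigr => v _; have [B' hB'] := linear_pack (lb1 (sg t v)).
    by rewrite -!hB' linearZ.
  under eq_bigr => v _ do rewrite -hB -linearZ /=.
  rewrite -hB -linearZ -linear_sum; apply/eqP; rewrite -subr_eq0 -linearB hB; apply/eqP/hQ.
  rewrite -(subrK (u t *: hmg i (t + r) z.2) (u t *: z.2)) -addrA.
  have iC := chart_of_ideal L i; have [_ hD hM] := iC; apply: hD; last first.
    by apply: mem_chart_of; apply: spn; exact: hmg_homog.
  rewrite -scalerBr -mul_mpolyC; refine (hM _ _ _); rewrite -opprB; refine (idealN iC _).
  exact: (hmg_mod iC (@chart_of_X1 _ _ L i) (hs z zs)).
have eZ : u t *: Z = \sum_(z <- s) \sum_(v <- idx t) b (lc z v *: z.1) (sg t v).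
  by rewrite /Z scaler_sumr; apply: eq_big_seq => z zs; exact: ez.
rewrite -scalerA eZ exchange_big scaler_sumr.
rewrite big1_seq // => v /= vt.
have [B' hB'] := linear_pack (lb1 (sg t v)).
under [X in _ *: X = _]eq_bigr => z _ do rewrite -hB'.
rewrite -linear_sum -linearZ (big_rem v) //= mulrC -scalerA; case: (hw' v) => _ -> //.
by rewrite scaler0 linear0.
Qed.

End FlatCharts.

Section FreeCoordinates.
Context (n : nat) (A : comNzRingType) (r : nat) (L : {mpoly A[n.+1]} -> Prop).
Context (m : A -> Prop) (hm : maximal_ideal m).
Context (g V : 'M[A]_n.+1) (Vg : V *m g = 1%:M) (Nt : nat -> pred 'X_{1..n.+1}).
Local Notation ll := (locpi hm : {rmorphism A -> loc hm}).
Hypothesis fr : forall t, free_mod (t + r)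
  (fun f => mulS t (extend ll L) (lsub (map_mx ll g) f)) (Nt t).

(** All denominators of one degree are multiplied into the single [u t]; each coefficient is
    rescaled by the product of the other denominators, which makes the coordinates linear over [A]
    itself. *)
Lemma free_local_coordinates : exists u idx sg l, local_coordinates r L m u idx sg l.
Proof.
pose idx t := [seq v <- monomials n (t + r) | Nt t v].
pose sg (t : nat) (v : 'X_{1..n.+1}) : {mpoly A[n.+1]} := lsub g 'X_[v].
have hx (z : nat * 'X_{1..n.+1}) : exists y : A * ('X_{1..n.+1} -> A), ~ m y.1 /\
    (mdeg z.2 = (z.1 + r)%N -> mulS z.1 L (y.1 *: 'X_[z.2] - \sum_(v <- idx z.1) y.2 v *: sg z.1 v)).
  case: z => t x /=; have [dx|ne] := eqVneq (mdeg x) (t + r)%N; last first.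
    by exists (1, fun=> 0); split=> [|dx]; [case: hm|rewrite dx eqxx in ne].
  have [h hh Ih] := (fr t).1 _ (homog_map ll (lsub_homog V (homogX A dx))).
  have [s [H [hs eH H0]]] := mpoly_clear_den h.
  have hH : supported (t + r) (Nt t) H by move=> v nz; apply: hh; apply: contraNneq nz => /H0 ->.
  have : locl (hm := hm) (mulS t L) (map_mpoly ll (s *: 'X_[x] - lsub g H)).
    rewrite (lsub_clear (h := h) _ Vg eH); case: (subm_locl hm (subm_mulS t L)) => _ _; apply.
    exact: locl_mulS.
  move/(locl_map hm _ (subm_mulS t L)) => [w nw Lw].
  exists (w * s, fun v => w * H@_v) => /=; split=> [|_]; first exact: maximal_idealM.
  rewrite (_ : _ - _ = w *: (s *: 'X_[x] - lsub g H)) // scalerBr scalerA; congr (_ - _).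
  have -> : lsub g H = \sum_(v <- idx t) H@_v *: sg t v.
    rewrite {1}(supportedE hH) linear_sum big_filter; apply: eq_bigr => v _ /=.
    by rewrite linearZ.
  by rewrite scaler_sumr; apply: eq_bigr => v _; rewrite scalerA.
have [y hy] := choice hx.
pose u t := \prod_(x <- monomials n (t + r)) (y (t, x)).1.
pose c t x v := (\prod_(x' <- rem x (monomials n (t + r))) (y (t, x')).1) * (y (t, x)).2 v.
pose l t v (f : {mpoly A[n.+1]}) := \sum_(x <- monomials n (t + r)) f@_x * c t x v.
have hspan t f : f \is (t + r)%N.-homog -> mulS t L (u t *: f - \sum_(v <- idx t) l t v f *: sg t v).
  move=> hf; have sM := subm_mulS t L.
  have ef : f = \sum_(x <- monomials n (t + r)) f@_x *: 'X_[x].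
    exact: supportedE (homog_supported hf).
  have -> : u t *: f - \sum_(v <- idx t) l t v f *: sg t v =
      \sum_(x <- monomials n (t + r)) f@_x *: (u t *: 'X_[x] - \sum_(v <- idx t) c t x v *: sg t v).
    rewrite {1}ef scaler_sumr; under [X in _ - X]eq_bigr => v _ do rewrite scaler_suml.
    rewrite exchange_big -sumrB; apply: eq_bigr => x _.
    rewrite scalerBr !scalerA mulrC; congr (_ - _); rewrite scaler_sumr.
    by apply: eq_bigr => v _; rewrite scalerA.
  apply: subm_sumr => // x; rewrite mem_monomials => /eqP dx; case: (sM) => _ _ sZ; apply: (sZ).
  rewrite /u (big_rem x) ?mem_monomials ?dx //= mulrC.
  have -> : \sum_(v <- idx t) c t x v *: sg t v = (\prod_(x' <- rem x (monomials n (t + r))) (y (t, x')).1) *: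
      \sum_(v <- idx t) (y (t, x)).2 v *: sg t v.
    by rewrite scaler_sumr; apply: eq_bigr => v _; rewrite scalerA.
  by rewrite -scalerA -scalerBr; apply: (sZ); case: (hy (t, x)) => _; apply.
exists u, idx, sg, l; split=> [t|t v a f f'|//|t f v hf Lf vt].
- by apply: maximal_ideal_prod => // x _; case: (hy (t, x)).
- rewrite /l mulr_sumr -big_split; apply: eq_bigr => x _.
  by rewrite mcoeffD mcoeffZ mulrDl -mulrA.
have sM := subm_mulS t L; pose H := \sum_(v <- idx t) l t v f *: 'X_[v] : {mpoly A[n.+1]}.
have HE v' : H@_v' = if (mdeg v' == (t + r)%N) && Nt t v' then l t v' f else 0.
  by rewrite /H big_filter mcoeff_msumX.
have LH : mulS t L (lsub g H).
  have -> : lsub g H = \sum_(v <- idx t) l t v f *: sg t v.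
    by rewrite linear_sum; apply: eq_bigr => v' _; rewrite /= linearZ.
  apply: (subm_sub sM (hspan t f hf)); case: (sM) => _ _; exact.
have H0 : map_mpoly ll H = 0.
  apply: (fr t).2.
    move=> v'; rewrite mcoeff_map_mpoly HE; case: ifP => [/andP[/eqP -> //]|_].
    by move=> nz; case/eqP: nz; exact: rmorph0.
  by rewrite -lsub_map; exact: mulS_extend.
move: vt; rewrite mem_filter mem_monomials => /andP[Nv dv].
have := congr1 (mcoeff v) H0; rewrite mcoeff0 mcoeff_map_mpoly HE dv Nv.
by move/locpi_eq0.
Qed.

End FreeCoordinates.

Section FibreHilbertPolynomial.
Context (K : fieldType) (n r : nat) (pt : {poly rat}) (Y : charts n K).
Context (g V : 'M[K]_n.+1) (Vg : V *m g = 1%:M) (Nt : nat -> pred 'X_{1..n.+1}).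
Context (I : nat -> {mpoly K[n.+1]} -> Prop).
Hypothesis sI : forall t, subm (I t).
Hypothesis hI : forall t f, f \is (t + r)%N.-homog -> ideal_sections Y (t + r) f <-> I t f.
Hypothesis fr : forall t, free_mod (t + r) (fun f => I t (lsub g f)) (Nt t).
Hypothesis hpt : forall t, pt.[(t + r)%:R] = (cnt (t + r) 0 (Nt t))%:R.

Lemma free_has_hilbert_polynomial : has_hilbert_polynomial Y pt.
Proof.
exists r => t' ht; have [t ->] : exists t, t' = (t + r)%N by exists (t' - r)%N; rewrite subnK.
set D := (t + r)%N; pose J := [set x : 'I_(nmon n D) | Nt t (alpha x)].
have mJ (i : 'I_#|J|) : Nt t (alpha (enum_val i)) by have := enum_valP i; rewrite inE.
pose b (i : 'I_#|J|) : {mpoly K[n.+1]} := lsub g 'X_[alpha (enum_val i)].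
have hb i : b i \is D.-homog by apply: lsub_homog; apply: homogX; exact: mdeg_alpha.
exists #|J|, b; split=> //.
  rewrite hpt; congr (_%:R); rewrite /cnt count_alpha; apply: eq_card => x; rewrite !inE.
  by rewrite (_ : supge 0 _) ?andbT //; apply/supgeP.
pose low (c : 'rV[K]_#|J|) : {mpoly K[n.+1]} := \sum_i c 0 i *: 'X_[alpha (enum_val i)].
have lowE c : lsub g (low c) = \sum_i c 0 i *: b i.
  by rewrite linear_sum; apply: eq_bigr => i _; rewrite /= linearZ.
have slow c : supported D (Nt t) (low c).
  apply: subm_sum => [|i _]; first exact: subm_supported.
  by case: (subm_supported K D (Nt t)) => _ _; apply; apply: supportedX => //; exact: mdeg_alpha.
have clow c i : (low c)@_(alpha (enum_val i)) = c 0 i.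
  rewrite /low (raddf_sum (mcoeff _)) (bigD1 i) //= mcoeffZ mcoeffX eqxx mulr1 big1 ?addr0 // => i' ne.
  by rewrite mcoeffZ mcoeffX (inj_eq (@alpha_inj n D)) (inj_eq enum_val_inj) (negbTE ne) mulr0.
move=> f hf; have hfb (c : 'rV[K]_#|J|) : f - \sum_i c 0 i *: b i \is D.-homog.
  by apply: rpredB => //; apply: rpred_sum => i _; apply: rpredZ; exact: hb.
have [h hh Ih] := (fr t).1 _ (lsub_homog V hf).
exists (\row_i h@_(alpha (enum_val i))); split=> [|c].
  apply/hI => //; rewrite -lowE.
  have <- : h = low (\row_i h@_(alpha (enum_val i))).
    rewrite {1}(homog_pv (supported_homog hh)) /pv (bigID (mem J)) /= [X in _ + X]big1 ?addr0.
      by rewrite big_enum_val; apply: eq_bigr => i _; rewrite mxE.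
    move=> x; rewrite inE => Nx; have [->|/hh[_]] := eqVneq h@_(alpha x) 0; first by rewrite scale0r.
    by rewrite (negbTE Nx).
  by move: Ih; rewrite linearB /= lsub_comp Vg lsub1.
move/hI => /(_ (hfb c)); rewrite -lowE => Ic.
have e : low c - h = 0.
  apply: (fr t).2; first by apply: (submB (subm_supported K D (Nt t))).
  rewrite -(subrK (lsub V f) (low c)) -addrA linearD /=; case: (sI t) => _ hD _; apply: hD => //.
  by rewrite -opprB linearN; apply: submN => //; rewrite linearB /= lsub_comp Vg lsub1.
apply/rowP => i; rewrite mxE -clow; apply/esym/eqP; rewrite -subr_eq0 -mcoeffB e.
by rewrite mcoeff0.
Qed.

End FibreHilbertPolynomial.

Lemma scale_eq_map_pihomog n t (A B : comNzRingType) (phi : {rmorphism A -> B}) (c : B)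
    (w : {mpoly B[n]}) (f : {mpoly A[n]}) : w \is t.-homog ->
  c *: w = map_mpoly phi f -> c *: w = map_mpoly phi (pihomog [measure of mdeg] t f).
Proof. by move=> hw e; rewrite pihomog_map -e linearZ /= pihomog_dE. Qed.

Section BackwardGlobal.
Context (k : fieldType) (fq : {rmorphism rat -> k}) (hfq : forall x, fq x = ratr x).
Context (n : nat) (pt : {poly rat}) (d : nat) (a : seq nat).
Local Notation r := (size a).
Local Notation p := (hval pt r).
Hypothesis sa : sorted geq a.
Hypothesis ad : all (fun x => x <= d)%N a.
Hypothesis hpt : forall t, (r <= t)%N -> pt.[t%:R] = (gval t a)%:R.
Hypothesis hv : forall t, (r <= t)%N -> hval pt t = gval t a.
Hypothesis hZ : (hval pt r.+1 <= #|Zset n d r|)%N.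
Context (A : comAlgType k) (L : 'rV[A]_(nmon n r) -> Prop).
Hypothesis hL : cut_out (frakH k n pt d r) L.
Local Notation Lp := (forms_of L).
Local Notation X := (chart_of Lp).

Let homL := @forms_of_homog k n a A L.
Let sL := subm_forms_of hL.

Lemma forms_saturated : saturated_from r Lp.
Proof.
apply: saturated_local_global => m hm; have [rho [hrho _]] := loc_residue hm.
exact: (extend_saturated hfq sa ad hv hZ hL (phi := locpi hm) hrho).
Qed.

Lemma scrH_chart_of v : scrH X v <-> L v.
Proof.
have hh := pv_homog (fun j => v 0 j).
have e := secs_chart_of (t := 0) homL forms_saturated hh.
rewrite -(forms_of_pv L) -(mulS0 _ sL) -e (secs_homog (chart_of_closed homL) hh).
by split=> [[]|].
Qed.

Lemma chart_of_hilbert_flat i : flat_quotient (X i).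
Proof.
apply: (chart_of_flat homL) => m hm; have [rho [hrho _]] := loc_residue hm.
have [g [N [ug _ _ fr]]] := backward_local hfq sa ad hv hZ hL (locpi hm) hrho.
apply: (@free_local_coordinates n A r Lp m hm (map_mx (qalg fq A) g)
  (map_mx (qalg fq A) (invmx g)) _ (fun t => iter t grow N)) => //.
by rewrite -map_mxM mulVmx // map_mx1.
Qed.

Lemma chart_of_fibre (K : fieldType) (phi : {rmorphism A -> K}) :
  has_hilbert_polynomial (base_change phi X) pt.
Proof.
(* A field is a local ring with itself as residue field, so the local statements apply to the fibre
   with the identity for [rho]. *)
have hid (x : K) : (x \is a GRing.unit) = ((idfun : {rmorphism K -> K}) x != 0) by rewrite unitfE.
have [g [N [ug _ ct fr]]] := backward_local hfq sa ad hv hZ hL phi hid.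
have sat := extend_saturated hfq sa ad hv hZ hL (phi := phi) hid.
pose gK := map_mx phi (map_mx (qalg fq A) g); pose V := map_mx phi (map_mx (qalg fq A) (invmx g)).
have Vg : V *m gK = 1%:M by rewrite -!map_mxM mulVmx // !map_mx1.
have homE f : extend phi Lp f -> f \is r.-homog.
  move=> Lf; apply: (Lf (fun f => f \is r.-homog)) => [|_ [f0 /homL h0 ->]]; last exact: homog_map.
  by split=> [|u v|c u]; [exact: rpred0|exact: rpredD|exact: rpredZ].
apply: (@free_has_hilbert_polynomial K n r pt _ gK V Vg (fun t => iter t grow N)
  (fun t => mulS t (extend phi Lp))) => // [t|t f hf|t].
- exact: subm_mulS.
- rewrite -(secs_chart_of homE sat hf) (secs_homog (chart_of_closed homE) hf).
  split=> [[_ h] i|h]; first exact/base_change_chart_of.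
  by split=> // i; exact/base_change_chart_of.
by rewrite ct hpt // leq_addl.
Qed.

Lemma chart_of_hilbert : hilbert_functor pt X.
Proof.
split=> [|i|K phi _]; first exact: (chart_of_closed homL).
  exact: chart_of_hilbert_flat.
exact: chart_of_fibre.
Qed.

(** Near each maximal ideal the sections of [Y] in degrees from [r] on are free with standard bases
    grown from degree [r], so they are generated by those of degree [r], which are prescribed by
    [L]. *)
Lemma hilbert_unique Y : hilbert_functor pt Y -> (forall v, scrH Y v <-> L v) -> charts_eq Y X.
Proof.
move=> hY hYL; have [cY _ _] := hY; have sS := subm_secs cY.
apply: (@charts_eq_secs n r) => // [|t f hf]; first exact: (chart_of_closed homL).
rewrite (secs_chart_of homL forms_saturated hf); split=> [Yf|Lf]; last first.
  apply: (Lf (secs Y)) => // _ [ga [_ [_ [v Lv ->] ->]]]; apply: secs_mulX => //.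
  by apply/(scrH_secs hY)/hYL.
apply: mulS_local_global => m hm.
have [g [N [ug _ _ _ fr]]] := hilbert_forward fq sa hpt hv hY hm.
set gR := map_mx (locpi hm) (map_mx (qalg fq A) g) in fr.
pose V := map_mx (locpi hm) (map_mx (qalg fq A) (invmx g)).
have Vg : V *m gR = 1%:M by rewrite -!map_mxM mulVmx // !map_mx1.
have sI := subm_lsub gR (subm_locl hm sS).
have IX u w : locl (hm := hm) (secs Y) (lsub gR w) -> locl (hm := hm) (secs Y) (lsub gR ('X_[u] * w)).
  move=> hw; rewrite rmorphM; apply: lsub_mulX_mem; first exact: subm_locl.
  by move=> u' _; apply: locl_mulX hw => f0; exact: secs_mulX.
have Vf : lsub gR (lsub V (map_mpoly (locpi hm) f)) = map_mpoly (locpi hm) f.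
  by rewrite lsub_comp Vg lsub1.
have If : locl (hm := hm) (secs Y) (lsub gR (lsub V (map_mpoly (locpi hm) f))).
  by rewrite Vf; exact: mem_locl.
have := free_mod_generated sI IX (fr 0%N) (fr t) (lsub_homog V (homog_map _ hf)) If.
rewrite -[X in _ -> mulS t _ X]Vf; apply: mulS_lsub => w [hw [u [f0 [nu Yf0 e]]]].
have uu := ll_unit hm nu.
have e' : locpi hm u *: lsub gR w = map_mpoly (locpi hm) (pihomog [measure of mdeg] r f0).
  exact: (scale_eq_map_pihomog (lsub_homog gR hw) e).
rewrite -[lsub gR w]scale1r -(mulVr uu) -scalerA e'.
case: (subm_span (fun g => exists2 f, Lp f & g = map_mpoly (locpi hm) f)) => _ _; apply.
apply: mem_extend; have hp : pihomog [measure of mdeg] r f0 \is r.-homog by exact: pihomogP.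
exists (\row_j (pihomog [measure of mdeg] r f0)@_(alpha j)); last first.
  by rewrite [LHS](homog_pv hp); apply: eq_pv => j; rewrite mxE.
apply/hYL/(scrH_secs hY); rewrite (_ : pv _ = pihomog [measure of mdeg] r f0); last first.
  by rewrite [RHS](homog_pv hp); apply: eq_pv => j; rewrite mxE.
by apply/(secs_homog cY hp) => i; exact: Yf0.
Qed.

End BackwardGlobal.

Theorem theorem6p5 (k : fieldType) (n : nat) (pt : {poly rat}) (d r : nat)
    (char0 : [pchar k] =i pred0)
    (pt_admissible : admissible n k pt)
    (pt_degree : size pt = d.+1)
    (pt_gotzmann : gotzmann_number pt r) :
  [/\ homogeneous_ideal (frakH k n pt d r),
      generated_in_degree (frakH k n pt d r) d.+2
    & defines_hilbert_scheme k n pt r (frakH k n pt d r)].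
Proof.
have [a [<- sa ea]] := pt_gotzmann.
have [fq hfq] := ratr_rmorphism char0.
have hpt t := hilbert_value (t := t) ea.
have hv t := hval_gval (t := t) ea.
have ad := gotzmann_degree ea sa pt_degree.
(* Here admissibility enters: the generic initial set of an actual subscheme grows to a set of
   [p(r + 1)] monomials inside [Zset], so the truncated difference that defines [q''] is exact. *)
have hZ : (hval pt (size a).+1 <= #|Zset n d (size a)|)%N.
  have [Y [cY hY]] := pt_admissible.
  have [g [N [T [_ bN c1 c2 _]]]] := field_generic_initial fq sa hpt cY hY.
  have hd u : mdeg u = size a -> N u -> ~~ supge d.+1 u.
    by apply: (@borel_no_last n (size a) N a) => //; rewrite c1.
  by rewrite hv // -c2 -(card_grow bN hd) leq_addl.
split; [exact: frakH_homogeneous|exact: frakH_degree|move=> A nA; split=> [X hX|L hL]].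
  exact: (hilbert_cut_out hfq sa ad hpt hv nA hX).
exists (chart_of (forms_of L)); split.
- exact: (chart_of_hilbert hfq sa ad hpt hv hZ hL).
- exact: (scrH_chart_of hfq sa ad hv hZ hL).
by move=> Y hY hYL; exact: (hilbert_unique hfq sa ad hpt hv hZ hL hY hYL).
Qed.
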